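(* There exists, for some genus $g$ large enough, a quasi-Fuchsian representation $\rho:\Gamma_g\to \mathrm{SL}(2,\mathbb{C})$ of the fundamental group $\Gamma_g$ of a closed oriented surface $S_g$ of genus $g$ that admits no $\rho$-equivariant fitting immersion $u:\widetilde{S_g}\to \mathrm{Gr}_2^{\mathrm{mix}}(\mathcal{H})=\mathcal{G}$. Moreover it also admits no $\rho$-equivariant continuous map $u:\widetilde{S_g}\to \mathrm{Gr}_2^{\mathrm{mix}}(\mathcal{H})=\mathcal{G}$ that admits a $\rho$-equivariant fitting flow.
   Context: $\widetilde{S_g}$ is the universal cover of $S_g$. A representation $\rho:\Gamma_g\to\mathrm{SL}(2,\mathbb{C})$ is quasi-Fuchsian if it is a quasi-isometric embedding. $\mathcal{H}$ is the real $4$-dimensional vector space of Hermitian forms on $\mathbb{C}^2$, with the natural action of $\mathrm{SL}(2,\mathbb{C})$; ''positive'' means positive definite. A plane (pencil) $P\subset\mathcal{H}$ is mixed if it contains no non-zero positive semi-definite form; $\mathrm{Gr}_2^{\mathrm{mix}}(\mathcal{H})$ is the space of mixed pencils. It is identified with the space $\mathcal{G}$ of unoriented geodesics of $\mathbb{H}^3$ by sending $P$ to the geodesic given by the annihilator of $P$ in the projective Klein model of $\mathbb{H}^3$ inside $\mathbb{P}(\mathcal{H}^* )$; its endpoints in $\mathbb{CP}^1$ are the two common isotropic lines of the forms in $P$. With $T_P\mathrm{Gr}_2(\mathcal{H})=\mathrm{Hom}(P,\mathcal{H}/P)$, a tangent vector is fitting if its image contains the class $[q]\in\mathcal{H}/P$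 of some positive $q\in\mathcal{H}$. A smooth immersion $u$ from a surface into $\mathrm{Gr}_2^{\mathrm{mix}}(\mathcal{H})$ is fitting if $\mathrm{d}u(w)$ is fitting for every non-zero tangent vector $w$. For a continuous map $u:M\to\mathrm{Gr}_2(\mathcal{H})$ let $u^*\mathcal{E}=\{(x,q):x\in M,\ q\in u(x)\}$ and let $\mathbb{S}u^*\mathcal{E}$ be the circle bundle over $M$ obtained by removing the zero section and quotienting by positive scalars. A fitting flow for $u$ is a continuous flow $(\Phi_t)_{t\in\mathbb{R}}$ on $\mathbb{S}u^*\mathcal{E}$ such that for all $(x,[q])$ and all $t>0$, writing $\Phi_t(x,[q])=(x',[q'])$, one can choose representatives with $q'-q$ positive. It is $\rho$-equivariant if it commutes with $\gamma\cdot(x,[q])=(\gamma x,[\rho(\gamma)\cdot q])$. *)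

(* Defs.v *)
From HB Require Import structures.
From mathcomp Require Import all_boot all_order all_algebra.
From mathcomp Require Import generic_quotient lra.
From mathcomp Require Import complex.
From mathcomp Require Import all_classical all_reals all_analysis.

Set Implicit Arguments.
Unset Strict Implicit.
Unset Printing Implicit Defensive.

Import Order.TTheory GRing.Theory Num.Theory.
Import numFieldNormedType.Exports.

Local Open Scope quotient_scope.
Local Open Scope classical_set_scope.
Local Open Scope ring_scope.

(* The surface group
     Gamma_g = < a_i, b_i (i < g) | [a_0, b_0] ... [a_(g-1), b_(g-1)] = 1 >.
   The letter (i, s, e) is a_i if s = false and b_i if s = true, and it is
   inverted if e = true. *)
Definition letter (g : nat) : Type := ('I_g * bool * bool)%type.
Definition word (g : nat) : Type := seq (letter g).
HB.instance Definition _ g := Choice.on (word g).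

Definition letter_inv g (l : letter g) : letter g := (l.1, ~~ l.2).
Definition word_inv g (w : word g) : word g := rev (map (@letter_inv g) w).

Definition relator g : word g :=
  flatten [seq [:: (i, false, false); (i, true, false);
                   (i, false, true); (i, true, true)] | i <- enum 'I_g].

Inductive word_eq g : word g -> word g -> Prop :=
| word_eq_refl w : word_eq w w
| word_eq_sym w w' : word_eq w w' -> word_eq w' w
| word_eq_trans w w' w'' : word_eq w w' -> word_eq w' w'' -> word_eq w w''
| word_eq_cancel u v l : word_eq (u ++ [:: l; letter_inv l] ++ v) (u ++ v)
| word_eq_relator u v : word_eq (u ++ relator g ++ v) (u ++ v).

Definition word_eqb g : rel (word g) := fun w w' => `[< word_eq w w' >].

Lemma word_eqb_equiv g : equiv_class_of (@word_eqb g).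
Proof.
split=> [w|w w'|w' w w''].
- exact/asboolP/word_eq_refl.
- by apply/asboolP/asboolP; exact: word_eq_sym.
- by move=> /asboolP h /asboolP h'; apply/asboolP; exact: word_eq_trans h'.
Qed.

Canonical word_eqb_equivRel g := EquivRelPack (@word_eqb_equiv g).

Definition surface_group (g : nat) : Type := {eq_quot @word_eqb g}.
HB.instance Definition _ g := Choice.on (surface_group g).
HB.instance Definition _ g := Quotient.on (surface_group g).

Section SurfaceGroup.
Variable g : nat.
Notation G := (surface_group g).

Lemma word_eqP (w w' : word g) : \pi_G w = \pi_G w' <-> word_eq w w'.
Proof. by split=> [/eqmodP/asboolP|h] //; apply/eqmodP/asboolP. Qed.

Lemma word_eq_cat (w1 w1' w2 w2' : word g) :
  word_eq w1 w1' -> word_eq w2 w2' -> word_eq (w1 ++ w2) (w1' ++ w2').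
Proof.
have ctx (a b u v : word g) : word_eq u v -> word_eq (a ++ u ++ b) (a ++ v ++ b).
  elim=> {u v} [w|w w' _ h|w w' w'' _ h _ h'|u v l|u v].
  - exact: word_eq_refl.
  - exact: word_eq_sym.
  - exact: word_eq_trans h'.
  - rewrite -!catA (catA a u) (catA a u (v ++ b)); exact: word_eq_cancel.
  - rewrite -!catA (catA a u) (catA a u (v ++ b)); exact: word_eq_relator.
move=> h1 h2; apply: word_eq_trans (ctx [::] w2 _ _ h1) _.
by have := ctx w1' [::] _ _ h2; rewrite !cats0.
Qed.

Lemma letter_invK : involutive (@letter_inv g).
Proof. by move=> [i e]; rewrite /letter_inv /= negbK. Qed.

Lemma word_eq_catV (w : word g) : word_eq (w ++ word_inv w) [::].
Proof.
elim: w => [|l w IH]; first exact: word_eq_refl.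
rewrite /word_inv /= rev_cons -cats1 -/(word_inv w).
have -> : l :: w ++ word_inv w ++ [:: letter_inv l] =
          [:: l] ++ (w ++ word_inv w) ++ [:: letter_inv l] by rewrite -catA.
apply: word_eq_trans (word_eq_cancel [::] [::] l).
apply: (@word_eq_cat [:: l] [:: l]); first exact: word_eq_refl.
by apply: (@word_eq_cat _ [::] _ [:: letter_inv l]) => //; exact: word_eq_refl.
Qed.

Lemma word_invK : involutive (@word_inv g).
Proof. by move=> w; rewrite /word_inv map_rev revK mapK //; exact: letter_invK. Qed.

Lemma word_eq_inv (w w' : word g) :
  word_eq w w' -> word_eq (word_inv w) (word_inv w').
Proof.
move=> h; apply: (@word_eq_trans _ _ (word_inv w ++ w' ++ word_inv w')).
  rewrite -[X in word_eq X _]cats0; apply: word_eq_cat; first exact: word_eq_refl.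
  exact/word_eq_sym/word_eq_catV.
rewrite catA; apply: (@word_eq_cat _ [::] _ (word_inv w')); last exact: word_eq_refl.
apply: (@word_eq_trans _ _ (word_inv w ++ w)).
  by apply: word_eq_cat; [exact: word_eq_refl | exact: word_eq_sym].
by have := word_eq_catV (word_inv w); rewrite word_invK.
Qed.

Definition sg_one : G := \pi_G [::].
Definition sg_mul (x y : G) : G := \pi_G (repr x ++ repr y).
Definition sg_inv (x : G) : G := \pi_G (word_inv (repr x)).

Lemma repr_piE (w : word g) : word_eq (repr (\pi_G w)) w.
Proof. by apply/word_eqP; rewrite reprK. Qed.

Lemma sg_mulE (w w' : word g) : sg_mul (\pi_G w) (\pi_G w') = \pi_G (w ++ w').
Proof. by apply/word_eqP; apply: word_eq_cat; exact: repr_piE. Qed.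

Lemma sg_invE (w : word g) : sg_inv (\pi_G w) = \pi_G (word_inv w).
Proof. by apply/word_eqP; apply: word_eq_inv; exact: repr_piE. Qed.

Lemma sg_mulA : associative sg_mul.
Proof.
move=> x y z; rewrite -[x]reprK -[y]reprK -[z]reprK.
move: (repr x) (repr y) (repr z) => a b c.
by rewrite (sg_mulE b c) (sg_mulE a (b ++ c)) (sg_mulE a b) (sg_mulE (a ++ b) c) catA.
Qed.

Lemma sg_mul1 : left_id sg_one sg_mul.
Proof. by move=> x; rewrite -[x]reprK sg_mulE. Qed.

Lemma sg_mul1r : right_id sg_one sg_mul.
Proof. by move=> x; rewrite -[x]reprK sg_mulE cats0. Qed.

Lemma sg_mulV : right_inverse sg_one sg_inv sg_mul.
Proof.
by move=> x; rewrite -[x]reprK sg_invE sg_mulE; apply/word_eqP; exact: word_eq_catV.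
Qed.

Lemma sg_mulVl : left_inverse sg_one sg_inv sg_mul.
Proof.
move=> x; rewrite -[x]reprK sg_invE sg_mulE; apply/word_eqP.
by have := word_eq_catV (word_inv (repr x)); rewrite word_invK.
Qed.

HB.instance Definition _ :=
  isGroup.Build G sg_mulA sg_mul1 sg_mul1r sg_mulVl sg_mulV.

Lemma word_length_ex (x : G) : exists n, `[< exists2 w, size w = n & \pi_G w = x >].
Proof. by exists (size (repr x)); apply/asboolP; exists (repr x); rewrite ?reprK. Qed.

Definition word_length (x : G) : nat := ex_minn (word_length_ex x).

End SurfaceGroup.

(* Hermitian forms on C^2.  The real vector space H of Hermitian forms is
   'rV[R]_4 through the linear isomorphism
     (a, b, c, d) |-> [ a        c + i d ]
                      [ c - i d  b       ],
   a matrix Q standing for the form z |-> z^* Q z. *)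
Section HermitianForms.
Variable R : realType.
Local Open Scope complex_scope.
Local Open Scope sesquilinear_scope.
Notation C := R[i].
Notation H := 'rV[R]_4.

Definition herm (q : H) : 'M[C]_2 :=
  \matrix_(i, j)
    if i == j then (if i == 0 then q 0 0 else q 0 1)%:C
    else if i == 0 then q 0 2 +i* q 0 3 else q 0 2 -i* q 0 3.

Definition unherm (Q : 'M[C]_2) : H :=
  \row_k [:: complex.Re (Q 0 0); complex.Re (Q 1 1); complex.Re (Q 0 1);
             complex.Im (Q 0 1)]`_k.

Definition hform (q : H) (z : 'cV[C]_2) : C := (z ^t* *m herm q *m z) 0 0.

Definition positive (q : H) : Prop := forall z, z != 0 -> 0 < hform q z.
Definition pos_semidef (q : H) : Prop := forall z, 0 <= hform q z.

Definition herm_act (A : 'M[C]_2) (q : H) : H :=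
  unherm ((invmx A) ^t* *m herm q *m invmx A).

Lemma hermK : cancel herm unherm.
Proof.
move=> q; apply/rowP => k; rewrite !mxE.
case: k => [[|[|[|[|//]]]] kP] /=; congr (q 0 _); exact: val_inj.
Qed.

Lemma herm_hermitian (q : H) : (herm q) ^t* = herm q.
Proof.
apply/matrixP => -[[|[|//]] iP] [[|[|//]] jP]; rewrite !mxE /=;
  by apply/eqP; rewrite eq_complex /= ?opprK ?oppr0 !eqxx.
Qed.

Lemma unhermK (Q : 'M[C]_2) : Q ^t* = Q -> herm (unherm Q) = Q.
Proof.
move=> /matrixP hQ.
have conjE i j : Q j i = Complex (complex.Re (Q i j)) (- complex.Im (Q i j)).
  by rewrite -[LHS]hQ !mxE; case: (Q i j).
have im0 i : complex.Im (Q i i) = 0.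
  by have := conjE i i; case: (Q i i) => a b /= [] hb; lra.
have re (x : C) : complex.Im x = 0 -> (complex.Re x)%:C = x.
  by case: x => a b /= ->.
apply/matrixP => -[[|[|//]] iP] [[|[|//]] jP]; rewrite !mxE /=.
- by rewrite re ?im0 //; congr (Q _ _); exact: val_inj.
- by rewrite (_ : Ordinal iP = 0) 1?(_ : Ordinal jP = 1); [case: (Q 0 1)|exact: val_inj..].
- rewrite (_ : Ordinal iP = 1) 1?(_ : Ordinal jP = 0); [|exact: val_inj..].
  by rewrite (conjE 0 1).
- by rewrite re ?im0 //; congr (Q _ _); exact: val_inj.
Qed.

Lemma hform_act (A : 'M[C]_2) (q : H) (z : 'cV[C]_2) :
  hform (herm_act A q) z = hform q (invmx A *m z).
Proof.
rewrite /hform /herm_act unhermK.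
  by rewrite trmx_mul map_mxM !mulmxA.
by rewrite !trmx_mul !map_mxM trmxCK herm_hermitian mulmxA.
Qed.

End HermitianForms.

Section QuasiFuchsian.
Variables (R : realType) (g : nat).
Local Open Scope complex_scope.
Local Open Scope sesquilinear_scope.
Notation C := R[i].

Definition sl2_representation (rho : surface_group g -> 'M[C]_2) : Prop :=
  (forall x, \det (rho x) = 1) /\
  (forall x y, rho (x * y)%g = rho x *m rho y).

Definition arcosh (x : R) : R := ln (x + Num.sqrt (x ^+ 2 - 1)).

(* H^3 is the space of positive definite Hermitian matrices X of determinant 1,
   with cosh d(X, Y) = tr (X^-1 Y) / 2 and the isometric action of SL(2, C) by
   A . X = A X A^*; the identity matrix is taken as base point. *)
Definition hyp_dist (X Y : 'M[C]_2) : R :=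
  arcosh (complex.Re (\tr (invmx X *m Y)) / 2).

Definition orbit_pt (A : 'M[C]_2) : 'M[C]_2 := A *m A ^t*.

(* Quasi-isometric embedding for the word metric on the source and, on
   SL(2, C), the distance between orbit points in H^3: the stabilizer SU(2) of
   the base point being compact, the latter is quasi-isometric to every
   left-invariant Riemannian metric on SL(2, C). *)
Definition quasi_fuchsian (rho : surface_group g -> 'M[C]_2) : Prop :=
  exists K c : R, [/\ 0 < K, 0 <= c & forall x y : surface_group g,
    let l : R := (word_length (x^-1 * y)%g)%:R in
    let d := hyp_dist (orbit_pt (rho x)) (orbit_pt (rho y)) in
    K^-1 * l - c <= d /\ d <= K * l + c].

End QuasiFuchsian.

Section Smooth.
Variables (R : realType) (V W : normedModType R).

(* C^n on an open set U: the iterated directional derivatives of order at most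
   n exist and are continuous on U. *)
Fixpoint Ck (n : nat) (U : set V) (f : V -> W) : Prop :=
  (forall x, U x -> {for x, continuous f}) /\
  match n with
  | 0 => True
  | m.+1 => forall v, (forall x, U x -> derivable f x v) /\
                      Ck m U (fun x => 'D_v f x)
  end.

Definition smooth_on (U : set V) (f : V -> W) : Prop := forall n, Ck n U f.

End Smooth.

Section Pencils.
Variables (R : realType) (g : nat).
Local Open Scope complex_scope.
Notation C := R[i].
Notation H := 'rV[R]_4.
Notation M := 'rV[R]_2.

(* For g >= 2 the universal cover of S_g is diffeomorphic to the plane.  Such an
   action is the action of Gamma_g by deck transformations for the closed
   oriented surface S_g = M / Gamma_g of genus g, and all universal covers of
   closed oriented surfaces of genus g >= 2, with their deck transformations,
   are of this form up to diffeomorphism. *)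
Record deck_action (act : surface_group g -> M -> M) : Prop := {
  deck_act1 : forall x, act 1%g x = x;
  deck_actM : forall a b x, act (a * b)%g x = act a (act b x);
  deck_smooth : forall a, smooth_on setT (act a);
  deck_oriented : forall a x, 0 < \det ('J (act a) x);
  deck_free : forall a x, act a x = x -> a = 1%g;
  deck_proper : forall K : set M, compact K ->
    finite_set [set a | (act a @` K) `&` K !=set0];
  deck_cocompact : exists2 K : set M, compact K & forall x, exists a, K (act a x)
}.

Definition mixed (P : {vspace H}) : Prop :=
  \dim P = 2%N /\ forall q, q \in P -> q != 0 -> ~ pos_semidef q.

(* A map to Gr_2(H) is continuous, resp. smooth, iff it has continuous, resp.
   smooth, local lifts to the frame bundle, which is a locally trivial principal
   bundle over Gr_2(H). *)
Definition locally_framed (reg : set M -> (M -> H) -> Prop)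
    (u : M -> {vspace H}) : Prop :=
  forall x, exists U e1 e2, [/\ open_nbhs x U, reg U e1, reg U e2 &
    forall y, U y -> u y = <<[:: e1 y; e2 y]>>%VS].

Definition continuous_on (U : set M) (s : M -> H) : Prop :=
  forall x, U x -> {for x, continuous s}.

Definition continuous_pencil := locally_framed continuous_on.
Definition smooth_pencil := locally_framed (@smooth_on R M H).

Definition equivariant (rho : surface_group g -> 'M[C]_2)
    (act : surface_group g -> M -> M) (u : M -> {vspace H}) : Prop :=
  forall a x q, (herm_act (rho a) q \in u (act a x)) = (q \in u x).

(* du(w)(p) = [h] in H / u(x), where du(w) is the element of
   Hom(u(x), H / u(x)) sending p to the class of the derivative along w of any
   smooth local section s of u with s(x) = p. *)
Definition pencil_diff (u : M -> {vspace H}) (x w : M) (p h : H) : Prop :=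
  exists U s, [/\ open_nbhs x U, smooth_on U s, forall y, U y -> s y \in u y,
    s x = p & 'D_w s x - h \in u x].

Definition immersion (u : M -> {vspace H}) : Prop :=
  forall x w, w != 0 -> exists p h, pencil_diff u x w p h /\ h \notin u x.

Definition fitting_tangent (u : M -> {vspace H}) (x w : M) : Prop :=
  exists p q, positive q /\ pencil_diff u x w p q.

Definition fitting_immersion (u : M -> {vspace H}) : Prop :=
  [/\ smooth_pencil u, immersion u &
      forall x w, w != 0 -> fitting_tangent u x w].

End Pencils.

(* The circle bundle S u^*E: nonzero vectors of u^*E, with the topology induced
   by M x H, modulo positive scalars, with the quotient topology. *)
Section CircleBundle.
Variables (R : realType) (u : 'rV[R]_2 -> {vspace 'rV[R]_4}).

Definition nonzero_vectors : set ('rV[R]_2 * 'rV[R]_4) :=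
  [set z | z.2 \in u z.1 /\ z.2 != 0].

Definition same_ray : rel (set_type nonzero_vectors) := fun z w =>
  `[< (val z).1 = (val w).1 /\ exists2 c : R, 0 < c & (val w).2 = c *: (val z).2 >].

Lemma same_ray_equiv : equiv_class_of same_ray.
Proof.
split=> [z|z w|w z z'].
- by apply/asboolP; split=> //; exists 1; rewrite ?scale1r.
- have half (a b : set_type nonzero_vectors) : same_ray a b -> same_ray b a.
    move=> /asboolP[e [c c0 e']]; apply/asboolP; split; first exact: esym.
    by exists c^-1; rewrite ?invr_gt0// e' scalerA mulVf ?gt_eqF// scale1r.
  by apply/idP/idP; exact: half.
- move=> /asboolP[e1 [c c0 f1]] /asboolP[e2 [d d0 f2]]; apply/asboolP.
  split; first by rewrite e1.
  by exists (d * c); [exact: mulr_gt0 | rewrite f2 f1 scalerA].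
Qed.

Canonical same_ray_equivRel := EquivRelPack same_ray_equiv.

Definition circle_bundle : topologicalType :=
  quotient_topology {eq_quot same_ray}.

Definition ray (z : set_type nonzero_vectors) : circle_bundle :=
  \pi_{eq_quot same_ray} z.

Record flow (Phi : R -> circle_bundle -> circle_bundle) : Prop := {
  flow0 : forall s, Phi 0 s = s;
  flowD : forall t t' s, Phi (t + t') s = Phi t (Phi t' s);
  flow_continuous : continuous (fun ts : R * circle_bundle => Phi ts.1 ts.2)
}.

Definition fitting_flow (Phi : R -> circle_bundle -> circle_bundle) : Prop :=
  flow Phi /\ forall s t, 0 < t -> exists z z',
    [/\ ray z = s, ray z' = Phi t s & positive ((val z').2 - (val z).2)].

(* Here a . (x, [q]) = (a x, [rho(a) . q]). *)
Definition flow_equivariant g (rho : surface_group g -> 'M[R[i]]_2)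
    (act : surface_group g -> 'rV[R]_2 -> 'rV[R]_2)
    (Phi : R -> circle_bundle -> circle_bundle) : Prop :=
  let dot a (z : 'rV[R]_2 * 'rV[R]_4) := (act a z.1, herm_act (rho a) z.2) in
  forall a t z z' w w', val w = dot a (val z) -> val w' = dot a (val z') ->
    Phi t (ray z) = ray z' -> Phi t (ray w) = ray w'.

End CircleBundle.

(* Main.v *)
(* The leaf of a pencil P = u(x) is its annihilator in the Klein ball, a chord.  A fitting immersion and a
   fitting flow both force, through a winding number of an odd loop, that the leaves of nearby points
   are disjoint in the closed ball and sweep out neighbourhoods of each of their points.  By equivariance
   and cocompactness all leaves are then disjoint, every point of the open ball lies on a leaf, and so
   does every boundary point whose group orbit stays away from the boundary in a uniform sense ("good"),
   whereas fixed points of group elements lie on no leaf.  A good point has another endpoint of leaf,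
   and a path of good points cannot join the two ends of a leaf: otherwise the contractible leaf space
   would carry a map whose square root changes sign along a loop.

   The representation is the restriction, to a torsion-free subgroup of index 4, of the group generated
   by the inversions in pairwise tangent-free circles, orthogonal when consecutive, whose centres form an
   induced cycle of the Eisenstein lattice.  This cycle is the bank of a symmetric double spiral S, all
   of whose points are good.  A unit segment crossing an edge of S has good interior, and its ends are
   fixed by a product of two inversions; hence the other endpoints of its points describe a path between
   the same two ends that avoids S.  For the segment at the centre, this path must leave a large disc, so
   some leaf joins a point p near the origin to a point near infinity.  For a second segment, crossing one
   arm further out, disjointness from this leaf keeps the argument about p of the two paths within pi of
   each other; but that arm winds by more than a full turn on each side, so the path of the
   other endpoints cannot get from one side of the arm to the other. *)
From Stdlib Require Import ZArith.
From HB Require Import structures.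
From mathcomp Require Import all_boot all_order all_algebra complex ring lra zify ssrZ.
From mathcomp Require Import generic_quotient.
From mathcomp Require Import all_classical all_reals all_analysis.
Require Import Defs.
Set Implicit Arguments.
Unset Strict Implicit.
Unset Printing Implicit Defensive.
Import Order.TTheory GRing.Theory Num.Theory numFieldNormedType.Exports.
Local Open Scope classical_set_scope.
Local Open Scope ring_scope.

(** * Winding of plane curves *)

(** The circles have radius 1/sqrt 2 because two of them are then orthogonal when their centres are
    at distance 1 and disjoint when this distance is at least sqrt 3, and these are exactly the
    distances in an induced cycle of the lattice. The group is thus a right-angled polygon group;
    with 2g+2 sides, the words with an even number of letters of even index and an even number of
    odd index form a surface group of genus g, by Euler characteristic. The bank has 612 points, so
    g = 305. A numbers game on the values [lam i] along an orbit is the engine: its exponential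
    growth gives the quasi-isometry, and its invariant gives the orbit bounds that make points good.
    The guiding picture is a limit set that follows the bank, with the spiral on one side and the
    other ends of its leaves on the other side. The arm must wind by more than a full turn since a
    deformation through disjoint chords controls angles only up to pi on each side. The long
    straight tails of the spiral push a leaf end beyond radius 100, so that projecting along this
    leaf is close to a translation on the arm that is used. *)

Definition cat (T U : topologicalType) (f : T -> U) (x : T) : Prop :=
  {for x, continuous f}.

Section ContinuityAt.
Variables (R : realType) (T : topologicalType) (V : normedModType R).
Implicit Types (x : T).

Lemma cat_cst (U : topologicalType) (c : U) x : cat (fun _ : T => c) x.
Proof. exact: cvg_cst. Qed.
Lemma cat_id x : cat (fun y : T => y) x.
Proof. exact: cvg_id. Qed.
Lemma catD (f g : T -> V) x : cat f x -> cat g x -> cat (fun y => f y + g y) x.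
Proof. by move=> hf hg; apply: cvgD. Qed.
Lemma catN (f : T -> V) x : cat f x -> cat (fun y => - f y) x.
Proof. by move=> hf; apply: cvgN. Qed.
Lemma catZ (k : T -> R) (f : T -> V) x :
  cat k x -> cat f x -> cat (fun y => k y *: f y) x.
Proof. by move=> hk hf; apply: cvgZ. Qed.
Lemma catM (f g : T -> R) x : cat f x -> cat g x -> cat (fun y => f y * g y) x.
Proof. by move=> hf hg; apply: cvgM. Qed.
Lemma catV (f : T -> R) x : f x != 0 -> cat f x -> cat (fun y => (f y)^-1) x.
Proof. by move=> f0 hf; apply: cvgV. Qed.
Lemma catX (f : T -> R) n x : cat f x -> cat (fun y => f y ^+ n) x.
Proof.
move=> hf; elim: n => [|n IH]; first exact: cvg_cst.
rewrite [X in cat X](_ : _ = fun y => f y * f y ^+ n); first exact: catM.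
by apply/funext => y; rewrite exprS.
Qed.
Lemma cat_norm (f : T -> V) x : cat f x -> cat (fun y => `|f y|) x.
Proof. by move=> hf; apply: cvg_norm. Qed.
Lemma cat_comp (U W : topologicalType) (h : U -> W) (f : T -> U) x :
  cat h (f x) -> cat f x -> cat (fun y => h (f y)) x.
Proof. by move=> hh hf; exact: (@continuous_comp _ _ _ f h). Qed.
Lemma cat_pair (U W : topologicalType) (f : T -> U) (g : T -> W) x :
  cat f x -> cat g x -> cat (fun y => (f y, g y)) x.
Proof. by move=> hf hg; apply: cvg_pair. Qed.
Lemma cat_fst (U W : topologicalType) (f : T -> U * W) x :
  cat f x -> cat (fun y => (f y).1) x.
Proof. by move=> hf; apply: (@cat_comp _ _ fst) => //; exact: cvg_fst. Qed.
Lemma cat_snd (U W : topologicalType) (f : T -> U * W) x :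
  cat f x -> cat (fun y => (f y).2) x.
Proof. by move=> hf; apply: (@cat_comp _ _ snd) => //; exact: cvg_snd. Qed.
Lemma cat_coord m n (f : T -> 'M[R]_(m, n)) i j x :
  cat f x -> cat (fun y => f y i j) x.
Proof.
by move=> hf; apply: (@cat_comp _ _ (fun M : 'M[R]_(m, n) => M i j)) => //;
  exact: coord_continuous.
Qed.
Lemma cat_row n (f : T -> 'rV[R]_n) x :
  (forall j, cat (fun y => f y 0 j) x) -> cat f x.
Proof.
move=> hf A [P hP sub].
have h : \near x, forall j, P 0 j (f x 0 j).
  apply: filter_forall => j; exact: (hf j _ (hP 0 j)).
by apply: filterS h => y hy; apply: sub => i j; rewrite ord1.
Qed.
Lemma cat_sum (I : eqType) (r : seq I) (f : I -> T -> V) x :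
  (forall i, i \in r -> cat (f i) x) -> cat (fun y => \sum_(i <- r) f i y) x.
Proof.
elim: r => [|i r IH] hf.
  by rewrite [X in cat X](_ : _ = fun=> 0) ?funeqE => [|y]; [exact: cat_cst|rewrite big_nil].
rewrite [X in cat X](_ : _ = fun y => f i y + \sum_(j <- r) f j y); last first.
  by apply/funext => y; rewrite big_cons.
apply: catD; first by apply: hf; rewrite mem_head.
by apply: IH => j jr; apply: hf; rewrite in_cons jr orbT.
Qed.
Lemma cat_max (f g : T -> R) x : cat f x -> cat g x -> cat (fun y => Num.max (f y) (g y)) x.
Proof.
move=> hf hg.
rewrite [X in cat X](_ : _ = fun y => 2^-1 * (f y + g y + `|f y - g y|)).
  apply: catM; first exact: cat_cst.
  apply: cvgD; first exact: cvgD.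
  apply: (@cvg_norm _ R^o); exact: cvgB.
by apply/funext => y; case: (lerP (f y) (g y)) => h; lra.
Qed.
Lemma cat_min (f g : T -> R) x : cat f x -> cat g x -> cat (fun y => Num.min (f y) (g y)) x.
Proof.
move=> hf hg.
rewrite [X in cat X](_ : _ = fun y => 2^-1 * (f y + g y - `|f y - g y|)).
  apply: catM; first exact: cat_cst.
  apply: cvgB; first exact: cvgD.
  apply: (@cvg_norm _ R^o); exact: cvgB.
by apply/funext => y; case: (lerP (f y) (g y)) => h; lra.
Qed.
End ContinuityAt.

(** Continuity goals are kept in the form [cat (fun y => ...) x], whose head can be matched; [ct]
    decomposes the body and leaves side conditions such as nonzero denominators. [ct_hook] is
    redefined as new operations appear. *)
Ltac ct_hook := fail.
Ltac ct := repeat (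
  lazymatch goal with
  | H : cat ?f ?x |- cat ?f ?x => exact: H
  | |- continuous ?f => let x := fresh "x" in move=> x; change (cat f x)
  | |- cat (fun _ => ?c) _ => apply: cat_cst
  | |- cat (fun y => y) _ => apply: cat_id
  | |- cat (fun y => @?f y + @?g y) _ => apply: (catD (f := f) (g := g))
  | |- cat (fun y => - @?f y) _ => apply: (catN (f := f))
  | |- cat (fun y => @?k y *: @?f y) _ => apply: (catZ (k := k) (f := f))
  | |- cat (fun y => @?f y * @?g y) _ => apply: (catM (f := f) (g := g))
  | |- cat (fun y => @?f y ^+ ?n) _ => apply: (catX (f := f))
  | |- cat (fun y => (@?f y)^-1) _ => apply: (catV (f := f))
  | |- cat (fun y => `|@?f y|) _ => apply: (cat_norm (f := f))
  | |- cat (fun y => (@?f y, @?g y)) _ => apply: (cat_pair (f := f) (g := g))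
  | |- cat (fun y => (@?f y).1) _ => apply: (cat_fst (f := f))
  | |- cat (fun y => (@?f y).2) _ => apply: (cat_snd (f := f))
  | |- cat (fun y => Num.max (@?f y) (@?g y)) _ => apply: (cat_max (f := f) (g := g))
  | |- cat (fun y => Num.min (@?f y) (@?g y)) _ => apply: (cat_min (f := f) (g := g))
  | |- cat (fun y => fun_of_matrix (@?f y) _ _) _ => apply: (cat_coord (f := f))
  | |- cat (fun y => \sum_(i <- ?r) @?f y i) _ => apply: (cat_sum (f := fun i y => f y i)) => ? ?
  | H : continuous ?h |- cat ?h _ => exact: H
  | H : continuous ?h |- cat (fun y => ?h (@?f y)) _ =>
      apply: (cat_comp (h := h) (f := f)); [exact: H | idtac]
  | _ => ct_hook
  end).

Section Plane.
Variable R : realType.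

Definition v2 (a b : R) : 'rV[R]_2 := \row_j (if j == 0 then a else b).
Lemma v2_0 a b : v2 a b 0 0 = a. Proof. by rewrite mxE. Qed.
Lemma v2_1 a b : v2 a b 0 1 = b. Proof. by rewrite mxE. Qed.
Definition v2E := (v2_0, v2_1).
Lemma rV2P (u v : 'rV[R]_2) : u 0 0 = v 0 0 -> u 0 1 = v 0 1 -> u = v.
Proof.
move=> h0 h1; apply/rowP => -[[|[|//]] lt].
- by rewrite (_ : Ordinal lt = 0) //; exact/val_inj.
- by rewrite (_ : Ordinal lt = 1) //; exact/val_inj.
Qed.
Lemma v2_eta (u : 'rV[R]_2) : u = v2 (u 0 0) (u 0 1).
Proof. by apply: rV2P; rewrite v2E. Qed.
Lemma cat_v2 (T : topologicalType) (f g : T -> R) x :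
  cat f x -> cat g x -> cat (fun y => v2 (f y) (g y)) x.
Proof.
move=> hf hg; apply: cat_row => -[[|[|//]] lt].
- rewrite [X in cat X](_ : _ = f) //; apply/funext => y.
  by rewrite (_ : Ordinal lt = 0) ?v2E //; exact/val_inj.
- rewrite [X in cat X](_ : _ = g) //; apply/funext => y.
  by rewrite (_ : Ordinal lt = 1) ?v2E //; exact/val_inj.
Qed.

Lemma rvD n (u v : 'rV[R]_n) i j : (u + v) i j = u i j + v i j. Proof. by rewrite mxE. Qed.
Lemma rvN n (u : 'rV[R]_n) i j : (- u) i j = - u i j. Proof. by rewrite mxE. Qed.
Lemma rvZ n c (u : 'rV[R]_n) i j : (c *: u) i j = c * u i j. Proof. by rewrite mxE. Qed.
Lemma rv0 n i j : (0 : 'rV[R]_n) i j = 0. Proof. by rewrite mxE. Qed.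
Definition rvE := (v2_0, v2_1, rvD, rvN, rvZ, rv0).

Definition dot (u v : 'rV[R]_2) : R := u 0 0 * v 0 0 + u 0 1 * v 0 1.
Definition crs (u v : 'rV[R]_2) : R := u 0 0 * v 0 1 - u 0 1 * v 0 0.
Definition pol (a : R) : 'rV[R]_2 := v2 (cos a) (sin a).

Lemma cat_dot (T : topologicalType) (f g : T -> 'rV[R]_2) x :
  cat f x -> cat g x -> cat (fun y => dot (f y) (g y)) x.
Proof. by move=> hf hg; rewrite /dot; ct. Qed.
Lemma cat_crs (T : topologicalType) (f g : T -> 'rV[R]_2) x :
  cat f x -> cat g x -> cat (fun y => crs (f y) (g y)) x.
Proof. by move=> hf hg; rewrite /crs; ct. Qed.

Lemma dot_gt0 (u : 'rV[R]_2) : u != 0 -> 0 < dot u u.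
Proof.
move=> u0; rewrite lt_neqAle; apply/andP; split; last first.
  by rewrite /dot -!expr2 addr_ge0 ?sqr_ge0.
apply: contra u0; rewrite eq_sym /dot -!expr2 paddr_eq0 ?sqr_ge0 // !sqrf_eq0.
by move=> /andP[/eqP h0 /eqP h1]; apply/eqP/rV2P; rewrite rv0.
Qed.

(** Clamping to the unit interval: a map that matters only on [0, 1] is composed with it to become
    continuous on the whole line. *)
Definition cl (t : R) : R := Num.max 0 (Num.min 1 t).
Lemma cl_itv t : 0 <= cl t <= 1.
Proof. by rewrite le_max lexx ge_max ler01 ge_min lexx. Qed.
Lemma cl_id t : 0 <= t <= 1 -> cl t = t.
Proof. by move=> /andP[t0 t1]; rewrite /cl min_r ?max_r. Qed.
Lemma cat_cl (T : topologicalType) (f : T -> R) x : cat f x -> cat (fun y => cl (f y)) x.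
Proof. by move=> hf; rewrite /cl; ct. Qed.
End Plane.

Ltac ct_hook ::= lazymatch goal with
  | |- cat (fun y => cl (@?f y)) _ => apply: (cat_cl (f := f))
  | |- cat (fun y => v2 (@?f y) (@?g y)) _ => apply: (cat_v2 (f := f) (g := g))
  | |- cat (fun y => dot (@?f y) (@?g y)) _ => apply: (cat_dot (f := f) (g := g))
  | |- cat (fun y => crs (@?f y) (@?g y)) _ => apply: (cat_crs (f := f) (g := g))
  end.

Section Lift.
Variable R : realType.
Implicit Types (u v : 'rV[R]_2) (a b t s : R).

Lemma cos1_eq0 a : cos a = 1 -> `|a| < pi *+ 2 -> a = 0.
Proof.
move=> c1 ha; apply/eqP/negP => /negP a0.
wlog ap : a c1 ha a0 / 0 < a.
  move=> W; have := a0; rewrite neq_lt => /orP[h|h]; last exact: (W a).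
  by apply: (W (- a)); rewrite ?cosN ?normrN ?oppr_eq0 ?oppr_gt0.
have s2 : 0 < sin (a / 2).
  apply: sin_gt0_pi; move: ha; rewrite gtr0_norm // mulr2n => ha; apply/andP; split; lra.
have e : (a / 2) *+ 2 = a by rewrite -mulr_natr divfK ?pnatr_eq0.
have := cos_mulr2n (a / 2); rewrite e c1 cos2sin2 => h.
have := exprn_gt0 2 s2; move: h; rewrite mulr2n; lra.
Qed.

Lemma pol_neq0 a : pol a != 0.
Proof.
apply/negP => /eqP /rowP h; have := cos2Dsin2 a.
by have := h 0; have := h 1; rewrite !rvE => -> ->; lra.
Qed.

Lemma dot_polB a b : dot (pol a) (pol b) = cos (b - a).
Proof. by rewrite /dot !rvE cosB; ring. Qed.
Lemma crs_polB a b : crs (pol a) (pol b) = sin (b - a).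
Proof. by rewrite /crs !rvE sinB; ring. Qed.

(** The number [a] is one of the arguments of [u], not normalized to any interval. *)
Definition dir u a := exists2 r : R, 0 < r & u = r *: pol a.

Lemma dir_neq0 u a : dir u a -> u != 0.
Proof. by case=> r r0 ->; rewrite scaler_eq0 negb_or gt_eqF ?pol_neq0. Qed.
Lemma dir_dot u v a b : dir u a -> dir v b ->
  exists2 c, 0 < c & dot u v = c * cos (b - a).
Proof.
move=> [r r0 ->] [r' r'0 ->]; exists (r * r'); first exact: mulr_gt0.
by rewrite -dot_polB /dot !rvE; ring.
Qed.
Lemma dir_crs u v a b : dir u a -> dir v b ->
  exists2 c, 0 < c & crs u v = c * sin (b - a).
Proof.
move=> [r r0 ->] [r' r'0 ->]; exists (r * r'); first exact: mulr_gt0.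
by rewrite -crs_polB /crs !rvE; ring.
Qed.
Lemma dirN u a : dir u a -> dir (- u) (a + pi).
Proof.
move=> [r r0 ->]; exists r => //; apply: rV2P; rewrite !rvE ?cosDpi ?sinDpi; ring.
Qed.
Lemma dirZ c u a : 0 < c -> dir u a -> dir (c *: u) a.
Proof. by move=> c0 [r r0 ->]; exists (c * r); rewrite ?mulr_gt0 // scalerA. Qed.
Lemma dir_cos u a b : dir u a -> dir u b -> cos (b - a) = 1.
Proof.
move=> [r r0 e] [r' r'0]; rewrite e => /rowP h.
have := h 0; have := h 1; rewrite !rvE => h1 h0.
have rr : r = r'.
  apply/eqP; rewrite -(@eqrXn2 _ 2) ?ltW //; apply/eqP.
  have ea : r ^+ 2 = (r * cos a) ^+ 2 + (r * sin a) ^+ 2.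
    by rewrite !exprMn -mulrDr cos2Dsin2 mulr1.
  have eb : r' ^+ 2 = (r' * cos b) ^+ 2 + (r' * sin b) ^+ 2.
    by rewrite !exprMn -mulrDr cos2Dsin2 mulr1.
  by rewrite ea eb h0 h1.
move: h0 h1; rewrite -rr => /(mulfI (lt0r_neq0 r0)) ec /(mulfI (lt0r_neq0 r0)) es.
by rewrite cosB ec es -!expr2 cos2Dsin2.
Qed.

Lemma dir_ex u : u != 0 -> exists a, dir u a.
Proof.
move=> /dot_gt0 u0; set r := Num.sqrt (dot u u).
have r0 : 0 < r by rewrite sqrtr_gt0.
have r2 : r ^+ 2 = dot u u by rewrite sqr_sqrtr // ltW.
set c := u 0 0 / r; set d := u 0 1 / r.
have cd : c ^+ 2 + d ^+ 2 = 1.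
  have rn : r != 0 by rewrite gt_eqF.
  have -> : c ^+ 2 + d ^+ 2 = dot u u / r ^+ 2 by rewrite /c /d /dot; field.
  by rewrite r2 divff // gt_eqF.
have c1 : -1 <= c <= 1.
  have : c ^+ 2 <= 1 by have := sqr_ge0 d; lra.
  by move=> h; apply/andP; split; nra.
have hd : sin (acos c) = Num.sqrt (1 - c ^+ 2) by rewrite sin_acos.
have sd : 1 - c ^+ 2 = d ^+ 2 by lra.
have [d0|d0] := leP 0 d.
  exists (acos c), r => //; apply: rV2P; rewrite !rvE.
    by rewrite acosK // mulrC divfK ?gt_eqF.
  by rewrite hd sd sqrtr_sqr ger0_norm // mulrC divfK ?gt_eqF.
exists (- acos c), r => //; apply: rV2P; rewrite !rvE.
  by rewrite cosN acosK // mulrC divfK ?gt_eqF.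
by rewrite sinN hd sd sqrtr_sqr ltr0_norm // opprK mulrC divfK ?gt_eqF.
Qed.

(** Between two vectors at an acute angle the increment of the argument is an arctangent, hence
    continuous in both. Lifts are built as sums of such increments. *)
Lemma dir_atan u v a : dir u a -> 0 < dot u v -> dir v (a + atan (crs u v / dot u v)).
Proof.
move=> [r r0 eu] d0; set t := crs u v / dot u v; set s := Num.sqrt (1 + t ^+ 2).
have s2 : s ^+ 2 = 1 + t ^+ 2 by rewrite sqr_sqrtr // addr_ge0 ?sqr_ge0.
have s0 : 0 < s by rewrite sqrtr_gt0; have := sqr_ge0 t; lra.
have hc : cos (atan t) = s^-1 by rewrite cos_atan.
have hs : sin (atan t) = t / s.
  have := atanK t; rewrite /tan hc invrK => h.
  by rewrite -{2}h mulfK // gt_eqF.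
exists (s * (dot u v) / r); first by rewrite divr_gt0 ?mulr_gt0.
have rn : r != 0 by rewrite gt_eqF.
have sn : s != 0 by rewrite gt_eqF.
have e0 : dot u v = r * (cos a * v 0 0 + sin a * v 0 1) by rewrite /dot eu !rvE; ring.
have e1 : crs u v = r * (cos a * v 0 1 - sin a * v 0 0) by rewrite /crs eu !rvE; ring.
have et : t * dot u v = crs u v by rewrite divfK // gt_eqF.
have ca : cos a ^+ 2 = 1 - sin a ^+ 2 by have := cos2Dsin2 a; lra.
apply: rV2P; rewrite !rvE ?cosD ?sinD hc hs.
- transitivity ((dot u v * cos a - t * dot u v * sin a) / r); last by field; rewrite sn rn.
  rewrite et e0 e1; transitivity (v 0 0 * (cos a ^+ 2 + sin a ^+ 2)); last by field.
  by rewrite cos2Dsin2 mulr1.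
- transitivity ((dot u v * sin a + t * dot u v * cos a) / r); last by field; rewrite sn rn.
  rewrite et e0 e1; transitivity (v 0 1 * (cos a ^+ 2 + sin a ^+ 2)); last by field.
  by rewrite cos2Dsin2 mulr1.
Qed.

Lemma cat_atan (T : topologicalType) (f : T -> R) x : cat f x -> cat (fun y => atan (f y)) x.
Proof. by move=> hf; apply: (@cat_comp _ _ _ (@atan R)) => //; exact: continuous_atan. Qed.
Lemma cat_cos (T : topologicalType) (f : T -> R) x : cat f x -> cat (fun y => cos (f y)) x.
Proof. by move=> hf; apply: (@cat_comp _ _ _ (@cos R)) => //; exact: continuous_cos. Qed.
Lemma cat_sin (T : topologicalType) (f : T -> R) x : cat f x -> cat (fun y => sin (f y)) x.
Proof. by move=> hf; apply: (@cat_comp _ _ _ (@sin R)) => //; exact: continuous_sin. Qed.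
Lemma cat_pol (T : topologicalType) (f : T -> R) x : cat f x -> cat (fun y => pol (f y)) x.
Proof. by move=> hf; apply: cat_v2; [exact: cat_cos|exact: cat_sin]. Qed.

Lemma near_gt0 (T : topologicalType) (f : T -> R) x : cat f x -> 0 < f x ->
  \forall y \near x, 0 < f y.
Proof. by move=> hf f0; apply: (hf [set y | 0 < y]); exact: lt_nbhsr. Qed.

(** The tube lemma: one neighbourhood of the parameter [u] serves a whole compact set. *)
Lemma tube (T U : topologicalType) (K : set T) (P : T -> U -> Prop) (u : U) :
  compact K -> (forall x, K x -> \forall y \near (x, u), P y.1 y.2) ->
  \forall w \near u, forall x, K x -> P x w.
Proof.
move=> cK hP; have := (compact_near_coveringP _).1 cK U (nbhs u) (fun w x => P x w) _.
by apply => x Kx; have := hP x Kx.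
Qed.

(** The segment from the corner (0, 0) to [p] is cut into [N] equal steps, so short that consecutive
    values of [f] make an acute angle; the increments of the argument are then added up. *)
Theorem lift (f : R * R -> 'rV[R]_2) : continuous f ->
  (forall p, 0 <= p.1 <= 1 -> 0 <= p.2 <= 1 -> f p != 0) ->
  exists th : R * R -> R, continuous th /\
    forall p, 0 <= p.1 <= 1 -> 0 <= p.2 <= 1 -> dir (f p) (th p).
Proof.
move=> cf f0.
(* The first coordinate is the parameter of the contraction to the corner; the clamps keep the point
   in the square, where [f] does not vanish. *)
pose F (x : R * (R * R)) := f (cl x.1 * cl x.2.1, cl x.1 * cl x.2.2).
have F0 x : F x != 0.
  have [/andP[a0 a1] /andP[b0 b1] /andP[c0 c1]] := And3 (cl_itv x.1) (cl_itv x.2.1) (cl_itv x.2.2).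
  by apply: f0 => /=; rewrite mulr_ge0 ?mulr_ile1.
have cF : continuous F.
  by rewrite /F; ct.
pose Phi (x : (R * (R * R)) * R) := dot (F x.1) (F (x.1.1 + x.2, x.1.2)).
have cPhi : continuous Phi.
  by rewrite /Phi; ct.
have cpt : compact (`[0, 1] `*` (`[0, 1] `*` `[0, 1]) : set (R * (R * R))).
  by apply: compact_setX; [|apply: compact_setX]; exact: segment_compact.
have /nbhs_ballP[] : \forall h \near (0 : R), forall x,
    (`[0, 1] `*` (`[0, 1] `*` `[0, 1]) : set (R * (R * R))) x -> 0 < Phi (x, h).
  apply: tube => // x _; have : \forall y \near (x, 0 : R), 0 < Phi y.
    apply: near_gt0; first exact: cPhi.
    by rewrite /Phi /= addr0 -surjective_pairing; exact: dot_gt0.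
  by apply: filterS => -[].
move=> d /= d0 hd.
pose N := (Num.truncn d^-1).+1.
have Nd : (N%:R : R)^-1 < d.
  by rewrite invf_plt ?posrE ?ltr0n //; have := truncnS_gt d^-1.
pose t (k : nat) := k%:R / N%:R : R.
have tK k p : (k < N)%N -> 0 < dot (F (t k, p)) (F (t k.+1, p)).
  move=> kN; pose p' := (cl p.1, cl p.2).
  have tk : 0 <= t k <= 1.
    by rewrite /t divr_ge0 // ler_pdivrMr ?ltr0n // mul1r ler_nat ltnW.
  have -> : dot (F (t k, p)) (F (t k.+1, p)) = Phi ((t k, p'), N%:R^-1).
    rewrite /Phi /F /= /p' /=; rewrite !(@cl_id _ (cl _)) ?cl_itv //.
    by rewrite /t -addn1 natrD mulrDl mul1r.
  apply: (hd N%:R^-1) => /=.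
    by rewrite /ball /= sub0r normrN gtr0_norm // invr_gt0 ltr0n.
  by rewrite /p' !in_itv /= !cl_itv.
have [a0 ha0] := dir_ex (f0 (0, 0) (ltac:(by rewrite /= lexx ler01)) (ltac:(by rewrite /= lexx ler01))).
pose g k p := atan (crs (F (t k, p)) (F (t k.+1, p)) / dot (F (t k, p)) (F (t k.+1, p))).
exists (fun p => a0 + \sum_(k <- iota 0 N) g k p); split.
  move=> p; have cFt k : cat (fun y => F (t k, y)) p.
    by ct.
  apply: catD; first exact: cat_cst.
  apply: (cat_sum (f := g)) => k; rewrite mem_iota /= add0n => kN.
  rewrite /g; apply: (cat_atan (f := fun y => _ / _)); apply: catM; first exact: cat_crs.
  by apply: catV; [rewrite gt_eqF // tK | exact: cat_dot].
move=> p p1 p2.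
have key j : (j <= N)%N -> dir (F (t j, p)) (a0 + \sum_(k <- iota 0 j) g k p).
  elim: j => [_|j IH jN].
    rewrite big_nil addr0 /F /t mul0r /=.
    by rewrite !(@cl_id _ 0) ?lexx ?ler01 // !mul0r.
  rewrite -addn1 iotaD big_cat /= big_cons big_nil addr0 addrA add0n addn1.
  by apply: dir_atan; [apply: IH; exact: ltnW | exact: tK].
have := key N (leqnn N); rewrite /F /t divff ?pnatr_eq0 //= !cl_id ?lexx ?ler01 // !mul1r.
by rewrite -surjective_pairing.
Qed.

Lemma ivt (D : R -> R) a b (y : R) : continuous D -> a <= b ->
  (D a <= y <= D b) || (D b <= y <= D a) -> exists2 c, a <= c <= b & D c = y.
Proof.
move=> cD ab hv.
have [|c cab <-] := @IVT R D a b y ab (continuous_subspaceT cD).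
  by rewrite ge_min le_max; case/orP: hv => /andP[-> ->]; rewrite ?orbT.
by exists c => //; move: cab; rewrite in_itv.
Qed.

(** All increments are multiples of 2 pi. If one were not zero, the intermediate value theorem would
    give another of absolute value at most pi and still not zero. *)
Lemma cos1_cst (D : R -> R) a b : continuous D -> a <= b ->
  (forall s, a <= s <= b -> cos (D s - D a) = 1) -> D b = D a.
Proof.
move=> cD ab h; apply/eqP/negP => /negP ne.
have [c cab Dc] : exists2 c, a <= c <= b & `|D c - D a| = Num.min `|D b - D a| pi.
  apply: (@ivt (fun s => `|D s - D a|)) => //.
    by ct.
  by rewrite subrr normr0 le_min normr_ge0 pi_ge0 ge_min lexx.
have m0 : 0 < Num.min `|D b - D a| pi by rewrite lt_min normr_gt0 subr_eq0 ne pi_gt0.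
have m1 : Num.min `|D b - D a| pi < pi *+ 2.
  by rewrite gt_min mulr2n ltrDl pi_gt0 orbT.
have := cos1_eq0 (h c cab); rewrite Dc => /(_ m1) e.
by move: m0; rewrite -Dc e normr0 ltxx.
Qed.

Lemma lift_cst (f : R -> 'rV[R]_2) (th th' : R -> R) a b :
  continuous th -> continuous th' -> a <= b ->
  (forall s, a <= s <= b -> dir (f s) (th s)) ->
  (forall s, a <= s <= b -> dir (f s) (th' s)) -> th' b - th b = th' a - th a.
Proof.
move=> c c' ab h h'.
apply: (@cos1_cst (fun s => th' s - th s)) => // [|s sab]; first by ct.
have aab : a <= a <= b by rewrite lexx ab.
have e := dir_cos (h s sab) (h' s sab); have e' := dir_cos (h a aab) (h' a aab).
have s0 : sin (th' s - th s) = 0.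
  by apply/eqP; rewrite -(@sqrf_eq0) sin2cos2 e expr1n subrr.
by rewrite cosB e e' s0; ring.
Qed.

(** Total change of the argument over [0, 1], in radians; the curve need not be closed. *)
Definition turn (f : R -> 'rV[R]_2) (D : R) := exists2 th : R -> R, continuous th &
  (forall t, 0 <= t <= 1 -> dir (f t) (th t)) /\ th 1 - th 0 = D.

Lemma turn_uniq f D D' : turn f D -> turn f D' -> D = D'.
Proof.
move=> [th c [h <-]] [th' c' [h' <-]].
by have := lift_cst c c' ler01 h h'; lra.
Qed.

(** Free homotopy of loops in the punctured plane. *)
Definition lhom (f g : R -> 'rV[R]_2) := exists H : R * R -> 'rV[R]_2,
  [/\ continuous H, forall p, 0 <= p.1 <= 1 -> 0 <= p.2 <= 1 -> H p != 0,
      forall s, 0 <= s <= 1 -> H (s, 0) = H (s, 1) &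
      forall t, 0 <= t <= 1 -> H (0, t) = f t /\ H (1, t) = g t].

Lemma lhom_sym f g : lhom f g -> lhom g f.
Proof.
move=> [H [cH H0 per e]]; exists (fun p => H (1 - p.1, p.2)); split.
- by ct.
- by move=> p p1 p2; apply: H0 => //=; lra.
- by move=> s hs /=; apply: per; lra.
- by move=> t ht; have [<- <-] := e t ht; rewrite /= subr0 subrr.
Qed.

Lemma lhom_turn f g : lhom f g -> exists2 D, turn f D & turn g D.
Proof.
move=> [H [cH H0 per e]]; have [th [cth hth]] := lift cH H0.
have i0 : 0 <= (0 : R) <= 1 by rewrite lexx ler01.
have i1 : 0 <= (1 : R) <= 1 by rewrite lexx ler01.
exists (th (0, 1) - th (0, 0)).
  exists (fun t => th (0, t)); first by ct.
  by split=> // t ht; rewrite -(e t ht).1; exact: hth.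
exists (fun t => th (1, t)); first by ct.
split=> [t ht|]; first by rewrite -(e t ht).2; exact: hth.
apply: (@cos1_cst (fun s => th (s, 1) - th (s, 0))) => // [|s hs]; first by ct.
have d1 := hth (s, 1) hs i1; rewrite -(per s hs) in d1.
have c1 := dir_cos (hth (s, 0) hs i0) d1.
have d2 := hth (0, 1) i0 i1; rewrite -(per 0 i0) in d2.
have c2 := dir_cos (hth (0, 0) i0 i0) d2.
have s0 : sin (th (s, 1) - th (s, 0)) = 0.
  by apply/eqP; rewrite -(@sqrf_eq0) sin2cos2 c1 expr1n subrr.
by rewrite cosB c1 c2 s0; ring.
Qed.

Lemma turn_hom f g D : lhom f g -> turn f D -> turn g D.
Proof. by move=> /lhom_turn[D' hf hg] hf'; rewrite (turn_uniq hf' hf). Qed.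

Lemma turn_cst u : u != 0 -> turn (fun=> u) 0.
Proof.
by move=> /dir_ex[a ha]; exists (fun=> a); [ct | rewrite subrr].
Qed.

(** Over both halves of the loop the argument changes by the same odd multiple of pi. *)
Lemma turn_odd f D : (forall t, 0 <= t <= 2^-1 -> f (t + 2^-1) = - f t) -> turn f D -> D != 0.
Proof.
move=> odd [th c [h e]]; apply/negP => /eqP D0.
have hE s : 0 <= s <= 2^-1 -> cos (th (s + 2^-1) - th s) = -1.
  move=> hs; have d1 : dir (f (s + 2^-1)) (th (s + 2^-1)) by apply: h; lra.
  have d2 : dir (f s) (th s) by apply: h; lra.
  move/dirN in d2; rewrite -odd // in d2.
  have := dir_cos d2 d1.
  rewrite (_ : th (s + 2^-1) - (th s + pi) = (th (s + 2^-1) - th s) - pi); last by ring.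
  by move: (th _ - th s) => x; rewrite cosB cospi sinpi; lra.
have hs s : 0 <= s <= 2^-1 -> sin (th (s + 2^-1) - th s) = 0.
  by move=> ?; apply/eqP; rewrite -(@sqrf_eq0) sin2cos2 hE // sqrrN expr1n subrr.
have i0 : 0 <= (0 : R) <= 2^-1 by lra.
have i2 : 0 <= (2^-1 : R) <= 2^-1 by lra.
have := @cos1_cst (fun s => th (s + 2^-1) - th s) 0 2^-1 (ltac:(by ct)) (ltac:(by lra)).
rewrite add0r (_ : 2^-1 + 2^-1 = 1); last by lra.
move=> /(_ _) E; have {}E : th 1 - th 2^-1 = th 2^-1 - th 0.
  apply: E => s sI; have := hE 0 i0; have := hs 0 i0; rewrite add0r => e1 e2.
  by rewrite cosB e1 e2 hE // hs //; ring.
have : th 2^-1 - th 0 = 0 by lra.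
have := hE 0 i0; rewrite add0r => /[swap] ->; rewrite cos0; lra.
Qed.

(** At a difference of exactly pi the two vectors would point in opposite directions. *)
Lemma lift_noneg (f g : R -> 'rV[R]_2) (tf tg : R -> R) a b :
  continuous tf -> continuous tg -> a <= b ->
  (forall s, a <= s <= b -> dir (f s) (tf s)) ->
  (forall s, a <= s <= b -> dir (g s) (tg s)) ->
  (forall s c, a <= s <= b -> 0 < c -> f s != - (c *: g s)) ->
  `|tf a - tg a| < pi -> `|tf b - tg b| < pi.
Proof.
move=> cf cg ab hf hg ne ha; rewrite ltNge; apply/negP => hb.
have [c cab] : exists2 c, a <= c <= b & `|tf c - tg c| = pi.
  by apply: (@ivt (fun s => `|tf s - tg s|)) => //; [ct|rewrite (ltW ha) hb].
have [r r0 er] := hf c cab; have [r' r'0 er'] := hg c cab.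
have nh := ne c (r / r') cab (divr_gt0 r0 r'0).
move=> epi; case/negP: nh; rewrite er er' scalerA divfK ?gt_eqF //.
have [e1 e2] : cos (tf c) = - cos (tg c) /\ sin (tf c) = - sin (tg c).
  have [hh|hh] := leP 0 (tf c - tg c).
    have -> : tf c = tg c + pi by move: epi; rewrite ger0_norm //; lra.
    by rewrite cosDpi sinDpi.
  have -> : tf c = tg c - pi by move: epi; rewrite ltr0_norm //; lra.
  by rewrite cosB sinB cospi sinpi; split; ring.
apply/eqP/rV2P; rewrite !rvE ?e1 ?e2; ring.
Qed.
End Lift.

(** * Hermitian forms and the Klein model *)

Section Minkowski.
Variable R : realType.
Notation H := 'rV[R]_4.
Implicit Types (q X Y : H) (a b c d m s t : R).

Definition v4 a b c d : H :=
  \row_j (if j == 0 then a else if j == 1 then b else if j == 2 then c else d).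
Lemma v4_0 a b c d : v4 a b c d 0 0 = a. Proof. by rewrite mxE. Qed.
Lemma v4_1 a b c d : v4 a b c d 0 1 = b. Proof. by rewrite mxE. Qed.
Lemma v4_2 a b c d : v4 a b c d 0 2 = c. Proof. by rewrite mxE. Qed.
Lemma v4_3 a b c d : v4 a b c d 0 3 = d. Proof. by rewrite mxE. Qed.
Definition v4E := (v4_0, v4_1, v4_2, v4_3, @rvD R, @rvN R, @rvZ R, @rv0 R).
Lemma rV4P X Y : X 0 0 = Y 0 0 -> X 0 1 = Y 0 1 -> X 0 2 = Y 0 2 -> X 0 3 = Y 0 3 -> X = Y.
Proof.
move=> h0 h1 h2 h3; apply/rowP => -[[|[|[|[|//]]]] lt].
- by rewrite (_ : Ordinal lt = 0) //; exact/val_inj.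
- by rewrite (_ : Ordinal lt = 1) //; exact/val_inj.
- by rewrite (_ : Ordinal lt = 2) //; exact/val_inj.
- by rewrite (_ : Ordinal lt = 3) //; exact/val_inj.
Qed.
Lemma cat_v4 (T : topologicalType) (f g h k : T -> R) x :
  cat f x -> cat g x -> cat h x -> cat k x -> cat (fun y => v4 (f y) (g y) (h y) (k y)) x.
Proof.
move=> hf hg hh hk; apply: cat_row => -[[|[|[|[|//]]]] lt].
- rewrite [X in cat X](_ : _ = f) //; apply/funext => y.
  by rewrite (_ : Ordinal lt = 0) ?v4E //; exact/val_inj.
- rewrite [X in cat X](_ : _ = g) //; apply/funext => y.
  by rewrite (_ : Ordinal lt = 1) ?v4E //; exact/val_inj.
- rewrite [X in cat X](_ : _ = h) //; apply/funext => y.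
  by rewrite (_ : Ordinal lt = 2) ?v4E //; exact/val_inj.
- rewrite [X in cat X](_ : _ = k) //; apply/funext => y.
  by rewrite (_ : Ordinal lt = 3) ?v4E //; exact/val_inj.
Qed.

(** The trace pairing between Hermitian forms and their dual, both written in the same four
    coordinates; [qd] is the determinant. The positive semidefinite matrices of trace 1 are the
    closed Klein ball, with centre [org]. *)
Definition pr q X : R := q 0 0 * X 0 0 + q 0 1 * X 0 1 + 2 * (q 0 2 * X 0 2 + q 0 3 * X 0 3).
Definition qd X : R := X 0 0 * X 0 1 - X 0 2 ^+ 2 - X 0 3 ^+ 2.
Definition tr X : R := X 0 0 + X 0 1.
Definition pos X := 0 < X 0 0 /\ 0 < qd X.
Definition psd X := [/\ 0 <= X 0 0, 0 <= X 0 1 & 0 <= qd X].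
Definition ball_closed X := psd X /\ tr X = 1.
Definition ball_open X := pos X /\ tr X = 1.
Definition org : H := v4 2^-1 2^-1 0 0.

Lemma cat_pr (T : topologicalType) (f g : T -> H) x :
  cat f x -> cat g x -> cat (fun y => pr (f y) (g y)) x.
Proof. by move=> hf hg; rewrite /pr; ct. Qed.
Lemma cat_qd (T : topologicalType) (f : T -> H) x : cat f x -> cat (fun y => qd (f y)) x.
Proof. by move=> hf; rewrite /qd; ct. Qed.
Lemma cat_tr (T : topologicalType) (f : T -> H) x : cat f x -> cat (fun y => tr (f y)) x.
Proof. by move=> hf; rewrite /tr; ct. Qed.

Lemma prDr q X Y : pr q (X + Y) = pr q X + pr q Y. Proof. by rewrite /pr !v4E; ring. Qed.
Lemma prZr q X c : pr q (c *: X) = c * pr q X. Proof. by rewrite /pr !v4E; ring. Qed.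
Lemma prNr q X : pr q (- X) = - pr q X. Proof. by rewrite /pr !v4E; ring. Qed.
Lemma prDl q q' X : pr (q + q') X = pr q X + pr q' X. Proof. by rewrite /pr !v4E; ring. Qed.
Lemma prZl q X c : pr (c *: q) X = c * pr q X. Proof. by rewrite /pr !v4E; ring. Qed.
Lemma prNl q X : pr (- q) X = - pr q X. Proof. by rewrite /pr !v4E; ring. Qed.
Lemma pr0l X : pr 0 X = 0. Proof. by rewrite /pr !v4E; ring. Qed.
Definition prE := (prDr, prZr, prNr, prDl, prZl, prNl, pr0l).
Lemma trD X Y : tr (X + Y) = tr X + tr Y. Proof. by rewrite /tr !v4E; ring. Qed.
Lemma trZ X c : tr (c *: X) = c * tr X. Proof. by rewrite /tr !v4E; ring. Qed.
Lemma trN X : tr (- X) = - tr X. Proof. by rewrite /tr !v4E; ring. Qed.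
Lemma qdZ X c : qd (c *: X) = c ^+ 2 * qd X. Proof. by rewrite /qd !v4E; ring. Qed.
Lemma qdN X : qd (- X) = qd X. Proof. by rewrite /qd !v4E; ring. Qed.
Lemma qd0 : qd (0 : H) = 0. Proof. by rewrite /qd !v4E; ring. Qed.

Lemma cs2 a b c d s t : 0 <= s -> 0 <= t -> a ^+ 2 + b ^+ 2 <= s -> c ^+ 2 + d ^+ 2 <= t ->
  (a * c + b * d) ^+ 2 <= s * t.
Proof.
move=> s0 t0 hs ht; apply: (@le_trans _ _ ((a ^+ 2 + b ^+ 2) * (c ^+ 2 + d ^+ 2))).
  rewrite -subr_ge0 [leRHS](_ : _ = (a * d - b * c) ^+ 2) ?sqr_ge0 //; ring.
by apply: ler_pM => //; rewrite addr_ge0 ?sqr_ge0.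
Qed.

Lemma pos_psd X : pos X -> psd X.
Proof.
move=> [x0 x1]; split; try exact: ltW.
by rewrite -(pmulr_rge0 _ x0); have := sqr_ge0 (X 0 2); have := sqr_ge0 (X 0 3);
  move: x1; rewrite /qd; lra.
Qed.
Lemma pos_1 X : pos X -> 0 < X 0 1.
Proof.
move=> [x0 x1].
by rewrite -(pmulr_rgt0 _ x0); have := sqr_ge0 (X 0 2); have := sqr_ge0 (X 0 3);
  move: x1; rewrite /qd; lra.
Qed.

Lemma psd0P X : psd X -> tr X = 0 -> X = 0.
Proof.
rewrite /tr => -[x0 x1 hq] t0; have e0 : X 0 0 = 0 by lra.
have e1 : X 0 1 = 0 by lra.
move: hq; rewrite /qd e0 mul0r sub0r => hq.
have := sqr_ge0 (X 0 2); have := sqr_ge0 (X 0 3) => h3 h2.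
apply: rV4P; rewrite !v4E //; apply/eqP; rewrite -sqrf_eq0; apply/eqP; lra.
Qed.

Lemma psd_tr_ge0 X : psd X -> 0 <= tr X.
Proof. by case=> x0 x1 _; rewrite addr_ge0. Qed.
Lemma psd_tr_gt0 X : psd X -> X != 0 -> 0 < tr X.
Proof.
move=> pX X0; rewrite lt_neqAle psd_tr_ge0 // andbT eq_sym.
by apply: contra X0 => /eqP h; rewrite (psd0P pX h).
Qed.

(** Self-duality of the positive cone: the off-diagonal part is bounded by Cauchy-Schwarz, and the
    diagonal part from below by the inequality of arithmetic and geometric means. *)
Lemma pr_ge0 q X : psd q -> psd X -> 0 <= pr q X.
Proof.
move=> [q0 q1 hq] [x0 x1 hX]; rewrite leNgt; apply/negP => lt0.
pose S := q 0 0 * X 0 0 + q 0 1 * X 0 1; pose T := q 0 2 * X 0 2 + q 0 3 * X 0 3.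
have S0 : 0 <= S by rewrite addr_ge0 ?mulr_ge0.
have hT : T ^+ 2 <= (q 0 0 * q 0 1) * (X 0 0 * X 0 1).
  by apply: cs2; rewrite ?mulr_ge0 //; [move: hq|move: hX]; rewrite /qd; lra.
have hS : 4 * ((q 0 0 * q 0 1) * (X 0 0 * X 0 1)) <= S ^+ 2.
  rewrite /S -subr_ge0 [leRHS](_ : _ = (q 0 0 * X 0 0 - q 0 1 * X 0 1) ^+ 2) ?sqr_ge0 //.
  ring.
have lt : S < - (2 * T) by move: lt0; rewrite /pr -/S -/T; lra.
have : S ^+ 2 < (- (2 * T)) ^+ 2 by rewrite ltr_sqr ?nnegrE //; lra.
by rewrite sqrrN exprMn; lra.
Qed.

(** A positive form leaves room for a small multiple of [org], which turns the weak inequality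
    [pr_ge0] into a strict one. *)
Lemma pos_qdB q : pos q -> exists2 e, 0 < e & psd (q - e *: org).
Proof.
move=> hq; have [q0 hd] := hq; have q1 := pos_1 hq.
have t0 : 0 < tr q by rewrite addr_gt0.
exists (Num.min (qd q / tr q) (Num.min (q 0 0) (q 0 1))).
  by rewrite !lt_min q0 q1 divr_gt0.
set e := Num.min _ _.
have e0 : 0 < e by rewrite !lt_min q0 q1 divr_gt0.
have e1 : e <= q 0 0 by rewrite /e !ge_min lexx orbT.
have e2 : e <= q 0 1 by rewrite /e !ge_min lexx !orbT.
have e3 : e * tr q <= qd q by rewrite -ler_pdivlMr // /e ge_min lexx.
split; rewrite ?/org ?v4E; [lra | lra |].
have -> : qd (q - e *: org) = qd q - e / 2 * tr q + e ^+ 2 / 4.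
  by rewrite /qd /tr !v4E; field.
have := sqr_ge0 e; nra.
Qed.

Lemma pr_org X : pr org X = tr X / 2.
Proof. by rewrite /pr /tr !v4E; field. Qed.

Lemma pr_gt0 q X : pos q -> psd X -> X != 0 -> 0 < pr q X.
Proof.
move=> /pos_qdB[e e0 hp] pX X0; have := pr_ge0 hp pX.
rewrite !prE pr_org => h; have := psd_tr_gt0 pX X0; nra.
Qed.

(** The mixed term of the determinant of a sum is the pairing with the adjugate of [Y], which is
    again positive semidefinite. *)
Lemma psdD X Y : psd X -> psd Y -> psd (X + Y).
Proof.
move=> pX pY; have [x0 x1 hX] := pX; have [y0 y1 hY] := pY.
split; [by rewrite v4E addr_ge0 | by rewrite v4E addr_ge0 |].
have pY' : psd (v4 (Y 0 1) (Y 0 0) (- Y 0 2) (- Y 0 3)).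
  by split; rewrite ?v4E //; move: hY; rewrite /qd !v4E; lra.
have := pr_ge0 pX pY'; rewrite /pr /qd !v4E; move: hX hY; rewrite /qd; nra.
Qed.
Lemma psdZ c X : 0 <= c -> psd X -> psd (c *: X).
Proof. by move=> c0 [x0 x1 h]; split; rewrite ?qdZ ?v4E ?mulr_ge0 ?sqr_ge0. Qed.
Lemma posZ c X : 0 < c -> pos X -> pos (c *: X).
Proof. by move=> c0 [x0 h]; split; rewrite ?qdZ ?v4E ?mulr_gt0 ?exprn_gt0. Qed.
Lemma posDpsd X Y : pos X -> psd Y -> pos (X + Y).
Proof.
move=> pX pY; have [x0 hX] := pX; have [y0 y1 hY] := pY.
split; first by rewrite v4E ltr_wpDr.
have pY' : psd (v4 (Y 0 1) (Y 0 0) (- Y 0 2) (- Y 0 3)).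
  by split; rewrite ?v4E //; move: hY; rewrite /qd !v4E; lra.
have := pr_ge0 (pos_psd pX) pY'; rewrite /pr /qd !v4E; move: hX hY; rewrite /qd; nra.
Qed.
Lemma posD X Y : pos X -> pos Y -> pos (X + Y).
Proof. by move=> pX /pos_psd; exact: posDpsd. Qed.
Lemma pos_org : pos org. Proof. by split; rewrite ?/qd !v4E; lra. Qed.
Lemma tr_org : tr org = 1. Proof. by rewrite /tr !v4E; lra. Qed.
Lemma ball_open_org : ball_open org. Proof. by split; [exact: pos_org|exact: tr_org]. Qed.
Lemma ball_openW X : ball_open X -> ball_closed X.
Proof. by case=> /pos_psd. Qed.
Lemma pos_tr_gt0 X : pos X -> 0 < tr X.
Proof. by move=> pX; rewrite addr_gt0 ?(pos_1 pX) //; case: pX. Qed.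
Lemma ball_closed_neq0 X : ball_closed X -> X != 0.
Proof.
by case=> _ t1; apply/eqP => e; move: t1; rewrite e /tr !v4E; lra.
Qed.

Lemma psd_norm X : psd X -> `|X| <= tr X.
Proof.
move=> pX; have [x0 x1 hX] := pX; have t0 := psd_tr_ge0 pX.
rewrite [`|X|]mx_normrE; apply/bigmax_leP; split => //= -[i j] _ /=; rewrite ord1.
have h2 : X 0 2 ^+ 2 <= tr X ^+ 2.
  by move: hX; rewrite /qd /tr; have := sqr_ge0 (X 0 3); nra.
have h3 : X 0 3 ^+ 2 <= tr X ^+ 2.
  by move: hX; rewrite /qd /tr; have := sqr_ge0 (X 0 2); nra.
have ab (x : R) : x ^+ 2 <= tr X ^+ 2 -> `|x| <= tr X.
  by move=> h; rewrite ler_norml; apply/andP; split; nra.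
case: j => -[|[|[|[|//]]]] lt.
- by rewrite (_ : Ordinal lt = 0) ?ger0_norm /tr; [lra|lra|exact/val_inj].
- by rewrite (_ : Ordinal lt = 1) ?ger0_norm /tr; [lra|lra|exact/val_inj].
- by rewrite (_ : Ordinal lt = 2); [exact: ab|exact/val_inj].
- by rewrite (_ : Ordinal lt = 3); [exact: ab|exact/val_inj].
Qed.
End Minkowski.

Ltac ct_hook ::= lazymatch goal with
  | |- cat (fun y => cl (@?f y)) _ => apply: (cat_cl (f := f))
  | |- cat (fun y => v2 (@?f y) (@?g y)) _ => apply: (cat_v2 (f := f) (g := g))
  | |- cat (fun y => dot (@?f y) (@?g y)) _ => apply: (cat_dot (f := f) (g := g))
  | |- cat (fun y => crs (@?f y) (@?g y)) _ => apply: (cat_crs (f := f) (g := g))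
  | |- cat (fun y => pr (@?f y) (@?g y)) _ => apply: (cat_pr (f := f) (g := g))
  | |- cat (fun y => qd (@?f y)) _ => apply: (cat_qd (f := f))
  | |- cat (fun y => tr (@?f y)) _ => apply: (cat_tr (f := f))
  | |- cat (fun y => v4 (@?a y) (@?b y) (@?c y) (@?d y)) _ =>
      apply: (cat_v4 (f := a) (g := b) (h := c) (k := d))
  | |- cat (fun y => pol (@?f y)) _ => apply: (cat_pol (f := f))
  end.

Lemma closed_pre (T U : topologicalType) (f : T -> U) (D : set U) :
  continuous f -> closed D -> closed [set x | D (f x)].
Proof. by move=> cf cD; apply: (@closed_comp _ _ f D) => // x _; exact: cf. Qed.
Lemma open_pre (T U : topologicalType) (f : T -> U) (D : set U) :
  continuous f -> open D -> open [set x | D (f x)].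
Proof. by move=> cf cD; apply: (@open_comp _ _ f D) => // x _; exact: cf. Qed.

(** * Systems of disjoint leaves *)

Section Leaves.
Variable R : realType.
Notation M := 'rV[R]_2.
Notation H := 'rV[R]_4.
Implicit Types (x y : M) (X Y : H) (e d s m : R).

Definition nrm X : H := (tr X)^-1 *: X.

(** What a fitting immersion and a fitting flow have in common. [on x] is the linear span of the
    leaf of [x]; disjointness and sweeping are only local in [x], but they hold up to the boundary
    of the ball. *)
Record leaf_system (on : M -> H -> Prop) : Prop := {
  lf_lin : forall x X Y (c : R), on x X -> on x Y -> on x (c *: X + Y);
  lf_closed : closed [set p : M * H | on p.1 p.2];
  lf_base : exists X0 : M -> H, continuous X0 /\ forall x, ball_open (X0 x) /\ on x (X0 x);
  lf_disj : forall x, exists2 e, 0 < e & forall y y' Y, `|y - x| < e -> `|y' - x| < e ->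
    ball_closed Y -> on y Y -> on y' Y -> y = y';
  lf_open : forall x e X, 0 < e -> ball_closed X -> on x X -> exists2 d, 0 < d &
    forall Y, ball_closed Y -> `|Y - X| < d -> exists2 y, `|y - x| < e & on y Y
}.

Record leaf_action (G : groupType) (act : G -> M -> M) (L : G -> H -> H)
    (on : M -> H -> Prop) : Prop := {
  la_act1 : forall x, act 1%g x = x;
  la_actM : forall a b x, act (a * b)%g x = act a (act b x);
  la_cont : forall a, continuous (act a);
  la_proper : forall K : set M, compact K -> finite_set [set a | (act a @` K) `&` K !=set0];
  la_cocompact : exists2 K : set M, compact K & forall x, exists a, K (act a x);
  la_lin : forall a X Y (c : R), L a (c *: X + Y) = c *: L a X + L a Y;
  la_qd : forall a X, qd (L a X) = qd X;
  la_psd : forall a X, psd X -> psd (L a X);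
  la_K : forall a X, L a^-1%g (L a X) = X;
  la_on : forall a x X, on x X -> on (act a x) (L a X)
}.

Lemma cl_le0 s : s <= 0 -> cl s = 0.
Proof. by move=> s0; rewrite /cl max_l // ge_min s0 orbT. Qed.
Lemma cl_ge1 s : 1 <= s -> cl s = 1.
Proof. by move=> s1; rewrite /cl min_l // max_r. Qed.

Lemma norm_coord n (u : 'rV[R]_n) j : `|u 0 j| <= `|u|.
Proof.
by rewrite [leRHS]mx_normrE; exact: (le_bigmax _ (fun ij => `|u ij.1 ij.2|) (0, j)).
Qed.
Lemma norm_le n (u : 'rV[R]_n) e : 0 <= e -> (forall j, `|u 0 j| <= e) -> `|u| <= e.
Proof.
move=> e0 h; rewrite [leLHS]mx_normrE; apply/bigmax_leP; split => //= -[i j] _ /=.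
by rewrite ord1.
Qed.
Lemma rv_compact n e : compact [set x : 'rV[R]_n | `|x| <= e].
Proof.
apply: bounded_closed_compact.
  exists e; split; first exact: num_real.
  by move=> r er x /= xe; apply: le_trans xe (ltW er).
apply: closed_comp (@closed_le _ e) => x _; exact: (@norm_continuous _ _ x).
Qed.

Lemma ball_closed_norm X : ball_closed X -> `|X| <= 1.
Proof. by case=> pX <-; exact: psd_norm. Qed.

Lemma ball_closed_compact : compact [set X : H | ball_closed X].
Proof.
apply: (@subclosed_compact _ _ [set X : H | `|X| <= 1]); last exact: ball_closed_norm; last exact: rv_compact.
rewrite (_ : [set X | _] = [set X : H | 0 <= X 0 0] `&` [set X : H | 0 <= X 0 1] `&`
  [set X : H | 0 <= qd X] `&` [set X : H | tr X = 1]); last first.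
  by apply/seteqP; split=> X /=; [case=> -[] | case=> [[[]]]] => //; split.
repeat apply: closedI.
- by apply: (@closed_pre _ _ (fun X : H => X 0 0) _ _ (@closed_ge _ 0)); ct.
- by apply: (@closed_pre _ _ (fun X : H => X 0 1) _ _ (@closed_ge _ 0)); ct.
- by apply: (@closed_pre _ _ (fun X : H => qd X) _ _ (@closed_ge _ 0)); ct.
- by apply: (@closed_pre _ _ (fun X : H => tr X) _ _ (@closed_eq _ 1)); ct.
Qed.

Lemma nrm_closed X : psd X -> X != 0 -> ball_closed (nrm X).
Proof.
move=> pX X0; have t0 := psd_tr_gt0 pX X0.
by split; [apply: psdZ => //; rewrite invr_ge0 ltW | rewrite trZ mulVf ?gt_eqF].
Qed.
Lemma nrm_open X : pos X -> ball_open (nrm X).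
Proof.
move=> pX; have t0 := pos_tr_gt0 pX.
by split; [apply: posZ => //; rewrite invr_gt0 | rewrite trZ mulVf ?gt_eqF].
Qed.
Lemma conv_open X Y s : 0 < s <= 1 -> ball_open X -> ball_closed Y ->
  ball_open (s *: X + (1 - s) *: Y).
Proof.
move=> /andP[s0 s1] [pX tX] [pY tY]; split.
  by apply: posDpsd; [exact: posZ | apply: psdZ => //; rewrite subr_ge0].
by rewrite trD !trZ tX tY; ring.
Qed.

(** Depth inside the ball, expressed through the cone alone: this is a convex condition, and linear
    maps that preserve the cone respect the inequality behind it. *)
Definition thick m X := psd (X - m *: org R) /\ tr X = 1.

Lemma thick_open m X : 0 < m -> thick m X -> ball_open X.
Proof.
move=> m0 [h t]; split => //; rewrite -[X](subrKC (m *: org R)).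
by apply: posDpsd => //; apply: posZ => //; exact: pos_org.
Qed.
Lemma thick_conv m X Y s : 0 <= s <= 1 -> thick m X -> thick m Y ->
  thick m (X + s *: (Y - X)).
Proof.
move=> /andP[s0 s1] [hX tX] [hY tY]; split; last by rewrite trD trZ trD trN tX tY; ring.
have -> : X + s *: (Y - X) - m *: org R = (1 - s) *: (X - m *: org R) + s *: (Y - m *: org R).
  by apply: rV4P; rewrite !v4E; ring.
by apply: psdD; apply: psdZ => //; rewrite subr_ge0.
Qed.
Lemma open_thick X m : ball_open X -> 0 <= m <= qd X -> thick m X.
Proof.
move=> [pX t1] /andP[m0 mq]; split => //; have [x0 hX] := pX; have x1 := pos_1 pX.
have mx0 : m <= X 0 0.
  move: mq t1; rewrite /qd /tr; have := sqr_ge0 (X 0 2); have := sqr_ge0 (X 0 3); nra.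
have mx1 : m <= X 0 1.
  move: mq t1; rewrite /qd /tr; have := sqr_ge0 (X 0 2); have := sqr_ge0 (X 0 3); nra.
split; rewrite ?/org ?v4E; [lra | lra |].
have -> : qd (X - m *: org R) = qd X - m / 2 * tr X + m ^+ 2 / 4.
  by rewrite /qd /tr !v4E; field.
rewrite t1; have := sqr_ge0 m; lra.
Qed.

(** The modulus [d] is the same for all linear maps [f] preserving the cone, hence for the whole
    group. If a small multiple [s] of [X] dominates both signs of [Y - X], the same holds between
    the images, so that their difference is small relative to the trace of [f X], however much [f]
    distorts. *)
Lemma nrm_contract m e : 0 < m -> 0 < e -> exists2 d, 0 < d &
  forall (f : H -> H), (forall X Y c, f (c *: X + Y) = c *: f X + f Y) ->
    (forall X, psd X -> psd (f X)) -> (forall X, pos X -> pos (f X)) ->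
    forall X Y, thick m X -> thick m Y -> `|Y - X| < d -> `|nrm (f Y) - nrm (f X)| < e.
Proof.
move=> m0 e0; pose s := Num.min 2^-1 (e / 16); pose d := s * m / 8.
have s0 : 0 < s by rewrite lt_min invr_gt0 ltr0n divr_gt0.
have s1 : s <= 2^-1 by rewrite /s ge_min lexx.
have se : s * 16 <= e by rewrite -ler_pdivlMr // /s ge_min lexx orbT.
exists d; first by rewrite /d !mulr_gt0.
move=> f flin fpsd fpos X Y tX tY XY.
have f0 : f 0 = 0 by have := flin 0 0 1; rewrite !scale1r addr0 => h; apply: (@addrI _ (f 0)); rewrite -h addr0.
have fD U V : f (U + V) = f U + f V by have := flin U V 1; rewrite !scale1r.
have fZ c U : f (c *: U) = c *: f U by have := flin U 0 c; rewrite !addr0 f0 addr0.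
have [[X0' X1' Xd] tX1] := tX; have pX : pos X by have [] := thick_open m0 tX.
have pY : pos Y by have [] := thick_open m0 tY.
pose D := Y - X.
have cD j : - d <= D 0 j <= d.
  rewrite -ler_norml; apply: le_trans (ltW XY).
  exact: norm_coord.
(* Entries of size at most [d] are absorbed by [8 * d] times [org], whose diagonal entries are
   [4 * d]. *)
have hs (U : H) : (forall j, - d <= U 0 j <= d) -> psd (s *: X + U).
  move=> hU; have -> : s *: X + U = s *: (X - m *: org R) + ((s * m) *: org R + U).
    by apply: rV4P; rewrite !v4E; ring.
  apply: psdD; first by apply: psdZ => //; exact: ltW.
  have sm : s * m = 8 * d by rewrite /d; field.
  rewrite sm; have d0 : 0 < d by rewrite /d !mulr_gt0.
  have [u0 u1 u2 u3] := And4 (hU 0) (hU 1) (hU 2) (hU 3).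
  have sq2 : U 0 2 ^+ 2 <= d ^+ 2 by nra.
  have sq3 : U 0 3 ^+ 2 <= d ^+ 2 by nra.
  split; rewrite ?/qd !v4E; [lra | lra | ].
  have : 3 * d * (3 * d) <= (8 * d * 2^-1 + U 0 0) * (8 * d * 2^-1 + U 0 1).
    by apply: ler_pM; lra.
  nra.
have h1 : psd (s *: f X + f D) by rewrite -fZ -fD; apply: fpsd; exact: hs.
have h2 : psd (s *: f X - f D).
  rewrite -scaleN1r -fZ -fZ -fD; apply: fpsd; apply: hs => j.
  by rewrite scaleN1r rvN; have := cD j; lra.
have fY : f Y = f X + f D by rewrite -fD /D subrKC.
set T := tr (f X); have T0 : 0 < T by apply: pos_tr_gt0; exact: fpos.
set T' := tr (f Y); have T'0 : 0 < T' by apply: pos_tr_gt0; exact: fpos.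
have eT : T' = T + tr (f D) by rewrite /T' fY trD.
have b1 := psd_tr_ge0 h1; have b2 := psd_tr_ge0 h2; rewrite trD trZ -/T in b1.
rewrite trD trN trZ -/T in b2.
have nfX : `|f X| <= T by apply: psd_norm; apply: fpsd; exact: pos_psd.
have nfD : `|f D| <= 3 * s * T.
  have -> : f D = (s *: f X + f D) - s *: f X by rewrite addrAC subrr add0r.
  apply: le_trans (ler_normB _ _) _.
  have := psd_norm h1; rewrite trD trZ -/T normrZ gtr0_norm // => h.
  have : s * `|f X| <= s * T by rewrite ler_pM2l.
  nra.
have -> : nrm (f Y) - nrm (f X) = T'^-1 *: (f D - (tr (f D) / T) *: f X).
  have Tn : T != 0 by rewrite gt_eqF.
  have Tn' : T + tr (f D) != 0 by rewrite -eT gt_eqF.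
  rewrite /nrm -/T -/T' fY eT; apply: rV4P; rewrite !v4E; field; rewrite Tn Tn' //.
rewrite normrZ gtr0_norm ?invr_gt0 // -ltr_pdivlMl ?invr_gt0 // invrK.
apply: le_lt_trans (ler_normB _ _) _; rewrite normrZ.
have : `|tr (f D) / T| <= s.
  by rewrite normrM normfV (gtr0_norm T0) ler_pdivrMr // ler_norml; apply/andP; split; lra.
move=> h; have : `|tr (f D) / T| * `|f X| <= s * T by apply: ler_pM.
have : T / 2 <= T' by rewrite eT; nra.
nra.
Qed.

Section Uniform.
Variable on : M -> H -> Prop.
Hypothesis lf : leaf_system on.

Lemma unif_disj (K : set M) : compact K -> exists2 e, 0 < e &
  forall x y y' Y, K x -> `|y - x| < e -> `|y' - x| < e ->
    ball_closed Y -> on y Y -> on y' Y -> y = y'.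
Proof.
move=> cK; pose P (x : M) e := forall y y' Y, `|y - x| < e -> `|y' - x| < e ->
    ball_closed Y -> on y Y -> on y' Y -> y = y'.
have /nbhs_ballP[d /= d0 hd] : \forall e \near (0 : R), forall x, K x -> P x e.
  apply: tube => // x _; have [e e0 he] := lf_disj lf x.
  exists (ball x (e / 2), ball (0 : R) (e / 2)).
    by split; apply: nbhsx_ballx; rewrite divr_gt0.
  move=> [x' e'] /= [xx' ee'] y y' Y hy hy'.
  have le : e' < e / 2.
    by move: ee'; rewrite /ball /= sub0r normrN; apply: le_lt_trans; exact: ler_norm.
  have lx z : `|z - x'| < e' -> `|z - x| < e.
    move=> hz; rewrite -(subrKA x'); apply: le_lt_trans (ler_normD _ _) _.
    by move: xx'; rewrite -ball_normE /= distrC => xx'; lra.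
  by apply: he; exact: lx.
exists (d / 2); first by rewrite divr_gt0.
move=> x y y' Y Kx; apply: hd => //=.
by rewrite /ball /= sub0r normrN gtr0_norm ?divr_gt0 // ltr_pdivrMr // mulr2n mulrDr mulr1 ltrDl.
Qed.

Lemma unif_open (K : set M) e : compact K -> 0 < e -> exists2 d, 0 < d &
  forall x X Y, K x -> ball_closed X -> on x X -> ball_closed Y -> `|Y - X| < d ->
    exists2 y, `|y - x| < e & on y Y.
Proof.
move=> cK e0; pose P (p : M * H) d := on p.1 p.2 -> forall Y, ball_closed Y ->
  `|Y - p.2| < d -> exists2 y, `|y - p.1| < e & on y Y.
have : \forall d \near (0 : R), forall p, (K `*` [set X : H | ball_closed X]) p -> P p d.
  apply: tube; first by apply: compact_setX => //; exact: ball_closed_compact.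
  (* Away from the leaf the claim is vacuous, and stays so nearby since the complement of [on] is
     open. *)
  move=> [x X] [/= Kx bX]; have [hon|hon] := pselect (on x X); last first.
    have op : open [set p : M * H | ~ on p.1 p.2] by apply: closed_openC; exact: lf_closed lf.
    have [[A B] /= [hA hB] sub] := op (x, X) hon.
    exists (A `*` B, setT) => /=.
      by split; [exists (A, B) | exact: filterT].
    by move=> [p d] /= [hp _] honp; have := sub p hp honp.
  have [d d0 hd] := lf_open lf (divr_gt0 e0 (ltr0n R 2)) bX hon.
  exists (ball x (e / 2) `*` ball X (d / 2), ball (0 : R) (d / 2)) => /=.
    split; last by apply: nbhsx_ballx; rewrite divr_gt0.
    by exists (ball x (e / 2), ball X (d / 2)) => //; split; apply: nbhsx_ballx; rewrite divr_gt0.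
  move=> [[x' X'] d'] /= [[hx hX] hd'] _ Y bY hY.
  have le : d' < d / 2.
    by move: hd'; rewrite /ball /= sub0r normrN; apply: le_lt_trans; exact: ler_norm.
  move: hx hX; rewrite -!ball_normE /= => hx hX.
  have [y yx hy] : exists2 y, `|y - x| < e / 2 & on y Y.
    apply: hd => //; rewrite -(subrKA X'); apply: le_lt_trans (ler_normD _ _) _.
    by rewrite (distrC X'); lra.
  exists y => //; rewrite -(subrKA x); apply: le_lt_trans (ler_normD _ _) _; lra.
case/nbhs_ballP => d /= d0 hd; exists (d / 2); first by rewrite divr_gt0.
move=> x X Y Kx bX hon; apply: (hd (d / 2) _ (x, X)) => //=.
by rewrite /ball /= sub0r normrN gtr0_norm ?divr_gt0 // ltr_pdivrMr // mulr2n mulrDr mulr1 ltrDl.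
Qed.

(** By local disjointness, uniform on the compact image of [y], the two lifts either agree or are at
    distance at least [e]; a continuous distance that starts at 0 cannot jump over [e / 2]. *)
Lemma lift_unique (Xi : R -> H) (y z : R -> M) :
  continuous y -> continuous z -> (forall s, 0 <= s <= 1 -> ball_closed (Xi s)) ->
  (forall s, 0 <= s <= 1 -> on (y s) (Xi s)) -> (forall s, 0 <= s <= 1 -> on (z s) (Xi s)) ->
  y 0 = z 0 -> y 1 = z 1.
Proof.
move=> cy cz bX hy hz e0.
have cK : compact (y @` `[0, 1]).
  by apply: continuous_compact; [exact: continuous_subspaceT | exact: segment_compact].
have [e ep he] := unif_disj cK.
apply/eqP/negP => /negP ne; pose d s := `|y s - z s|.
have d1 : d 1 = 0 \/ e <= d 1.
  have [lt|] := ltP (d 1) e; last by right.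
  left; apply/eqP; rewrite normr_eq0 subr_eq0; apply/eqP.
  apply: (he (y 1)) (bX 1 _) (hy 1 _) (hz 1 _); rewrite ?lexx ?ler01 //.
  - by exists 1 => //=; rewrite in_itv /= lexx ler01.
  - by rewrite subrr normr0.
  - by rewrite distrC.
have {}d1 : e <= d 1.
  by case: d1 => // /eqP; rewrite normr_eq0 subr_eq0 (negbTE ne).
have [c c01 dc] : exists2 c, 0 <= c <= 1 & d c = e / 2.
  apply: ivt => //; first by rewrite /d; ct.
  by rewrite {1}/d e0 subrr normr0; apply/orP; left; lra.
have : y c = z c.
  apply: (he (y c)) (bX c c01) (hy c c01) (hz c c01).
  - by exists c => //=; rewrite in_itv.
  - by rewrite subrr normr0.
  - by rewrite distrC -/(d c) dc; lra.
by move=> h; move: dc; rewrite /d h subrr normr0; lra.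
Qed.
End Uniform.

Lemma finite_uniform (T : choiceType) (F : set T) (P : T -> R -> Prop) : finite_set F ->
  (forall b e e', P b e -> e' <= e -> P b e') ->
  (forall b, F b -> exists2 e, 0 < e & P b e) ->
  exists2 e, 0 < e & forall b, F b -> P b e.
Proof.
move=> /finite_seqP[s ->] mono; elim: s => [|b s IH] h.
  by exists 1 => // b; rewrite /= in_nil.
have [|e e0 he] := IH; first by move=> c /= cs; apply: h; rewrite /= in_cons cs orbT.
have [|e' e'0 he'] := h b; first by rewrite /= mem_head.
exists (Num.min e e'); first by rewrite lt_min e0.
move=> c /=; rewrite in_cons => /orP[/eqP ->|cs].
  by apply: (mono _ e') => //; rewrite ge_min lexx orbT.
by apply: (mono _ e); [exact: he | rewrite ge_min lexx].
Qed.

Section Global.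
Variables (G : groupType) (act : G -> M -> M) (L : G -> H -> H) (on : M -> H -> Prop).
Hypothesis lf : leaf_system on.
Hypothesis la : leaf_action act L on.

Lemma la_pos a X : pos X -> pos (L a X).
Proof.
move=> pX; have [h0 h1 h2] := la_psd la a (pos_psd pX).
have hq : 0 < qd (L a X) by rewrite (la_qd la); case: pX.
split => //; rewrite lt_neqAle h0 andbT; apply/eqP => e.
move: hq; rewrite /qd -e mul0r sub0r; have := sqr_ge0 (L a X 0 2); have := sqr_ge0 (L a X 0 3); lra.
Qed.
Lemma la_actV a x : act a^-1%g (act a x) = x.
Proof. by rewrite -(la_actM la) mulVg (la_act1 la). Qed.
Lemma la_actVK a x : act a (act a^-1%g x) = x.
Proof. by rewrite -(la_actM la) mulgV (la_act1 la). Qed.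

Lemma on_scale x X c : on x X -> on x (c *: X).
Proof.
move=> h; have h0 : on x 0 by have := lf_lin lf (- 1) h h; rewrite scaleN1r addNr.
by have := lf_lin lf c h h0; rewrite addr0.
Qed.
Lemma on_nrm a x X : on x X -> on (act a x) (nrm (L a X)).
Proof. by move=> h; apply: on_scale; exact: (la_on la). Qed.
Lemma nrm_LK a X : tr X = 1 -> pos X -> nrm (L a^-1%g (nrm (L a X))) = X.
Proof.
move=> t1 pX; rewrite /nrm.
have LZ b c Y : L b (c *: Y) = c *: L b Y.
  have := la_lin la b 0 0 1; rewrite !scale1r addr0 => h.
  have h0 : L b 0 = 0 by apply: (@addrI _ (L b 0)); rewrite -h addr0.
  by have := la_lin la b Y 0 c; rewrite h0 !addr0.
rewrite LZ (la_K la) trZ t1 mulr1 invrK scalerA mulfV ?scale1r //.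
by rewrite gt_eqF //; apply: pos_tr_gt0; exact: la_pos.
Qed.

(** An invariant substitute for closeness on M, which carries no invariant metric here: the two
    points are compared after some group element has brought the first one into a fixed ball. *)
Definition close_rel (r e : R) (y y' : M) :=
  exists a, `|act a y| < r /\ `|act a y' - act a y| < e.

Lemma close_rel_open r e : open [set p : M * M | close_rel r e p.1 p.2].
Proof.
rewrite (_ : [set p | _] = \bigcup_a ([set p | `|act a p.1| < r] `&`
    [set p | `|act a p.2 - act a p.1| < e])); last first.
  by apply/seteqP; split=> p /= [a h]; [exists a|exists a].
apply: bigcup_open => a _; have ca : continuous (act a) by exact: (la_cont la).
apply: openI.
- apply: (@open_pre _ R (fun p : M * M => `|act a p.1|) [set t | t < r]); last exact: open_lt.
  by ct.
- apply: (@open_pre _ R (fun p : M * M => `|act a p.2 - act a p.1|) [set t | t < e]).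
    by ct.
  exact: open_lt.
Qed.

(** Closeness to [y] may be witnessed by different elements [a] and [b]. By properness only finitely
    many quotients [c] of them occur, and these are uniformly continuous on the ball, so one [e]
    works for all pairs. *)
Lemma close_rel_ex : exists r e, [/\ 0 < e, forall y, exists a, `|act a y| < r &
  forall y y' y'' Y, close_rel r e y y' -> close_rel r e y y'' ->
    ball_closed Y -> on y' Y -> on y'' Y -> y' = y''].
Proof.
have [K cK hK] := la_cocompact la.
have [r [r0 hr]] := compact_bounded cK.
pose r1 := `|r| + 1; pose V : set M := [set x | `|x| <= r1].
have KV x : K x -> `|x| < r1.
  move=> Kx; apply: le_lt_trans (hr (`|r| + 2^-1) _ x Kx) _; rewrite /r1; last by rewrite ltrD2l; lra.
  by have := ler_norm r; lra.
have cV : compact V by exact: rv_compact.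
have [e e0 he] := unif_disj lf cV.
pose F := [set b | (act b @` V) `&` V !=set0].
pose P b d := forall p p', V p -> `|p' - p| < d -> `|act b p' - act b p| < e.
have [d d0 hd] : exists2 d, 0 < d & forall b, F b -> P b d.
  apply: finite_uniform; first exact: la_proper la _ cV.
    by move=> b d d' h dd p p' Vp hp; apply: h => //; exact: lt_le_trans dd.
  move=> b _; have ca : continuous (act b) by exact: (la_cont la).
  have : \forall h \near (0 : M), forall p, V p -> `|act b (p + h) - act b p| < e.
    apply: tube => // p _.
    have : \forall z \near (p, 0 : M), 0 < e - `|act b (z.1 + z.2) - act b z.1|.
      apply: (@near_gt0 _ _ (fun z : M * M => e - `|act b (z.1 + z.2) - act b z.1|)).
        by ct.
      by rewrite /= addr0 subrr normr0 subr0.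
    by apply: filterS => z; rewrite subr_gt0.
  case/nbhs_ballP => d /= d0 hd; exists d => // p p' Vp pp'.
  have := hd (p' - p) _ p Vp; rewrite subrKC; apply.
  by rewrite -ball_normE /= sub0r normrN.
exists r1, (Num.min d e); split; first by rewrite lt_min d0.
  by move=> y; have [a /KV] := hK y; exists a.
move=> y y' y'' Y [a [ha hay]] [b [hb hby]] bY oy' oy''.
pose c := (a * b^-1)%g.
have cy z : act c (act b z) = act a z by rewrite -(la_actM la) /c -mulgA mulVg mulg1.
have Vb : V (act b y) by rewrite /V /= ltW.
have Fc : F c.
  exists (act a y); split; last by rewrite /V /= ltW.
  by exists (act b y).
have h2 : `|act a y'' - act a y| < e.
  rewrite -!cy; apply: (hd c Fc) => //.
  by apply: lt_le_trans hby _; rewrite ge_min lexx.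
have h1 : `|act a y' - act a y| < e by apply: lt_le_trans hay _; rewrite ge_min lexx orbT.
have aY : ball_closed (nrm (L a Y)).
  apply: nrm_closed; first by apply: la_psd la _ _ _; case: bY.
  apply/eqP => h; have := la_K la a Y.
  have L0 : L a^-1%g 0 = 0.
    have := la_lin la a^-1%g 0 0 1; rewrite !scale1r addr0 => hh.
    by apply: (@addrI _ (L a^-1%g 0)); rewrite -hh addr0.
  by rewrite h L0 => h'; have := ball_closed_neq0 bY; rewrite -h' eqxx.
have Va : V (act a y) by rewrite /V /= ltW.
have := he (act a y) _ _ _ Va h1 h2 aY (on_nrm a oy') (on_nrm a oy'').
by move=> h; rewrite -(la_actV a y') h la_actV.
Qed.

(** The points are carried into the fundamental ball, where sweeping is uniform. The step [d] does
    not depend on the element used, because [nrm_contract] is uniform over the group. *)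
Lemma close_step r e m : 0 < e -> (forall y, exists a, `|act a y| < r) -> 0 < m ->
  exists2 d, 0 < d & forall y X Y, thick m X -> thick m Y -> on y X -> `|Y - X| < d ->
    exists2 y', close_rel r e y y' & on y' Y.
Proof.
move=> e0 cov m0; have [d1 d10 hd1] := unif_open lf (@rv_compact 2 r) e0.
have [d d0 hd] := nrm_contract m0 d10.
exists d => // y X Y tX tY oX XY; have [a ha] := cov y.
have close := hd (L a) (la_lin la a) (la_psd la a) (la_pos a) X Y tX tY XY.
have bX : ball_closed (nrm (L a X)).
  by apply/ball_openW/nrm_open/la_pos; case: (thick_open m0 tX).
have bY : ball_closed (nrm (L a Y)).
  by apply/ball_openW/nrm_open/la_pos; case: (thick_open m0 tY).
have [b hb ob] := hd1 (act a y) _ _ (ltW ha) bX (on_nrm a oX) bY close.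
exists (act a^-1%g b); first by exists a; rewrite la_actVK.
have [pY tY1] := thick_open m0 tY.
by rewrite -(nrm_LK a tY1 pY); exact: on_nrm.
Qed.

(* Lifting of the radial contraction of a path of the open ball to the point [X0]. *)
Lemma lift_exists m X0 x0 (Xi : R -> H) : 0 < m -> thick m X0 -> on x0 X0 ->
  continuous Xi -> (forall s, thick m (Xi s)) ->
  exists y : R -> M, [/\ continuous y, forall s, on (y s) (Xi s) &
    forall s, Xi s = X0 -> y s = x0].
Proof.
move=> m0 tX0 o0 cXi tXi; have [r [e [e0 cov uniq]]] := close_rel_ex.
have [d d0 step] := close_step e0 cov m0.
pose N := (Num.truncn (2 / d)).+1.
have N0 : 0 < N%:R :> R by rewrite ltr0n.
have Nd : 2 / N%:R < d.
  by rewrite ltr_pdivrMr // mulrC -ltr_pdivrMr //; exact: truncnS_gt.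
pose t (k : nat) := k%:R / N%:R : R.
have t01 k : (k <= N)%N -> 0 <= t k <= 1.
  by move=> kN; rewrite /t divr_ge0 //= ler_pdivrMr // mul1r ler_nat.
pose C k s := X0 + t k *: (Xi s - X0).
have tC k s : (k <= N)%N -> thick m (C k s).
  by move=> kN; apply: thick_conv; [exact: t01|exact: tX0|exact: tXi].
have cC k : continuous (C k) by rewrite /C; ct.
have bC k s : (k <= N)%N -> ball_closed (C k s).
  by move=> kN; apply: ball_openW; apply: (thick_open m0); exact: tC.
have dC k s : (k < N)%N -> `|C k.+1 s - C k s| < d.
  move=> kN; have -> : C k.+1 s - C k s = N%:R^-1 *: (Xi s - X0).
    have tS : t k.+1 = t k + N%:R^-1 by rewrite /t -addn1 natrD mulrDl mul1r.
    by apply: rV4P; rewrite /C tS !v4E; ring.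
  rewrite normrZ gtr0_norm ?invr_gt0 //; apply: le_lt_trans Nd.
  rewrite mulrC ler_pM2r ?invr_gt0 //; apply: le_trans (ler_normB _ _) _.
  have := ball_closed_norm (ball_openW (thick_open m0 (tXi s))).
  by have := ball_closed_norm (ball_openW (thick_open m0 tX0)); lra.
have key k : (k <= N)%N -> exists y : R -> M, [/\ continuous y, forall s, on (y s) (C k s) &
    forall s, Xi s = X0 -> y s = x0].
  elim: k => [_|k IH kN].
    exists (fun=> x0); split => // [|s]; first by ct.
    by rewrite /C /t mul0r scale0r addr0.
  have [y [cy oy ey]] := IH (ltnW kN).
  have ex s : {y' | close_rel r e (y s) y' & on y' (C k.+1 s)}.
    apply: cid2; apply: (step _ (C k s)) => //; [exact: tC (ltnW kN)|exact: tC|exact: dC].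
  pose z s := s2val (ex s).
  have hz s : close_rel r e (y s) (z s) := s2valP (ex s).
  have oz s : on (z s) (C k.+1 s) := s2valP' (ex s).
  have id_rel y1 : close_rel r e y1 y1.
    by have [a ha] := cov y1; exists a; rewrite subrr normr0.
  exists z; split => //; last first.
    move=> s es; apply: (uniq (y s) _ _ X0) => //.
    - by rewrite -(ey s es).
    - exact: ball_openW (thick_open m0 tX0).
    - by have := oz s; rewrite /C es subrr scaler0 addr0.
  (* Continuity of the new lift: sweeping at [z s] provides a nearby point [w] for the parameter
     [s'], and uniqueness under the open relation [close_rel] identifies it with [z s']. *)
  move=> s; apply/cvgrPdist_lt => eps eps0.
  have [[A B] /= [hA hB] sub] := @close_rel_open r e (y s, z s) (hz s).
  have /nbhs_ballP[b b0 hb] := hB.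
  have me : 0 < Num.min eps b by rewrite lt_min eps0.
  have [dl dl0 hdl] := lf_open lf me (bC _ s kN) (oz s).
  have h1 : \forall s' \near s, A (y s') by apply: cy.
  have h2 : \forall s' \near s, `|C k.+1 s' - C k.+1 s| < dl.
    have /cvgrPdist_lt /(_ _ dl0) := cC k.+1 s.
    by apply: filterS => s'; rewrite distrC.
  near=> s'.
  have [w ws ow] : exists2 w, `|w - z s| < Num.min eps b & on w (C k.+1 s').
    by apply: hdl; [exact: bC | near: s'].
  have [w1 w2] : `|w - z s| < eps /\ `|w - z s| < b by move: ws; rewrite lt_min => /andP[].
  have -> : z s' = w.
    apply: (uniq (y s') _ _ (C k.+1 s')) => //; last exact: bC.
    apply: (sub (y s', w)) => /=; split; first by near: s'.
    by apply: hb; rewrite -ball_normE /= distrC.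
  by rewrite distrC.
have [y [cy oy ey]] := key N (leqnn N); exists y; split => // s.
by have := oy s; rewrite /C /t divff ?gt_eqF // scale1r subrKC.
Unshelve. all: by end_near.
Qed.

Lemma on_open_exists X : ball_open X -> exists x, on x X.
Proof.
move=> bX; have [X0 [cX0 hX0]] := lf_base lf; have [b0 o0] := hX0 0.
pose m := Num.min (qd X) (qd (X0 0)).
have m0 : 0 < m by rewrite lt_min; case: bX => -[_ ->]; case: b0 => -[_ ->].
have tX : thick m X by apply: open_thick => //; rewrite ltW // /m ge_min lexx.
have t0 : thick m (X0 0) by apply: open_thick => //; rewrite ltW // /m ge_min lexx orbT.
have [y [_ oy _]] := lift_exists m0 t0 o0 (fun s => @cvg_cst _ X _ _ _) (fun=> tX).
by exists (y 0).
Qed.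

(** Simple connectedness of the ball. A loop at [X] goes along the leaf of [x] to [X0 x], along the
    base points to [X0 y], and back along the leaf of [y]; it is covered by the path [z] from [x] to
    [y]. The lift obtained by contracting the loop to [X] starts and ends at [x], and the two lifts
    coincide. *)
Lemma on_open_unique x y X : ball_open X -> on x X -> on y X -> x = y.
Proof.
move=> bX ox oy; have [X0 [cX0 hX0]] := lf_base lf.
pose c1 s : R := cl (3 * s); pose c2 s : R := cl (3 * s - 1); pose c3 s : R := cl (3 * s - 2).
pose z s : M := x + c2 s *: (y - x).
pose Xi s : H := X0 (z s) + ((1 - c1 s) *: (X - X0 x) + c3 s *: (X - X0 y)).
have cz : continuous z by rewrite /z /c2; ct.
have cXi : continuous Xi by rewrite /Xi /c1 /c3; ct.
have cases s : [\/ z s = x /\ Xi s = c1 s *: X0 x + (1 - c1 s) *: X,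
    Xi s = X0 (z s) | z s = y /\ Xi s = c3 s *: X + (1 - c3 s) *: X0 y].
  have [s1|s1] := leP (3 * s) 1.
    apply: Or31; have e2 : c2 s = 0 by apply: cl_le0; lra.
    have e3 : c3 s = 0 by apply: cl_le0; lra.
    have ez : z s = x by rewrite /z e2 scale0r addr0.
    by split => //; rewrite /Xi ez e3; apply: rV4P; rewrite !v4E; ring.
  have e1 : c1 s = 1 by apply: cl_ge1; lra.
  have [s2|s2] := leP (3 * s) 2.
    apply: Or32; have e3 : c3 s = 0 by apply: cl_le0; lra.
    by rewrite /Xi e1 e3 subrr !scale0r !addr0.
  apply: Or33; have e2 : c2 s = 1 by apply: cl_ge1; lra.
  have ez : z s = y by rewrite /z e2 scale1r subrKC.
  by split => //; rewrite /Xi ez e1; apply: rV4P; rewrite !v4E; ring.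
have onXi s : on (z s) (Xi s).
  case: (cases s) => [[ez ->]|->|[ez ->]]; last 2 [by case: (hX0 (z s))].
  - rewrite ez; apply: (lf_lin lf); [by case: (hX0 x) | exact: on_scale].
  - rewrite ez; apply: (lf_lin lf) => //; apply: on_scale; by case: (hX0 y).
have conv (A B : H) c : 0 <= c <= 1 -> ball_open A -> ball_open B -> ball_open (c *: A + (1 - c) *: B).
  move=> /andP[c0 c1']; case: (eqVneq c 0) => [->|cn] hA hB.
    by rewrite scale0r add0r subr0 scale1r.
  by apply: conv_open => //; [rewrite lt_neqAle eq_sym cn c0 | exact: ball_openW].
have bXi s : ball_open (Xi s).
  case: (cases s) => [[_ ->]|->|[_ ->]].
  - by apply: conv => //; [exact: cl_itv | case: (hX0 x)].
  - by case: (hX0 (z s)).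
  - by apply: conv => //; [exact: cl_itv | case: (hX0 y)].
have [v0 v1] : (c1 0 = 0 /\ c2 0 = 0 /\ c3 0 = 0) /\ (c1 1 = 1 /\ c2 1 = 1 /\ c3 1 = 1).
  by rewrite /c1 /c2 /c3; do !split; (apply: cl_le0 || apply: cl_ge1); lra.
have Xi0 : Xi 0 = X.
  by rewrite /Xi /z; move: v0 => [-> [-> ->]]; apply: rV4P; rewrite !v4E ?scale0r ?addr0; ring.
have z1 : z 1 = y by rewrite /z; move: v1 => [_ [-> _]]; rewrite scale1r subrKC.
have Xi1 : Xi 1 = X.
  by rewrite /Xi z1; move: v1 => [-> [_ ->]]; apply: rV4P; rewrite !v4E; ring.
have z0 : z 0 = x by rewrite /z; move: v0 => [_ [-> _]]; rewrite scale0r addr0.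
(* The minimum of the determinant along the loop is a common depth for all its points. *)
have [||t0 _ hmin] := @compact_EVT_min _ R (fun s => qd (Xi s)) `[0, 1] _ (@segment_compact _ _ _).
  - by exists 0; rewrite /= in_itv /= lexx ler01.
  - by apply: continuous_subspaceT; ct.
have m0 : 0 < qd (Xi t0) by case: (bXi t0) => -[].
have tXi s : thick (qd (Xi t0)) (Xi (cl s)).
  by apply: open_thick => //; rewrite ltW //= hmin // inE /= in_itv /= cl_itv.
have tX : thick (qd (Xi t0)) X.
  by have := tXi 0; rewrite cl_id ?lexx ?ler01 // Xi0.
have [|w [cw ow ew]] := lift_exists m0 tX ox (Xi := fun s => Xi (cl s)) _ tXi.
  by ct.
have e01 : cl 0 = 0 :> R by rewrite cl_id ?lexx ?ler01.
have e11 : cl 1 = 1 :> R by rewrite cl_id ?lexx ?ler01.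
have w0 : w 0 = x by apply: ew; rewrite e01.
have w1 : w 1 = x by apply: ew; rewrite e11.
have cz' : continuous (fun s => z (cl s)) by ct.
have bX' s : 0 <= s <= 1 -> ball_closed (Xi (cl s)) by move=> _; exact: ball_openW.
have := lift_unique lf cw cz' bX' (fun s _ => ow s) (fun s _ => onXi (cl s)).
by rewrite w0 w1 e01 e11 z0 z1 => h; rewrite h.
Qed.

Lemma ball_open_near X e : ball_closed X -> 0 < e -> exists2 Y, ball_open Y & `|Y - X| < e.
Proof.
move=> bX e0; pose s := Num.min 1 (e / 4).
have s0 : 0 < s by rewrite lt_min ltr01 divr_gt0.
exists (s *: org R + (1 - s) *: X).
  by apply: conv_open => //; [rewrite s0 /s ge_min lexx | exact: ball_open_org].
have -> : s *: org R + (1 - s) *: X - X = s *: (org R - X).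
  by apply: rV4P; rewrite !v4E; ring.
rewrite normrZ gtr0_norm //; have h := ler_normB (org R) X.
have h1 := ball_closed_norm bX; have h2 := ball_closed_norm (ball_openW (ball_open_org R)).
have : s * `|org R - X| <= s * 2 by rewrite ler_pM2l //; lra.
have : s <= e / 4 by rewrite /s ge_min lexx orbT.
lra.
Qed.

(** Close to a boundary point there are interior points; by sweeping they lie on a leaf close to
    that of [x] and on one close to that of [y], so that uniqueness in the interior applies. *)
Theorem on_unique x y X : ball_closed X -> on x X -> on y X -> x = y.
Proof.
move=> bX ox oy; apply/eqP/negP => /negP ne.
have e0 : 0 < `|x - y| / 2 by rewrite divr_gt0 // normr_gt0 subr_eq0.
have [d d0 hd] := lf_open lf e0 bX ox; have [d' d'0 hd'] := lf_open lf e0 bX oy.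
have dd : 0 < Num.min d d' by rewrite lt_min d0.
have [Y bY] := ball_open_near bX dd; rewrite lt_min => /andP[Yd Yd'].
have [x' x'x ox'] := hd Y (ball_openW bY) Yd.
have [y' y'y oy'] := hd' Y (ball_openW bY) Yd'.
have e := on_open_unique bY ox' oy'; rewrite -e in y'y.
have : `|x - y| <= `|x' - x| + `|x' - y|.
  by rewrite -(subrKA x') (distrC x' x); exact: ler_normD.
lra.
Qed.

Lemma on_continuous X x e : ball_closed X -> on x X -> 0 < e ->
  exists2 d, 0 < d & forall y Y, ball_closed Y -> `|Y - X| < d -> on y Y -> `|y - x| < e.
Proof.
move=> bX ox e0; have [d d0 hd] := lf_open lf e0 bX ox; exists d => // y Y bY YX oy.
by have [z zx oz] := hd Y bY YX; rewrite (on_unique bY oy oz).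
Qed.
End Global.
End Leaves.

(** * Mixed pencils *)

Section PositiveForms.
Variable R : realType.
Local Open Scope complex_scope.
Local Open Scope sesquilinear_scope.
Notation C := R[i].
Notation H := 'rV[R]_4.
Implicit Types (q X Y : H).

(** The rank one matrix z z^* of the vector z = (a + i b, c + i d). *)
Definition zz (a b c d : R) : H :=
  v4 (a ^+ 2 + b ^+ 2) (c ^+ 2 + d ^+ 2) (a * c + b * d) (b * c - a * d).
Definition cv (a b c d : R) : 'cV[C]_2 := \col_j (if j == 0 then a +i* b else c +i* d).

Lemma hform_cv q a b c d : hform q (cv a b c d) = (pr q (zz a b c d))%:C.
Proof.
rewrite /hform !mxE !big_ord_recl !big_ord0 !mxE !big_ord_recl !big_ord0 !mxE /= /pr !v4E.
apply/eqP; rewrite eq_complex /=; apply/andP; split; apply/eqP; ring.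
Qed.

Lemma cv_surj (z : 'cV[C]_2) : exists a b c d, z = cv a b c d.
Proof.
case e0 : (z 0 0) => [a b]; case e1 : (z 1 0) => [c d]; exists a, b, c, d.
apply/colP => -[[|[|//]] lt]; rewrite !mxE /=.
- by rewrite -e0; congr (z _ _); exact/val_inj.
- by rewrite -e1; congr (z _ _); exact/val_inj.
Qed.

Lemma zz_psd a b c d : psd (zz a b c d).
Proof.
split; [by rewrite v4E addr_ge0 ?sqr_ge0 | by rewrite v4E addr_ge0 ?sqr_ge0 |].
by rewrite [leRHS](_ : _ = 0) // /qd !v4E; ring.
Qed.

Lemma positive_pos q : positive q -> pos q.
Proof.
move=> h; have hp a b c d : cv a b c d != 0 -> 0 < pr q (zz a b c d).
  by move=> /h; rewrite hform_cv ltcR.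
have ne a b c d : (a != 0) || (c != 0) -> cv a b c d != 0.
  move=> n; apply/eqP => /colP e; have := e 0; have := e 1; rewrite !mxE /=.
  by move=> [e1 _] [e0 _]; move: n; rewrite e0 e1 eqxx.
have q0 : 0 < q 0 0.
  have := hp 1 0 0 0 (ne _ _ _ _ _); rewrite oner_eq0 => /(_ isT).
  by rewrite /pr !v4E; lra.
split => //; have := hp (- q 0 2) (- q 0 3) (q 0 0) 0 (ne _ _ _ _ _).
rewrite (gt_eqF q0) orbT => /(_ isT).
have -> : pr q (zz (- q 0 2) (- q 0 3) (q 0 0) 0) = q 0 0 * qd q.
  by rewrite /pr /qd !v4E; ring.
by rewrite pmulr_rgt0.
Qed.

Lemma psd_pos_semidef q : psd q -> pos_semidef q.
Proof.
move=> h z; have [a [b [c [d ->]]]] := cv_surj z.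
by rewrite hform_cv lecR; apply: pr_ge0 => //; exact: zz_psd.
Qed.
End PositiveForms.

Lemma cat_near (T U : topologicalType) (f g : T -> U) (x : T) :
  cat f x -> (\forall y \near x, f y = g y) -> cat g x.
Proof.
move=> cf h A hA; rewrite -(nbhs_singleton h) in hA.
have h2 := cf _ hA; apply: filterS2 h h2 => y e; by rewrite /= e.
Qed.
Lemma cat_fst_comp (T U W : topologicalType) (e : T -> W) (x : T) (y : U) :
  cat e x -> cat (fun p : T * U => e p.1) (x, y).
Proof. by move=> ce; apply: (@cat_comp _ _ _ e fst (x, y)) => //; exact: cvg_fst. Qed.

Section Pencil.
Variable R : realType.
Notation M := 'rV[R]_2.
Notation H := 'rV[R]_4.
Implicit Types (q e f X Y : H) (P : {vspace H}) (a b c : R).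

Lemma mem_span2 q e f : reflect (exists a b, q = a *: e + b *: f) (q \in <<[:: e; f]>>%VS).
Proof.
rewrite span_cons span_seq1; apply: (iffP memv_addP).
  by move=> [u /vlineP[a ->]] [v /vlineP[b ->] ->]; exists a, b.
move=> [a [b ->]]; exists (a *: e); first by apply/vlineP; exists a.
by exists (b *: f) => //; apply/vlineP; exists b.
Qed.

Definition spacelike e f := forall a b, (a != 0) || (b != 0) -> qd (a *: e + b *: f) < 0.

(** A form of nonnegative determinant is semidefinite up to a sign, which is read on its trace. *)
Lemma mixed_qd P q : mixed P -> q \in P -> q != 0 -> qd q < 0.
Proof.
move=> [_ mx] qP q0; rewrite ltNge; apply/negP => hq.
have [x0|x0] := leP 0 (q 0 0 + q 0 1).
  apply: (mx q) => //; apply: psd_pos_semidef; split => //.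
    by move: hq; rewrite /qd; have := sqr_ge0 (q 0 2); have := sqr_ge0 (q 0 3); nra.
  by move: hq; rewrite /qd; have := sqr_ge0 (q 0 2); have := sqr_ge0 (q 0 3); nra.
apply: (mx (- q)); [by rewrite memvN | by rewrite oppr_eq0 |].
apply: psd_pos_semidef; split; rewrite ?qdN //; rewrite v4E.
  by move: hq; rewrite /qd; have := sqr_ge0 (q 0 2); have := sqr_ge0 (q 0 3); nra.
by move: hq; rewrite /qd; have := sqr_ge0 (q 0 2); have := sqr_ge0 (q 0 3); nra.
Qed.

Lemma mixed_free e f a b : \dim <<[:: e; f]>>%VS = 2%N -> a *: e + b *: f = 0 -> a = 0 /\ b = 0.
Proof.
move=> d2; have fr : free [:: e; f] by rewrite /free d2.
move: fr; rewrite free_cons => /andP[ne].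
rewrite seq1_free span_seq1 in ne * => f0 h.
have a0 : a = 0.
  apply/eqP/negP => /negP a0; case/negP: ne; apply/vlineP; exists (- b / a).
  apply: (scalerI a0); rewrite scalerA mulrC divfK // scaleNr.
  by apply/eqP; rewrite -addr_eq0 h.
split => //; move: h; rewrite a0 scale0r add0r => /eqP; rewrite scaler_eq0 (negbTE f0) orbF.
by move/eqP.
Qed.

Lemma mixed_spacelike e f : mixed <<[:: e; f]>> -> spacelike e f.
Proof.
move=> mx a b ab; apply: (mixed_qd mx); first by apply/mem_span2; exists a, b.
by apply/eqP => /(mixed_free mx.1)[a0 b0]; move: ab; rewrite a0 b0 eqxx.
Qed.

(* Polarization of the determinant: [pr q (dual_form X) = mk q X], [mk q q = 2 * qd q]. *)
Definition mk q X := q 0 0 * X 0 1 + q 0 1 * X 0 0 - 2 * (q 0 2 * X 0 2 + q 0 3 * X 0 3).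
Definition dual_form X : H := v4 (X 0 1) (X 0 0) (- X 0 2) (- X 0 3).
Definition gram e f := mk e e * mk f f - mk e f ^+ 2.
(** The component of [org] orthogonal to the pencil for the Lorentzian product [mk], written by
    Cramer's rule so that it varies continuously with the frame. Its [dual_form] annihilates the
    pencil and gives a base point on the leaf. *)
Definition perp e f : H :=
  org R - (gram e f)^-1 *: ((mk e (org R) * mk f f - mk f (org R) * mk e f) *: e +
                            (mk f (org R) * mk e e - mk e (org R) * mk e f) *: f).

Lemma cat_mk (T : topologicalType) (u v : T -> H) x :
  cat u x -> cat v x -> cat (fun y => mk (u y) (v y)) x.
Proof. by move=> hu hv; rewrite /mk; ct. Qed.
Lemma pr_adj q X : pr q (dual_form X) = mk q X.
Proof. by rewrite /pr /mk !v4E; ring. Qed.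

(** The determinant is evaluated on the combination of [e] and [f] that is [mk]-orthogonal to
    [f]. *)
Lemma gram_gt0 e f : spacelike e f -> 0 < gram e f.
Proof.
move=> sp; have hf : mk f f < 0.
  have := sp 0 1; rewrite oner_eq0 orbT => /(_ isT).
  by rewrite scale0r add0r scale1r /qd /mk; lra.
have := sp (mk f f) (- mk e f); rewrite lt_eqF // => /(_ isT).
have -> : qd (mk f f *: e + - mk e f *: f) = gram e f * mk f f / 2.
  by rewrite /gram /qd /mk !v4E; field.
by rewrite pmulr_llt0 ?invr_gt0 // nmulr_llt0.
Qed.

(** The part [p] of [org] in the pencil has nonpositive determinant, so the orthogonal part has
    determinant at least 1/4. Its trace is 4 times its determinant, which decides the sign. *)
Lemma perp_spec e f : spacelike e f ->
  [/\ mk e (perp e f) = 0, mk f (perp e f) = 0 & pos (perp e f)].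
Proof.
move=> sp; have g0 := gram_gt0 sp; have gn : gram e f != 0 by rewrite gt_eqF.
have mkl q X Y c : mk q (X - c *: Y) = mk q X - c * mk q Y by rewrite /mk !v4E; ring.
have mkD q X Y a b : mk q (a *: X + b *: Y) = a * mk q X + b * mk q Y by rewrite /mk !v4E; ring.
have mkC q X : mk q X = mk X q by rewrite /mk; ring.
have he : mk e (perp e f) = 0.
  by rewrite /perp mkl mkD; apply: (mulfI gn); rewrite mulrBr mulrA mulfV // mul1r mulr0 /gram; ring.
have hf : mk f (perp e f) = 0.
  rewrite /perp mkl mkD; apply: (mulfI gn); rewrite mulrBr mulrA mulfV // mul1r mulr0 /gram (mkC f e).
  ring.
split => //; set Y := perp e f in he hf *.
pose p := org R - Y.
have [a [b pab]] : exists a b, p = a *: e + b *: f.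
  rewrite /p /Y /perp opprB addrC subrK scalerDr !scalerA; by do 2 eexists.
have hp : qd p <= 0.
  case: (boolP ((a != 0) || (b != 0))) => h; first by rewrite pab ltW // sp.
  by move: h; rewrite negb_or !negbK pab => /andP[/eqP -> /eqP ->]; rewrite !scale0r addr0 qd0.
have mp : mk Y p = 0 by rewrite pab mkD (mkC Y e) (mkC Y f) he hf; ring.
have qo : qd (org R) = 4^-1 by rewrite /qd !v4E; lra.
have eo : org R = Y + p by rewrite /p subrKC.
have hq : qd (org R) = qd Y + qd p + mk Y p by rewrite eo /qd /mk !v4E; ring.
have ht : tr Y = 4 * qd Y.
  have -> : tr Y = 2 * mk Y (org R) by rewrite /tr /mk !v4E; field.
  have -> : mk Y (org R) = mk Y Y + mk Y p by rewrite {1}eo /mk !v4E; ring.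
  by rewrite mp /mk /qd; ring.
have qY : 0 < qd Y by lra.
split => //; move: ht qY; rewrite /tr /qd; have := sqr_ge0 (Y 0 2); have := sqr_ge0 (Y 0 3); nra.
Qed.

Lemma perp_mem e f : exists a b, perp e f - org R = a *: e + b *: f.
Proof.
exists (- ((gram e f)^-1 * (mk e (org R) * mk f f - mk f (org R) * mk e f))).
exists (- ((gram e f)^-1 * (mk f (org R) * mk e e - mk e (org R) * mk e f))).
by apply: rV4P; rewrite /perp !v4E; ring.
Qed.

Lemma perp_unique e f Y Y' : spacelike e f ->
  (exists a b, Y' - Y = a *: e + b *: f) -> mk e Y = 0 -> mk f Y = 0 -> mk e Y' = 0 -> mk f Y' = 0 ->
  Y = Y'.
Proof.
move=> sp [a [b h]] e1 f1 e2 f2; apply/eqP; rewrite eq_sym -subr_eq0 h; apply/negP => /negP ne.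
have ab : (a != 0) || (b != 0).
  apply: contraNT ne; rewrite negb_or !negbK => /andP[/eqP -> /eqP ->].
  by rewrite !scale0r addr0.
have := sp a b ab; rewrite -h.
have -> : qd (Y' - Y) = (a * (mk e Y' - mk e Y) + b * (mk f Y' - mk f Y)) / 2.
  transitivity (mk (Y' - Y) (Y' - Y) / 2); first by rewrite /mk /qd; field.
  by rewrite {1}h /mk !v4E; field.
by rewrite e1 e2 f1 f2 !subrr !mulr0 addr0 mul0r ltxx.
Qed.

Definition onp (u : M -> {vspace H}) x X := forall q, q \in u x -> pr q X = 0.

Lemma onp_frame u x e f X : u x = <<[:: e; f]>>%VS -> onp u x X <-> pr e X = 0 /\ pr f X = 0.
Proof.
move=> ux; split=> [h|[he hf] q].
  by split; apply: h; rewrite ux; apply/mem_span2; [exists 1, 0 | exists 0, 1];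
    rewrite scale1r scale0r ?addr0 ?add0r.
by rewrite ux => /mem_span2[a [b ->]]; rewrite !prE he hf !mulr0 addr0.
Qed.

Lemma adj_pos Y : pos Y -> pos (dual_form Y).
Proof.
move=> pY; split; first by rewrite v4E; exact: pos_1.
by case: pY; rewrite /qd !v4E; lra.
Qed.

Section LeafSystem.
Variable u : M -> {vspace H}.
Hypothesis mx : forall x, mixed (u x).
Hypothesis cu : continuous_pencil u.

Lemma frame_at x : exists U (e f : M -> H), [/\ open_nbhs x U, forall y, U y -> cat e y,
  forall y, U y -> cat f y & forall y, U y -> u y = <<[:: e y; f y]>>%VS].
Proof. by have [U [e [f [h1 h2 h3 h4]]]] := cu x; exists U, e, f. Qed.

Lemma onp_closed : closed [set p : M * H | onp u p.1 p.2].
Proof.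
rewrite -openC openE => -[x X] /= nX; have [U [e [f [[oU Ux] ce cf uU]]]] := frame_at x.
have nh : 0 < `|pr (e x) X| + `|pr (f x) X|.
  rewrite lt_neqAle addr_ge0 // andbT eq_sym paddr_eq0 //; apply/negP => /andP[/eqP h1 /eqP h2].
  apply: nX; apply/(onp_frame _ (uU x Ux)); split; apply/eqP; rewrite -normr_eq0; exact/eqP.
have cg : cat (fun p : M * H => `|pr (e p.1) p.2| + `|pr (f p.1) p.2|) (x, X).
  have ce' : cat (fun p : M * H => e p.1) (x, X) by apply: cat_fst_comp; exact: ce.
  have cf' : cat (fun p : M * H => f p.1) (x, X) by apply: cat_fst_comp; exact: cf.
  by ct.
have h1 := near_gt0 cg nh.
have h2 : \forall p \near (x, X), U p.1.
  by exists (U, setT) => /=; [split; [exact: open_nbhs_nbhs | exact: filterT] | move=> p []].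
apply: filterS2 h1 h2 => -[y Y] /= h Uy /(onp_frame _ (uU y Uy))[e1 e2].
by move: h; rewrite e1 e2 normr0 addr0 ltxx.
Qed.

(** The vector [perp] depends on the pencil and not on its frame, so that an arbitrary choice of
    frames still gives a map that agrees near each point with a continuous one. *)
Lemma onp_base : exists X0 : M -> H, continuous X0 /\ forall x, ball_open (X0 x) /\ onp u x (X0 x).
Proof.
have ex x : {ef : H * H | u x = <<[:: ef.1; ef.2]>>%VS}.
  apply: cid; have [U [e [f [[oU Ux] ce cf uU]]]] := frame_at x.
  by exists (e x, f x); rewrite uU.
pose Y x := perp (sval (ex x)).1 (sval (ex x)).2.
have sp x (a b : H) : u x = <<[:: a; b]>>%VS -> spacelike a b.
  by move=> ux; apply: mixed_spacelike; rewrite -ux.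
have YE x (a b : H) : u x = <<[:: a; b]>>%VS -> Y x = perp a b.
  move=> ux; rewrite /Y; case: (ex x) => -[a' b'] /= ux'.
  have [h1 h2 _] := perp_spec (sp _ _ _ ux); have [h1' h2' _] := perp_spec (sp _ _ _ ux').
  have mkl c q q' X : mk (c *: q + q') X = c * mk q X + mk q' X by rewrite /mk !v4E; ring.
  have mem q : q \in u x -> mk q (perp a' b') = 0.
    rewrite ux' => /mem_span2[c [d ->]]; rewrite mkl h1' mulr0 add0r.
    by rewrite -[d *: b']addr0 mkl h2' mulr0 add0r /mk !v4E; ring.
  have [c [d cd]] := perp_mem a b.
  have [c' [d' cd']] : exists c d, perp a' b' - org R = c *: a + d *: b.
    by apply/mem_span2; rewrite -ux ux'; apply/mem_span2; exact: perp_mem.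
  symmetry; apply: (perp_unique (sp _ _ _ ux)) => //.
  - exists (c' - c), (d' - d).
    rewrite -[perp a' b'](subrK (org R)) -[perp a b](subrK (org R)) cd cd'.
    by apply: rV4P; rewrite !v4E; ring.
  - by apply: mem; rewrite ux; apply/mem_span2; exists 1, 0; rewrite scale1r scale0r addr0.
  - by apply: mem; rewrite ux; apply/mem_span2; exists 0, 1; rewrite scale1r scale0r add0r.
have pY x : pos (Y x) by case: (perp_spec (sp _ _ _ (svalP (ex x)))).
exists (fun x => nrm (dual_form (Y x))); split=> [x|x]; last first.
  split; first by apply/nrm_open/adj_pos.
  apply/(onp_frame _ (svalP (ex x))); have [h1 h2 _] := perp_spec (sp _ _ _ (svalP (ex x))).
  by rewrite /nrm !prZr !pr_adj h1 h2 !mulr0.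
change (cat (fun x => nrm (dual_form (Y x))) x).
have [U [e [f [[oU Ux] ce cf uU]]]] := frame_at x.
have cY : cat Y x.
  have ce' := ce x Ux; have cf' := cf x Ux.
  have cp : cat (fun y => perp (e y) (f y)) x.
    have cg : cat (fun y => gram (e y) (f y)) x.
      have h1 := cat_mk ce' ce'; have h2 := cat_mk cf' cf'; have h3 := cat_mk ce' cf'.
      by rewrite /gram; ct.
    have o (c : M) : cat (fun _ : M => org R) c by exact: cat_cst.
    have h1 := cat_mk ce' ce'; have h2 := cat_mk cf' cf'; have h3 := cat_mk ce' cf'.
    have h4 := cat_mk ce' (o x); have h5 := cat_mk cf' (o x).
    rewrite /perp; apply: catD; first exact: cat_cst.
    apply: catN; apply: catZ; first (apply: catV; [rewrite gt_eqF //; apply: gram_gt0; apply: (sp x); exact: uU | exact: cg]).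
    by apply: catD; ct.
  have eY : \forall y \near x, perp (e y) (f y) = Y y.
    have := open_nbhs_nbhs (conj oU Ux); apply: filterS => y Uy.
    by rewrite (YE y _ _ (uU y Uy)).
  exact: cat_near cp eY.
have ca : cat (fun x => dual_form (Y x)) x by rewrite /dual_form; ct.
rewrite /nrm; ct; rewrite gt_eqF //; apply: pos_tr_gt0; exact: adj_pos.
Qed.
End LeafSystem.
End Pencil.

(** * Fitting flows *)

Section FlowLift.
Local Open Scope quotient_scope.
Variable R : realType.
Notation M := 'rV[R]_2.
Notation H := 'rV[R]_4.
Variable u : M -> {vspace H}.

(* A flow on the circle bundle, seen through unit representatives of rays. *)
Record flow_lift (F : R -> M * H -> M * H) : Prop := {
  fl_cont : forall (T : topologicalType) (t : T -> R) (p : T -> M * H),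
    continuous t -> continuous p -> (forall a, nonzero_vectors u (p a)) ->
    continuous (fun a => F (t a) (p a));
  fl_0 : forall p, nonzero_vectors u p -> F 0 p = (p.1, `|p.2|^-1 *: p.2);
  fl_nz : forall t p, nonzero_vectors u p -> nonzero_vectors u (F t p);
  fl_pos : forall t p, 0 < t -> nonzero_vectors u p ->
    exists c d : R, [/\ 0 < c, 0 < d & pos (d *: (F t p).2 - c *: p.2)]
}.

Notation B := (circle_bundle u).
Definition base (s : B) : M := (val (repr s)).1.
Definition unit_rep (s : B) : H := `|(val (repr s)).2|^-1 *: (val (repr s)).2.

Lemma nz_neq0 (z : set_type (nonzero_vectors u)) : (val z).2 != 0.
Proof. by have [] := set_valP z. Qed.

Lemma unit_repZ (z w : set_type (nonzero_vectors u)) : same_ray z w ->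
  (val z).1 = (val w).1 /\ `|(val z).2|^-1 *: (val z).2 = `|(val w).2|^-1 *: (val w).2.
Proof.
move=> /asboolP[e [c c0 e2]]; split => //; rewrite e2 normrZ gtr0_norm // scalerA.
by rewrite invfM mulrAC mulVf ?gt_eqF // mul1r.
Qed.

Lemma ray_repr (z : set_type (nonzero_vectors u)) : same_ray (repr (ray z)) z.
Proof. by apply/eqmodP; rewrite reprK. Qed.
Lemma base_ray z : base (ray z) = (val z).1.
Proof. by have [] := unit_repZ (ray_repr z). Qed.
Lemma unit_ray z : unit_rep (ray z) = `|(val z).2|^-1 *: (val z).2.
Proof. by have [] := unit_repZ (ray_repr z). Qed.

Lemma set_val_continuous : continuous (fun z : set_type (nonzero_vectors u) => val z).
Proof. exact: initial_continuous. Qed.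

Lemma base_continuous : continuous base.
Proof.
apply/quotient_continuous => z.
rewrite (_ : _ \o _ = fun z : set_type (nonzero_vectors u) => (val z).1); last first.
  by apply/funext => w; exact: base_ray.
have cv := set_val_continuous; change (cat (fun z : set_type (nonzero_vectors u) => (val z).1) z).
by ct.
Qed.

Lemma unit_continuous : continuous unit_rep.
Proof.
apply/quotient_continuous => z.
rewrite (_ : _ \o _ = fun z : set_type (nonzero_vectors u) => `|(val z).2|^-1 *: (val z).2); last first.
  by apply/funext => w; exact: unit_ray.
have cv := set_val_continuous.
change (cat (fun z : set_type (nonzero_vectors u) => `|(val z).2|^-1 *: (val z).2) z).
by ct; rewrite normr_eq0 nz_neq0.
Qed.

Lemma unit_nz (s : B) : nonzero_vectors u (base s, unit_rep s).
Proof.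
rewrite /base /unit_rep; have [h1 h2] := set_valP (repr s); split => /=.
  by rewrite memvZ.
by rewrite scaler_eq0 negb_or h2 andbT invr_eq0 normr_eq0.
Qed.

Definition to_bundle (p : M * H) (h : nonzero_vectors u p) : B :=
  ray (exist _ p (mem_set h)).

Definition flow_fun (Phi : R -> B -> B) t (p : M * H) : M * H :=
  match pselect (nonzero_vectors u p) with
  | left h => let s := Phi t (to_bundle h) in (base s, unit_rep s)
  | right _ => p
  end.
Lemma flow_funE Phi t p (h : nonzero_vectors u p) :
  flow_fun Phi t p = (base (Phi t (to_bundle h)), unit_rep (Phi t (to_bundle h))).
Proof.
rewrite /flow_fun; case: pselect => // h'.
by rewrite (_ : to_bundle h' = to_bundle h) //; congr to_bundle; exact: Prop_irrelevance.
Qed.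

(** The representatives chosen by the fitting condition differ from the unit ones by positive
    factors, which [c] and [d] record. *)
Lemma flow_lift_ex Phi : fitting_flow Phi -> flow_lift (flow_fun Phi).
Proof.
move=> [fP fit]; split.
- move=> T t p ct' cp hp; rewrite (_ : (fun a => _) =
    fun a => (base (Phi (t a) (to_bundle (hp a))), unit_rep (Phi (t a) (to_bundle (hp a))))); last first.
    by apply/funext => a; exact: flow_funE.
  have c1 : continuous (fun a => exist _ (p a) (mem_set (hp a)) : set_type (nonzero_vectors u)).
    by apply: continuous_comp_initial => /= a; exact: cp.
  have c2 : continuous (fun a => to_bundle (hp a)).
    move=> a; apply: (@continuous_comp _ _ _ _ (@ray R u)); first exact: c1.
    exact: pi_continuous.
  have c3 := flow_continuous fP.
  have c4 : continuous (fun a => Phi (t a) (to_bundle (hp a))).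
    move=> a; apply: (@continuous_comp _ _ _ (fun a => (t a, to_bundle (hp a)))
      (fun ts : R * B => Phi ts.1 ts.2)); last exact: c3.
    exact: (cat_pair (ct' a) (c2 a)).
  have cb := base_continuous; have cu := unit_continuous.
  by ct.
- move=> p h; rewrite (flow_funE _ _ h) (flow0 fP) /to_bundle base_ray unit_ray //.
- by move=> t p h; rewrite (flow_funE _ _ h); exact: unit_nz.
- move=> t p t0 h; rewrite (flow_funE _ _ h) /=.
  have [z [z' [ez ez' /positive_pos hp]]] := fit (to_bundle h) t t0.
  have [e1 e2] : (val z).1 = p.1 /\ `|(val z).2|^-1 *: (val z).2 = `|p.2|^-1 *: p.2.
    by have := @unit_repZ z (exist _ p (mem_set h)); apply; apply/eqmodP; exact: ez.
  rewrite -ez' unit_ray; have n0 := nz_neq0 z; have n0' := nz_neq0 z'.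
  have [_ /= np] := h.
  exists (`|(val z).2| * `|p.2|^-1), `|(val z').2|; split.
  + by rewrite mulr_gt0 ?invr_gt0 ?normr_gt0.
  + by rewrite normr_gt0.
  + rewrite scalerA mulfV ?normr_eq0 // scale1r -scalerA -e2 scalerA mulfV ?normr_eq0 //.
    by rewrite scale1r.
Qed.
End FlowLift.

Section Retraction.
Local Open Scope quotient_scope.
Variable R : realType.
Notation M := 'rV[R]_2.
Implicit Types (x y : M) (r : R).

(** Retraction onto the sup-norm ball of radius [r] around [x], used to make maps defined near [x]
    global. *)
Definition ret x r y : M := x + v2 (Num.max (- r) (Num.min r ((y - x) 0 0)))
                                    (Num.max (- r) (Num.min r ((y - x) 0 1))).
Lemma ret_cont x r : continuous (ret x r).
Proof. by rewrite /ret; ct. Qed.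
Lemma ret_norm x r y : 0 <= r -> `|ret x r y - x| <= r.
Proof.
move=> r0; have -> : ret x r y - x = v2 (Num.max (- r) (Num.min r ((y - x) 0 0)))
    (Num.max (- r) (Num.min r ((y - x) 0 1))) by rewrite /ret addrAC subrr add0r.
have h (a : R) : `|Num.max (- r) (Num.min r a)| <= r.
  rewrite ler_norml le_max lexx ge_max ge_min lexx /= andbT; lra.
by apply: norm_le => // -[[|[|//]] lt]; rewrite mxE /=; exact: h.
Qed.
Lemma ret_id x r y : `|y - x| <= r -> ret x r y = y.
Proof.
move=> h; have h0 := le_trans (norm_coord (y - x) 0) h; have h1 := le_trans (norm_coord (y - x) 1) h.
move: h0 h1; rewrite !ler_norml => /andP[a0 a1] /andP[b0 b1].
rewrite /ret min_r // max_r // min_r // max_r // -v2_eta subrKC //.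
Qed.
Lemma cont_in (T : topologicalType) (U : set M) (V : topologicalType) (e : M -> V) (g : T -> M) :
  (forall y, U y -> cat e y) -> continuous g -> (forall p, U (g p)) -> continuous (fun p => e (g p)).
Proof. by move=> ce cg hU p; apply: (@cat_comp _ _ _ e g); [exact: ce | exact: cg]. Qed.
End Retraction.

(** * Leaves of a pencil with a fitting flow *)

Section FlowLocal.
Local Open Scope quotient_scope.
Variable R : realType.
Notation M := 'rV[R]_2.
Notation H := 'rV[R]_4.
Variables (u : M -> {vspace H}) (F : R -> M * H -> M * H).
Hypothesis mx : forall x, mixed (u x).
Hypothesis cu : continuous_pencil u.
Hypothesis fl : flow_lift u F.
Notation nz := (nonzero_vectors u).
Ltac flc := lazymatch goal with |- continuous (fun a : ?T => F (@?t a) (@?p a)) =>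
  refine (@fl_cont _ _ _ fl T t p _ _ _) end.

Lemma mixed_nopos x q : q \in u x -> ~ pos q.
Proof.
move=> qx pq; have q0 : q != 0 by apply/eqP => e; case: pq; rewrite e v4E ltxx.
by have := mixed_qd (mx x) qx q0; case: pq => _ h1 h2; lra.
Qed.

(** If the base point did not move, the positive form given by the fitting condition would belong to
    a mixed pencil. *)
Lemma flow_moves t p : 0 < t -> nz p -> (F t p).1 != p.1.
Proof.
move=> t0 np; apply/eqP => e; have [c [d [c0 d0 hp]]] := fl_pos fl t0 np.
have [m1 _] := fl_nz fl t np; have [m2 _] := np; rewrite e in m1.
by apply: (@mixed_nopos p.1 _ _ hp); rewrite rpredB // memvZ.
Qed.

Lemma flow_pr t p X : 0 < t -> nz p -> ball_closed X -> pr p.2 X = 0 -> 0 < pr (F t p).2 X.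
Proof.
move=> t0 np bX h; have [c [d [c0 d0 hp]]] := fl_pos fl t0 np.
have := pr_gt0 hp bX.1 (ball_closed_neq0 bX).
by rewrite !prE h mulr0 subr0 pmulr_rgt0.
Qed.

Lemma flow_off t p X : 0 < t -> nz p -> ball_closed X -> onp u p.1 X -> ~ onp u (F t p).1 X.
Proof.
move=> t0 np bX oX oX'; have := flow_pr t0 np bX (oX _ np.1).
by rewrite (oX' _ (fl_nz fl t np).1) ltxx.
Qed.

(** Adding the fitting relations started at two opposite rays cancels the initial form; if the flows
    met over one base point, a positive form would remain in its mixed pencil. *)
Lemma flow_opp t s p : 0 < t -> 0 <= s -> nz p -> (F t p).1 != (F s (p.1, - p.2)).1.
Proof.
move=> t0 s0 np; have np' : nz (p.1, - p.2).
  by have [h1 h2] := np; split; rewrite /= ?memvN // oppr_eq0.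
have [->|sn] := eqVneq s 0; first by rewrite (fl_0 fl np') flow_moves.
have {sn}s0 : 0 < s by rewrite lt_neqAle eq_sym sn.
apply/eqP => e; have [c [d [c0 d0 hp]]] := fl_pos fl t0 np.
have [c' [d' [c'0 d'0 hp']]] := fl_pos fl s0 np'.
have [m1 _] := fl_nz fl t np; have [m2 _] := fl_nz fl s np'; rewrite -e in m2.
have := posD (posZ c'0 hp) (posZ c0 hp') => /=; apply: (@mixed_nopos (F t p).1).
have -> : c' *: (d *: (F t p).2 - c *: p.2) + c *: (d' *: (F s (p.1, - p.2)).2 - c' *: - p.2) =
   (c' * d) *: (F t p).2 + (c * d') *: (F s (p.1, - p.2)).2.
  by apply: rV4P; rewrite !v4E /=; ring.
by rewrite rpredD // memvZ.
Qed.

Section AtPoint.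
Local Open Scope quotient_scope.
Variables (U : set M) (e f : M -> H).
Hypothesis oU : open U.
Hypothesis ce : forall y, U y -> cat e y.
Hypothesis cf : forall y, U y -> cat f y.
Hypothesis uU : forall y, U y -> u y = <<[:: e y; f y]>>%VS.

Definition circ y (s : R) : H :=
  let q := cos (pi *+ 2 * s) *: e y + sin (pi *+ 2 * s) *: f y in `|q|^-1 *: q.

Lemma span_neq0 y a b : U y -> (a != 0) || (b != 0) -> a *: e y + b *: f y != 0.
Proof.
move=> Uy ab; apply/eqP => h; have [d2 _] := mx y; rewrite (uU Uy) in d2.
by have [a0 b0] := mixed_free d2 h; move: ab; rewrite a0 b0 eqxx.
Qed.
Lemma cs_neq0 (a : R) : (cos a != 0) || (sin a != 0).
Proof.
rewrite -negb_and; apply/negP => /andP[/eqP h0 /eqP h1].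
by have := cos2Dsin2 a; rewrite h0 h1; lra.
Qed.
Lemma circ_nz y s : U y -> nz (y, circ y s).
Proof.
move=> Uy; have h := span_neq0 Uy (cs_neq0 (pi *+ 2 * s)); split => /=.
  by rewrite memvZ // (uU Uy); apply/mem_span2; do 2 eexists.
by rewrite scaler_eq0 negb_or h andbT invr_eq0 normr_eq0.
Qed.
Lemma circ_norm y s : U y -> `|circ y s|^-1 *: circ y s = circ y s.
Proof.
move=> Uy; have h := span_neq0 Uy (cs_neq0 (pi *+ 2 * s)).
by rewrite /circ normrZ normfV normr_id mulVf ?normr_eq0 // invr1 scale1r.
Qed.
Lemma circ_half y s : circ y (s + 2^-1) = - circ y s.
Proof.
rewrite /circ (_ : pi *+ 2 * (s + 2^-1) = pi *+ 2 * s + pi); last first.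
  by rewrite mulr2n; field.
by rewrite cosDpi sinDpi !scaleNr -opprD normrN scalerN.
Qed.
Lemma circ_per y : circ y 0 = circ y 1.
Proof. by rewrite /circ mulr0 mulr1 cos0 sin0 cos2pi sin2pi. Qed.
Lemma circ_cont (T : topologicalType) (g : T -> M) (s : T -> R) :
  continuous g -> continuous s -> (forall a, U (g a)) -> continuous (fun a => circ (g a) (s a)).
Proof.
move=> cg cs gU; have ceg := cont_in ce cg gU; have cfg := cont_in cf cg gU.
have cc : continuous (fun a => cos (pi *+ 2 * s a)).
  by move=> a; apply: (@cat_cos R T (fun a => pi *+ 2 * s a)); ct.
have csn : continuous (fun a => sin (pi *+ 2 * s a)).
  by move=> a; apply: (@cat_sin R T (fun a => pi *+ 2 * s a)); ct.
rewrite /circ; ct.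
by rewrite normr_eq0; apply: span_neq0; [exact: gU | exact: cs_neq0].
Qed.

(** Replacing the subtracted point [y] by the base point of the flow of the opposite ray, for times
    from 0 to 1, never meets 0 by [flow_opp], and ends with an odd loop. *)
Lemma turn_flow y : U y -> exists2 D, D != 0 & turn (fun s => (F 1 (y, circ y s)).1 - y) D.
Proof.
move=> Uy; have cc : continuous (fun s => circ y s).
  by apply: circ_cont => //; [exact: cst_continuous | ct].
pose g s := (F 1 (y, circ y s)).1 - y.
pose g' s := (F 1 (y, circ y s)).1 - (F 1 (y, - circ y s)).1.
have ncirc s : nz (y, - circ y s).
  by have [h1 h2] := circ_nz s Uy; split; rewrite /= ?memvN // oppr_eq0.
have hh : lhom g g'.
  exists (fun p => (F 1 (y, circ y p.2)).1 - (F p.1 (y, - circ y p.2)).1).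
  have c1 : continuous (fun p : R * R => F 1 (y, circ y p.2)).
    by flc => [||a]; [ct | ct | exact: circ_nz].
  have c2 : continuous (fun p : R * R => F p.1 (y, - circ y p.2)).
    by flc => [||a]; [ct | ct | exact: ncirc].
  split.
  - by ct.
  - move=> p /andP[p0 _] _; rewrite subr_eq0.
    exact: (@flow_opp 1 p.1 (y, circ y p.2) ltr01 p0 (circ_nz _ Uy)).
  - by move=> s _ /=; rewrite circ_per.
  - by move=> t _ /=; rewrite (fl_0 fl (ncirc t)) /g /g' /=.
have [D tg tg'] := lhom_turn hh; exists D => //.
apply: turn_odd tg' => t ht; rewrite /g' circ_half opprK opprB //.
Qed.
End AtPoint.
Ltac circc ce cf uU := lazymatch goal with
  |- continuous (fun a : ?T => circ _ _ (@?g a) (@?s a)) =>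
    refine (@circ_cont _ _ _ ce cf uU T g s _ _ _) end.

Lemma frame_ball x e0 : 0 < e0 -> exists U (e f : M -> H) r, [/\ open U,
  (forall y, U y -> cat e y) /\ (forall y, U y -> cat f y),
  forall y, U y -> u y = <<[:: e y; f y]>>%VS, 0 < r < e0 & forall y, `|y - x| <= r -> U y].
Proof.
move=> e00; have [U [e [f [[oU Ux] ce cf uU]]]] := frame_at cu x.
have /nbhs_ballP[r /= r0 hr] : nbhs x U by exact: open_nbhs_nbhs.
have m0 : 0 < Num.min r e0 by rewrite lt_min r0.
exists U, e, f, (Num.min r e0 / 2); split => //.
  rewrite divr_gt0 //= ltr_pdivrMr //; apply: (@le_lt_trans _ _ e0); last lra.
  by rewrite ge_min lexx orbT.
move=> y yx; apply: hr; rewrite -ball_normE /= distrC; apply: le_lt_trans yx _.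
by rewrite ltr_pdivrMr //; apply: (@le_lt_trans _ _ r); [rewrite ge_min lexx | lra].
Qed.

(** The loop of displacements from [y] has nonzero turn. It stays away from 0 when the origin moves
    from [y] to the very close [y']. If both leaves contained [Y], running the flow back to time 0
    could not hit [y'], by [flow_off], and would deform the loop to the constant [y - y']. *)
Lemma flow_disj x : exists2 d, 0 < d & forall y y' Y, `|y - x| < d -> `|y' - x| < d ->
    ball_closed Y -> onp u y Y -> onp u y' Y -> y = y'.
Proof.
have [U [e [f [r [oU [ce cf] uU /andP[r0 _] hU]]]]] := frame_ball x ltr01.
pose V (p : M * R) := (F 1 (ret x r p.1, circ e f (ret x r p.1) p.2)).1 - ret x r p.1.
have rU y : U (ret x r y) by apply: hU; apply: ret_norm; exact: ltW.
have cret := @ret_cont _ x r.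
have cV : continuous V.
  have c1 : continuous (fun p : M * R => F 1 (ret x r p.1, circ e f (ret x r p.1) p.2)).
    flc => [||a]; [ct | | exact: (circ_nz uU)].
    have c2 : continuous (fun p : M * R => circ e f (ret x r p.1) p.2).
      by circc ce cf uU => //; ct.
    by ct.
  by rewrite /V; ct.
have [|||[y0 s0] _ hmin] := @compact_EVT_min _ R (fun p => `|V p|)
    ([set y : M | `|y| <= `|x| + r] `*` `[0, 1]).
- by exists (0, 0); split; rewrite /= ?in_itv /= ?normr0 ?addr_ge0 ?lexx ?ler01 // ltW.
- by apply: compact_setX; [exact: rv_compact | exact: segment_compact].
- by apply: continuous_subspaceT; ct.
have m0 : 0 < `|V (y0, s0)|.
  by rewrite normr_gt0 subr_eq0; apply: (flow_moves ltr01 (p := (ret x r y0, _))); exact: (circ_nz uU).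
set m := `|V (y0, s0)| in hmin m0.
exists (Num.min r (m / 4)); first by rewrite lt_min r0 divr_gt0.
move=> y y' Y; rewrite !lt_min => /andP[yr ym] /andP[y'r y'm] bY oy oy'.
apply/eqP/negP => /negP ne; have Uy : U y by apply: hU; exact: ltW.
have [D D0 tD] := turn_flow ce cf uU Uy; case/eqP: D0.
have Vm s : 0 <= s <= 1 -> m <= `|(F 1 (y, circ e f y s)).1 - y|.
  move=> s01; have := hmin (y, s); rewrite inE /V /= (ret_id (ltW yr)); apply; split => /=.
    have := ler_normD (y - x) x; rewrite subrK; lra.
  by rewrite in_itv.
have cc : continuous (fun s => circ e f y s).
  by circc ce cf uU => //; [exact: cst_continuous | ct].
have c1 : continuous (fun p : R * R => F 1 (y, circ e f y p.2)).
  by flc => [||a]; [ct | ct | exact: (circ_nz uU)].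
have c2 : continuous (fun p : R * R => F (1 - p.1) (y, circ e f y p.2)).
  by flc => [||a]; [ct | ct | exact: (circ_nz uU)].
have h1 : lhom (fun s => (F 1 (y, circ e f y s)).1 - y) (fun s => (F 1 (y, circ e f y s)).1 - y').
  exists (fun p => (F 1 (y, circ e f y p.2)).1 - (y + p.1 *: (y' - y))); split.
  - by ct.
  - move=> p /andP[p0 p1] p2; rewrite -normr_gt0 opprD addrA.
    have := Vm p.2 p2; have := ler_norm (`|p.1 *: (y' - y)|); rewrite normrZ normrM normr_id.
    rewrite (ger0_norm p0) => _ hm.
    have h := lerB_normD ((F 1 (y, circ e f y p.2)).1 - y) (- (p.1 *: (y' - y))).
    rewrite normrN normrZ (ger0_norm p0) in h.
    have hy : `|y' - y| < m / 2.
      rewrite -(subrKA x); apply: le_lt_trans (ler_normD _ _) _.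
      by rewrite (distrC x); lra.
    have : p.1 * `|y' - y| <= `|y' - y| by apply: ler_piMl.
    lra.
  - by move=> s _ /=; rewrite circ_per.
  - by move=> t _ /=; rewrite scale0r addr0 scale1r subrKC.
have h2 : lhom (fun s => (F 1 (y, circ e f y s)).1 - y') (fun=> y - y').
  exists (fun p => (F (1 - p.1) (y, circ e f y p.2)).1 - y'); split.
  - by ct.
  - move=> p /andP[p0 p1] p2; rewrite subr_eq0; have nc := circ_nz uU p.2 Uy.
    have [->|p1n] := eqVneq p.1 1; first by rewrite subrr (fl_0 fl nc).
    apply/eqP => ey; apply: (@flow_off (1 - p.1) (y, circ e f y p.2) Y) => //.
      by rewrite subr_gt0 lt_neqAle p1n.
    by rewrite ey.
  - by move=> s _ /=; rewrite circ_per.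
  - by move=> t _ /=; rewrite subr0 subrr (fl_0 fl (circ_nz uU t Uy)).
have := turn_hom h2 (turn_hom h1 tD).
by move/turn_uniq; apply; apply: turn_cst; rewrite subr_eq0.
Qed.

(** Suppose that no leaf near [x] contains [Y]. Then the forms positive at [Y] give a vector field
    [W] without zeros near [x], so its turn along the image of a circle fibre at time [t0] is 0. The
    flow started from that image is also positive at [Y] and gives a homotopic loop; letting [t0]
    tend to 0 then gives the loop of [turn_flow], whose turn is not 0. *)
Lemma flow_open x e0 X : 0 < e0 -> ball_closed X -> onp u x X -> exists2 d, 0 < d &
    forall Y, ball_closed Y -> `|Y - X| < d -> exists2 y, `|y - x| < e0 & onp u y Y.
Proof.
move=> e00 bX oX; have [U [e [f [r [oU [ce cf] uU /andP[r0 re] hU]]]]] := frame_ball x e00.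
have Ux : U x by apply: hU; rewrite subrr normr0 ltW.
pose c s := circ e f x (cl s).
have cc : continuous c by rewrite /c; circc ce cf uU => //; [exact: cst_continuous | ct].
have ncs s : nz (x, c s) by exact: (circ_nz uU).
have cG : continuous (fun p : R * R => F p.2 (x, c p.1)).
  by flc => [||a]; [ct | ct | exact: ncs].
have [t0 t00 ht0] : exists2 t0, 0 < t0 & forall t s, 0 <= t <= t0 -> `|(F t (x, c s)).1 - x| < r.
  have : \forall t \near (0 : R), forall s, `[0, 1]%classic s -> `|(F t (x, c s)).1 - x| < r.
    apply: tube; first exact: segment_compact.
    move=> s _; have ch : cat (fun p : R * R => r - `|(F p.2 (x, c p.1)).1 - x|) (s, 0) by ct.
    have := near_gt0 ch; rewrite /= (fl_0 fl (ncs s)) /= subrr normr0 subr0 => /(_ r0).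
    by apply: filterS => p /=; rewrite subr_gt0.
  move=> /nbhs_ballP[d /= d0 hd]; exists (d / 2); first by rewrite divr_gt0.
  move=> t s /andP[t1 t2]; have -> : c s = c (cl s) by rewrite /c (cl_id (cl_itv s)).
  apply: hd; last by rewrite /= in_itv /= cl_itv.
  by rewrite -ball_normE /= sub0r normrN ger0_norm //; apply: le_lt_trans t2 _; lra.
have [d d0 hd] : exists2 d, 0 < d & forall Y s, `|Y - X| < d -> 0 < pr (F t0 (x, c s)).2 Y.
  have : \forall Y \near X, forall s, `[0, 1]%classic s -> 0 < pr (F t0 (x, c s)).2 Y.
    apply: tube; first exact: segment_compact.
    move=> s _; have c1 : continuous (fun p : R * H => F t0 (x, c p.1)).
      by flc => [||a]; [ct | ct | exact: ncs].
    have ch : cat (fun p : R * H => pr (F t0 (x, c p.1)).2 p.2) (s, X) by ct.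
    apply: (near_gt0 ch); apply: flow_pr => //; apply: oX; exact: (ncs s).1.
  move=> /nbhs_ballP[d /= d0 hd]; exists d => // Y s hY.
  have -> : c s = c (cl s) by rewrite /c (cl_id (cl_itv s)).
  apply: hd; last by rewrite /= in_itv /= cl_itv.
  by rewrite -ball_normE /= distrC.
exists d => // Y bY YX; apply: contrapT => no.
have noy y : `|y - x| < r -> ~ onp u y Y.
  by move=> hy oy; apply: no; exists y => //; exact: lt_trans re.
(* A form of the pencil at [y] whose value at [Y] is a sum of squares, zero only if [Y] lies on the
   leaf of [y]. *)
pose rr y := pr (e y) Y *: e y + pr (f y) Y *: f y.
have Ur y : `|y - x| < r -> U y by move=> h; apply: hU; exact: ltW.
have rin y : `|y - x| < r -> rr y \in u y.
  by move=> h; rewrite (uU y (Ur y h)); apply/mem_span2; do 2 eexists.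
have rpos y : `|y - x| < r -> 0 < pr (rr y) Y.
  move=> h; rewrite /rr !prE -!expr2 lt_neqAle addr_ge0 ?sqr_ge0 // andbT eq_sym.
  rewrite paddr_eq0 ?sqr_ge0 // !sqrf_eq0; apply/negP => /andP[/eqP h1 /eqP h2].
  by apply: (noy y h); apply/(onp_frame _ (uU y (Ur y h))).
have pnz q y : q \in u y -> 0 < pr q Y -> nz (y, q).
  by move=> qy h; split => //=; apply/eqP => q0; move: h; rewrite q0 pr0l ltxx.
have crr (T : topologicalType) (g : T -> M) : continuous g -> (forall a, `|g a - x| < r) ->
    continuous (fun a => rr (g a)).
  move=> cg hg; have gU a : U (g a) by exact: Ur.
  have := cont_in ce cg gU; have := cont_in cf cg gU => h1 h2; rewrite /rr; ct.
pose G t s := F t (x, c s).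
have cGT (T : topologicalType) (t s : T -> R) : continuous t -> continuous s ->
    continuous (fun a => G (t a) (s a)).
  move=> ct' cs; rewrite /G; flc => [//||a]; [ct | exact: ncs].
have Gper t : G t 0 = G t 1 by rewrite /G /c cl_le0 // cl_ge1 // circ_per.
have t0' : 0 <= t0 by exact: ltW.
have clt t : 0 <= cl t * t0 <= t0.
  by have /andP[h1 h2] := cl_itv t; rewrite mulr_ge0 //= ler_piMl.
have t0t : 0 <= t0 <= t0 by rewrite t0' lexx.
pose W y := (F 1 (y, rr y)).1 - y.
have Wn y : `|y - x| < r -> W y != 0.
  move=> h; rewrite subr_eq0; apply: (@flow_moves 1 (y, rr y)) => //.
  by apply: pnz; [exact: rin | exact: rpos].
have cW (T : topologicalType) (g : T -> M) : continuous g -> (forall a, `|g a - x| < r) ->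
    continuous (fun a => W (g a)).
  move=> cg hg; have h := crr _ _ cg hg.
  have h1 : continuous (fun a => F 1 (g a, rr (g a))).
    flc => [||a]; [ct | ct |].
    by apply: pnz; [exact: rin | exact: rpos].
  by rewrite /W; ct.
have l1 : lhom (fun=> W x) (fun s => W (G t0 s).1).
  exists (fun p => W (G (cl p.1 * t0) p.2).1); split.
  - by apply: cW => [|p]; [have := cGT (R * R)%type (fun p => cl p.1 * t0) (fun p => p.2);
      move=> h; have {}h := h ltac:(ct) ltac:(ct); ct | exact: ht0].
  - by move=> p _ _; apply: Wn; exact: ht0.
  - by move=> s _ /=; rewrite Gper.
  - move=> t _ /=; rewrite cl_le0 // mul0r cl_ge1 // mul1r; split => //.
    by rewrite /G (fl_0 fl (ncs t)).
have cG0 : continuous (fun p : R * R => G t0 p.2).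
  by apply: (cGT (R * R)%type (fun=> t0) (fun p => p.2)); ct.
have cr0 : continuous (fun p : R * R => rr (G t0 p.2).1).
  by apply: (crr (R * R)%type (fun p => (G t0 p.2).1)) => [|p]; [ct | exact: ht0].
have l2 : lhom (fun s => W (G t0 s).1) (fun s => (F 1 (G t0 s)).1 - (G t0 s).1).
  (* Both forms are positive at [Y], hence so are their convex combinations, which therefore do not
     vanish. *)
  pose q (p : R * R) := (1 - cl p.1) *: rr (G t0 p.2).1 + cl p.1 *: (G t0 p.2).2.
  have nq p : nz ((G t0 p.2).1, q p).
    apply: pnz.
      by rewrite rpredD // memvZ //; [exact/rin/ht0 | exact: (fl_nz fl t0 (ncs _)).1].
    have /andP[h1 h2] := cl_itv p.1; 
    have -> : pr (q p) Y = (1 - cl p.1) * pr (rr (G t0 p.2).1) Y + cl p.1 * pr (G t0 p.2).2 Y.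
      by rewrite /q prDl !prZl.
    have h3 := rpos _ (ht0 t0 p.2 t0t); have h4 := hd Y p.2 YX.
    have [->|n1] := eqVneq (cl p.1) 1; first by rewrite subrr mul0r add0r mul1r.
    apply: ltr_pwDl; last by apply: mulr_ge0 => //; exact: ltW.
    by apply: mulr_gt0 => //; rewrite subr_gt0 lt_neqAle n1.
  exists (fun p => (F 1 ((G t0 p.2).1, q p)).1 - (G t0 p.2).1); split.
  - have h1 : continuous q by rewrite /q; ct.
    have h2 : continuous (fun p => F 1 ((G t0 p.2).1, q p)).
      by flc => [||a]; [ct | ct | exact: nq].
    by ct.
  - by move=> p _ _; rewrite subr_eq0; apply: (@flow_moves 1 (_, _) ltr01 (nq p)).
  - by move=> s _; rewrite /q /= Gper.
  - move=> t _ /=; rewrite /q /= cl_le0 // cl_ge1 // subr0 subrr !scale1r !scale0r addr0 add0r.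
    by rewrite -surjective_pairing.
have l3 : lhom (fun s => (F 1 (G t0 s)).1 - (G t0 s).1) (fun s => (F 1 (x, circ e f x s)).1 - x).
  exists (fun p => (F 1 (G (t0 * (1 - p.1)) p.2)).1 - (G (t0 * (1 - p.1)) p.2).1).
  have c1 : continuous (fun p : R * R => G (t0 * (1 - p.1)) p.2).
    by apply: (cGT (R * R)%type (fun p => t0 * (1 - p.1)) (fun p => p.2)); ct.
  have nG t s : nz (G t s) by exact: (fl_nz fl _ (ncs s)).
  split.
  - have h2 : continuous (fun p : R * R => F 1 (G (t0 * (1 - p.1)) p.2)).
      by flc => [||a]; [ct | ct | exact: nG].
    by ct.
  - by move=> p _ _; rewrite subr_eq0; exact: flow_moves.
  - by move=> s _; rewrite /= Gper.
  - move=> t ht /=; rewrite subr0 mulr1 subrr mulr0; split => //.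
    by rewrite /G (fl_0 fl (ncs t)) /= /c (cl_id ht) (circ_norm uU) //.
have [D D0 tD] := turn_flow ce cf uU Ux; case/eqP: D0.
apply: turn_uniq tD _; apply: turn_hom l3 _; apply: turn_hom l2 _; apply: turn_hom l1 _.
by apply: turn_cst; apply: Wn; rewrite subrr normr0.
Qed.

Lemma flow_leaf_system : leaf_system (onp u).
Proof.
split.
- by move=> x X Y c hX hY q qx; rewrite !prE hX // hY // mulr0 addr0.
- exact: onp_closed cu.
- exact: onp_base mx cu.
- exact: flow_disj.
- exact: flow_open.
Qed.
End FlowLocal.

(** * Fitting immersions *)

Section StrictDerivative.
Variable R : realType.
Notation M := 'rV[R]_2.
Notation H := 'rV[R]_4.

Lemma mvt_bound (g g' : R -> R) (c e a b : R) :
  (forall t, Num.min a b <= t <= Num.max a b -> is_derive t 1 g (g' t) /\ `|g' t - c| <= e) ->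
  `|g b - g a - (b - a) * c| <= e * `|b - a|.
Proof.
wlog ab : a b / a <= b => [hw h|].
  case: (leP a b) => ab; first exact: hw.
  have -> : g b - g a - (b - a) * c = - (g a - g b - (a - b) * c) by ring.
  by rewrite normrN (distrC b); apply: hw; [exact: ltW | rewrite minC maxC].
rewrite min_l // max_r // => h.
have [||t tab ->] := @MVT_segment R g g' a b ab.
- by move=> t; rewrite in_itv /= => /andP[h1 h2]; apply: (h t _).1; rewrite !ltW.
- apply: continuous_in_subspaceT => t; rewrite inE /= in_itv /= => tab.
  by have [h1 _] := h t tab; apply/differentiable_continuous/derivable1_diffP.
rewrite (_ : g' t * (b - a) - (b - a) * c = (g' t - c) * (b - a)); last by ring.
rewrite normrM ler_wpM2r //; apply: (h t _).2; by move: tab; rewrite in_itv.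
Qed.

Lemma two_steps (f0 f1 f2 p q u v e n : R) : 0 <= e -> `|f1 - f0 - u * p| <= e * `|u| ->
  `|f2 - f1 - v * q| <= e * `|v| -> `|u| <= n -> `|v| <= n ->
  `|f2 - f0 - (u * p + v * q)| <= e *+ 2 * n.
Proof.
move=> e0 h1 h2 un vn; have -> : f2 - f0 - (u * p + v * q) = (f1 - f0 - u * p) + (f2 - f1 - v * q) by ring.
apply: le_trans (ler_normD _ _) _; rewrite mulr2n mulrDl; apply: lerD.
  by apply: le_trans h1 _; exact: ler_wpM2l.
by apply: le_trans h2 _; exact: ler_wpM2l.
Qed.

Lemma line_derive (f : M -> H) (a v : M) k (t : R) : derivable f (a + t *: v) v ->
  is_derive t 1 (fun s => f (a + s *: v) 0 k) ('D_v f (a + t *: v) 0 k).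
Proof.
move=> df; have cv : (fun h : R => h^-1 *: (f (a + (h + t) *: v) 0 k - f (a + t *: v) 0 k)) @ 0^'
    --> 'D_v f (a + t *: v) 0 k.
  have h1 : (fun h : R => (h^-1 *: ((f \o shift (a + t *: v)) (h *: v) - f (a + t *: v))) 0 k) @ 0^'
    --> 'D_v f (a + t *: v) 0 k.
    apply: (@cvg_comp _ _ _ _ (fun q : H => q 0 k) _ _ _ df); exact: coord_continuous.
  apply: cvg_trans h1; apply: near_eq_cvg; near=> h.
  rewrite !rvE /= /shift /=; congr (_ * (f _ _ _ - _)).
  by rewrite scalerDl addrCA.
have cv' : (fun h : R => h^-1 *: (((fun s => f (a + s *: v) 0 k) \o shift t) (h *: (1 : R)) -
    f (a + t *: v) 0 k)) @ 0^' --> 'D_v f (a + t *: v) 0 k.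
  apply: cvg_trans cv; apply: near_eq_cvg; near=> h.
  by rewrite /= /shift /= /GRing.scale /= mulr1.
split; first by apply/cvg_ex; eexists; exact: cv'.
by apply: cvg_lim => //; exact: cv'.
Unshelve. all: by end_near. Qed.

Notation dx := (v2 1 0 : M).
Notation dy := (v2 0 1 : M).

Lemma strict_aux (U : set M) (f : M -> H) x (p q : H) eta d : 0 < eta ->
  (forall z, U z -> derivable f z dx) -> (forall z, U z -> derivable f z dy) ->
  (forall z, ball x d z -> U z /\ (`|'D_dx f z - p| < eta / 2 /\ `|'D_dy f z - q| < eta / 2)) ->
  forall y y', `|y - x| < d -> `|y' - x| < d ->
  `|f y' - f y - ((y' - y) 0 0 *: p + (y' - y) 0 1 *: q)| <= eta * `|y' - y|.
Proof.
move=> eta0 d1 d2 hd y y' yd y'd.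
have zd (s t : R) : `|s - x 0 0| < d -> `|t - x 0 1| < d -> ball x d (v2 s t).
  move=> sd td; rewrite -ball_normE /= distrC.
  have m0 : 0 <= Num.max `|s - x 0 0| `|t - x 0 1| by rewrite le_max normr_ge0.
  apply: (@le_lt_trans _ _ (Num.max `|s - x 0 0| `|t - x 0 1|)); last by rewrite gt_max sd td.
  apply: norm_le => // -[[|[|//]] lt]; rewrite !mxE /= le_max;
    [rewrite (_ : Ordinal lt = 0) ?lexx //; exact/val_inj
    |rewrite (_ : Ordinal lt = 1) ?lexx ?orbT //; exact/val_inj].
have cd (z : M) j : `|z - x| < d -> `|z 0 j - x 0 j| < d.
  by move=> zx; apply: le_lt_trans zx; have := norm_coord (z - x) j; rewrite !rvE.
have btw (a b t c : R) : `|a - c| < d -> `|b - c| < d -> Num.min a b <= t <= Num.max a b -> `|t - c| < d.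
  move=> /ltr_normlP[a1 a2] /ltr_normlP[b1 b2]; rewrite ge_min le_max => /andP[/orP h3 /orP h4].
  by apply/ltr_normlP; split; case: h3; case: h4; lra.
apply: norm_le => [|k]; first by rewrite mulr_ge0 // ltW.
pose a := y 0 0; pose b := y 0 1; pose a' := y' 0 0; pose b' := y' 0 1.
have ha : `|f (v2 a' b) 0 k - f (v2 a b) 0 k - (a' - a) * p 0 k| <= eta / 2 * `|a' - a|.
  have E t : v2 t b = v2 0 b + t *: dx by apply: rV2P; rewrite !rvE; ring.
  rewrite (E a) (E a').
  apply: (@mvt_bound (fun t => f (v2 0 b + t *: dx) 0 k) (fun t => 'D_dx f (v2 0 b + t *: dx) 0 k)).
  move=> t ht; have [|Uz [h3 _]] := hd (v2 t b).
    by apply: zd; [apply: btw ht; exact: cd | exact: cd].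
  rewrite E in Uz h3; split; first by apply: line_derive; exact: (d1 _ Uz).
  by apply: le_trans (ltW h3); have := norm_coord ('D_dx f (v2 0 b + t *: dx) - p) k; rewrite !rvE.
have hb : `|f (v2 a' b') 0 k - f (v2 a' b) 0 k - (b' - b) * q 0 k| <= eta / 2 * `|b' - b|.
  have E t : v2 a' t = v2 a' 0 + t *: dy by apply: rV2P; rewrite !rvE; ring.
  rewrite (E b) (E b').
  apply: (@mvt_bound (fun t => f (v2 a' 0 + t *: dy) 0 k) (fun t => 'D_dy f (v2 a' 0 + t *: dy) 0 k)).
  move=> t ht; have [|Uz [_ h3]] := hd (v2 a' t).
    by apply: zd; [exact: cd | apply: btw ht; exact: cd].
  rewrite E in Uz h3; split; first by apply: line_derive; exact: (d2 _ Uz).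
  by apply: le_trans (ltW h3); have := norm_coord ('D_dy f (v2 a' 0 + t *: dy) - q) k; rewrite !rvE.
have fE (z : M) : f (v2 (z 0 0) (z 0 1)) = f z by rewrite -v2_eta.
rewrite rvD rvD rvN rvN rvD rvZ rvZ -(fE y) -(fE y') [eta]splitr -mulr2n.
have u0 : (y' - y) 0 0 = a' - a by rewrite rvD rvN.
have u1 : (y' - y) 0 1 = b' - b by rewrite rvD rvN.
rewrite -u0 in ha; rewrite -u1 in hb.
by apply: (two_steps _ ha hb); [rewrite divr_ge0 // ltW | exact: norm_coord..].
Qed.

(** Strict differentiability: the error is controlled for two arbitrary points near [x], which is
    what local injectivity requires later. *)
Lemma strict_estimate (U : set M) (f : M -> H) x eta : open U -> U x -> smooth_on U f -> 0 < eta ->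
  exists2 d, 0 < d & forall y y', `|y - x| < d -> `|y' - x| < d ->
  `|f y' - f y - ((y' - y) 0 0 *: 'D_dx f x + (y' - y) 0 1 *: 'D_dy f x)| <= eta * `|y' - y|.
Proof.
move=> oU Ux sf eta0; have [_ /= h1] := sf 1%N.
have [d1 [c1 _]] := h1 dx; have [d2 [c2 _]] := h1 dy.
have near_close (g : M -> H) : cat g x -> \forall z \near x, `|g z - g x| < eta / 2.
  move=> cg; have ch : cat (fun z => eta / 2 - `|g z - g x|) x by ct.
  have h0 : 0 < eta / 2 - `|g x - g x| by rewrite subrr normr0 subr0 divr_gt0.
  by apply: filterS (near_gt0 ch h0) => z; rewrite subr_gt0.
have /nbhs_ballP[d /= d0 hd] : \forall z \near x, U z /\
    (`|'D_dx f z - 'D_dx f x| < eta / 2 /\ `|'D_dy f z - 'D_dy f x| < eta / 2).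
  apply: filterI; first exact: open_nbhs_nbhs.
  by apply: filterI; [apply: (near_close ('D_dx f)); exact: c1 | apply: (near_close ('D_dy f)); exact: c2].
by exists d => //; exact: (strict_aux eta0 d1 d2 hd).
Qed.

Lemma pr_norm (q X : H) : `|pr q X| <= 6 * `|q| * `|X|.
Proof.
have h j : `|q 0 j * X 0 j| <= `|q| * `|X|.
  by rewrite normrM; apply: ler_pM => //; exact: norm_coord.
rewrite /pr; have h0 := h 0; have h1 := h 1; have h2 := h 2; have h3 := h 3.
move: h0 h1 h2 h3; rewrite !ler_norml => /andP[? ?] /andP[? ?] /andP[? ?] /andP[? ?].
apply/andP; split; lra.
Qed.
End StrictDerivative.

(** * Leaves of a fitting immersion *)

Section ImmersionLocal.
Variable R : realType.
Notation M := 'rV[R]_2.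
Notation H := 'rV[R]_4.
Variable u : M -> {vspace H}.
Hypothesis mx : forall x, mixed (u x).
Hypothesis su : smooth_pencil u.
Hypothesis ft : forall x w, w != 0 -> fitting_tangent u x w.
Notation dx := (v2 1 0 : M).
Notation dy := (v2 0 1 : M).

Lemma smooth_cat (U : set M) (f : M -> H) : smooth_on U f -> forall y, U y -> cat f y.
Proof. by move=> /(_ 0%N)[h _]. Qed.

Lemma smooth_continuous_pencil : continuous_pencil u.
Proof.
move=> x; have [U [e [f [oU se sf uU]]]] := su x; exists U, e, f; split => //.
  by move=> y Uy; exact: (smooth_cat se).
by move=> y Uy; exact: (smooth_cat sf).
Qed.

Lemma crs0_dep (A B : M) : crs A B = 0 -> exists2 w : M, w != 0 & w 0 0 *: A + w 0 1 *: B = 0.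
Proof.
rewrite /crs => h.
have nz (a b : R) : (a != 0) || (b != 0) -> v2 a b != 0.
  by move=> ab; apply/eqP => e; move: ab; rewrite -(v2_0 a b) -{2}(v2_1 a b) e !rv0 eqxx.
have [B0|B0] := eqVneq (B 0 0) 0; last first.
  exists (v2 (B 0 0) (- A 0 0)); first by rewrite nz ?B0.
  by apply: rV2P; rewrite !rvE; [ring | lra].
have [B1|B1] := eqVneq (B 0 1) 0; last first.
  exists (v2 (B 0 1) (- A 0 1)); first by rewrite nz ?B1.
  by apply: rV2P; rewrite !rvE; [lra | ring].
exists (v2 0 1); first by rewrite nz ?oner_eq0 ?orbT.
by apply: rV2P; rewrite !rvE ?B0 ?B1; ring.
Qed.

Lemma v2_comb (a b p q p' q' : R) : a *: v2 p q + b *: v2 p' q' = 0 -> a * p + b * p' = 0 /\ a * q + b * q' = 0.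
Proof.
by move=> h; have h0 := congr1 (fun v : M => v 0 0) h; have h1 := congr1 (fun v : M => v 0 1) h; move: h0 h1; rewrite !rvE.
Qed.

Lemma crs_inv (A B : M) : crs A B != 0 ->
  exists2 m, 0 < m & forall w : M, m * `|w| <= `|w 0 0 *: A + w 0 1 *: B|.
Proof.
move=> h; have c0 : 0 < `|crs A B| by rewrite normr_gt0.
have s0 : 0 < 2 * (`|A| + `|B| + 1) by have := normr_ge0 A; have := normr_ge0 B; lra.
exists (`|crs A B| / (2 * (`|A| + `|B| + 1))); first by rewrite divr_gt0.
move=> w; rewrite mulrAC ler_pdivrMr //; set z := _ + _.
have cb (a b : M) : `|crs a b| <= 2 * `|a| * `|b|.
  have h1 i j : `|a 0 i * b 0 j| <= `|a| * `|b| by rewrite normrM; apply: ler_pM => //; exact: norm_coord.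
  apply: le_trans (ler_normB _ _) _; have := h1 0 1; have := h1 1 0; lra.
have cw : crs A B *: w = v2 (crs z B) (crs A z).
  by apply: rV2P; rewrite /z /crs !rvE; ring.
rewrite -[`|crs A B| * _]normrZ cw; have h1 := cb z B; have h2 := cb A z.
have := normr_ge0 z; have := normr_ge0 A; have := normr_ge0 B => a0 b0 z0.
have t1 : 0 <= 2 * `|z| * (`|A| + `|B| + 1) by rewrite !mulr_ge0 //; lra.
have n1 : 0 <= `|z| * `|A| by exact: mulr_ge0.
have n2 : 0 <= `|z| * `|B| by exact: mulr_ge0.
rewrite mulrA (mulrC _ 2); apply: norm_le => // -[[|[|//]] lt]; rewrite mxE /=; lra.
Qed.

(** In a frame [e], [f] of the pencil, the zeros of [sect e f Y] are the points whose leaf contains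
    [Y]. *)
Definition sect (e f : M -> H) (Y : H) (y : M) : M := v2 (pr (e y) Y) (pr (f y) Y).

(** The coefficients of a section in a frame are given by Cramer's rule with the Gram matrix for
    [mk], hence are continuous. *)
Lemma coeff_ex (U U' : set M) (e f s : M -> H) x : open U -> U x -> smooth_on U e -> smooth_on U f ->
  (forall y, U y -> u y = <<[:: e y; f y]>>%VS) -> open U' -> U' x -> smooth_on U' s ->
  (forall y, U' y -> s y \in u y) -> exists al be : M -> R, [/\ cat al x, cat be x &
  forall y, U y -> U' y -> s y = al y *: e y + be y *: f y].
Proof.
move=> oU Ux se sf uU oU' Ux' ss us.
pose al y := (mk (s y) (e y) * mk (f y) (f y) - mk (s y) (f y) * mk (e y) (f y)) / gram (e y) (f y).
pose be y := (mk (s y) (f y) * mk (e y) (e y) - mk (s y) (e y) * mk (e y) (f y)) / gram (e y) (f y).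
have gn y : U y -> 0 < gram (e y) (f y).
  by move=> Uy; apply/gram_gt0/mixed_spacelike; rewrite -uU.
have sE y : U y -> U' y -> s y = al y *: e y + be y *: f y.
  move=> Uy U'y; have := us y U'y; rewrite (uU y Uy) => /mem_span2[a [b sab]].
  have g0 := gn y Uy; have mkl c c' (v v' v'' : H) : mk (c *: v + c' *: v') v'' = c * mk v v'' + c' * mk v' v''.
    by rewrite /mk !v4E; ring.
  have mkC (v v' : H) : mk v v' = mk v' v by rewrite /mk; ring.
  rewrite sab /al /be sab !mkl (mkC (f y) (e y)); congr (_ *: _ + _ *: _);
    by apply: (mulIf (lt0r_neq0 g0)); rewrite divfK ?gt_eqF // /gram; ring.
have ce := smooth_cat se Ux; have cf := smooth_cat sf Ux; have cs := smooth_cat ss Ux'.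
exists al, be.
have h1 := cat_mk ce ce; have h2 := cat_mk cf cf; have h3 := cat_mk ce cf.
have h4 := cat_mk cs ce; have h5 := cat_mk cs cf.
have g0 : gram (e x) (f x) != 0 by rewrite gt_eqF // gn.
have hg : cat (fun y => gram (e y) (f y)) x by rewrite /gram; ct.
by split=> //; [rewrite /al; ct|rewrite /be; ct].
Qed.

Lemma small_contra (h c C eta n a b p q : R) : h != 0 -> 0 < c -> 0 < C -> 0 < eta -> 0 < n + 1 -> 
  12 * C * eta * (n + 1) = c ->
  `|a| + `|b| < C -> `|p| <= 6 * eta * `|h| * n -> `|q| <= 6 * eta * `|h| * n ->
  `|c - h^-1 * (a * p + b * q)| < c / 2 -> False.
Proof.
move=> h0 c0 C0 e0 n0 ce aC hp hq; have hn0 : 0 < `|h| by rewrite normr_gt0.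
have k0 : 0 <= 6 * eta * `|h| * n by exact: le_trans hp.
have hb : `|a * p + b * q| <= C * (6 * eta * `|h| * n).
  apply: le_trans (ler_normD _ _) _; rewrite !normrM.
  apply: (@le_trans _ _ ((`|a| + `|b|) * (6 * eta * `|h| * n))).
    by rewrite mulrDl lerD // ler_wpM2l.
  by rewrite ler_wpM2r // ltW.
have hb2 : `|h^-1 * (a * p + b * q)| <= c / 2.
  rewrite normrM normfV mulrC ler_pdivrMr //; apply: le_trans hb _.
  rewrite -ce (_ : C * _ = 6 * C * eta * `|h| * n); last by ring.
  rewrite (_ : _ / 2 * _ = 6 * C * eta * `|h| * (n + 1)); last by field.
  rewrite ler_wpM2l ?lerDl //; apply: ltW; do !apply: mulr_gt0 => //.
move=> /ltr_normlP[_ h5]; move: hb2 => /ler_normlP[_ h6]; lra.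
Qed.

Lemma small_sect (k : M -> H) (x w : M) (p q X : H) (eta d h : R) : 0 < d -> `|X| <= 1 ->
  (forall y y', `|y - x| < d -> `|y' - x| < d ->
    `|k y' - k y - ((y' - y) 0 0 *: p + (y' - y) 0 1 *: q)| <= eta * `|y' - y|) ->
  pr (k x) X = 0 -> w 0 0 * pr p X + w 0 1 * pr q X = 0 ->
  `|h *: w| < d -> `|pr (k (x + h *: w)) X| <= 6 * eta * `|h| * `|w|.
Proof.
move=> d0 X1 hk k0 kw hd; have := hk x (x + h *: w).
rewrite subrr normr0 addrAC subrr add0r => /(_ d0 hd); rewrite normrZ => hh.
set E := _ - _ in hh; have -> : pr (k (x + h *: w)) X = pr E X.
  rewrite /E prDl (prNl (_ + _)) prDl prNl k0 prDl !prZl !rvZ.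
  have -> : h * w 0 0 * pr p X + h * w 0 1 * pr q X = h * (w 0 0 * pr p X + w 0 1 * pr q X) by ring.
  by rewrite kw mulr0 !subr0.
apply: le_trans (pr_norm _ _) _; have E0 := normr_ge0 E.
apply: (@le_trans _ _ (6 * `|E|)); first by rewrite ler_piMr // mulr_ge0.
by rewrite -!mulrA ler_wpM2l.
Qed.

(** Suppose that a direction [w] is killed. Fitting gives a section [s] whose derivative along [w]
    pairs positively with [X]. In the frame, [s] has bounded coefficients, while the pairings of [e]
    and [f] with [X] are negligible to first order along [w]; so that derivative would pair to 0. *)
Lemma sect_linear (U : set M) (e f : M -> H) x X : open U -> U x -> smooth_on U e -> smooth_on U f ->
  (forall y, U y -> u y = <<[:: e y; f y]>>%VS) -> ball_closed X -> onp u x X ->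
  crs (v2 (pr ('D_dx e x) X) (pr ('D_dx f x) X)) (v2 (pr ('D_dy e x) X) (pr ('D_dy f x) X)) != 0.
Proof.
move=> oU Ux se sf uU bX oX; apply/eqP => /crs0_dep[w w0 hw].
have [p [q [/positive_pos pq [U' [s [[oU' Ux'] ss us sp sd]]]]]] := ft x w0.
have [hwe hwf] := v2_comb hw.
have [oe of_] := (onp_frame X (uU x Ux)).1 oX.
have c0 : 0 < pr q X by apply: pr_gt0 => //; [exact: bX.1 | exact: ball_closed_neq0].
have [al [be [ca cb sE]]] := coeff_ex oU Ux se sf uU oU' Ux' ss us.
pose C := `|al x| + `|be x| + 1.
have C0 : 0 < C by rewrite /C ltr_wpDl // addr_ge0.
have nC : \forall y \near x, `|al y| + `|be y| < C.
  have ch : cat (fun y => C - (`|al y| + `|be y|)) x by ct.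
  have h0 : 0 < C - (`|al x| + `|be x|) by rewrite /C addrAC subrr add0r.
  by apply: filterS (near_gt0 ch h0) => y; rewrite subr_gt0.
have X1 := ball_closed_norm bX.
(* With this precision the two frame vectors contribute at most half of [pr q X] to the difference
   quotient. *)
pose eta := pr q X / (12 * C * (`|w| + 1)).
have wp : 0 < `|w| + 1 by rewrite ltr_wpDl.
have eta0 : 0 < eta by rewrite divr_gt0 // !mulr_gt0.
have [de de0 he] := strict_estimate oU Ux se eta0.
have [df df0 hf] := strict_estimate oU Ux sf eta0.
have dw : (fun h : R => pr (h^-1 *: (s (h *: w + x) - s x)) X) @ 0^' --> pr ('D_w s x) X.
  have [_ /(_ w)[ds _]] := ss 1%N.
  apply: (@cvg_comp _ _ _ _ (fun v : H => pr v X) _ _ _ (ds x Ux')).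
  have ci : cat (fun v : H => pr v X) ('D_w s x) by ct.
  exact: ci.
have qE : pr ('D_w s x) X = pr q X.
  by apply/eqP; rewrite -subr_eq0 -prNl -prDl; apply/eqP; exact: oX.
rewrite qE in dw.
have /cvgrPdist_lt /(_ (pr q X / 2)) := dw; rewrite divr_gt0 // => /(_ isT) n1.
have lin : cat (fun h : R => h *: w + x) 0 by ct.
have n2 : \forall h \near 0^', U (h *: w + x) /\ (U' (h *: w + x) /\
    (`|al (h *: w + x)| + `|be (h *: w + x)| < C)).
  apply: nbhs_dnbhs; apply: (lin [set y | U y /\ (U' y /\ `|al y| + `|be y| < C)]).
  rewrite scale0r add0r; apply: filterI; first exact: open_nbhs_nbhs.
  by apply: filterI => //; exact: open_nbhs_nbhs.
have n3 : \forall h \near 0^', `|h *: w| < de /\ `|h *: w| < df.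
  have ci : cat (fun h : R => Num.min de df - `|h *: w|) 0 by ct.
  have h0 : 0 < Num.min de df - `|0 *: w| by rewrite scale0r normr0 subr0 lt_min de0.
  apply: nbhs_dnbhs; apply: filterS (near_gt0 ci h0) => h.
  by rewrite subr_gt0 lt_min => /andP[].
have n4 : \forall h \near (0 : R)^', h != 0 by exact: nbhs_dnbhs_neq.
have [h [[[hn1 [Uh [U'h aC]]] [hde hdf]] h0]] :=
  @filter_ex _ _ (Proper_dnbhs_numFieldType 0) _ (filterI (filterI (filterI n1 n2) n3) n4).
have s0 : pr (s x) X = 0 by apply: oX; exact: us.
have := small_sect de0 X1 he oe hwe hde; have := small_sect df0 X1 hf of_ hwf hdf.
rewrite (addrC x) => hF hE.
move: hn1; rewrite prZl prDl prNl s0 subr0 (sE _ Uh U'h) prDl !prZl.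
set y := _ + x in hF hE aC *; set a := al y in aC *; set b := be y in aC *.
apply: (small_contra h0 c0 C0 eta0 wp _ aC hE hF).
by rewrite /eta; field; rewrite !gt_eqF.
Qed.

Lemma small_est (k : M -> H) (x : M) (p q X : H) (m d : R) : 0 < m -> 0 < d -> `|X| <= 1 ->
  (forall y y', `|y - x| < d -> `|y' - x| < d ->
    `|k y' - k y - ((y' - y) 0 0 *: p + (y' - y) 0 1 *: q)| <= m / 48 * `|y' - y|) ->
  exists2 d', 0 < d' <= d & forall y y' Y, `|y - x| < d' -> `|y' - x| < d' -> `|Y - X| < d' ->
  `|pr (k y') Y - pr (k y) Y - ((y' - y) 0 0 * pr p X + (y' - y) 0 1 * pr q X)| <= m / 2 * `|y' - y|.
Proof.
move=> m0 d0 X1 hk; have s0 : 0 < 24 * (`|p| + `|q| + 1) by rewrite mulr_gt0 // ltr_wpDl // addr_ge0.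
exists (Num.min d (Num.min 1 (m / (24 * (`|p| + `|q| + 1))))).
  by rewrite ge_min lexx !lt_min d0 ltr01 divr_gt0.
move=> y y' Y; rewrite !lt_min => /andP[yd _] /andP[y'd _] /and3P[_ Y1 Y2].
have := hk y y' yd y'd; move: (y' - y) => w; move: (k y') (k y) => k' k0.
set a := w 0 0; set b := w 0 1; set E := k' - k0 - _ => h.
have -> : pr k' Y - pr k0 Y - (a * pr p X + b * pr q X) =
    pr E Y + (a * pr p (Y - X) + b * pr q (Y - X)).
  rewrite /E prDl (prNl (_ + _)) !prDl prNl !prZl !(prDr _ Y) !prNr -/a -/b; ring.
have Y2' : `|Y| <= 2.
  by rewrite -(subrK X Y); apply: le_trans (ler_normD _ _) _; lra.
have a1 : `|a| <= `|w| := norm_coord w 0; have b1 : `|b| <= `|w| := norm_coord w 1.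
apply: le_trans (ler_normD _ _) _; rewrite [m / 2](_ : _ = m / 4 + m / 4); last by field.
rewrite mulrDl; apply: lerD.
  apply: le_trans (pr_norm _ _) _; apply: (@le_trans _ _ (6 * `|E| * 2)).
    by rewrite ler_wpM2l // mulr_ge0.
  move: h; move: `|E| `|w| => n1 n2; lra.
have pp (r : H) : `|pr r (Y - X)| <= 6 * `|r| * (m / (24 * (`|p| + `|q| + 1))).
  apply: le_trans (pr_norm _ _) _; rewrite ler_wpM2l ?mulr_ge0 //; exact: ltW.
apply: le_trans (ler_normD _ _) _; rewrite !normrM.
apply: (@le_trans _ _ (`|w| * (6 * `|p| * (m / (24 * (`|p| + `|q| + 1)))) +
    `|w| * (6 * `|q| * (m / (24 * (`|p| + `|q| + 1)))))).
  by apply: lerD; apply: ler_pM.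
rewrite -mulrDr mulrC ler_wpM2r //.
have -> : 6 * `|p| * (m / (24 * (`|p| + `|q| + 1))) + 6 * `|q| * (m / (24 * (`|p| + `|q| + 1))) =
    m / 4 * ((`|p| + `|q|) / (`|p| + `|q| + 1)).
  by field; rewrite gt_eqF // ltr_wpDl // addr_ge0.
rewrite ler_piMr // ?divr_ge0 ?(ltW m0) // ler_pdivrMr ?mul1r ?lerDl //.
Qed.

Lemma imm_est x X : ball_closed X -> onp u x X ->
  exists (e f : M -> H) (A B : M) (m d : R), [/\ 0 < m, 0 < d,
    forall y, `|y - x| < d -> [/\ cat e y, cat f y & u y = <<[:: e y; f y]>>%VS],
    forall w : M, m * `|w| <= `|w 0 0 *: A + w 0 1 *: B| &
    forall y y' Y, `|y - x| < d -> `|y' - x| < d -> `|Y - X| < d ->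
    `|sect e f Y y' - sect e f Y y - ((y' - y) 0 0 *: A + (y' - y) 0 1 *: B)| <= m / 2 * `|y' - y|].
Proof.
move=> bX oX; have [U [e [f [[oU Ux] se sf uU]]]] := su x.
have [m m0 hm] := crs_inv (sect_linear oU Ux se sf uU bX oX).
have X1 := ball_closed_norm bX; have m48 : 0 < m / 48 by rewrite divr_gt0.
have [d1 d10 h1] := strict_estimate oU Ux se m48.
have [d2 d20 h2] := strict_estimate oU Ux sf m48.
have [e1 /andP[e10 _] k1] := small_est m0 d10 X1 h1.
have [e2 /andP[e20 _] k2] := small_est m0 d20 X1 h2.
have /nbhs_ballP[r /= r0 hr] : nbhs x U by exact: open_nbhs_nbhs.
exists e, f, (v2 (pr ('D_dx e x) X) (pr ('D_dx f x) X)), (v2 (pr ('D_dy e x) X) (pr ('D_dy f x) X)).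
exists m, (Num.min r (Num.min e1 e2)); split => //; first by rewrite !lt_min r0 e10.
  move=> y; rewrite lt_min => /andP[yr _]; have Uy : U y.
    by apply: hr; rewrite -ball_normE /= distrC.
  by split; [exact: (smooth_cat se) | exact: (smooth_cat sf) | exact: uU].
move: k1 k2; move: ('D_dx e x) ('D_dx f x) ('D_dy e x) ('D_dy f x) => p q p' q' k1 k2.
move=> y y' Y; rewrite !lt_min => /and3P[_ a1 a2] /and3P[_ b1 b2] /and3P[_ c1 c2].
apply: norm_le => [|j]; first by rewrite mulr_ge0 // divr_ge0 // ltW.
have -> : sect e f Y y' - sect e f Y y - ((y' - y) 0 0 *: v2 (pr p X) (pr q X) + (y' - y) 0 1 *: v2 (pr p' X) (pr q' X))
  = v2 (pr (e y') Y - pr (e y) Y - ((y' - y) 0 0 * pr p X + (y' - y) 0 1 * pr p' X))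
       (pr (f y') Y - pr (f y) Y - ((y' - y) 0 0 * pr q X + (y' - y) 0 1 * pr q' X)).
  by move: ((y' - y) 0 0) ((y' - y) 0 1) => a b; apply: rV2P; rewrite /sect !rvE.
by case: j => -[|[|//]] lt; rewrite mxE /=; [exact: k1 | exact: k2].
Qed.

Lemma sect0P (e f : M -> H) y Y : u y = <<[:: e y; f y]>>%VS -> sect e f Y y = 0 <-> onp u y Y.
Proof.
move=> uy; rewrite (onp_frame Y uy) /sect; split=> [h|[-> ->]]; last first.
  by apply: rV2P; rewrite !rvE.
by move: (congr1 (fun v : M => v 0 0) h) (congr1 (fun v : M => v 0 1) h); rewrite !rvE.
Qed.

(** Near each point [X] of the leaf, [sect e f Y] is injective in [y] because it is close to an
    invertible linear map; elsewhere [on] fails nearby. Compactness of the ball makes the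
    neighbourhood of [x] uniform. *)
Lemma imm_disj x : exists2 d, 0 < d & forall y y' Y, `|y - x| < d -> `|y' - x| < d ->
    ball_closed Y -> onp u y Y -> onp u y' Y -> y = y'.
Proof.
have : \forall p \near (x, x), forall Y, [set Y : H | ball_closed Y] Y ->
    onp u p.1 Y -> onp u p.2 Y -> p.1 = p.2.
  apply: tube; first exact: ball_closed_compact.
  move=> X bX; have [oX|nX] := pselect (onp u x X); last first.
    have o := closed_openC (onp_closed smooth_continuous_pencil).
    have cz : cat (fun z : H * (M * M) => (z.2.1, z.1)) (X, (x, x)) by ct.
    have nb : nbhs (x, X) (~` [set p : M * H | onp u p.1 p.2]) by exact: open_nbhs_nbhs.
    have nc : \forall z \near (X, (x, x)), ~ onp u z.2.1 z.1 by exact: (cz _ nb).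
    by apply: filterS nc => z h1 h2; case: h1.
  have [e [f [A [B [m [d [m0 d0 hf hm he]]]]]]] := imm_est bX oX.
  have c1 : cat (fun z : H * (M * M) => d - `|z.1 - X|) (X, (x, x)) by ct.
  have c2 : cat (fun z : H * (M * M) => d - `|z.2.1 - x|) (X, (x, x)) by ct.
  have c3 : cat (fun z : H * (M * M) => d - `|z.2.2 - x|) (X, (x, x)) by ct.
  have e1 : 0 < d - `|X - X| by rewrite subrr normr0 subr0.
  have e2 : 0 < d - `|x - x| by rewrite subrr normr0 subr0.
  apply: filterS3 (near_gt0 c1 e1) (near_gt0 c2 e2) (near_gt0 c3 e2) => -[Y [y y']] /=.
  rewrite !subr_gt0 => YX yx y'x oy oy'.
  have [_ _ uy] := hf y yx; have [_ _ uy'] := hf y' y'x.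
  have := he y y' Y yx y'x YX; rewrite (sect0P Y uy).2 // (sect0P Y uy').2 // subrr sub0r normrN.
  move=> h; have := le_trans (hm (y' - y)) h => h3.
  apply/eqP; rewrite eq_sym -subr_eq0 -normr_le0; have := normr_ge0 (y' - y).
  move: h3; move: `|y' - y| => n; nra.
move=> /nbhs_ballP[d /= d0 hd]; exists d => // y y' Y yx y'x bY.
by apply: (hd (y, y')) => //; split; rewrite -ball_normE /= distrC.
Qed.

Lemma pol_norm (a : R) : 2^-1 <= `|pol a| <= 1.
Proof.
  have h1 := norm_coord (pol a) 0; have h2 := norm_coord (pol a) 1; have h3 := cos2Dsin2 a.
  rewrite /pol !rvE in h1 h2; apply/andP; split; last first.
    apply: norm_le => // -[[|[|//]] lt]; rewrite mxE /= ler_norml; apply/andP; split; nra.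
  rewrite leNgt; apply/negP => h4.
  have k1 := le_lt_trans h1 h4; have k2 := le_lt_trans h2 h4.
  move: k1 k2 => /ltr_normlP[? ?] /ltr_normlP[? ?]; nra.
Qed.

(** A degree argument: without a zero of [sect e f Y] in a small disc, its turn along the boundary
    would be 0, yet there it is homotopic to an invertible linear map, which is an odd loop. *)
Lemma imm_open x e0 X : 0 < e0 -> ball_closed X -> onp u x X -> exists2 d, 0 < d &
    forall Y, ball_closed Y -> `|Y - X| < d -> exists2 y, `|y - x| < e0 & onp u y Y.
Proof.
move=> e00 bX oX; have [e [f [A [B [m [d [m0 d0 hf hm he]]]]]]] := imm_est bX oX.
have xd : `|x - x| < d by rewrite subrr normr0.
have s0 : sect e f X x = 0 by apply/(sect0P X _).2 => //; case: (hf x xd).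
pose r := Num.min d e0 / 2.
have r0 : 0 < r by rewrite divr_gt0 // lt_min d0.
have [rd re] : r < d /\ r < e0.
  by rewrite /r !ltr_pdivrMr //; split; rewrite gt_min; apply/orP; [left | right]; lra.
have cs : cat (fun Y => m * r / 4 - `|sect e f Y x|) X by rewrite /sect; ct.
have h0 : 0 < m * r / 4 - `|sect e f X x| by rewrite s0 normr0 subr0 divr_gt0 // mulr_gt0.
have /nbhs_ballP[d' /= d'0 hd'] := near_gt0 cs h0.
exists (Num.min d d'); first by rewrite lt_min d0.
move=> Y bY; rewrite lt_min => /andP[Yd Yd']; apply: contrapT => no.
have small : `|sect e f Y x| < m * r / 4.
  by rewrite -subr_gt0; apply: hd'; rewrite -ball_normE /= distrC.
pose w (s : R) : M := r *: pol (pi *+ 2 * s).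
have wn s : r / 2 <= `|w s| <= r.
  have /andP[h1 h2] := pol_norm (pi *+ 2 * s); rewrite normrZ gtr0_norm //.
  by rewrite ler_pM2l // h1 /= ler_piMr // ltW.
have cw : continuous w by rewrite /w; ct.
have win t s : `|x + cl t *: w s - x| < d /\ `|x + cl t *: w s - x| < e0.
  rewrite addrAC subrr add0r normrZ; have /andP[h1 h2] := cl_itv t; rewrite ger0_norm //.
  have /andP[_ h3] := wn s; have h4 : cl t * `|w s| <= r by apply: le_trans h3; exact: ler_piMl.
  by split; apply: le_lt_trans h4 _.
have csect (T : topologicalType) (g : T -> M) : continuous g -> (forall a, `|g a - x| < d) ->
    continuous (fun a => sect e f Y (g a)).
  move=> cg hg; have ce : continuous (fun a => e (g a)).
    by apply: (@cont_in _ _ (fun y => `|y - x| < d)) => // y /hf[].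
  have cf : continuous (fun a => f (g a)).
    by apply: (@cont_in _ _ (fun y => `|y - x| < d)) => // y /hf[].
  by rewrite /sect; ct.
have sn t s : sect e f Y (x + cl t *: w s) != 0.
  have [w1 w2] := win t s; apply/eqP => h; apply: no; exists (x + cl t *: w s) => //.
  by have [_ _ uy] := hf _ w1; apply/(sect0P Y uy).
have w01 : w 0 = w 1 by rewrite /w mulr0 mulr1 /pol cos0 sin0 cos2pi sin2pi.
have cl1 : cl (1 : R) = 1 by rewrite cl_ge1.
have win1 s : `|x + w s - x| < d by have [] := win 1 s; rewrite cl1 scale1r.
pose L (v : M) := v 0 0 *: A + v 0 1 *: B.
have l1 : lhom (fun s => L (w s)) (fun s => sect e f Y (x + w s)).
  exists (fun p => L (w p.2) + p.1 *: (sect e f Y (x + w p.2) - L (w p.2))); split.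
  - have c1 : continuous (fun p : R * R => sect e f Y (x + w p.2)).
      by apply: (csect (R * R)%type (fun p => x + w p.2)) => [|p]; [ct | exact: win1].
    by rewrite /L; ct.
  - move=> [t s] /= /andP[t0 t1] _; rewrite -normr_gt0.
    have := he x (x + w s) Y xd (win1 s) Yd; rewrite addrAC (addrAC x) subrr add0r -/(L (w s)) => h1.
    have h2 := hm (w s); rewrite -/(L (w s)) in h2; have /andP[h3 h4] := wn s.
    have h5 : `|sect e f Y (x + w s) - L (w s)| <= m / 2 * `|w s| + `|sect e f Y x|.
      by apply: le_trans (lerD h1 (lexx _)); rewrite -{1}[_ - L _](subrK (sect e f Y x)) addrAC; exact: ler_normD.
    have h6 := lerB_normD (L (w s)) (t *: (sect e f Y (x + w s) - L (w s))).
    rewrite normrZ ger0_norm // in h6.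
    have h7 : t * `|sect e f Y (x + w s) - L (w s)| <= `|sect e f Y (x + w s) - L (w s)| by rewrite ler_piMl.
    apply: lt_le_trans h6; have h8 : m * (r / 2) <= m * `|w s| by rewrite ler_pM2l.
    lra.
  - by move=> s _ /=; rewrite w01.
  - by move=> t _ /=; rewrite scale0r addr0 scale1r subrKC.
have l2 : lhom (fun=> sect e f Y x) (fun s => sect e f Y (x + w s)).
  exists (fun p => sect e f Y (x + cl p.1 *: w p.2)); split.
  - by apply: (csect (R * R)%type (fun p => x + cl p.1 *: w p.2)) => [|p]; [ct | case: (win p.1 p.2)].
  - by move=> p _ _; exact: sn.
  - by move=> s _ /=; rewrite w01.
  - by move=> t _ /=; rewrite cl_le0 // scale0r addr0 cl1 scale1r.
have tc : turn (fun=> sect e f Y x) 0.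
  by apply: turn_cst; have := sn 0 0; rewrite cl_le0 // scale0r addr0.
suff : (0 : R) != 0 by rewrite eqxx.
apply: turn_odd (turn_hom (lhom_sym l1) (turn_hom l2 tc)).
move=> t _; rewrite /L /w (_ : pi *+ 2 * (t + 2^-1) = pi *+ 2 * t + pi); last first.
  by rewrite mulr2n; field.
by rewrite /pol cosDpi sinDpi; apply: rV2P; rewrite !rvE; ring.
Qed.

Lemma immersion_leaf_system : leaf_system (onp u).
Proof.
split.
- by move=> x X Y c hX hY q qx; rewrite !prE hX // hY // mulr0 addr0.
- exact: (onp_closed smooth_continuous_pencil).
- exact: (onp_base mx smooth_continuous_pencil).
- exact: imm_disj.
- exact: imm_open.
Qed.
End ImmersionLocal.

(** * Endpoints of leaves *)

Section Endpoints.
Variable R : realType.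
Notation M := 'rV[R]_2.
Notation H := 'rV[R]_4.

Lemma mkC (u v : H) : mk u v = mk v u. Proof. by rewrite /mk; ring. Qed.
Lemma qd_line (X D : H) t : qd (X + t *: D) = qd X + t * mk X D + t ^+ 2 * qd D.
Proof. by rewrite /qd /mk !v4E; ring. Qed.
Lemma mk_self (X : H) : mk X X = 2 * qd X. Proof. by rewrite /mk /qd; ring. Qed.
Lemma mkDr (X Y Z : H) : mk X (Y + Z) = mk X Y + mk X Z. Proof. by rewrite /mk !v4E; ring. Qed.
Lemma mkZr (X Y : H) c : mk X (c *: Y) = c * mk X Y. Proof. by rewrite /mk !v4E; ring. Qed.
Lemma mkNr (X Y : H) : mk X (- Y) = - mk X Y. Proof. by rewrite /mk !v4E; ring. Qed.

Lemma qd_traceless (D : H) : tr D = 0 -> D != 0 -> qd D < 0.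
Proof.
move=> t0 D0; rewrite ltNge; apply/negP => h; case/eqP: D0.
move: t0 h; rewrite /tr /qd => t0 h.
have e : D 0 1 = - D 0 0 by lra.
rewrite e in h; have h0 := sqr_ge0 (D 0 0); have h2 := sqr_ge0 (D 0 2); have h3 := sqr_ge0 (D 0 3).
have a0 : D 0 0 = 0 by apply/eqP; rewrite -sqrf_eq0; apply/eqP; nra.
have a2 : D 0 2 = 0 by apply/eqP; rewrite -sqrf_eq0; apply/eqP; nra.
have a3 : D 0 3 = 0 by apply/eqP; rewrite -sqrf_eq0; apply/eqP; nra.
by apply: rV4P; rewrite !v4E // e a0 oppr0.
Qed.

Definition bd (X : H) := ball_closed X /\ qd X = 0.

Lemma bd_mk_gt0 (X Y : H) : bd X -> ball_closed Y -> X != Y -> 0 < mk X Y.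
Proof.
move=> [bX qX] bY ne; have := @qd_traceless (Y - X).
rewrite trD trN bY.2 bX.2 subrr subr_eq0 eq_sym => /(_ erefl ne).
have -> : qd (Y - X) = qd Y - mk X Y + qd X by rewrite /qd /mk !v4E; ring.
by rewrite qX addr0; have [[_ _ h] _] := bY; lra.
Qed.

Lemma ball_closed_boundary (X : H) : tr X = 1 -> 0 <= qd X -> ball_closed X.
Proof.
move=> t1 q0; split=> //; move: t1 q0; rewrite /tr /qd => t1 q0.
have h2 := sqr_ge0 (X 0 2); have h3 := sqr_ge0 (X 0 3).
have h : 0 <= X 0 0 * X 0 1 by lra.
split; [| |by rewrite /qd]; rewrite leNgt; apply/negP => hn; nra.
Qed.

(** Each leaf is a chord: its trace zero vectors form a line, with a generator that is continuous
    near each point. *)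
Record leaf_dir (on : M -> H -> Prop) : Prop := {
  ld_dir : forall x, exists U (V : M -> H), open_nbhs x U /\ forall y, U y ->
    [/\ cat V y, V y != 0, tr (V y) = 0, on y (V y) &
        forall Y, on y Y -> tr Y = 0 -> exists t, Y = t *: V y]
}.

Variables (G : groupType) (act : G -> M -> M) (L : G -> H -> H) (on : M -> H -> Prop).
Hypothesis lf : leaf_system on.
Hypothesis la : leaf_action act L on.
Hypothesis ld : leaf_dir on.

Lemma L0 a : L a 0 = 0.
Proof. by have := la_lin la a 0 0 (-1); rewrite scaler0 addr0 scaleN1r addNr. Qed.
Lemma LD a X Y : L a (X + Y) = L a X + L a Y.
Proof. by rewrite -{1}[X]scale1r (la_lin la) scale1r. Qed.
Lemma LZ a X c : L a (c *: X) = c *: L a X.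
Proof. by rewrite -[c *: X]addr0 (la_lin la) L0 addr0. Qed.

Lemma tr_norm (X : H) : `|tr X| <= 2 * `|X|.
Proof. by apply: le_trans (ler_normD _ _) _; have := norm_coord X 0; have := norm_coord X 1; lra. Qed.

Lemma psd_shift (V : H) : psd (V + (6 * `|V|) *: org R).
Proof.
have h j : - `|V| <= V 0 j <= `|V| by rewrite -ler_norml; exact: norm_coord.
have /andP[a0 b0] := h 0; have /andP[a1 b1] := h 1; have /andP[a2 b2] := h 2; have /andP[a3 b3] := h 3.
by have n0 := normr_ge0 V; split; rewrite /qd !v4E; nra.
Qed.

(** Both [V] and [- V] become positive semidefinite once a multiple of [org] proportional to the
    norm of [V] is added; so a map preserving the cone is controlled by its value at [org]. *)
Lemma L_norm a V : `|L a V| <= 18 * `|V| * tr (L a (org R)).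
Proof.
have p1 := la_psd la a (psd_shift V); have p2 := la_psd la a (psd_shift (- V)).
rewrite normrN in p2; set T := tr _.
have hD X c : tr (L a (X + c *: org R)) = tr (L a X) + c * T by rewrite LD LZ trD trZ.
have t2 := psd_tr_ge0 p2; have n1 := psd_norm p1; rewrite !hD in t2 n1.
have hN : tr (L a (- V)) = - tr (L a V) by rewrite -scaleN1r LZ trZ; ring.
have po : psd (L a (org R)) by apply: (la_psd la); apply: pos_psd; exact: pos_org.
have no := psd_norm po; rewrite -/T in no.
have -> : L a V = L a (V + (6 * `|V|) *: org R) - (6 * `|V|) *: L a (org R) by rewrite LD LZ addrK.
apply: le_trans (ler_normB _ _) _; rewrite normrZ ger0_norm ?mulr_ge0 //.
have h : 6 * `|V| * `|L a (org R)| <= 6 * `|V| * T by apply: ler_wpM2l => //; rewrite mulr_ge0.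
rewrite hN in t2; lra.
Qed.

(** By invariance of [mk], this says that the orbit of [org], normalized to the ball, stays away
    from [X] when [X] is a boundary point: [X] is not a limit point. *)
Definition good X := exists2 c, 0 < c & forall a, c * tr (L a (org R)) <= tr (L a X).

(** An interior point [Y] close to [X] lies on some leaf, which is carried by [a] to one based in
    the compact [K]. Goodness prevents [L a X] from collapsing, so the normalized images of [X] and
    [Y] are still close, and sweeping, uniform on [K], reaches the image of [X]. *)
Theorem good_leaf X : ball_closed X -> good X -> exists x, on x X.
Proof.
move=> bX [c c0 hc]; have [K cK hK] := la_cocompact la.
have [d d0 hd] := unif_open lf cK ltr01.
(* The bound [c / 144] keeps the trace of [L a Y] above half of that of [L a X]; 109 is just above
   the 108 = 2 * 3 * 18 that comes from this half, the normalization and [L_norm]. *)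
have e0 : 0 < d * c / 109 by rewrite divr_gt0 // mulr_gt0.
have e1 : 0 < Num.min (d * c / 109) (c / 144) by rewrite lt_min e0 divr_gt0.
have [Y bY YX] := ball_open_near bX e1.
have [y oy] := on_open_exists lf la bY; have [a Ka] := hK y.
have T0 : 0 < tr (L a (org R)).
  by apply: pos_tr_gt0; apply: (la_pos la); exact: pos_org.
move: YX; rewrite lt_min => /andP[YX1 YX2].
have trY1 : tr Y = 1 by case: bY.
have nV := L_norm a (Y - X); have tV := tr_norm (L a (Y - X)).
have LE : L a Y = L a X + L a (Y - X) by rewrite -LD addrC subrK.
have TX : 0 < tr (L a X) by apply: lt_le_trans (hc a); exact: mulr_gt0.
set T := tr (L a (org R)) in T0 nV; set v := `|Y - X| in YX1 YX2 nV.
have k1 : 18 * v * T <= c / 8 * T by rewrite ler_wpM2r ?(ltW T0) //; move: YX2; lra.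
have trLY : tr (L a Y) = tr (L a X) + tr (L a (Y - X)) by rewrite LE trD.
have hcT := hc a; rewrite -/T in hcT.
have TY : tr (L a X) / 2 <= tr (L a Y).
  by rewrite trLY; move: tV => /ler_normlP[h1 _]; lra.
have bn : ball_closed (nrm (L a X)).
  apply: nrm_closed; first exact: la_psd la _ _ bX.1.
  by apply/eqP => e; move: TX; rewrite e /tr !v4E addr0 ltxx.
have close : `|nrm (L a X) - nrm (L a Y)| < d.
  have TY0 : 0 < tr (L a Y) by lra.
  have -> : nrm (L a X) - nrm (L a Y) = (tr (L a Y))^-1 *: (tr (L a (Y - X)) *: nrm (L a X) - L a (Y - X)).
    have -> : tr (L a (Y - X)) = tr (L a Y) - tr (L a X) by rewrite trLY; ring.
    have -> : L a (Y - X) = L a Y - L a X by rewrite LE; apply/eqP; rewrite eq_sym subr_eq addrC.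
    rewrite /nrm; move: (tr (L a X)) (tr (L a Y)) (L a X) (L a Y) TX TY0 => tx ty LX LY tx0 ty0.
    by apply: rV4P; rewrite !v4E; field; rewrite !gt_eqF.
  rewrite normrZ normfV (gtr0_norm TY0) mulrC ltr_pdivrMr //.
  apply: le_lt_trans (ler_normB _ _) _; rewrite normrZ.
  have nn := ball_closed_norm bn.
  have h1 : `|tr (L a (Y - X))| * `|nrm (L a X)| <= 2 * `|L a (Y - X)|.
    by apply: le_trans tV; apply: ler_piMr.
  have h2 : 3 * (18 * v * T) < d * (c * T / 2).
    have : 54 * v < d * c / 2 by move: YX1; lra.
    by move=> h; have := ltr_pM2r T0 (54 * v) (d * c / 2); rewrite h; lra.
  have h3 : d * (c * T / 2) <= d * tr (L a Y) by rewrite ler_pM2l //; lra.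
  lra.
have oaY : on (act a y) (nrm (L a Y)) by apply: (on_nrm lf la).
have bnY : ball_closed (nrm (L a Y)).
  by apply: ball_openW; apply: nrm_open; apply: (la_pos la); case: bY.
have [y' _ oy'] := hd _ _ _ Ka bnY oaY bn close.
have o2 : on y' (L a X).
  by have := @on_scale _ _ lf y' _ (tr (L a X)) oy'; rewrite /nrm scalerA mulfV ?gt_eqF // scale1r.
by exists (act a^-1%g y'); have := la_on la a^-1%g o2; rewrite (la_K la).
Qed.

Lemma fixed_off X a m : ball_closed X -> m != 0 -> L a X = m *: X -> (forall x, act a x != x) ->
  forall x, ~ on x X.
Proof.
move=> bX m0 LX free x ox; case/eqP: (free x).
have := la_on la a ox; rewrite LX => /(on_scale lf m^-1).
by rewrite scalerA mulVf // scale1r => o; exact: (on_unique lf la bX o ox).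
Qed.

(** If a leaf had a point near [Xl] and another far from it, their midpoint would be near an
    interior point, whose leaf is that of some [x0]. The leaf would then be close to that of [x0],
    and closedness would put [Xl] on the latter. So leaves shrink to a point near [Xl]. *)
Lemma end_limit Xl e : bd Xl -> (forall x, ~ on x Xl) -> 0 < e -> exists2 d, 0 < d &
  forall x X Y, ball_closed X -> ball_closed Y -> on x X -> on x Y -> `|X - Xl| < d -> `|Y - Xl| < e.
Proof.
move=> bl off e0; pose K := [set W : H | ball_closed W /\ e <= `|W - Xl|].
have cK : compact K.
  apply: (@subclosed_compact _ _ [set W : H | ball_closed W]); last by move=> W [].
    apply: closedI; first exact: compact_closed (@ball_closed_compact R).
    have cn : continuous (fun W : H => `|W - Xl|) by ct.
    exact: (closed_pre cn (@closed_ge _ e)).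
  exact: ball_closed_compact.
have : \forall X \near Xl, forall W, K W -> ball_closed W -> ball_closed X -> forall x, on x X -> on x W -> False.
  apply: tube => // W [bW eW].
  have ne : Xl != W by apply: contraTneq eW => ->; rewrite subrr normr0 -ltNge.
  pose mid := 2^-1 *: (Xl + W).
  have om : ball_open mid.
    have tm : tr mid = 1 by rewrite /mid trZ trD bl.1.2 bW.2; lra.
    have qm : 0 < qd mid.
      have -> : qd mid = (qd Xl + mk Xl W + qd W) / 4 by rewrite /mid /qd /mk !v4E; field.
      have := bd_mk_gt0 bl bW ne; rewrite bl.2; have [[_ _ h] _] := bW; lra.
    split=> //; split=> //; have [[h1 h2 _] _] := ball_closed_boundary tm (ltW qm).
    rewrite lt_neqAle h1 andbT; apply/eqP => h0; move: qm; rewrite /qd -h0 mul0r.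
    by have := sqr_ge0 (mid 0 2); have := sqr_ge0 (mid 0 3); lra.
  have [x0 ox0] := on_open_exists lf la om.
  have o := closed_openC (lf_closed lf).
  have nb : nbhs (x0, Xl) (~` [set p : M * H | on p.1 p.2]).
    by apply: open_nbhs_nbhs; split => //=; exact: off.
  have [[A B] /= [nA nB] hAB] := nb.
  have /nbhs_ballP[r /= r0 hr] := nA.
  have [d d0 hd] := on_continuous lf la (ball_openW om) ox0 r0.
  have cm : cat (fun z : H * H => d - `|2^-1 *: (z.2 + z.1) - mid|) (W, Xl) by ct.
  have d1 : 0 < d - `|2^-1 *: (Xl + W) - mid| by rewrite subrr normr0 subr0.
  have nB' : \forall z \near (W, Xl), B z.2.
    by exists (setT, B) => //=; [split => //; exact: filterT | move=> z []].
  apply: filterS2 (near_gt0 cm d1) nB' => -[W' X'] /=; rewrite subr_gt0 => dm BX' bW' bX' x oX' oW'.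
  have bm : ball_closed (2^-1 *: (X' + W')).
    split; first by apply: psdZ => //; apply: psdD; [exact: bX'.1 | exact: bW'.1].
    by rewrite trZ trD bX'.2 bW'.2; lra.
  have omx : on x (2^-1 *: (X' + W')) by apply: (on_scale lf); rewrite -[X']scale1r; exact: (lf_lin lf).
  have hx := hd x _ bm dm omx.
  apply: (hAB (x, X')) => //; split => //=; apply: hr.
  by rewrite -ball_normE /= distrC.
move=> /nbhs_ballP[d /= d0 hd]; exists d => // x X Y bX bY oX oY Xd.
rewrite ltNge; apply/negP => Ye; apply: (hd X _ Y) oY => //.
by rewrite -ball_normE /= distrC.
Qed.

Variable X0 : M -> H.
Hypothesis cX0 : continuous X0.
Hypothesis bX0 : forall x, ball_open (X0 x).
Hypothesis oX0 : forall x, on x (X0 x).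

(** The second root of the quadratic equation of the sphere on the line through [X] and the interior
    point [X0 x]. *)
Definition oth x (X : H) : H :=
  X - (mk X (X0 x - X) / qd (X0 x - X)) *: (X0 x - X).

Lemma sub_X0 x X : bd X -> qd (X0 x - X) < 0.
Proof.
move=> [bX qX]; apply: qd_traceless; first by rewrite trD trN (bX0 x).2 bX.2 subrr.
by rewrite subr_eq0; apply/eqP => e; have := (bX0 x).1.2; rewrite e qX ltxx.
Qed.

Lemma oth_bd x X : bd X -> bd (oth x X).
Proof.
move=> bX; have q0 := sub_X0 x bX; have [[_ tX] qX] := bX.
have qo : qd (oth x X) = 0.
  rewrite /oth -scaleNr qd_line qX add0r.
  by move: (mk _ _) (qd _) q0 => m q q0; field; rewrite lt_eqF.
split=> //; apply: ball_closed_boundary; last by rewrite qo.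
by rewrite /oth trD trN trZ trD trN tX (bX0 x).2 subrr mulr0 subr0.
Qed.

Lemma oth_on x X : on x X -> on x (oth x X).
Proof.
move=> oX; rewrite /oth -scaleNr addrC; apply: (lf_lin lf) => //.
by rewrite addrC -scaleN1r; exact: (lf_lin lf).
Qed.

Lemma oth_coef_neq0 x X : bd X -> mk X (X0 x - X) != 0.
Proof.
move=> bX; have [b1 qX] := bX; rewrite mkDr mkNr mk_self qX mulr0 subr0 gt_eqF //.
apply: bd_mk_gt0 => //; first exact: ball_openW.
by apply/eqP => e; have := (bX0 x).1.2; rewrite -e qX ltxx.
Qed.

Lemma oth_neq x X : bd X -> oth x X != X.
Proof.
move=> bX; have q0 := sub_X0 x bX; rewrite /oth -subr_eq0 addrAC subrr add0r oppr_eq0 scaler_eq0.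
rewrite negb_or mulf_neq0 ?oth_coef_neq0 ?invr_neq0 ?lt_eqF //=.
by apply/eqP => e; move: q0; rewrite e qd0 ltxx.
Qed.

Lemma oth_unique x X Y : bd X -> on x X -> bd Y -> on x Y -> Y = X \/ Y = oth x X.
Proof.
move=> bX oX bY oY; have [U [V [[oU Ux] /(_ x Ux)[_ V0 tV oV hV]]]] := ld_dir ld x.
have q0 := sub_X0 x bX.
have [s es] : exists s, X0 x - X = s *: V x.
  apply: hV; last by rewrite trD trN (bX0 x).2 bX.1.2 subrr.
  by rewrite addrC -scaleN1r; exact: (lf_lin lf).
have [t et] : exists t, Y - X = t *: V x.
  apply: hV; last by rewrite trD trN bY.1.2 bX.1.2 subrr.
  by rewrite addrC -scaleN1r; exact: (lf_lin lf).
have s0 : s != 0 by apply/eqP => e; move: q0; rewrite es e scale0r qd0 ltxx.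
have eY : Y = X + (t / s) *: (X0 x - X) by rewrite es scalerA divfK // -et subrKC.
have := bY.2; rewrite eY; move: (t / s) => r; rewrite qd_line bX.2 add0r expr2 -mulrA -mulrDr => /eqP.
rewrite mulf_eq0 => /orP[/eqP ->|/eqP h]; first by left; rewrite scale0r addr0.
right; rewrite /oth -scaleNr; congr (_ + _ *: _).
move: (mk _ _) (qd _) q0 h => m q q0' h; have -> : m = - (r * q) by lra.
by field; rewrite lt_eqF.
Qed.

Lemma othK x X : bd X -> on x X -> oth x (oth x X) = X.
Proof.
move=> bX oX; have [e|//] := oth_unique (oth_bd x bX) (oth_on oX) bX oX.
by have := oth_neq x bX; rewrite -e eqxx.
Qed.

Section Labelling.
Variable Xl : H.
Hypothesis bl : bd Xl.
Hypothesis l1 : Xl 0 1 != 0.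
Hypothesis off : forall x, ~ on x Xl.

(* The chart 1 / (z - l) at the boundary point z of X, where l is that of Xl. *)
Definition chart (X : H) : M := (mk Xl X)^-1 *:
  v2 (X 0 2 - Xl 0 2 / Xl 0 1 * X 0 1) (Xl 0 3 / Xl 0 1 * X 0 1 - X 0 3).

Definition sqv (v : M) : M := v2 (v 0 0 ^+ 2 - v 0 1 ^+ 2) (2 * v 0 0 * v 0 1).

Lemma sqvN v : sqv (- v) = sqv v.
Proof. by rewrite /sqv !rvE; congr v2; ring. Qed.

Lemma sqv_dir v a : dir v a -> dir (sqv v) (2 * a).
Proof.
move=> [r r0 ->]; exists (r ^+ 2); first exact: exprn_gt0.
rewrite (_ : 2 * a = a + a); last by ring.
by rewrite /pol cosD sinD; apply: rV2P; rewrite /sqv !rvE; ring.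
Qed.

Lemma chart_inj X Y : bd X -> bd Y -> X != Xl -> Y != Xl -> chart X = chart Y -> X = Y.
Proof.
move=> bX bY nX nY e; have pX := bd_mk_gt0 bl bX.1; have pY := bd_mk_gt0 bl bY.1.
rewrite eq_sym in nX; rewrite eq_sym in nY; move: pX pY => /(_ nX) pX /(_ nY) pY.
have qX := bX.2; have qY := bY.2; have ql := bl.2; have tX := bX.1.2; have tY := bY.1.2.
have e0 := congr1 (fun v : M => v 0 0) e; have e1 := congr1 (fun v : M => v 0 1) e.
rewrite /chart !rvE in e0 e1.
set n := mk Xl X in pX e0 e1; set n' := mk Xl Y in pY e0 e1; pose k := n / n'.
have nE : n = k * n' by rewrite divfK // gt_eqF.
pose a := Xl 0 2 / Xl 0 1; pose b := Xl 0 3 / Xl 0 1.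
have aE : Xl 0 2 = Xl 0 1 * a by rewrite /a; field.
have bE : Xl 0 3 = Xl 0 1 * b by rewrite /b; field.
have cE : Xl 0 0 = Xl 0 1 * (a ^+ 2 + b ^+ 2).
  by apply: (mulIf l1); move: ql; rewrite /qd aE bE => ql; lra.
have dv (p q : R) : n^-1 * p = n'^-1 * q -> p = k * q.
  by move=> h; rewrite -mulrA -h mulrA mulfV ?mul1r // gt_eqF.
have f0 : X 0 2 - a * X 0 1 = k * (Y 0 2 - a * Y 0 1) := dv _ _ e0.
have f1 : X 0 3 - b * X 0 1 = k * (Y 0 3 - b * Y 0 1).
  by rewrite -[LHS]opprB (dv _ _ e1) -mulrN opprB.
clearbody a b.
have norm (Z : H) : qd Z = 0 ->
    Xl 0 1 * ((Z 0 2 - a * Z 0 1) ^+ 2 + (Z 0 3 - b * Z 0 1) ^+ 2) = Z 0 1 * mk Xl Z.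
  move=> qZ; apply/eqP; rewrite -subr_eq0.
  have -> : Xl 0 1 * ((Z 0 2 - a * Z 0 1) ^+ 2 + (Z 0 3 - b * Z 0 1) ^+ 2) - Z 0 1 * mk Xl Z = - Xl 0 1 * qd Z.
    by rewrite /mk aE bE cE /qd; ring.
  by rewrite qZ mulr0.
have f2 : X 0 1 = k * Y 0 1.
  have := norm X qX; rewrite f0 f1 -/n nE (_ : Xl 0 1 * _ = k ^+ 2 * (Xl 0 1 *
    ((Y 0 2 - a * Y 0 1) ^+ 2 + (Y 0 3 - b * Y 0 1) ^+ 2))); last by ring.
  rewrite norm // -/n' => h; have k0 : 0 < k by rewrite divr_gt0.
  by apply: (mulIf (lt0r_neq0 (mulr_gt0 k0 pY))); rewrite -h; ring.
have f3 : X 0 2 = k * Y 0 2 by move: f0; rewrite f2; lra.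
have f4 : X 0 3 = k * Y 0 3 by move: f1; rewrite f2; lra.
have f5 : X 0 0 = k * Y 0 0.
  apply: (mulfI l1); move: nE; rewrite /n /n' /mk f2 f3 f4; lra.
have k1 : k = 1 by move: tX; rewrite /tr f5 f2 -mulrDr -/(tr Y) tY mulr1.
by apply: rV4P; rewrite ?f5 ?f2 ?f3 ?f4 k1 mul1r.
Qed.

Lemma cat_chart (T : topologicalType) (f : T -> H) t : cat f t -> mk Xl (f t) != 0 ->
  cat (fun s => chart (f s)) t.
Proof.
move=> cf n0; have h : cat (fun s => mk Xl (f s)) t.
  by apply: (cat_mk (u := fun=> Xl)) => //; exact: cat_cst.
by rewrite /chart; ct.
Qed.

Lemma bd_off x X : bd X -> on x X -> 0 < mk Xl X.
Proof. by move=> bX oX; apply: bd_mk_gt0 => //; [case: bX | apply: contra_not_neq (@off x) => ->]. Qed.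

Lemma cat_oth (T : topologicalType) (f : T -> H) (g : T -> M) t : cat f t -> cat g t -> bd (f t) ->
  cat (fun s => oth (g s) (f s)) t.
Proof.
move=> cf cg bf; have cx : cat (fun s => X0 (g s)) t by ct.
have h : cat (fun s => mk (f s) (X0 (g s) - f s)) t by apply: cat_mk => //; ct.
by rewrite /oth; ct; rewrite lt_eqF // sub_X0.
Qed.

Definition gap x X := chart (oth x X) - chart X.

Lemma gap_neq0 x X : bd X -> on x X -> gap x X != 0.
Proof.
move=> bX oX; rewrite subr_eq0; apply: contra_neq (oth_neq x bX).
apply: chart_inj => //; first exact: oth_bd.
  by apply: contra_not_neq (@off x) => <-; exact: oth_on.
by apply: contra_not_neq (@off x) => <-.
Qed.

Lemma gap_oth x X : bd X -> on x X -> gap x (oth x X) = - gap x X.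
Proof. by move=> bX oX; rewrite /gap othK // opprB. Qed.

Lemma sqv_neq0 v : v != 0 -> sqv v != 0.
Proof. by move=> /dir_ex[a /sqv_dir /dir_neq0]. Qed.

(* Squaring forgets the order of the two ends, so it gives a function on all of M. *)
Lemma sq_gap : exists g : M -> M, [/\ continuous g, forall x, g x != 0 &
  forall x X, bd X -> on x X -> g x = sqv (gap x X)].
Proof.
have ends x : exists U (Z : M -> H), open_nbhs x U /\ forall y, U y -> [/\ cat Z y, bd (Z y) & on y (Z y)].
  have [U [V [oU hV]]] := ld_dir ld x.
  pose q y := qd (V y); pose m y := mk (X0 y) (V y).
  pose t y := (- m y - Num.sqrt (m y ^+ 2 - 4 * q y * qd (X0 y))) / (2 * q y).
  exists U, (fun y => X0 y + t y *: V y); split=> // y Uy; have [cV V0 tV oV _] := hV y Uy.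
  have q0 : q y < 0 by exact: qd_traceless.
  have p0 : 0 < qd (X0 y) by exact: (bX0 y).1.2.
  have d0 : 0 <= m y ^+ 2 - 4 * q y * qd (X0 y) by have := sqr_ge0 (m y); nra.
  have cx : cat X0 y by exact: cX0.
  have cm : cat m y by exact: cat_mk.
  have cs : cat (fun y => Num.sqrt (m y ^+ 2 - 4 * q y * qd (X0 y))) y.
    apply: (cat_comp (h := @Num.sqrt R) (f := fun y => m y ^+ 2 - 4 * q y * qd (X0 y))).
      exact: sqrt_continuous.
    by rewrite /q; ct.
  split.
  - by rewrite /t /q; ct; rewrite mulf_neq0 // lt_eqF.
  - have qz : qd (X0 y + t y *: V y) = 0.
      rewrite qd_line -/(q y) -/(m y) /t; have hs := sqr_sqrtr d0.
      move: (Num.sqrt _) hs => s hs.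
      have -> : qd (X0 y) = (m y ^+ 2 - s ^+ 2) / (4 * q y).
        by rewrite hs; field; rewrite lt_eqF.
      by field; rewrite lt_eqF.
    split=> //; apply: ball_closed_boundary; last by rewrite qz.
    by rewrite trD trZ tV mulr0 addr0; case: (bX0 y).
  - by rewrite addrC; apply: (lf_lin lf).
have ex x : {Z : H | bd Z /\ on x Z}.
  by apply: cid; have [U [Z [[oU Ux] /(_ x Ux)[_ h1 h2]]]] := ends x; exists (Z x).
have E x X : bd X -> on x X -> sqv (gap x (sval (ex x))) = sqv (gap x X).
  move=> bX oX; case: (ex x) => Z [bZ oZ] /=.
  by have [->|->] := oth_unique bX oX bZ oZ => //; rewrite gap_oth // sqvN.
exists (fun x => sqv (gap x (sval (ex x)))); split => //.
- move=> x; have [U [Z [[oU Ux] hZ]]] := ends x; have [cZ bZ oZ] := hZ x Ux.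
  apply: (@cat_near _ _ (fun y => sqv (gap y (Z y)))).
    have co : cat (fun y => oth y (Z y)) x by apply: cat_oth => //; exact: cat_id.
    have c1 : cat (fun y => chart (Z y)) x by apply: cat_chart => //; rewrite gt_eqF // (bd_off bZ oZ).
    have c2 : cat (fun y => chart (oth y (Z y))) x.
      by apply: cat_chart => //; rewrite gt_eqF // (bd_off (oth_bd x bZ) (oth_on oZ)).
    by rewrite /gap /sqv; ct.
  have := open_nbhs_nbhs (conj oU Ux); apply: filterS => y Uy.
  by have [_ b o] := hZ y Uy; rewrite (E y _ b o).
- by move=> x; case: (ex x) => Z [bZ oZ] /=; apply/sqv_neq0/gap_neq0.
Qed.

(* Along a path of boundary points lying on leaves, the gap would change sign while its square
   has winding number 0, the leaf space M being contractible. *)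
Theorem oth_path (f : R -> H) (x : R -> M) : (forall s, 0 <= s <= 1 -> cat f s) ->
  (forall s, 0 <= s <= 1 -> cat x s) ->
  (forall s, 0 <= s <= 1 -> bd (f s) /\ on (x s) (f s)) -> f 1 != oth (x 0) (f 0).
Proof.
move=> cf cx hf; apply/eqP => e.
have i0 : 0 <= (0 : R) <= 1 by rewrite lexx ler01.
have i1 : 0 <= (1 : R) <= 1 by rewrite lexx ler01.
have [b0 o0] := hf 0 i0; have [b1 o1] := hf 1 i1.
have x1 : x 1 = x 0 by apply: (on_unique lf la b1.1 o1); rewrite e; exact: oth_on.
pose F s := f (cl s); pose x' s := x (cl s).
have cF : continuous F.
  move=> s; change (cat (fun s => f (cl s)) s).
  by apply: (cat_comp (h := f) (f := @cl R)); [exact/cf/cl_itv | exact: (cat_cl (f := id) (@cat_id _ s))].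
have cx' : continuous x'.
  move=> s; change (cat (fun s => x (cl s)) s).
  by apply: (cat_comp (h := x) (f := @cl R)); [exact/cx/cl_itv | exact: (cat_cl (f := id) (@cat_id _ s))].
have hF s : bd (F s) /\ on (x' s) (F s) by exact: hf (cl_itv s).
pose h s := gap (x' s) (F s).
have ch : continuous h.
  move=> s; have [bs os] := hF s; have cFs : cat F s by exact: cF.
  have co : cat (fun y => oth (x' y) (F y)) s by apply: cat_oth => //; exact: cx'.
  have c1 : cat (fun y => chart (F y)) s by apply: cat_chart => //; rewrite gt_eqF // (bd_off bs os).
  have c2 : cat (fun y => chart (oth (x' y) (F y))) s.
    by apply: cat_chart => //; rewrite gt_eqF // (bd_off (oth_bd _ bs) (oth_on os)).
  by change (cat (fun y => chart (oth (x' y) (F y)) - chart (F y)) s); ct.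
have h0 s : h s != 0 by have [bs os] := hF s; exact: gap_neq0.
have [g [cg g0 hg]] := sq_gap.
have [th [cth hth]] := @lift R (fun p => h p.2) ltac:(ct) (fun p _ _ => h0 p.2).
have h10 : h 1 = - h 0.
  rewrite /h /F /x' cl_ge1 // cl_le0 // x1 e; exact: gap_oth.
have t2 : turn (fun s => sqv (h s)) (2 * th (0, 1) - 2 * th (0, 0)).
  exists (fun s => 2 * th (0, s)); first by ct.
  by split => // s hs; apply: sqv_dir; exact: (hth (0, s)).
have t0 : turn (fun s => sqv (h s)) 0.
  apply: (turn_hom (f := fun=> g (x' 0))); last by apply: turn_cst.
  exists (fun p => g (x' 0 + p.1 *: (x' p.2 - x' 0))); split.
  - by ct.
  - by move=> p _ _.
  - by move=> s _ /=; rewrite /x' (cl_ge1 (lexx 1)) x1 (cl_le0 (lexx 0)).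
  - move=> t _ /=; rewrite scale0r addr0 scale1r subrKC; split => //.
    by have [bs os] := hF t; rewrite (hg _ _ bs os).
have := turn_uniq t2 t0 => t20.
have d1 := hth (0, 1) i0 i1; have d0 := dirN (hth (0, 0) i0 i0); rewrite /= h10 in d1.
have := dir_cos d1 d0; rewrite (_ : th (0, 0) + pi - th (0, 1) = pi) ?cospi; lra.
Qed.
End Labelling.
End Endpoints.

(** * The action on pencils *)

Section HermitianAction.
Variable R : realType.
Local Open Scope complex_scope.
Local Open Scope sesquilinear_scope.
Notation C := R[i].
Notation H := 'rV[R]_4.
Notation M := 'rV[R]_2.

Implicit Types A B : 'M[C]_2.

(** The action on the dual space, contragredient to [herm_act] by [pr_Lact]; it is also the
    isometric action on hyperbolic space. *)
Definition Lact (A : 'M[C]_2) (X : H) : H := unherm (A *m herm X *m A ^t*).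

Lemma mx2P (A B : 'M[C]_2) : A 0 0 = B 0 0 -> A 0 1 = B 0 1 -> A 1 0 = B 1 0 -> A 1 1 = B 1 1 -> A = B.
Proof.
move=> h00 h01 h10 h11; apply/matrixP => i j.
have c (k : 'I_2) : k = 0 \/ k = 1 by case: k => -[|[|//]] h; [left|right]; exact: val_inj.
by case: (c i) => ->; case: (c j) => ->.
Qed.

Lemma hermE (X : H) : (herm X 0 0 = (X 0 0)%:C) * (herm X 1 1 = (X 0 1)%:C) *
  (herm X 0 1 = X 0 2 +i* X 0 3) * (herm X 1 0 = X 0 2 -i* X 0 3).
Proof. by rewrite !mxE. Qed.

Lemma hermDZ c (X Y : H) : herm (c *: X + Y) = c%:C *: herm X + herm Y.
Proof.
by apply: mx2P; rewrite !mxE /= ?v4E; apply/eqP; rewrite eq_complex /=; apply/andP; split; apply/eqP; ring.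
Qed.

Lemma unhermE (Q : 'M[C]_2) : unherm Q = v4 (complex.Re (Q 0 0)) (complex.Re (Q 1 1))
  (complex.Re (Q 0 1)) (complex.Im (Q 0 1)).
Proof. by apply: rV4P; rewrite !v4E mxE. Qed.

Lemma unhermDZ c (P Q : 'M[C]_2) : unherm (c%:C *: P + Q) = c *: unherm P + unherm Q.
Proof.
rewrite !unhermE !mxE; move: (P 0 0) (P 0 1) (P 1 1) (Q 0 0) (Q 0 1) (Q 1 1).
by move=> [? ?] [? ?] [? ?] [? ?] [? ?] [? ?]; apply: rV4P; rewrite !v4E /=; ring.
Qed.

Lemma Lact_hermitian A (X : H) : (A *m herm X *m A ^t*) ^t* = A *m herm X *m A ^t*.
Proof. by rewrite !trmx_mul !map_mxM trmxCK herm_hermitian mulmxA. Qed.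

Lemma herm_Lact A (X : H) : herm (Lact A X) = A *m herm X *m A ^t*.
Proof. by rewrite unhermK // Lact_hermitian. Qed.

Lemma Lact_lin A c (X Y : H) : Lact A (c *: X + Y) = c *: Lact A X + Lact A Y.
Proof. by rewrite /Lact hermDZ mulmxDr mulmxDl -scalemxAr -scalemxAl unhermDZ. Qed.

Lemma LactM A B (X : H) : Lact (A *m B) X = Lact A (Lact B X).
Proof. by rewrite {2}/Lact /Lact unhermK ?Lact_hermitian // trmx_mul map_mxM !mulmxA. Qed.

Lemma Lact1 (X : H) : Lact 1%:M X = X.
Proof. by rewrite /Lact trmx1 map_mx1 mul1mx mulmx1 hermK. Qed.

Lemma det2 (A : 'M[C]_2) : \det A = A 0 0 * A 1 1 - A 0 1 * A 1 0.
Proof.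
rewrite (expand_det_row _ 0) !big_ord_recl big_ord0 /cofactor !det_mx11 !mxE /=.
have l0 : fintype.lift (ord0 : 'I_2) (0 : 'I_1) = 1 by exact: val_inj.
have l1 : fintype.lift (1 : 'I_2) (0 : 'I_1) = 0 by exact: val_inj.
by rewrite !l0 !l1 /= expr0 expr1; ring.
Qed.

Lemma det_herm (X : H) : \det (herm X) = (qd X)%:C.
Proof.
by rewrite det2 !hermE /qd; apply/eqP; rewrite eq_complex /=; apply/andP; split; apply/eqP; ring.
Qed.

Lemma det_conj (A : 'M[C]_2) : \det (A ^t*) = (\det A)^*.
Proof. by rewrite det_map_mx det_tr. Qed.

Lemma qd_Lact A (X : H) : \det A = 1 -> qd (Lact A X) = qd X.
Proof.
move=> dA; have : (qd (Lact A X))%:C = (qd X)%:C.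
  by rewrite -!det_herm herm_Lact !det_mulmx det_conj dA rmorph1 mul1r mulr1.
by case.
Qed.

Lemma pr_trace (q X : H) : pr q X = complex.Re (\tr (herm q *m herm X)).
Proof.
rewrite /mxtrace !big_ord_recl big_ord0 !mxE !big_ord_recl !big_ord0.
have l0 : fintype.lift (ord0 : 'I_2) (ord0 : 'I_1) = 1 by exact: val_inj.
by rewrite !l0 !hermE /pr /=; ring.
Qed.

Lemma pr_Lact A (q X : H) : \det A = 1 -> pr (herm_act A q) (Lact A X) = pr q X.
Proof.
move=> dA; have uA : A \in unitmx by rewrite unitmxE dA unitr1.
rewrite !pr_trace herm_Lact /herm_act unhermK; last first.
  by rewrite !trmx_mul !map_mxM trmxCK herm_hermitian mulmxA.
rewrite !mulmxA mulmxKV // mxtrace_mulC !mulmxA -map_mxM -trmx_mul mulVmx // trmx1 map_mx1 mul1mx.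
by [].
Qed.

Lemma psd_Lact A (X : H) : \det A = 1 -> psd X -> psd (Lact A X).
Proof.
move=> dA pX; have hf z : 0 <= complex.Re (hform X z).
  by have [a [b [c [d ->]]]] := cv_surj z; rewrite hform_cv /=; apply: pr_ge0 => //; exact: zz_psd.
have diag i : 0 <= complex.Re ((A *m herm X *m A ^t*) i i).
  have := hf (col i (A ^t*)); rewrite /hform.
  rewrite (_ : (col i (A ^t*)) ^t* = row i A); last by apply/rowP => j; rewrite !mxE conjCK.
  by rewrite colE mulmxA -colE -row_mul -row_mul !mxE.
split; [by rewrite /Lact unhermE !v4E | by rewrite /Lact unhermE !v4E |].
by rewrite qd_Lact //; case: pX.
Qed.

Lemma herm_actM A B (q : H) : A \in unitmx -> B \in unitmx -> herm_act (A *m B) q = herm_act A (herm_act B q).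
Proof.
move=> uA uB; rewrite /herm_act unhermK; last first.
  by rewrite !trmx_mul !map_mxM trmxCK herm_hermitian mulmxA.
have -> : invmx (A *m B) = invmx B *m invmx A.
  by apply: (can_inj (mulmxK (_ : A *m B \in unitmx))); rewrite ?unitmx_mul ?uA // mulVmx ?unitmx_mul ?uA // mulmxA mulmxKV // mulVmx.
by rewrite trmx_mul map_mxM !mulmxA.
Qed.

Lemma herm_act1 (q : H) : herm_act 1%:M q = q.
Proof. by rewrite /herm_act invmx1 trmx1 map_mx1 mul1mx mulmx1 hermK. Qed.
End HermitianAction.

Section Equivariance.
Variables (R : realType) (g : nat).
Notation C := R[i].
Notation H := 'rV[R]_4.
Notation M := 'rV[R]_2.
Variables (rho : surface_group g -> 'M[C]_2) (act : surface_group g -> M -> M).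
Hypothesis hrho : sl2_representation rho.
Hypothesis hact : deck_action act.

Lemma rho1 : rho 1%g = 1%:M.
Proof.
have [d m] := hrho; have u1 : rho 1%g \in unitmx by rewrite unitmxE d unitr1.
by have := m 1%g 1%g; rewrite mulg1 => /(congr1 (mulmx (invmx (rho 1%g)))); rewrite mulmxA !mulVmx // mul1mx.
Qed.

Lemma leaf_action_pencil u : equivariant rho act u ->
  leaf_action act (fun a => Lact (rho a)) (onp u).
Proof.
have [d m] := hrho => eu; have uu a : rho a \in unitmx by rewrite unitmxE d unitr1.
have K a X : Lact (rho a^-1%g) (Lact (rho a) X) = X by rewrite -LactM -m mulVg rho1 Lact1.
split.
- exact: deck_act1 hact.
- exact: deck_actM hact.
- by move=> a x; have [h _] := deck_smooth hact a 0%N; exact: h.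
- exact: deck_proper hact.
- exact: deck_cocompact hact.
- by move=> a X Y c; exact: Lact_lin.
- by move=> a X; exact: qd_Lact.
- by move=> a X; exact: psd_Lact.
- exact: K.
- move=> a x X oX q qu.
  have qE : herm_act (rho a) (herm_act (rho a^-1%g) q) = q.
    by rewrite -herm_actM // -m mulgV rho1 herm_act1.
  by rewrite -qE pr_Lact //; apply: oX; rewrite -(eu a) qE.
Qed.
End Equivariance.

(** * Leaves as chords of the ball *)

Section LeafDirection.
Variable R : realType.
Notation H := 'rV[R]_4.
Notation M := 'rV[R]_2.

(* A vector (s, -s, v, w) is orthogonal to q iff (s, v, w) is orthogonal to (q0 - q1, 2 q2, 2 q3). *)
Definition chord (e f : H) : H :=
  let s := 2 * e 0 2 * (2 * f 0 3) - 2 * e 0 3 * (2 * f 0 2) in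
  v4 s (- s) (2 * e 0 3 * (f 0 0 - f 0 1) - (e 0 0 - e 0 1) * (2 * f 0 3))
     ((e 0 0 - e 0 1) * (2 * f 0 2) - 2 * e 0 2 * (f 0 0 - f 0 1)).

Lemma sum3_eq0 (a b c : R) : a ^+ 2 + b ^+ 2 + c ^+ 2 = 0 -> [/\ a = 0, b = 0 & c = 0].
Proof.
have := sqr_ge0 a; have := sqr_ge0 b; have := sqr_ge0 c => h1 h2 h3 h.
by split; apply/eqP; rewrite -sqrf_eq0; apply/eqP; lra.
Qed.

Lemma cross_eq0 (A B C a b c : R) (n := a ^+ 2 + b ^+ 2 + c ^+ 2) (m := A * a + B * b + C * c) :
  B * c - C * b = 0 -> C * a - A * c = 0 -> A * b - B * a = 0 ->
  [/\ n * A - m * a = 0, n * B - m * b = 0 & n * C - m * c = 0].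
Proof.
move=> h1 h2 h3; split.
- apply: (@eq_trans _ _ (b * (A * b - B * a) - c * (C * a - A * c))); [by rewrite /n /m; ring | by rewrite h2 h3; ring].
- apply: (@eq_trans _ _ (c * (B * c - C * b) - a * (A * b - B * a))); [by rewrite /n /m; ring | by rewrite h1 h3; ring].
- apply: (@eq_trans _ _ (a * (C * a - A * c) - b * (B * c - C * b))); [by rewrite /n /m; ring | by rewrite h1 h2; ring].
Qed.

Lemma qd_scalar (q : H) : q 0 0 - q 0 1 = 0 -> 2 * q 0 2 = 0 -> 2 * q 0 3 = 0 -> 0 <= qd q.
Proof.
move=> a b c; have e : q 0 0 = q 0 1 by lra.
have e2 : q 0 2 = 0 by lra.
have e3 : q 0 3 = 0 by lra.
by rewrite /qd e e2 e3 expr0n /= !subr0 -expr2 sqr_ge0.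
Qed.

(** If the traceless parts of [e] and [f] were proportional, some nonzero combination of them would
    be a scalar matrix, of nonnegative determinant. *)
Lemma chord_neq0 (e f : H) : spacelike e f -> chord e f != 0.
Proof.
move=> sp; apply/eqP => h.
have h0 := congr1 (fun v : H => v 0 0) h; have h2 := congr1 (fun v : H => v 0 2) h.
have h3 := congr1 (fun v : H => v 0 3) h; rewrite /chord !v4E in h0 h2 h3.
pose bb := (f 0 0 - f 0 1) ^+ 2 + (2 * f 0 2) ^+ 2 + (2 * f 0 3) ^+ 2.
pose ab := (e 0 0 - e 0 1) * (f 0 0 - f 0 1) + 2 * e 0 2 * (2 * f 0 2) + 2 * e 0 3 * (2 * f 0 3).
have bb0 : bb != 0.
  apply/eqP => /sum3_eq0[b0 b1 b2]; have := sp 0 1; rewrite oner_eq0 orbT => /(_ isT).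
  by rewrite scale0r scale1r add0r ltNge (qd_scalar b0 b1 b2).
have := sp bb (- ab); rewrite bb0 => /(_ isT); apply/negP; rewrite -leNgt.
have [v0 v1 v2] := cross_eq0 h0 h2 h3.
apply: qd_scalar; rewrite !v4E.
- by rewrite -[RHS]v0 /ab /bb; ring.
- by rewrite -[RHS]v1 /ab /bb; ring.
- by rewrite -[RHS]v2 /ab /bb; ring.
Qed.

Lemma chord_line (e f Y : H) : chord e f != 0 -> pr e Y = 0 -> pr f Y = 0 -> tr Y = 0 ->
  exists t, Y = t *: chord e f.
Proof.
rewrite /pr /tr => V0 he hf tY.
have e1 : Y 0 1 = - Y 0 0 by lra.
rewrite e1 in he hf; set s := 2 * e 0 2 * (2 * f 0 3) - 2 * e 0 3 * (2 * f 0 2) in V0 *.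
have hs : chord e f 0 0 = s /\ chord e f 0 1 = - s by rewrite /chord !v4E.
have ha : (e 0 0 - e 0 1) * Y 0 0 + 2 * e 0 2 * Y 0 2 + 2 * e 0 3 * Y 0 3 = 0 by lra.
have hb : (f 0 0 - f 0 1) * Y 0 0 + 2 * f 0 2 * Y 0 2 + 2 * f 0 3 * Y 0 3 = 0 by lra.
pose v := chord e f 0 2; pose w := chord e f 0 3.
have vE : v = 2 * e 0 3 * (f 0 0 - f 0 1) - (e 0 0 - e 0 1) * (2 * f 0 3) by rewrite /v /chord !v4E.
have wE : w = (e 0 0 - e 0 1) * (2 * f 0 2) - 2 * e 0 2 * (f 0 0 - f 0 1) by rewrite /w /chord !v4E.
have h0 : v * Y 0 3 - w * Y 0 2 = 0.
  rewrite vE wE; move: (e 0 0 - e 0 1) (f 0 0 - f 0 1) ha hb => A a ha hb.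
  apply: (@eq_trans _ _ (a * (A * Y 0 0 + 2 * e 0 2 * Y 0 2 + 2 * e 0 3 * Y 0 3) -
    A * (a * Y 0 0 + 2 * f 0 2 * Y 0 2 + 2 * f 0 3 * Y 0 3))); [by ring | by rewrite ha hb; ring].
have h1 : w * Y 0 0 - s * Y 0 3 = 0.
  rewrite /s wE; move: (e 0 0 - e 0 1) (f 0 0 - f 0 1) ha hb => A a ha hb.
  apply: (@eq_trans _ _ (2 * f 0 2 * (A * Y 0 0 + 2 * e 0 2 * Y 0 2 + 2 * e 0 3 * Y 0 3) -
    2 * e 0 2 * (a * Y 0 0 + 2 * f 0 2 * Y 0 2 + 2 * f 0 3 * Y 0 3))); [by ring | by rewrite ha hb; ring].
have h2 : s * Y 0 2 - v * Y 0 0 = 0.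
  rewrite /s vE; move: (e 0 0 - e 0 1) (f 0 0 - f 0 1) ha hb => A a ha hb.
  apply: (@eq_trans _ _ (2 * f 0 3 * (A * Y 0 0 + 2 * e 0 2 * Y 0 2 + 2 * e 0 3 * Y 0 3) -
    2 * e 0 3 * (a * Y 0 0 + 2 * f 0 2 * Y 0 2 + 2 * f 0 3 * Y 0 3))); [by ring | by rewrite ha hb; ring].
have n0 : s ^+ 2 + v ^+ 2 + w ^+ 2 != 0.
  apply: contra_neq V0 => /sum3_eq0[s0 v0 w0]; apply: rV4P; rewrite [RHS]rv0 //.
  - by rewrite hs.1.
  - by rewrite hs.2 s0 oppr0.
have k1 : Y 0 2 * w - Y 0 3 * v = 0 by lra.
have k2 : Y 0 3 * s - Y 0 0 * w = 0 by lra.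
have k3 : Y 0 0 * v - Y 0 2 * s = 0 by lra.
have [c0 c1 c2] := cross_eq0 k1 k2 k3.
exists ((Y 0 0 * s + Y 0 2 * v + Y 0 3 * w) / (s ^+ 2 + v ^+ 2 + w ^+ 2)).
move: n0 c0 c1 c2; set n := _ + _ + _; set m := _ + _ + _ => n0 c0 c1 c2.
have dv (x y : R) : n * x - m * y = 0 -> x = m / n * y.
  by move=> h; apply: (mulfI n0); rewrite mulrA mulrCA mulfV // mulr1; lra.
by apply: rV4P; rewrite rvZ ?hs.1 ?hs.2 ?e1 ?mulrN -?(dv _ _ c0) //; [exact: dv | exact: dv].
Qed.

Variable u : M -> {vspace H}.
Hypothesis mx : forall x, mixed (u x).
Hypothesis cu : continuous_pencil u.

Lemma onp_leaf_dir : leaf_dir (onp u).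
Proof.
split=> x; have [U [e [f [oU ce cf uU]]]] := frame_at cu x.
exists U, (fun y => chord (e y) (f y)); split=> // y Uy.
have sp : spacelike (e y) (f y) by apply: mixed_spacelike; rewrite -uU.
have n0 := chord_neq0 sp; have cey := ce y Uy; have cfy := cf y Uy.
split=> //.
- by rewrite /chord; ct.
- by rewrite /tr /chord !v4E subrr.
- by apply/(onp_frame _ (uU y Uy)); split; rewrite /pr /chord !v4E; ring.
- by move=> Y /(onp_frame _ (uU y Uy))[h1 h2] tY; exact: chord_line.
Qed.
End LeafDirection.

(** * Reflections of the Riemann sphere *)

Section Reflections.
Variable R : realType.
Notation H := 'rV[R]_4.
Variables (n : nat) (cx cy : nat -> R) (adj : rel nat).

(* The boundary point of z lies outside the circle of centre (cx i, cy i) and radius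
   1 / sqrt 2 iff [lam i] is positive there; [refl i] extends the inversion in that circle. *)
Definition polar i : H := v4 (cx i ^+ 2 + cy i ^+ 2 - 2^-1) 1 (cx i) (cy i).
Definition lam i X : R := mk (polar i) X.
Definition refl i X : H := X + (2 * lam i X) *: polar i.
Definition refls (w : seq nat) X : H := foldr refl X w.
Definition base_pt : H := v4 1 1 0 0.

Lemma polarE i : polar i = v4 (cx i ^+ 2 + cy i ^+ 2 - 2^-1) 1 (cx i) (cy i). Proof. by []. Qed.
Lemma lamE i X : lam i X = mk (polar i) X. Proof. by []. Qed.
Lemma reflE i X : refl i X = X + (2 * lam i X) *: polar i. Proof. by []. Qed.

Hypothesis adjC : symmetric adj.
Hypothesis adj_orth : forall i j, (i < n)%N -> (j < n)%N -> adj i j -> mk (polar i) (polar j) = 0.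
Hypothesis nadj_orth : forall i j, (i < n)%N -> (j < n)%N -> i != j -> ~~ adj i j -> 2 <= mk (polar i) (polar j).

Lemma mkDl (X Y Z : H) : mk (X + Y) Z = mk X Z + mk Y Z. Proof. by rewrite /mk !v4E; ring. Qed.
Lemma mkZl (X Y : H) c : mk (c *: X) Y = c * mk X Y. Proof. by rewrite /mk !v4E; ring. Qed.
Lemma polar_self i : mk (polar i) (polar i) = -1. Proof. by rewrite /mk !v4E; field. Qed.
Lemma tr_polar i : 2^-1 <= tr (polar i).
Proof. by rewrite /tr !v4E; have := sqr_ge0 (cx i); have := sqr_ge0 (cy i); lra. Qed.
Lemma lam_base i : 2^-1 <= lam i base_pt.
Proof. by rewrite /lam /mk !v4E; have := sqr_ge0 (cx i); have := sqr_ge0 (cy i); lra. Qed.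
Lemma tr_mk X : tr X = mk base_pt X. Proof. by rewrite /tr /mk !v4E; ring. Qed.

Lemma lam_refl i j X : lam i (refl j X) = lam i X + 2 * lam j X * mk (polar i) (polar j).
Proof. by rewrite /lam /refl mkDr mkZr. Qed.
Lemma lam_refl_self i X : lam i (refl i X) = - lam i X.
Proof. by rewrite lam_refl polar_self; ring. Qed.
Lemma lam_refl_adj i j X : (i < n)%N -> (j < n)%N -> adj i j -> lam i (refl j X) = lam i X.
Proof. by move=> hi hj a; rewrite lam_refl adj_orth // mulr0 addr0. Qed.
Lemma lam_refl_nadj i j X : (i < n)%N -> (j < n)%N -> i != j -> ~~ adj i j -> 0 <= lam j X ->
  lam i X + 4 * lam j X <= lam i (refl j X).
Proof. by move=> hi hj ne a l0; rewrite lam_refl; have := nadj_orth hi hj ne a; nra. Qed.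

Lemma reflK i : involutive (refl i).
Proof. by move=> X; rewrite {1}/refl lam_refl_self /refl mulrN scaleNr addrK. Qed.
Lemma refl_comm i j X : (i < n)%N -> (j < n)%N -> adj i j -> refl i (refl j X) = refl j (refl i X).
Proof.
move=> hi hj a; have a' : adj j i by rewrite adjC.
by rewrite {1}/refl (lam_refl_adj X hi hj a) /refl -/(refl i X) (lam_refl_adj X hj hi a') addrAC.
Qed.
Lemma mk_refl i X Y : mk (refl i X) Y = mk X (refl i Y).
Proof. by rewrite /refl mkDl mkZl mkDr mkZr (mkC X (polar i)) /lam; ring. Qed.
Lemma qd_refl i X : qd (refl i X) = qd X.
Proof.
have h (Y : H) : qd Y = mk Y Y / 2 by rewrite mk_self; field.
by rewrite !h mk_refl reflK.
Qed.
Lemma reflZ i c X : refl i (c *: X) = c *: refl i X.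
Proof. by rewrite /refl /lam mkZr scalerDr scalerA mulrCA. Qed.
Lemma refls_cat u v X : refls (u ++ v) X = refls u (refls v X). Proof. by rewrite /refls foldr_cat. Qed.
Lemma reflsZ w c X : refls w (c *: X) = c *: refls w X.
Proof. by elim: w => //= i w ->; rewrite reflZ. Qed.
Lemma mk_refls w X Y : mk (refls w X) Y = mk X (refls (rev w) Y).
Proof. by elim: w Y => //= i w IH Y; rewrite mk_refl IH rev_cons -cats1 refls_cat. Qed.
Lemma tr_refls_rev w : tr (refls (rev w) base_pt) = tr (refls w base_pt).
Proof. by rewrite !tr_mk -mk_refls mkC. Qed.

(** The diagonal entries of the image are, up to a factor 2, values of [X] on rank one matrices; the
    determinant is preserved. *)
Lemma psd_refl i X : psd X -> psd (refl i X).
Proof.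
move=> pX; have z (a b c d : R) : 0 <= pr X (zz a b c d) by apply: pr_ge0 => //; exact: zz_psd.
split; last by rewrite qd_refl; case: pX.
- have -> : refl i X 0 0 = 2 * pr X (zz (cx i) (cy i) (2^-1 - cx i ^+ 2 - cy i ^+ 2) 0).
    by rewrite /refl /lam /mk /pr /zz !v4E; field.
  by rewrite mulr_ge0.
- have -> : refl i X 0 1 = 2 * pr X (zz 1 0 (- cx i) (cy i)).
    by rewrite /refl /lam /mk /pr /zz !v4E; field.
  by rewrite mulr_ge0.
Qed.
Lemma psd_base : psd base_pt.
Proof. by split; rewrite /qd !v4E //; lra. Qed.
Lemma psd_refls w : psd (refls w base_pt).
Proof. by elim: w => [|i w IH] /=; [exact: psd_base | exact: psd_refl]. Qed.

Lemma lam_le i : exists2 C, 0 < C & forall X, psd X -> `|lam i X| <= C * tr X.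
Proof.
exists (6 * `|polar i| + 1); first by rewrite ltr_wpDl // mulr_ge0.
move=> X pX; rewrite /lam mkC -pr_adj; apply: le_trans (pr_norm _ _) _.
have e : `|dual_form (polar i)| <= `|polar i|.
  have h j := norm_coord (polar i) j.
  by apply: norm_le => // -[[|[|[|[|//]]]] lt]; rewrite mxE /= ?normrN; exact: h.
have n1 := psd_norm pX; have t0 := psd_tr_ge0 pX.
apply: (@le_trans _ _ (6 * `|polar i| * tr X)); last by rewrite ler_wpM2r // lerDl.
rewrite -!mulrA ler_wpM2l // mulrC; exact: ler_pM.
Qed.

Lemma tr_refl_le i : exists2 C, 0 < C & forall X, psd X -> tr X <= C * tr (refl i X).
Proof.
have [C C0 hC] := lam_le i; have t0 : 0 < tr (polar i) by apply: lt_le_trans (tr_polar i); lra.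
exists (1 + 2 * C * tr (polar i)); first by rewrite ltr_wpDr // !mulr_ge0 // ltW.
move=> X pX; have pY := psd_refl i pX; rewrite -{1}[X](reflK i) {1}/refl trD trZ.
have := hC _ pY; move: (refl i X) => Y /ler_normlP[_ h].
have := ler_wpM2r (ltW t0) h; lra.
Qed.

(** Legal plays of a numbers game: reading from the right, a letter is fired only while its value is
    positive, that is, with the point outside of the circle of inversion. They take the place of
    reduced words. *)
Fixpoint play (w : seq nat) : Prop :=
  if w is b :: w' then [/\ (b < n)%N, play w' & 0 < lam b (refls w' base_pt)] else True.

Lemma play_all w : play w -> all (fun i => i < n)%N w.
Proof. by elim: w => //= b w IH [-> /IH ->]. Qed.

(** The invariant of the game, by cases on the last letter fired: a negative value is dominated,
    with a factor 2, by the values of all letters that do not commute with it. In particular two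
    such letters are never negative together. *)
Lemma play_inv w : play w -> forall a b, (a < n)%N -> (b < n)%N -> b != a -> ~~ adj a b ->
  lam a (refls w base_pt) < 0 -> - 2 * lam a (refls w base_pt) <= lam b (refls w base_pt).
Proof.
elim: w => [_ a b _ _ _ _ h|c w IH /= [cn /IH{}IH v0] a b an bn ba nab].
  by have := lam_base a; move: h => /=; lra.
set Y := refls w base_pt in IH v0 *.
have neg d : (d < n)%N -> d != c -> ~~ adj d c -> - lam c Y <= 2 * lam d Y.
  move=> dn dc ndc; case: (ltP (lam d Y) 0) => h; last lra.
  by have := IH d c dn cn; rewrite eq_sym => /(_ dc ndc h); lra.
have [e|ac] := eqVneq a c.
  rewrite e in ba nab *; rewrite adjC in nab.
  rewrite lam_refl_self => _; have := lam_refl_nadj bn cn ba nab (ltW v0).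
  have := neg b bn ba nab; lra.
have [aac|nac] := boolP (adj a c); last first.
  have := lam_refl_nadj an cn ac nac (ltW v0); have := neg a an ac nac; lra.
rewrite (lam_refl_adj Y an cn aac) => l0.
have bc : b != c by apply: contraNneq nab => ->.
have h := IH a b an bn ba nab l0.
have [abc|nbc] := boolP (adj b c); first by rewrite (lam_refl_adj Y bn cn abc).
have := lam_refl_nadj bn cn bc nbc (ltW v0); lra.
Qed.

(** Firing [a] only changes the sign of its value. Before [a] can be fired again, a letter [c] not
    adjacent to it must raise the value by at least 4 times that of [c], which by [play_inv] more
    than doubles its size. *)
Lemma play_growth w : play w -> forall a, (a < n)%N ->
  let l := lam a (refls w base_pt) in
  [/\ 2 ^+ count_mem a w / 4 <= tr (refls w base_pt), 0 <= l -> 2 ^+ count_mem a w / 2 <= l &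
      l < 0 -> 2 ^+ count_mem a w / 4 <= - l].
Proof.
elim: w => [_ a an /=|c w IH [cn pw v0] a an].
  by have := lam_base a; rewrite /tr !v4E expr0; split; lra.
have := IH pw a an; have [] := IH pw c cn; move: (play_inv pw) v0 => /=; set Y := refls w base_pt.
move=> inv v0 tc /(_ (ltW v0)) vc _ [ta pa na]; have tp := tr_polar c.
have trE : tr (refl c Y) = tr Y + 2 * lam c Y * tr (polar c) by rewrite /refl trD trZ.
have trY : tr Y + lam c Y <= tr (refl c Y).
  rewrite trE lerD2l; have := ler_wpM2l (ltW v0) tp; lra.
have [e|ac] := eqVneq a c.
  rewrite e -[nat_of_bool true]/1%N add1n exprS lam_refl_self; have t0 := psd_tr_ge0 (psd_refls w).
  rewrite -/Y in t0; split; lra.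
rewrite -[nat_of_bool false]/0%N add0n; have e0 : 0 <= 2 ^+ count_mem a w :> R by rewrite exprn_ge0.
have [aac|nac] := boolP (adj a c).
  by rewrite (lam_refl_adj Y an cn aac); split=> //; apply: le_trans ta _; lra.
have h := lam_refl_nadj an cn ac nac (ltW v0).
case: (ltP (lam a Y) 0) => la; last by have := pa la; split; lra.
have := inv a c an cn; rewrite eq_sym => /(_ ac nac la); have := na la; split; lra.
Qed.

(** The exchange condition: a letter fired after [a] and not adjacent to it would have made the
    value of [a] positive again, so only letters commuting with [a] stand in front of its last
    occurrence. *)
Lemma play_exchange w a : play w -> (a < n)%N -> lam a (refls w base_pt) < 0 ->
  exists x u, w = x ++ a :: u /\ all (adj a) x.
Proof.
elim: w => [_ _ /=|c w IH pcw an l0]; first by have := lam_base a; lra.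
have [e|ac] := eqVneq a c; first by exists [::], w; rewrite e.
have [cn pw v0] := pcw; move: l0 => /=; set Y := refls w base_pt in IH v0 *.
have [aac|nac] := boolP (adj a c); last first.
  have := lam_refl_nadj an cn ac nac (ltW v0).
  case: (ltP (lam a Y) 0) => l0; last lra.
  by have := play_inv pw an cn; rewrite eq_sym => /(_ ac nac l0); lra.
rewrite (lam_refl_adj Y an cn aac) => l0; have [x [u [-> ax]]] := IH pw an l0.
by exists (c :: x), u; rewrite /= aac.
Qed.

Lemma refls_move a x X : (a < n)%N -> all (fun i => i < n)%N x -> all (adj a) x ->
  refls x (refl a X) = refl a (refls x X).
Proof. by move=> an; elim: x => //= i x IH /andP[xn xs] /andP[ai ax]; rewrite IH // refl_comm // adjC. Qed.

Lemma play_remove x a u : (a < n)%N -> play (x ++ a :: u) -> all (adj a) x -> play (x ++ u).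
Proof.
move=> an; elim: x => [[]//|c x IH /= [cn pxu v0] /andP[ac ax]].
split=> //; first exact: IH; move: v0; rewrite refls_cat /= refls_move //; last first.
  by have := play_all pxu; rewrite all_cat => /andP[].
by rewrite -refls_cat (lam_refl_adj _ cn an) // adjC.
Qed.

(** An illegal letter cancels against its previous occurrence, by exchange. The relation [E] is left
    abstract because the reduction serves twice: for the linear maps, and for the elements of the
    surface group encoded by words. *)
Lemma play_reduce (E : seq nat -> seq nat -> Prop) : E [::] [::] ->
  (forall w1 w2 w3, E w1 w2 -> E w2 w3 -> E w1 w3) ->
  (forall b w w', (b < n)%N -> E w w' -> E (b :: w) (b :: w')) ->
  (forall w, all (fun i => i < n)%N w -> E w w) ->
  (forall a x u, (a < n)%N -> all (fun i => i < n)%N x -> all (fun i => i < n)%N u -> all (adj a) x ->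
     E (a :: x ++ a :: u) (x ++ u)) ->
  forall w, all (fun i => i < n)%N w -> exists2 w', play w' & E w w'.
Proof.
move=> E0 tE cE rE xE; elim=> [_|b w IH /= /andP[bn wn]]; first by exists [::].
have [w' pw' ew'] := IH wn; have e1 := cE b _ _ bn ew'.
case: (ltP 0 (lam b (refls w' base_pt))) => l0; first by exists (b :: w').
have {}l0 : lam b (refls w' base_pt) < 0.
  rewrite lt_neqAle l0 andbT; apply/eqP => e; have [_ h _] := play_growth pw' bn.
  by move: h; rewrite e => /(_ (lexx 0)); apply/negP; rewrite -ltNge divr_gt0 // exprn_gt0.
have [x [u [e ax]]] := play_exchange pw' bn l0; rewrite e in pw' e1.
exists (x ++ u); first exact: play_remove pw' ax.
apply: tE e1 _; have := play_all pw'; rewrite all_cat /= => /and3P[xn _ un]; exact: xE.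
Qed.

Lemma refls_play w : all (fun i => i < n)%N w ->
  exists2 w', play w' & forall X, refls w X = refls w' X.
Proof.
apply: (play_reduce (E := fun w w' => forall X, refls w X = refls w' X)) => //.
- by move=> w1 w2 w3 h1 h2 Z; rewrite h1.
- by move=> b v v' _ h Z; rewrite /= h.
- by move=> b x u bn xn un bx Z; rewrite /= !refls_cat /= refls_move // reflK.
Qed.

(** Pigeonhole: the most frequent letter occurs at least [size w / n] times, and its count alone
    makes the trace grow. *)
Lemma play_trace w : (0 < n)%N -> play w ->
  exists2 k : nat, (size w <= n * k)%N & 2 ^+ k / 4 <= tr (refls w base_pt).
Proof.
move=> n0 pw; pose m := \max_(i < n) count_mem (val i) w; exists m.
  have -> : size w = (\sum_(i < n) count_mem (val i) w)%N.
    have := play_all pw; elim: w {pw m} => [_|c w IH /= /andP[cn wn]].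
      by rewrite big1.
    rewrite big_split /= -IH // -add1n; congr (_ + _)%N; rewrite (bigD1 (Ordinal cn)) //= eqxx big1 ?addn0 //.
    by move=> i; rewrite -val_eqE /= eq_sym => /negbTE ->.
  have -> : (n * m = \sum_(i < n) m)%N by rewrite sum_nat_const card_ord.
  apply: leq_sum => i _.
  exact: (leq_bigmax (F := fun i : 'I_n => count_mem (val i) w)).
have : (0 < #|'I_n|)%N by rewrite card_ord.
move=> h; have [i ei] := @bigop.eq_bigmax _ (fun i : 'I_n => count_mem (val i) w) h.
by rewrite /m ei; have [] := play_growth pw (ltn_ord i).
Qed.

(** Counterpart of [good] for the whole reflection group, in terms of words. *)
Definition tame X := exists2 K, 0 < K & forall w, all (fun i => i < n)%N w ->
  tr (refls w base_pt) <= K * mk (refls w base_pt) X.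

(* A letter fired where [lam] vanishes on X does not bring the orbit away from X, so its last
   contribution is discounted from the trace. *)
Lemma tame_fund X a eta : 0 < eta -> 0 < tr X -> (a < n)%N -> 0 <= lam a X ->
  (forall i, (i < n)%N -> i != a -> eta <= lam i X) -> tame X.
Proof.
move=> e0 tX an la lX; pose T := \sum_(i < n) tr (polar i).
have tp0 i : 0 < tr (polar i) by apply: lt_le_trans (tr_polar i); lra.
have hT i : (i < n)%N -> tr (polar i) <= T.
  move=> hi; rewrite /T (bigD1 (Ordinal hi)) //= lerDl; apply: sumr_ge0 => j _; exact: ltW.
have T0 : 0 < T by apply: lt_le_trans (hT a an).
(* The first term pays for each firing of a letter other than [a], the second one for the empty
   word, where the trace is 2. *)
pose K := 3 * T / eta + 2 / tr X; have K0 : 0 < K by rewrite addr_gt0 // divr_gt0 // mulr_gt0.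
have Ke : 3 * T <= K * eta.
  rewrite (_ : K * eta = 3 * T + 2 / tr X * eta); last by rewrite /K; field; rewrite !gt_eqF.
  by rewrite lerDl mulr_ge0 ?divr_ge0 // ltW.
have KX : 2 <= K * tr X.
  rewrite (_ : K * tr X = 3 * T / eta * tr X + 2); last by rewrite /K; field; rewrite !gt_eqF.
  by rewrite lerDr mulr_ge0 ?divr_ge0 ?mulr_ge0 // ltW.
have main w : play w -> let Y := refls w base_pt in
    tr Y + 2 * Num.min (lam a Y) 0 * tr (polar a) <= K * mk Y X.
  elim: w => [_|c w IH [cn pw v0]] /=.
    rewrite min_r; last by have := lam_base a; lra.
    rewrite mulr0 mul0r addr0 -tr_mk; apply: le_trans KX; rewrite /tr !v4E; lra.
  have := IH pw; have inv := play_inv pw; move: v0 inv => /=; set Y := refls w base_pt => v0 inv hY.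
  have trE : tr (refl c Y) = tr Y + 2 * lam c Y * tr (polar c) by rewrite /refl trD trZ.
  have mE : mk (refl c Y) X = mk Y X + 2 * lam c Y * lam c X by rewrite /refl mkDl mkZl.
  rewrite trE mE; have [e|ca] := eqVneq c a.
    have mn : Num.min (- lam c Y) 0 = - lam c Y by rewrite min_l // oppr_le0 ltW.
    have mn' : Num.min (lam c Y) 0 = 0 by rewrite min_r // ltW.
    rewrite -e lam_refl_self mn; move: hY; rewrite -e mn'.
    have : 0 <= K * (2 * lam c Y * lam c X) by rewrite !mulr_ge0 ?(ltW K0) ?(ltW v0) // e.
    lra.
  have lc := lX c cn ca; have tc := hT c cn; have ta := hT a an.
  have h1 : lam c Y * (3 * T) <= lam c Y * (K * eta) by rewrite ler_pM2l.
  have h2 : lam c Y * (K * eta) <= lam c Y * (K * lam c X).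
    by rewrite ler_pM2l // ler_pM2l.
  have h3 : lam c Y * tr (polar c) <= lam c Y * T by rewrite ler_pM2l.
  have h4 : lam c Y * tr (polar a) <= lam c Y * T by rewrite ler_pM2l.
  have vT : 0 < lam c Y * T by exact: mulr_gt0.
  have [aac|nac] := boolP (adj a c).
    rewrite (lam_refl_adj Y an cn aac); lra.
  rewrite eq_sym in ca; have h := lam_refl_nadj an cn ca nac (ltW v0).
  case: (ltP (lam a Y) 0) => l0; last first.
    rewrite min_r; last lra.
    by move: hY; rewrite min_r //; lra.
  have i1 := inv a c an cn; rewrite eq_sym in i1; have {}i1 := i1 ca nac l0.
  rewrite min_r; last lra.
  have mn : Num.min (lam a Y) 0 = lam a Y by rewrite min_l // ltW.
  move: hY; rewrite mn => hY.
  have h5 : - 2 * lam a Y * tr (polar a) <= lam c Y * tr (polar a) by rewrite ler_wpM2r // ltW.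
  lra.
have [C C0 hC] := lam_le a; have c1 : 0 < 1 + 2 * C * tr (polar a).
  by rewrite ltr_wpDr // !mulr_ge0 // ltW.
exists ((1 + 2 * C * tr (polar a)) * K); first exact: mulr_gt0.
move=> w wn; have [w' pw' ->] := refls_play wn.
have := main w' pw' => /=; set Y := refls w' base_pt => hY; rewrite -mulrA.
have pY : psd Y by exact: psd_refls.
(* When the value of [a] is negative, the discounted trace is the trace of [refl a Y], which is
   comparable to that of [Y]. *)
suff : tr Y <= (1 + 2 * C * tr (polar a)) * (tr Y + 2 * Num.min (lam a Y) 0 * tr (polar a)).
  by move=> h; apply: le_trans h _; rewrite ler_pM2l.
have tY := psd_tr_ge0 pY.
case: (ltP (lam a Y) 0) => l0.
  have pZ := psd_refl a pY; have := hC _ pZ; rewrite lam_refl_self => /ler_normlP[_ h].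
  have trZ' : tr (refl a Y) = tr Y + 2 * lam a Y * tr (polar a) by rewrite /refl trD trZ.
  rewrite -trZ'; have := ler_wpM2r (ltW (tp0 a)) h; lra.
rewrite mulr0 mul0r addr0 ler_peMl // lerDl !mulr_ge0 // ?ltW //.
Qed.

Lemma tame_refl i X : (i < n)%N -> tame X -> tame (refl i X).
Proof.
move=> hi [K K0 hK]; have [C C0 hC] := tr_refl_le i.
exists (C * K); first exact: mulr_gt0.
move=> w wn; rewrite -mk_refl -mulrA; have := hK (i :: w); rewrite /= hi => /(_ wn) h.
by apply: le_trans (hC _ (psd_refls w)) _; rewrite ler_pM2l.
Qed.

Lemma tameZ c X : 0 < c -> tame X -> tame (c *: X).
Proof.
move=> c0 [K K0 hK]; exists (K / c); first exact: divr_gt0.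
by move=> w wn; rewrite mkZr mulrA divfK ?gt_eqF //; exact: hK.
Qed.

(** Reversing a word does not change the trace, and turns letters added on the right into outer
    ones, whose distortion is bounded. *)
Lemma tr_refls_shift u : all (fun i => i < n)%N u -> exists2 C, 0 < C & forall w,
  tr (refls w base_pt) <= C * tr (refls (w ++ u) base_pt).
Proof.
elim: u => [_|i u IH /= /andP[hi hu]]; first by exists 1 => // w; rewrite mul1r cats0.
have [C C0 hC] := IH hu; have [D D0 hD] := tr_refl_le i.
have hD' w : tr (refls w base_pt) <= D * tr (refls (w ++ [:: i]) base_pt).
  rewrite -tr_refls_rev -[tr (refls (_ ++ _) _)]tr_refls_rev rev_cat /=.
  exact: hD (psd_refls _).
exists (D * C); first exact: mulr_gt0.
move=> w; apply: le_trans (hD' w) _; rewrite -mulrA ler_pM2l //.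
by have := hC (w ++ [:: i]); rewrite -catA.
Qed.
End Reflections.

(** * A surface group of reflections *)

Section Inversions.
Variable R : realType.
Local Open Scope complex_scope.
Local Open Scope sesquilinear_scope.
Notation C := R[i].
Notation H := 'rV[R]_4.
Variables (n : nat) (cx cy : nat -> R) (adj : rel nat).
Notation polar := (polar cx cy).
Notation refl := (refl cx cy).
Notation refls := (refls cx cy).
Hypothesis adjC : symmetric adj.
Hypothesis adj_orth : forall i j, (i < n)%N -> (j < n)%N -> adj i j -> mk (polar i) (polar j) = 0.

Definition mxc (B : 'M[C]_2) : 'M[C]_2 := map_mx Num.conj B.
Definition mat2 (a b c d : C) : 'M[C]_2 :=
  \matrix_(i, j) if i == 0 then (if j == 0 then a else b) else (if j == 0 then c else d).
(* The inversion z |-> c + (1/2) / conj (z - c) is v |-> inv_mx * conj v in homogeneous coordinates. *)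
Definition inv_mx0 i : 'M[C]_2 :=
  mat2 (cx i +i* cy i) (2^-1 - cx i ^+ 2 - cy i ^+ 2)%:C 1 (- cx i +i* cy i).
Definition inv_mx i : 'M[C]_2 := (Num.sqrt 2)%:C *: inv_mx0 i.
Definition inv_op i (B : 'M[C]_2) := inv_mx i *m mxc B.
Definition inv_ops w B := foldr inv_op B w.
Definition mat w := inv_ops w 1%:M.

Lemma mul2 (A B : 'M[C]_2) : A *m B = mat2 (A 0 0 * B 0 0 + A 0 1 * B 1 0) (A 0 0 * B 0 1 + A 0 1 * B 1 1)
  (A 1 0 * B 0 0 + A 1 1 * B 1 0) (A 1 0 * B 0 1 + A 1 1 * B 1 1).
Proof.
have l0 : fintype.lift (ord0 : 'I_2) (ord0 : 'I_1) = 1 by exact: val_inj.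
by apply: mx2P; rewrite !mxE !big_ord_recl big_ord0 !l0 /= addr0.
Qed.

Lemma mat2E a b c d : (mat2 a b c d 0 0 = a) * (mat2 a b c d 0 1 = b) * (mat2 a b c d 1 0 = c) * (mat2 a b c d 1 1 = d).
Proof. by rewrite !mxE. Qed.

Lemma sqrt2C : (Num.sqrt 2)%:C * (Num.sqrt 2)%:C = 2%:C :> C.
Proof. by rewrite -rmorphM /= -expr2 sqr_sqrtr. Qed.

Lemma mxcM A B : mxc (A *m B) = mxc A *m mxc B. Proof. exact: map_mxM. Qed.
Lemma mxcK : involutive mxc. Proof. by move=> B; apply/matrixP => i j; rewrite !mxE conjCK. Qed.
Lemma mxcN B : mxc (- B) = - mxc B. Proof. exact: map_mxN. Qed.
Lemma mxc_real (c : R) B : mxc (c%:C *: B) = c%:C *: mxc B.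
Proof. by rewrite /mxc map_mxZ; congr (_ *: _); apply/eqP; rewrite eq_complex /= oppr0 !eqxx. Qed.

Ltac cring := apply/eqP; rewrite eq_complex /=; apply/andP; split; apply/eqP.

Lemma inv_mxM i j : inv_mx i *m mxc (inv_mx j) = 2%:C *: (inv_mx0 i *m mxc (inv_mx0 j)).
Proof. by rewrite /inv_mx mxc_real -scalemxAl -scalemxAr scalerA sqrt2C. Qed.

Lemma inv_mx_self i : inv_mx i *m mxc (inv_mx i) = 1%:M.
Proof.
by rewrite inv_mxM mul2; apply: mx2P; rewrite !mxE /=; cring; field.
Qed.

(** Orthogonal inversions commute as transformations, but their matrices only up to the sign -1.
    These signs must be tracked in order to land in SL(2) and not only in PSL(2). *)
Lemma inv_mx_adj i j : (i < n)%N -> (j < n)%N -> adj i j ->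
  inv_mx i *m mxc (inv_mx j) = - (inv_mx j *m mxc (inv_mx i)).
Proof.
move=> hi hj a; have := adj_orth hi hj a; rewrite /mk !v4E => e.
rewrite !inv_mxM !mul2; apply: mx2P; rewrite !mxE /=; cring; lra.
Qed.

Lemma inv_opK i : involutive (inv_op i).
Proof. by move=> B; rewrite /inv_op mxcM mxcK mulmxA inv_mx_self mul1mx. Qed.

Lemma inv_opN i B : inv_op i (- B) = - inv_op i B.
Proof. by rewrite /inv_op mxcN mulmxN. Qed.

Lemma inv_op_adj i j B : (i < n)%N -> (j < n)%N -> adj i j ->
  inv_op i (inv_op j B) = - inv_op j (inv_op i B).
Proof. by move=> hi hj a; rewrite /inv_op !mxcM !mxcK !mulmxA inv_mx_adj // mulNmx. Qed.

Lemma inv_ops_cat u v B : inv_ops (u ++ v) B = inv_ops u (inv_ops v B).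
Proof. by rewrite /inv_ops foldr_cat. Qed.

Lemma inv_ops_revK w B : inv_ops w (inv_ops (rev w) B) = B.
Proof.
elim/last_ind: w => //= w i IH; rewrite rev_rcons -cats1 inv_ops_cat /= inv_opK; exact: IH.
Qed.

Definition mxcb (b : bool) B := if b then mxc B else B.

Lemma inv_opsE w B : inv_ops w B = mat w *m mxcb (odd (size w)) B.
Proof.
elim: w => [|i w IH] /=; first by rewrite /mat /= mul1mx.
rewrite IH /mat /= -/(mat w) /inv_op mxcM mulmxA; congr (_ *m _).
by case: (odd _) => //=; rewrite mxcK.
Qed.

Lemma det_mat w : \det (mat w) = (-1) ^+ size w.
Proof.
elim: w => [|i w IH] /=; first by rewrite det1 expr0.
rewrite /mat /= -/(mat w) /inv_op det_mulmx exprS; congr (_ * _).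
  by rewrite /inv_mx detZ det2 !mat2E expr2 sqrt2C; cring; field.
by rewrite /mxc det_map_mx IH rmorphXn rmorphN rmorph1.
Qed.

Lemma herm_refl i (X : H) : herm (refl i X) = inv_mx i *m mxc (herm X) *m (inv_mx i) ^t*.
Proof.
have -> : (inv_mx i) ^t* = (Num.sqrt 2)%:C *: (inv_mx0 i) ^t*.
  by rewrite /inv_mx linearZ /= -/(mxc _) mxc_real.
rewrite /inv_mx -!scalemxAl -scalemxAr scalerA sqrt2C !mul2; apply: mx2P;
  by rewrite !mxE /= /lam /mk !v4E; cring; field.
Qed.

Lemma herm_refls w (X : H) : herm (refls w X) = mat w *m mxcb (odd (size w)) (herm X) *m (mat w) ^t*.
Proof.
elim: w => [|i w IH] /=; first by rewrite /mat /= trmx1 map_mx1 mul1mx mulmx1.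
rewrite herm_refl IH /mat /= -/(mat w) /inv_op !mxcM trmx_mul map_mxM !mulmxA.
congr (_ *m _ *m _ *m _); first by case: (odd _) => //=; rewrite mxcK.
by apply/matrixP => a b; rewrite !mxE.
Qed.

Lemma Lact_mat w (X : H) : ~~ odd (size w) -> Lact (mat w) X = refls w X.
Proof.
by move=> ev; rewrite -[RHS]hermK herm_refls (negbTE ev) /Lact.
Qed.
End Inversions.

(** * The surface group inside the reflection group *)

Section SurfaceWords.
Variables (g' : nat).
Notation g := g'.+1.
Notation Gam := (surface_group g).
Local Open Scope group_scope.
Local Open Scope quotient_scope.

Definition od j := j.*2.+1.
Definition ev j := j.*2.
(** Words with an even number of letters of each parity, chosen so that their commutators telescope
    over [j]. The index is reversed in [lw] because the relator multiplies by increasing index,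
    while [comms] puts the largest [j] in front. *)
Definition aw j : seq nat := [:: od g'; od j.+1; od j; od g'].
Definition bw j : seq nat := [:: od g'; od j; ev 0; ev j.+1; od j; od g'].
Definition lw (l : letter g) : seq nat :=
  let w := if l.1.2 then bw (g' - l.1.1) else aw (g' - l.1.1) in if l.2 then rev w else w.
Definition expw (w : word g) : seq nat := flatten (map lw w).

Lemma piM (u v : word g) : \pi_Gam (u ++ v) = (\pi_Gam u : Gam) * \pi_Gam v :> Gam.
Proof. exact: esym (sg_mulE u v). Qed.
Lemma pi_nil : \pi_Gam [::] = 1 :> Gam. Proof. by []. Qed.
Lemma piV (l : letter g) : \pi_Gam [:: letter_inv l] = (\pi_Gam [:: l] : Gam)^-1 :> Gam.
Proof. exact: esym (sg_invE [:: l]). Qed.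

Definition gena j : Gam := \pi_Gam [:: (inord (g' - j), false, false)].
Definition genb j : Gam := \pi_Gam [:: (inord (g' - j), true, false)].

Definition comm j : Gam := gena j * genb j * (gena j)^-1 * (genb j)^-1.
Fixpoint comms m : Gam := if m is j.+1 then comm j * comms j else 1.

Lemma pi_commutator (i : 'I_g) : \pi_Gam [:: (i, false, false); (i, true, false); (i, false, true); (i, true, true)] =
  comm (g' - i) :> Gam.
Proof.
rewrite /comm /gena /genb subKn ?inord_val; last by rewrite -ltnS.
rewrite -(piV (i, false, false)) -(piV (i, true, false)) /letter_inv /=.
by rewrite -!piM.
Qed.

Lemma comms_relator : comms g = 1.
Proof.
have -> : 1 = \pi_Gam (relator g) :> Gam.
  by apply/esym/word_eqP; have := @word_eq_relator g [::] [::]; rewrite cats0.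
have step (s : seq 'I_g) : \pi_Gam (flatten [seq [:: (i, false, false); (i, true, false);
    (i, false, true); (i, true, true)] | i <- s]) = foldr (fun i acc => comm (g' - i) * acc) (1 : Gam) (map val s) :> Gam.
  by elim: s => // i s IH; rewrite [flatten _]/= -cat1s -(cat1s (i, true, false)) -(cat1s (i, false, true))
    -(cat1s (i, true, true)) !catA piM pi_commutator IH.
rewrite /relator step val_enum_ord.
have gen m : (m <= g)%N -> foldr (fun i acc => comm (g' - i) * acc) (1 : Gam) (iota (g - m) m) = comms m.
  elim: m => // m IH mg; rewrite [iota _ _]/= /= -subSn // subSS IH; last exact: ltnW.
  by rewrite subKn.
by have := gen g (leqnn _); rewrite subnn => <-.
Qed.

(** Reidemeister-Schreier generators for the four cosets represented by [sheet], written in the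
    surface group: [Oel k], [Eel k], [Pel k], [Qel k] will act as the words [od k; 1], [ev k; 0],
    [0; od k; 1; 0], [1; ev k; 1; 0], and [Mel j], [Del j] as [od g'; od j], [od j.+1; od j]. *)
Fixpoint Mrev t : Gam := if t is s.+1 then (gena (g' - s.+1))^-1 * Mrev s else 1.
Definition Mel j := Mrev (g' - j).
Definition Del j := (Mel j)^-1 * (gena j)^-1 * Mel j.
Definition Eel k : Gam := if k is j.+1 then (Mel j)^-1 * (genb j)^-1 * Mel j else 1.
Fixpoint Oel k : Gam := if k is j.+1 then Del j * Oel j else 1.
Fixpoint Pel k : Gam := if k is j.+1 then (Eel k)^-1 * Del j * Eel k * Pel j else 1.
Definition Qel k := (Oel k)^-1 * Eel k * Pel k.

Lemma MelS j : (j < g')%N -> Mel j = (gena j)^-1 * Mel j.+1.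
Proof.
move=> jg; rewrite /Mel (_ : (g' - j = (g' - j.+1).+1)%N); last by rewrite subnSK.
by rewrite [LHS]/= subnSK // subKn // ltnW.
Qed.

Lemma MDel j : gena j * Mel j * Del j = Mel j.
Proof. by rewrite /Del !mulgA mulgK mulgV mul1g. Qed.

Lemma MelE j : (j <= g')%N -> Mel j = Oel g' * (Oel j)^-1.
Proof.
move=> jg; rewrite -(subKn jg); move: (g' - j)%N (leq_subr j g') => t {j jg}.
elim: t => [_|t IH tg]; first by rewrite subn0 mulgV /Mel subnn.
have lt : (g' - t.+1 < g')%N by rewrite -subSn // subSS leq_subr.
have eS : (g' - t.+1).+1 = (g' - t)%N by rewrite -subSn.
have := IH (ltnW tg); rewrite -eS [Oel _.+1]/= => h.
have M1 := MelS lt; have MD := MDel (g' - t.+1).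
have e1 : gena (g' - t.+1) * Mel (g' - t.+1) = Mel (g' - t.+1).+1 by rewrite M1 mulVKg.
by rewrite -MD e1 h; move: (Del _) => d; rewrite invgM mulgA mulgVK.
Qed.

Lemma EPOQ k : Eel k * Pel k = Oel k * Qel k.
Proof. by rewrite /Qel !mulgA mulgV mul1g. Qed.

Lemma EPOQS k : Eel k.+1 * Pel k = Oel k * Qel k.+1.
Proof.
have key (e p o d : Gam) : e * p = o * ((d * o)^-1 * e * (e^-1 * d * e * p)).
  by rewrite invgM !mulgA mulgV mul1g mulgK mulVg mul1g.
exact: key.
Qed.

(** The quotient of the two sides is conjugate to the product of all commutators. This is how the
    surface relation enters; it closes the polygon, making the last letter commute with the first on
    every sheet. *)
Lemma Pel_close : Pel g = Oel g.
Proof.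
pose U j := gena j * Mel j * (Pel j.+1 * (Oel j.+1)^-1) * (gena j * Mel j)^-1.
have step j : (j <= g')%N -> U j = comm j * (Mel j * (Pel j * (Oel j)^-1) * (Mel j)^-1).
  move=> jg; rewrite /U [Pel _]/= [Oel _]/= /Del /comm.
  move: (gena j) (genb j) (Mel j) (Pel j) (Oel j) => a b m p o.
  by rewrite !(invgM, invgK) !mulgA; do !rewrite mulgK || rewrite mulgVK || (rewrite mulgV mul1g).
have UE j : (j <= g')%N -> U j = comms j.+1.
  have key (c m : Gam) : c * (m * (1 * 1^-1) * m^-1) = c * 1 by rewrite invg1 !mulg1 mulgV mulg1.
  elim: j => [_|j IH jg]; first by rewrite step //; exact: key.
  rewrite step // [comms _]/= -[comm j * _]/(comms j.+1) -(IH (ltnW jg)); congr (_ * _).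
  by rewrite /U (_ : gena j * Mel j = Mel j.+1) // MelS // mulVKg.
have := UE g' (leqnn _); rewrite comms_relator /U => h.
have {}h : Pel g * (Oel g)^-1 = 1.
  move: h; move: (gena g' * Mel g') (Pel g * (Oel g)^-1) => a b h.
  have : a^-1 * (a * b * a^-1) * a = a^-1 * 1 * a by rewrite h.
  by rewrite -!mulgA mulKg mulVg !mulg1 mul1g mulVg.
by rewrite -[LHS](mulgVK (Oel g)) h mul1g.
Qed.

(* The generators of the reflection group permute the four sheets (Z/2)^2 over the polygon; [sheet i v w]
   elements of the surface group record the transitions. *)
Definition st i (v : bool * bool) := if odd i then (v.1, ~~ v.2) else (~~ v.1, v.2).
Definition trans i (v : bool * bool) : Gam :=
  if odd i then
    (if v.1 then (if v.2 then (Pel i./2)^-1 else Pel i./2)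
     else (if v.2 then (Oel i./2)^-1 else Oel i./2))
  else
    (if v.2 then (if v.1 then (Qel i./2)^-1 else Qel i./2)
     else (if v.1 then (Eel i./2)^-1 else Eel i./2)).
Fixpoint tau v w : Gam := if w is i :: w' then trans i v * tau (st i v) w' else 1.
Definition fin v w := foldl (fun v i => st i v) v w.

Lemma stK i v : st i (st i v) = v.
Proof. by rewrite /st; case: (odd i); case: v => a b /=; rewrite negbK. Qed.
Lemma trans_inv i v : trans i v * trans i (st i v) = 1.
Proof.
by rewrite /trans /st; case: (odd i); case: v => -[] [] /=; rewrite ?mulgV ?mulVg.
Qed.
Lemma tau_cat v u w : tau v (u ++ w) = tau v u * tau (fin v u) w.
Proof. by elim: u v => [|i u IH] v /=; rewrite ?mul1g // IH mulgA. Qed.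
Lemma fin_cat v u w : fin v (u ++ w) = fin (fin v u) w.
Proof. by rewrite /fin foldl_cat. Qed.
Lemma fin_rev v w : fin (fin v w) (rev w) = v.
Proof.
by elim: w v => //= i w IH v; rewrite rev_cons -cats1 fin_cat IH /= stK.
Qed.
Lemma tau_rev v w : tau (fin v w) (rev w) = (tau v w)^-1.
Proof.
elim: w v => [|i w IH] v /=; first by rewrite invg1.
rewrite rev_cons -cats1 tau_cat IH fin_rev /= mulg1 invgM; congr (_ * _).
by rewrite -[RHS]mulg1 -(trans_inv i v) mulKg.
Qed.

Definition cadj (i j : nat) := [|| j == i.+1, i == j.+1, (i == 0%N) && (j == od g) | (j == 0%N) && (i == od g)].
Lemma cadjC : symmetric cadj.
Proof. by move=> i j; rewrite /cadj; do ![case: eqP => //=]. Qed.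

(** Over the four sheets, the commutation of an even and an odd letter is one identity E P = O Q and
    its rearrangements. *)
Lemma trans_comm i j v : cadj i j -> trans i v * trans j (st i v) = trans j v * trans i (st j v).
Proof.
have sw (a b c d : Gam) : a * b = c * d -> [/\ a^-1 * c = b * d^-1, d * b^-1 = c^-1 * a & d^-1 * c^-1 = b^-1 * a^-1].
  move=> h; split.
  - by apply: (mulgI a); rewrite mulVKg mulgA h mulgK.
  - by apply: (mulgI c); rewrite mulVKg mulgA -h mulgK.
  - by rewrite -!invgM h.
have main p q : odd q -> ~~ odd p -> Eel p./2 * Pel q./2 = Oel q./2 * Qel p./2 ->
    forall v, trans p v * trans q (st p v) = trans q v * trans p (st q v).
  move=> oq ep h w; have [h1 h2 h3] := sw _ _ _ _ h.
  by rewrite /trans /st oq (negbTE ep); case: w => -[] [] /=.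
have sym p q : (forall v, trans p v * trans q (st p v) = trans q v * trans p (st q v)) ->
    forall v, trans q v * trans p (st q v) = trans p v * trans q (st p v) by move=> h w; rewrite h.
have nextS p : forall v, trans p v * trans p.+1 (st p v) = trans p.+1 v * trans p (st p.+1 v).
  case op: (odd p); last first.
    apply: main; rewrite /= ?op // (_ : uphalf p = p./2); first exact: EPOQ.
    by rewrite uphalf_half op.
  apply: sym; apply: main; rewrite /= ?op // uphalf_half op; exact: EPOQS.
have wrap : forall v, trans 0 v * trans (od g) (st 0 v) = trans (od g) v * trans 0 (st (od g) v).
  have h : (od g)./2 = g by rewrite /od [LHS]/= uphalf_double.
  have key (x : Gam) : 1 * x = x * (1^-1 * 1 * 1) by rewrite invg1 !mulg1 mul1g.
  by apply: main => //; [rewrite /od [odd _]/= odd_double | rewrite h Pel_close; exact: key].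
case/or4P => [/eqP ->|/eqP ->|/andP[/eqP -> /eqP ->]|/andP[/eqP -> /eqP ->]].
- exact: nextS.
- exact: sym (nextS j) v.
- exact: wrap.
- exact: sym wrap v.
Qed.

Lemma st_comm i j v : st i (st j v) = st j (st i v).
Proof. by rewrite /st; case: (odd i); case: (odd j). Qed.

Lemma tau_move v a x u : all (cadj a) x -> tau v (a :: x ++ a :: u) = tau v (x ++ u).
Proof.
elim: x v => [|c x IH] v /=; first by rewrite mulgA trans_inv mul1g stK.
move=> /andP[ac ax]; have := IH (st c v) ax => /= <-; rewrite !mulgA trans_comm //.
by rewrite st_comm.
Qed.

Lemma trans_od k v : trans (od k) v = if v.1 then (if v.2 then (Pel k)^-1 else Pel k)
     else (if v.2 then (Oel k)^-1 else Oel k).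
Proof. by rewrite /trans /od /= odd_double /= uphalf_double. Qed.
Lemma trans_ev k v : trans (ev k) v = if v.2 then (if v.1 then (Qel k)^-1 else Qel k)
     else (if v.1 then (Eel k)^-1 else Eel k).
Proof. by rewrite /trans /ev odd_double doubleK. Qed.
Lemma st_od k v : st (od k) v = (v.1, ~~ v.2). Proof. by rewrite /st /od /= odd_double. Qed.
Lemma st_ev k v : st (ev k) v = (~~ v.1, v.2). Proof. by rewrite /st /ev odd_double. Qed.
Notation v0 := (false, false).

Lemma tau_aw j : (j <= g')%N -> tau v0 (aw j) = gena j.
Proof.
move=> jg; rewrite /aw /=; do 4 rewrite ?(trans_od, st_od) /=.
have key (x y a : Gam) : x * ((((x * y^-1)^-1 * a^-1 * (x * y^-1)) * y)^-1 * (y * (x^-1 * 1))) = a.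
  by rewrite mulg1 !(invgM, invgK) !mulgA; do !rewrite mulgK || rewrite mulgVK || (rewrite mulgV mul1g).
by rewrite /Del (MelE jg); exact: key.
Qed.

Lemma tau_bw j : (j <= g')%N -> tau v0 (bw j) = genb j.
Proof.
move=> jg; rewrite /bw /=; do 4 rewrite ?(trans_od, st_od, trans_ev, st_ev) /=.
have key (x y b : Gam) : x * (y^-1 * (1 * (((x * y^-1)^-1 * b^-1 * (x * y^-1))^-1 * (y * (x^-1 * 1))))) = b.
  by rewrite mulg1 mul1g !(invgM, invgK) !mulgA; do !rewrite mulgK || rewrite mulgVK || (rewrite mulgV mul1g).
by rewrite (MelE jg); exact: key.
Qed.

Lemma fin_lw l : fin v0 (lw l) = v0.
Proof.
have fa j : fin v0 (aw j) = v0 by rewrite /aw /fin /= !st_od.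
have fb j : fin v0 (bw j) = v0 by rewrite /bw /fin /= !(st_od, st_ev).
have fr w : fin v0 w = v0 -> fin v0 (rev w) = v0 by move=> h; rewrite -{1}h fin_rev.
by rewrite /lw; case: (l.2); case: (l.1.2); rewrite ?fr ?fa ?fb.
Qed.

Lemma tau_lw l : tau v0 (lw l) = \pi_Gam [:: l].
Proof.
have ga (i : 'I_g) : gena (g' - i) = \pi_Gam [:: (i, false, false)].
  by rewrite /gena subKn ?inord_val // -ltnS.
have gb (i : 'I_g) : genb (g' - i) = \pi_Gam [:: (i, true, false)].
  by rewrite /genb subKn ?inord_val // -ltnS.
have tr' w : fin v0 w = v0 -> tau v0 (rev w) = (tau v0 w)^-1 by move=> h; rewrite -{1}h tau_rev.
case: l => -[i s] e; have := fin_lw (i, s, false); rewrite /lw [_.1.1]/= [_.1.2]/= [_.2]/=.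
case: s; case: e => h; rewrite ?tr' // ?tau_aw ?tau_bw ?leq_subr // ?ga ?gb //.
- by rewrite -(piV (i, true, false)).
- by rewrite -(piV (i, false, false)).
Qed.

(** Rewriting is a left inverse of the expansion into reflections, so lengths of reflection words
    will control lengths in the surface group. *)
Lemma tau_expw w : tau v0 (expw w) = \pi_Gam w /\ fin v0 (expw w) = v0.
Proof.
elim: w => [|l w [IH1 IH2]] //=; rewrite /expw /= -/(expw w) tau_cat fin_cat fin_lw tau_lw IH1 IH2.
by rewrite -piM.
Qed.

Lemma expw_lt w : all (fun i => i < (od g).+1)%N (expw w).
Proof.
elim: w => // l w IH; rewrite /expw /= all_cat -/(expw w) IH andbT /lw.
have a j : (j <= g')%N -> all (fun i => i < (od g).+1)%N (aw j).
  by move=> jg; rewrite /aw /od /=; apply/and5P; split => //; lia.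
have b j : (j <= g')%N -> all (fun i => i < (od g).+1)%N (bw j).
  by move=> jg; rewrite /bw /od /ev /=; do !(apply/andP; split => //); lia.
by case: (l.2); rewrite ?all_rev; case: (l.1.2); rewrite ?a ?b // leq_subr.
Qed.

Lemma expw_even w : ~~ odd (size (expw w)).
Proof.
elim: w => // l w IH; rewrite /expw /= size_cat oddD -/(expw w) (negbTE IH) addbF /lw.
by case: (l.2); rewrite ?size_rev; case: (l.1.2).
Qed.

Lemma expw_size w : (size (expw w) <= 6 * size w)%N.
Proof.
elim: w => // l w IH; rewrite /expw /= size_cat -/(expw w) mulnS leq_add // /lw.
by case: (l.2); rewrite ?size_rev; case: (l.1.2).
Qed.

Lemma word_length_le (x : Gam) w : \pi_Gam w = x -> (word_length x <= size w)%N.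
Proof.
move=> e; rewrite /word_length; case: ex_minnP => m _ h; apply: h; apply/asboolP; by exists w.
Qed.
Lemma word_length_wit (x : Gam) : exists2 w, size w = word_length x & \pi_Gam w = x.
Proof. by rewrite /word_length; case: ex_minnP => m /asboolP[w h1 h2] _; exists w. Qed.
Lemma word_lengthM (x y : Gam) : (word_length (x * y)%g <= word_length x + word_length y)%N.
Proof.
have [w <- <-] := word_length_wit x; have [w' <- <-] := word_length_wit y.
by rewrite -size_cat; apply: word_length_le; rewrite piM.
Qed.

Lemma tau_length n : exists C, forall v w, all (fun i => i < n)%N w -> (word_length (tau v w) <= C * size w)%N.
Proof.
pose C := (\max_(i < n) \max_(v : bool * bool) word_length (trans i v))%N; exists C => v w.
elim: w v => [|i w IH] v /=; first by move=> _; rewrite muln0; exact: (@word_length_le 1 [::]).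
move=> /andP[hi hw]; apply: leq_trans (word_lengthM _ _) _; rewrite mulnS leq_add ?IH //.
apply: (@leq_trans (\max_(v : bool * bool) word_length (trans i v))%N).
  exact: (leq_bigmax (F := fun v => word_length (trans i v))).
exact: (leq_bigmax (F := fun i : 'I_n => \max_(v : bool * bool) word_length (trans i v))%N (Ordinal hi)).
Qed.
End SurfaceWords.

(** * Words in involutions, with commutation up to sign *)

Section AbstractOps.
Variables (g' : nat) (T : Type) (op : nat -> T -> T).
Notation g := g'.+1.
Notation Gam := (surface_group g).
Notation n := (od g).+1.
Notation adj := (cadj g').
Hypothesis opK : forall i, involutive (op i).

Definition ops w X := foldr op X w.
Lemma ops_cat u v X : ops (u ++ v) X = ops u (ops v X). Proof. by rewrite /ops foldr_cat. Qed.
Lemma ops_revK w X : ops (rev w) (ops w X) = X.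
Proof. by elim: w X => //= i w IH X; rewrite rev_cons -cats1 ops_cat /= opK IH. Qed.

Section Anticommuting.
Variable neg : T -> T.
Hypothesis negK : involutive neg.
Hypothesis opN : forall i X, op i (neg X) = neg (op i X).
Hypothesis op_adj : forall i j X, (i < n)%N -> (j < n)%N -> adj i j -> op i (op j X) = neg (op j (op i X)).

Definition cc k B := op (od k) (op 0 (op (od k) B)).

Lemma ccK k B : cc k (cc k B) = B.
Proof. by rewrite /cc !opK. Qed.

Lemma cc_0 B : cc 0 B = neg (op 0 B).
Proof.
by rewrite /cc (op_adj _ _ _ (_ : adj (od 0) 0)) ?opK.
Qed.

Lemma cc_g B : cc g B = neg (op 0 B).
Proof.
have a : adj (od g) 0 by rewrite /cadj !eqxx !orbT.
by rewrite /cc (op_adj _ _ _ a) // opK.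
Qed.

(** The letter [ev j.+1] is adjacent to both [od j] and [od j.+1]; crossing the two costs two signs,
    which cancel. What remains telescopes over [j]. *)
Lemma ops_comm j B : (j <= g')%N ->
  ops (aw g' j ++ bw g' j ++ rev (aw g' j) ++ rev (bw g' j)) B =
  op (od g') (cc j.+1 (cc j (op (od g') B))).
Proof.
move=> jg; rewrite /aw /bw /rev /= !opK; congr (op _ _); rewrite /cc.
set Z := op (od g') B; congr (op _ (op _ _)).
have h1 : (ev j.+1 < n)%N by rewrite /ev /od; lia.
have h2 : (od j < n)%N by rewrite /od; lia.
have h3 : (od j.+1 < n)%N by rewrite /od; lia.
have a1 : adj (ev j.+1) (od j.+1) by rewrite /cadj /ev /od eqxx.
have a2 : adj (ev j.+1) (od j) by rewrite /cadj /ev /od doubleS eqxx orbT.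
by rewrite (op_adj (i := ev j.+1) (j := od j.+1)) // (op_adj (i := ev j.+1) (j := od j)) // !opN negK opK.
Qed.

(** The telescoping product of commutators leaves [cc g] and [cc 0] between two copies of [od g'].
    Since the letter 0 is adjacent to the first and to the last odd letter, both are [op 0] up to
    one sign, and the two signs cancel. *)
Lemma ops_relator B : ops (expw (relator g)) B = B.
Proof.
have ex (i : 'I_g) : expw [:: (i, false, false); (i, true, false); (i, false, true); (i, true, true)] =
    aw g' (g' - i) ++ bw g' (g' - i) ++ rev (aw g' (g' - i)) ++ rev (bw g' (g' - i)).
  by [].
pose f (i : 'I_g) : word g := [:: (i, false, false); (i, true, false); (i, false, true); (i, true, true)].
have ec u v : expw (u ++ v : word g) = expw u ++ expw v by rewrite /expw map_cat flatten_cat.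
pose F i X := ops (aw g' (g' - i) ++ bw g' (g' - i) ++ rev (aw g' (g' - i)) ++ rev (bw g' (g' - i))) X.
have FE m X : (m <= g')%N -> F (g' - m)%N X = op (od g') (cc m.+1 (cc m (op (od g') X))).
  by move=> mg; rewrite /F subKn // ops_comm.
have step (s : seq 'I_g) : ops (expw (flatten (map f s))) B = foldr F B (map val s).
  elim: s => // i s IH; have -> : flatten (map f (i :: s)) = f i ++ flatten (map f s) by [].
  by rewrite ec ops_cat ex IH.
rewrite (_ : relator g = flatten (map f (enum 'I_g))) // step val_enum_ord.
have gen m : (m <= g)%N -> foldr F B (iota (g - m) m) = op (od g') (cc m (cc 0 (op (od g') B))).
  elim: m => [_|m IH mg]; first by rewrite [LHS]/= ccK opK.
  have -> : iota (g - m.+1) m.+1 = (g' - m)%N :: iota (g - m) m by rewrite /= -subSn.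
  apply: (@eq_trans _ _ (F (g' - m)%N (foldr F B (iota (g - m) m)))) => //.
  by rewrite (IH (ltnW mg)) FE // opK ccK.
by have := gen g (leqnn _); rewrite subnn => ->; rewrite cc_g cc_0 !opN negK !opK.
Qed.
End Anticommuting.

Section Commuting.
Hypothesis op_comm : forall i j X, (i < n)%N -> (j < n)%N -> adj i j -> op i (op j X) = op j (op i X).
Variable Lam : Gam -> T -> T.
Hypothesis LamM : forall x y X, Lam (x * y)%g X = Lam x (Lam y X).
Hypothesis Lam1 : forall X, Lam 1%g X = X.
Definition rp x w := forall X, Lam x X = ops w X.
Hypothesis rp_gena : forall j, (j <= g')%N -> rp (gena g' j) (aw g' j).
Hypothesis rp_genb : forall j, (j <= g')%N -> rp (genb g' j) (bw g' j).

Lemma rpM x y u v : rp x u -> rp y v -> rp (x * y)%g (u ++ v).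
Proof. by move=> hx hy X; rewrite LamM hx hy ops_cat. Qed.
Lemma rp1 : rp 1%g [::]. Proof. exact: Lam1. Qed.
Lemma rpV x u : rp x u -> rp x^-1%g (rev u).
Proof.
move=> hx X; have h Y : Lam x^-1%g (Lam x Y) = Y by rewrite -LamM mulVg Lam1.
by rewrite -{1}[X](ops_revK (rev u)) revK -hx h.
Qed.
Lemma rp_eq x u v : (forall X, ops u X = ops v X) -> rp x u -> rp x v.
Proof. by move=> e h X; rewrite h. Qed.

Lemma rp_Mel j : (j <= g')%N -> rp (Mel g' j) [:: od g'; od j].
Proof.
move=> jg; rewrite -(subKn jg); move: (g' - j)%N (leq_subr j g') => t {j jg}.
elim: t => [_|t IH tg].
  by rewrite subn0 /Mel subnn; apply: rp_eq rp1 => X; rewrite /= opK.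
have lt : (g' - t.+1 < g')%N by rewrite -subSn // subSS leq_subr.
have eS : (g' - t.+1).+1 = (g' - t)%N by rewrite -subSn.
rewrite MelS //; apply: rp_eq (rpM (rpV (rp_gena (ltnW lt))) _); last by rewrite eS; exact: IH (ltnW tg).
by move=> X; rewrite /aw /rev /= -eS !opK.
Qed.

Lemma rp_Del j : (j <= g')%N -> rp (Del g' j) [:: od j.+1; od j].
Proof.
move=> jg; have hM := rp_Mel jg; apply: rp_eq (rpM (rpM (rpV hM) (rpV (rp_gena jg))) hM).
by move=> X; rewrite /aw /rev /= !opK.
Qed.

Lemma rp_Eel k : (k <= g)%N -> rp (Eel g' k) [:: ev k; 0%N].
Proof.
case: k => [_|j jg]; first by apply: rp_eq rp1 => X; rewrite /= opK.
have hM := rp_Mel jg; apply: rp_eq (rpM (rpM (rpV hM) (rpV (rp_genb jg))) hM).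
by move=> X; rewrite /bw /rev /= !opK.
Qed.

Lemma rp_Oel k : (k <= g)%N -> rp (Oel g' k) [:: od k; 1%N].
Proof.
elim: k => [_|j IH jg]; first by apply: rp_eq rp1 => X; rewrite /= opK.
apply: rp_eq (rpM (rp_Del jg) (IH (ltnW jg))) => X; by rewrite /= opK.
Qed.

Lemma op_evod k X : (k <= g)%N -> op (ev k) (op (od k) X) = op (od k) (op (ev k) X).
Proof.
move=> kg; apply: op_comm; rewrite ?/ev ?/od ?/cadj ?eqxx //; lia.
Qed.
Lemma op_evodS k X : (k < g)%N -> op (ev k.+1) (op (od k) X) = op (od k) (op (ev k.+1) X).
Proof.
move=> kg; apply: op_comm; rewrite ?/ev ?/od ?/cadj ?doubleS ?eqxx ?orbT //; lia.
Qed.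

Lemma rp_Pel k : (k <= g)%N -> rp (Pel g' k) [:: 0%N; od k; 1%N; 0%N].
Proof.
elim: k => [_|j IH jg]; first by apply: rp_eq rp1 => X; rewrite /= !opK.
have hE := rp_Eel jg.
apply: rp_eq (rpM (rpM (rpM (rpV hE) (rp_Del jg)) hE) (IH (ltnW jg))) => X.
rewrite /rev /= !opK; congr (op _ _).
by rewrite op_evod // op_evodS // !opK.
Qed.

Lemma rp_Qel k : (k <= g)%N -> rp (Qel g' k) [:: 1%N; ev k; 1%N; 0%N].
Proof.
move=> kg; apply: rp_eq (rpM (rpM (rpV (rp_Oel kg)) (rp_Eel kg)) (rp_Pel kg)) => X.
by rewrite /rev /= !opK -op_evod // opK.
Qed.

Definition sheet (v : bool * bool) : seq nat :=
  (if v.1 then [:: 0%N] else [::]) ++ (if v.2 then [:: 1%N] else [::]).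

Lemma rp_trans i v : (i < n)%N -> rp (trans g' i v) (sheet v ++ i :: rev (sheet (st i v))).
Proof.
move=> hi; have kg : (i./2 <= g)%N.
  by move: hi; rewrite /od ltnS => /half_leq; rewrite /= uphalf_double.
have ie := odd_double_half i.
have h01 X : op 0 (op 1 X) = op 1 (op 0 X) := op_evod X (leq0n g).
rewrite /trans /st /sheet; case oi: (odd i) ie => ie; rewrite ?add0n ?add1n in ie.
- have io : i = od i./2 by rewrite /od ie.
  case: v => -[] [] /=.
  + by apply: rp_eq (rpV (rp_Pel kg)) => X; rewrite /rev /= -io.
  + by apply: rp_eq (rp_Pel kg) => X; rewrite /rev /= -io.
  + by apply: rp_eq (rpV (rp_Oel kg)) => X; rewrite /rev /= -io.
  + by apply: rp_eq (rp_Oel kg) => X; rewrite /rev /= -io.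
- have io : i = ev i./2 by rewrite /ev ie.
  case: v => -[] [] /=.
  + by apply: rp_eq (rpV (rp_Qel kg)) => X; rewrite /rev /= -io.
  + by apply: rp_eq (rpV (rp_Eel kg)) => X; rewrite /rev /= -io.
  + by apply: rp_eq (rp_Qel kg) => X; rewrite /rev /= -io.
  + by apply: rp_eq (rp_Eel kg) => X; rewrite /rev /= -io.
Qed.

(** In the product of the transition words, the sheets between consecutive letters cancel. *)
Lemma rp_tau v w : all (fun i => i < n)%N w -> rp (tau g' v w) (sheet v ++ w ++ rev (sheet (fin v w))).
Proof.
elim: w v => [|i w IH] v /=.
  by move=> _; apply: rp_eq rp1 => X; rewrite ops_cat; have := ops_revK (rev (sheet v)) X; rewrite revK => ->.
move=> /andP[hi hw]; apply: rp_eq (rpM (rp_trans v hi) (IH (st i v) hw)) => X.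
move: (sheet v) (sheet (st i v)) (w ++ _) => A B W.
by rewrite -catA ops_cat [RHS]ops_cat /= ops_cat ops_cat ops_revK.
Qed.
End Commuting.
End AbstractOps.

(** * The representation *)

Section Representation.
Variable R : realType.
Local Open Scope complex_scope.
Local Open Scope sesquilinear_scope.
Local Open Scope quotient_scope.
Notation C := R[i].
Notation H := 'rV[R]_4.
Variables (g' : nat) (cx cy : nat -> R).
Notation g := g'.+1.
Notation Gam := (surface_group g).
Notation n := (od g).+1.
Notation polar := (polar cx cy).
Notation refl := (refl cx cy).
Notation refls := (refls cx cy).
Notation adj := (cadj g').
Notation inv_ops := (inv_ops cx cy).
Notation inv_op := (inv_op cx cy).
Notation mat := (mat cx cy).
Notation base_pt := (base_pt R).
Hypothesis adj_orth : forall i j, (i < n)%N -> (j < n)%N -> adj i j -> mk (polar i) (polar j) = 0.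
Hypothesis nadj_orth : forall i j, (i < n)%N -> (j < n)%N -> i != j -> ~~ adj i j -> 2 <= mk (polar i) (polar j).
Let adjC := @cadjC g'.

Definition rho (x : Gam) : 'M[C]_2 := mat (expw (repr x)).

Lemma ops_relatorE B : inv_ops (expw (relator g)) B = B.
Proof.
apply: (@ops_relator g' _ inv_op _ -%R) => //.
- exact: inv_opK.
- exact: opprK.
- exact: inv_opN.
- exact: (inv_op_adj adj_orth).
Qed.

Lemma ops_word_eq w w' : word_eq w w' -> forall B, inv_ops (expw w) B = inv_ops (expw (w' : word g)) B.
Proof.
have ec u v : expw (u ++ v : word g) = expw u ++ expw v by rewrite /expw map_cat flatten_cat.
elim=> {w w'} [w|w w' _ h|w w' w'' _ h _ h'|u v l|u v] B //.
- by rewrite h h'.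
- rewrite ec (ec [:: l; letter_inv l]) ec !inv_ops_cat; congr (inv_ops _ _).
  have -> : lw (letter_inv l) = rev (lw l).
    by rewrite /lw /letter_inv /=; case: (l.2) => /=; rewrite ?revK.
  exact: inv_ops_revK.
- by rewrite !ec !inv_ops_cat ops_relatorE.
Qed.

Lemma rho_pi w : rho (\pi_Gam w) = mat (expw w).
Proof. by rewrite /rho /mat; apply: ops_word_eq; exact: repr_piE. Qed.

Lemma rho_sl2 : sl2_representation rho.
Proof.
split=> [x|x y].
  by rewrite /rho det_mat -signr_odd (negbTE (expw_even _)) expr0.
rewrite -[x]reprK -[y]reprK; move: (repr x) (repr y) => u v.
rewrite -piM !rho_pi /expw map_cat flatten_cat -/(expw u) -/(expw v) /mat inv_ops_cat inv_opsE.
by rewrite (negbTE (expw_even _)).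
Qed.

Definition Lam x X : H := Lact (rho x) X.
Lemma LamM x y X : Lam (x * y)%g X = Lam x (Lam y X).
Proof. by rewrite /Lam (rho_sl2).2 LactM. Qed.
Lemma Lam1 X : Lam 1%g X = X.
Proof. by rewrite /Lam -pi_nil rho_pi /= Lact1. Qed.
Lemma Lam_pi w X : Lam (\pi_Gam w) X = refls (expw w) X.
Proof. by rewrite /Lam rho_pi Lact_mat // expw_even. Qed.

Theorem Lam_tau v w X : all (fun i => i < n)%N w ->
  Lam (tau g' v w) X = refls (sheet v ++ w ++ rev (sheet (fin v w))) X.
Proof.
move=> hw; apply: (@rp_tau g' _ refl _ _ Lam) => //.
- exact: reflK.
- by move=> i j Y; exact: (refl_comm adjC adj_orth).
- exact: LamM.
- exact: Lam1.
- move=> j jg Y; rewrite /gena Lam_pi /expw /= /lw /= inordK ?subKn ?cats0 // ltnS leq_subr //.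
- move=> j jg Y; rewrite /genb Lam_pi /expw /= /lw /= inordK ?subKn ?cats0 // ltnS leq_subr //.
Qed.
End Representation.

(** * Quasi-isometry *)

Section QuasiFuchsian.
Variable R : realType.
Local Open Scope complex_scope.
Local Open Scope sesquilinear_scope.
Local Open Scope quotient_scope.
Notation C := R[i].
Notation H := 'rV[R]_4.
Variables (g' : nat) (cx cy : nat -> R).
Notation g := g'.+1.
Notation Gam := (surface_group g).
Notation n := (od g).+1.
Notation polar := (polar cx cy).
Notation refl := (refl cx cy).
Notation refls := (refls cx cy).
Notation adj := (cadj g').
Notation base_pt := (base_pt R).
Notation rho := (@rho R g' cx cy).
Notation Lam := (@Lam R g' cx cy).
Hypothesis adj_orth : forall i j, (i < n)%N -> (j < n)%N -> adj i j -> mk (polar i) (polar j) = 0.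
Hypothesis nadj_orth : forall i j, (i < n)%N -> (j < n)%N -> i != j -> ~~ adj i j -> 2 <= mk (polar i) (polar j).
Let adjC := @cadjC g'.

Lemma herm_base : herm base_pt = 1%:M.
Proof. by apply: mx2P; rewrite hermE !mxE /=; apply/eqP; rewrite eq_complex /= ?v4E ?oppr0 !eqxx. Qed.

Lemma orbit_ptE (A : 'M[C]_2) : orbit_pt A = herm (Lact A base_pt).
Proof. by rewrite herm_Lact herm_base mulmx1. Qed.

Lemma tr_herm (X : H) : complex.Re (\tr (herm X)) = tr X.
Proof.
have l0 : fintype.lift (ord0 : 'I_2) (ord0 : 'I_1) = 1 by exact: val_inj.
by rewrite /mxtrace !big_ord_recl big_ord0 l0 !hermE /= addr0.
Qed.

Lemma hyp_distE (A B : 'M[C]_2) : A \in unitmx ->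
  hyp_dist (orbit_pt A) (orbit_pt B) = arcosh (tr (Lact (invmx A *m B) base_pt) / 2).
Proof.
move=> uA; congr (arcosh (_ / 2)); rewrite -tr_herm -orbit_ptE; congr (complex.Re _).
have uA' : A ^t* \in unitmx by rewrite map_unitmx unitmx_tr.
have -> : invmx (orbit_pt A) = (invmx A) ^t* *m invmx A.
  have uo : orbit_pt A \in unitmx by rewrite unitmx_mul uA.
  apply: (can_inj (mulmxK uo)); rewrite mulVmx // /orbit_pt mulmxA mulmxKV //.
  by rewrite -map_mxM -trmx_mul mulmxV // trmx1 map_mx1.
by rewrite /orbit_pt -mulmxA mxtrace_mulC trmx_mul map_mxM !mulmxA.
Qed.

Lemma rho_unit x : rho x \in unitmx.
Proof. by have [d _] := rho_sl2 adj_orth; rewrite unitmxE d unitr1. Qed.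

Lemma rho_quot x y : invmx (rho x) *m rho y = rho (x^-1 * y)%g.
Proof.
have [_ m] := rho_sl2 adj_orth; rewrite -{1}[y](mulVKg x) m mulmxA mulVmx ?mul1mx //; exact: rho_unit.
Qed.

Lemma arcosh_bounds (t : R) : 2 <= t -> ln (t / 2) <= arcosh (t / 2) /\ arcosh (t / 2) <= ln t.
Proof.
move=> t2; have s0 := sqrtr_ge0 ((t / 2) ^+ 2 - 1).
have h1 : 0 <= (t / 2) ^+ 2 - 1 by nra.
have s1 : Num.sqrt ((t / 2) ^+ 2 - 1) <= t / 2.
  have : Num.sqrt ((t / 2) ^+ 2 - 1) <= Num.sqrt ((t / 2) ^+ 2) by rewrite ler_wsqrtr // gerBl.
  by rewrite sqrtr_sqr ger0_norm //; lra.
by rewrite /arcosh; split; rewrite ler_ln ?posrE; lra.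
Qed.

(** The cocycle [tau] respects the cancellations of [play_reduce], so any word that represents [x]
    may be reduced to a legal one. *)
Lemma play_word (x : Gam) : exists2 w, play n cx cy w & tau g' (false, false) w = x.
Proof.
have [e _] := tau_expw (repr x : word g); rewrite reprK in e; rewrite -e.
have red w : all (fun i => i < n)%N w -> exists2 w', play n cx cy w' & forall v, tau g' v w = tau g' v w'.
  apply: (play_reduce adjC adj_orth nadj_orth (E := fun w w' => forall v, tau g' v w = tau g' v w')) => //.
  - by move=> w1 w2 w3 h1 h2 v; rewrite h1.
  - by move=> b w1 w2 _ h v; rewrite /= h.
  - by move=> a y u an yn un ay v; exact: tau_move.
by have [w' pw' ->] := red _ (expw_lt (repr x)); exists w'.
Qed.

Lemma sheet_lt v : all (fun i => i < n)%N (rev (sheet v)).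
Proof. by rewrite all_rev; case: v => -[] []. Qed.

(** A legal word for [x] is at least as long as [x] up to a constant, and makes the trace
    exponential in its length; the sheet appended on the right costs only a bounded factor. *)
Lemma trace_lower : exists c N, [/\ 0 < c, (0 < N)%N & forall x : Gam, exists k : nat,
  (word_length x <= N * k)%N /\ c * 2 ^+ k <= tr (Lam x base_pt)].
Proof.
have [Ct hCt] := tau_length g' n.
have shift v := tr_refls_shift cx cy (sheet_lt v).
have [D D0 hD] : exists2 D, 0 < D & forall v w,
    tr (refls w base_pt) <= D * tr (refls (w ++ rev (sheet v)) base_pt).
  have [C1 p1 h1] := shift (false, false); have [C2 p2 h2] := shift (true, false).
  have [C3 p3 h3] := shift (false, true); have [C4 p4 h4] := shift (true, true).
  exists (C1 + C2 + C3 + C4); first by rewrite !addr_gt0.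
  move=> v w; have pt u : 0 <= tr (refls u base_pt) by apply/psd_tr_ge0/psd_refls.
  have up Ci u : Ci <= C1 + C2 + C3 + C4 -> tr (refls w base_pt) <= Ci * tr (refls u base_pt) ->
      tr (refls w base_pt) <= (C1 + C2 + C3 + C4) * tr (refls u base_pt).
    by move=> hc h; apply: le_trans h _; rewrite ler_wpM2r.
  by case: v => -[] []; [apply: up (h4 w)|apply: up (h2 w)|apply: up (h3 w)|apply: up (h1 w)]; lra.
exists (D^-1 / 4), (Ct * n).+1; split=> [|//|x]; first by rewrite divr_gt0 // invr_gt0.
have [w pw e] := play_word x; have wn := play_all pw.
have [k hk tk] := play_trace adjC adj_orth nadj_orth (ltn0Sn _) pw.
exists k; split.
  have := hCt (false, false) w wn; rewrite e => h; apply: leq_trans h _.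
  by apply: (@leq_trans (Ct * (n * k))); [rewrite leq_mul2l hk orbT | rewrite mulnA leq_mul2r leqnSn orbT].
rewrite -e (Lam_tau adj_orth) // [sheet (false, false) ++ _]/(_ ++ rev (sheet _)).
have := hD (fin (false, false) w) w; move: (tr (refls (_ ++ _) _)) => T h.
have D0' := D0; rewrite -(ler_pM2l D0) (_ : D * (D^-1 / 4 * 2 ^+ k) = 2 ^+ k / 4); last first.
  by field; rewrite gt_eqF.
exact: le_trans tk h.
Qed.

Lemma trace_upper : exists2 D, 1 <= D & forall x : Gam, tr (Lam x base_pt) <= 2 * D ^+ (6 * word_length x).
Proof.
have [D D1 hD] : exists2 D, 1 <= D & forall i, (i < n)%N -> forall X : H, psd X -> tr (refl i X) <= D * tr X.
  move: n => m; elim: m => [|m [D D1 hD]]; first by exists 1.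
  have [C C0 hC] := tr_refl_le cx cy m; exists (D + C); first by rewrite ler_wpDr // ltW.
  move=> i; rewrite ltnS leq_eqVlt => /orP[/eqP ->|hi] X pX; have t0 := psd_tr_ge0 pX.
    have := hC _ (psd_refl cx cy m pX); rewrite reflK => h; apply: le_trans h _.
    by rewrite ler_wpM2r // lerDr; lra.
  by apply: le_trans (hD i hi X pX) _; rewrite ler_wpM2r // lerDl ltW.
exists D => // x; have [w <- <-] := word_length_wit x; rewrite (Lam_pi adj_orth).
have D0 : 0 <= D by lra.
apply: (@le_trans _ _ (2 * D ^+ size (expw w))); last first.
  by rewrite ler_pM2l // ler_weXn2l // expw_size.
elim: (expw w) (expw_lt w) => [_|i u IH /= /andP[hi hu]].
  by rewrite /= expr0 /tr !v4E; lra.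
have := hD i hi _ (psd_refls cx cy u); have := IH hu => h1 h2; apply: le_trans h2 _.
by rewrite exprS mulrCA ler_wpM2l.
Qed.

Lemma tr_ge2 (X : H) : psd X -> qd X = 1 -> 2 <= tr X.
Proof.
move=> [x0 x1 _]; rewrite /qd /tr => q.
have := sqr_ge0 (X 0 0 - X 0 1); have := sqr_ge0 (X 0 2); have := sqr_ge0 (X 0 3) => a b e.
by rewrite -(@ler_pXn2r _ 2) ?nnegrE ?addr_ge0 //; lra.
Qed.

(** The sum of the constants of the two inequalities, so that one multiplier serves both; the last
    term keeps it positive. *)
Definition qi_mult (D : R) (N : nat) : R := N%:R / ln 2 + 6 * ln D + 1.
Lemma ln2_gt0 : 0 < ln (2 : R). Proof. by rewrite ln_gt0 // ltr1n. Qed.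
Lemma qi_mult_gt0 D N : 1 <= D -> (0 < N)%N -> 0 < qi_mult D N.
Proof.
move=> D1 N0; have l2 := ln2_gt0; have lD : 0 <= ln D by rewrite ln_ge0.
have Nl : 0 < N%:R / ln 2 :> R by rewrite divr_gt0 // ltr0n.
by rewrite /qi_mult; lra.
Qed.

Lemma qi_bounds (c D t d : R) (N k l : nat) : 0 < c -> (0 < N)%N -> 1 <= D -> 2 <= t -> (l <= N * k)%N ->
  c * 2 ^+ k <= t -> t <= 2 * D ^+ (6 * l) -> ln (t / 2) <= d -> d <= ln t ->
  let c0 := `|ln (c / 2)| + ln 2 in
  (qi_mult D N)^-1 * l%:R - c0 <= d /\ d <= qi_mult D N * l%:R + c0.
Proof.
move=> c0 N0 D1 t2 lk tk hz b1 b2 c1; have K0 := qi_mult_gt0 D1 N0.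
have l2 := ln2_gt0; have lD : 0 <= ln D by rewrite ln_ge0.
have t0 : 0 < t by lra.
have D0 : 0 < D by lra.
have {}lk : l%:R <= N%:R * k%:R :> R by rewrite -natrM ler_nat.
split.
- have h1 : ln (c / 2) + k%:R * ln 2 <= ln (t / 2).
    have p2 : 0 < 2 ^+ k :> R by rewrite exprn_gt0.
    have p1 : 0 < c / 2 by rewrite divr_gt0.
    rewrite mulr_natl -lnXn // -lnM ?posrE // ler_ln ?posrE ?mulr_gt0 ?divr_gt0 //.
    by rewrite mulrAC ler_pM2r ?invr_gt0.
  have h2 : (qi_mult D N)^-1 * l%:R <= k%:R * ln 2.
    rewrite mulrC ler_pdivrMr //; apply: le_trans lk _; rewrite /qi_mult.
    have -> : k%:R * ln 2 * (N%:R / ln 2 + 6 * ln D + 1) = N%:R * k%:R + k%:R * ln 2 * (6 * ln D + 1).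
      by field; rewrite gt_eqF.
    by rewrite lerDl; apply: mulr_ge0; [apply: mulr_ge0 => //; exact: ltW | lra].
  have := ler_norm (- ln (c / 2)); rewrite normrN /c1; lra.
- have h1 : ln t <= ln 2 + 6 * l%:R * ln D.
    apply: (@le_trans _ _ (ln (2 * D ^+ (6 * l)))).
      by rewrite ler_ln // posrE mulr_gt0 // exprn_gt0.
    have -> : 6 * l%:R * ln D = ln D *+ (6 * l) by rewrite -[RHS]mulr_natl natrM.
    by rewrite lnM ?posrE ?exprn_gt0 // lerD2l lnXn.
  have h2 : 6 * l%:R * ln D <= qi_mult D N * l%:R.
    have -> : 6 * l%:R * ln D = (6 * ln D) * l%:R by ring.
    have Nl : 0 < N%:R / ln 2 :> R by rewrite divr_gt0 // ltr0n.
    by rewrite ler_wpM2r ?ler0n // /qi_mult; lra.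
  have := normr_ge0 (ln (c / 2)); rewrite /c1; lra.
Qed.

Lemma rho_dist x y : hyp_dist (orbit_pt (rho x)) (orbit_pt (rho y)) =
  arcosh (tr (Lam (x^-1 * y)%g base_pt) / 2).
Proof.
exact: (eq_trans (hyp_distE (rho y) (rho_unit x))
  (congr1 (fun A => arcosh (tr (Lact A base_pt) / 2)) (rho_quot x y))).
Qed.

Theorem rho_quasi_fuchsian : quasi_fuchsian rho.
Proof.
have [c [N [c0 N0 hl]]] := trace_lower; have [D D1 hu] := trace_upper.
exists (qi_mult D N), (`|ln (c / 2)| + ln 2); split=> [||x y]; first exact: qi_mult_gt0.
  by rewrite addr_ge0 // ltW // ln2_gt0.
move=> l d; have [k [hk tk]] := hl (x^-1 * y)%g; have hz := hu (x^-1 * y)%g.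
have t2 : 2 <= tr (Lam (x^-1 * y)%g base_pt).
  apply: tr_ge2; first by apply: psd_Lact; [exact: (rho_sl2 adj_orth).1 | exact: psd_base].
  by rewrite /Lam qd_Lact ?(rho_sl2 adj_orth).1 // /qd !v4E; ring.
have [b1 b2] := arcosh_bounds t2.
have := qi_bounds c0 N0 D1 t2 hk tk hz b1 b2; rewrite -rho_dist; exact: id.
Qed.

(** The trace after a word is the product of [X] with the orbit point of the reversed word. *)
Lemma tame_good X : tame n cx cy X -> good Lam X.
Proof.
move=> [K K0 hK]; exists K^-1; first by rewrite invr_gt0.
move=> a; have E Y : Lam a Y = refls (expw (repr a)) Y by rewrite -(Lam_pi adj_orth) reprK.
have o : org R = 2^-1 *: base_pt by apply: rV4P; rewrite !v4E; ring.
rewrite !E o reflsZ trZ; move: (expw _) (expw_lt (repr a)) => u hu.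
have e : tr (refls u X) = mk (refls (rev u) base_pt) X by rewrite tr_mk mkC mk_refls mkC.
have := hK (rev u); rewrite all_rev => /(_ hu); rewrite tr_refls_rev -e => h.
rewrite ler_pdivrMl //; apply: le_trans h; have := psd_tr_ge0 (psd_refls cx cy u); lra.
Qed.

(** The product of two reflections may lie outside the surface group, but its square returns to the
    same sheet. The eigenvalue [m ^+ 2] differs from 1, so that the square is not trivial. *)
Lemma loxodromic a c X m : (a < n)%N -> (c < n)%N -> refl a (refl c X) = m *: X -> m ^+ 2 != 1 -> X != 0 ->
  exists2 x : Gam, x <> 1%g & Lam x X = m ^+ 2 *: X.
Proof.
move=> an cn e m1 X0; have h v : fin v [:: a; c; a; c] = v.
  by rewrite /fin /= (st_comm c a) stK stK.
have E : Lam (tau g' (false, false) [:: a; c; a; c]) X = m ^+ 2 *: X.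
  rewrite (Lam_tau adj_orth); last by rewrite /= an cn.
  by rewrite h /= e !reflZ e scalerA.
exists (tau g' (false, false) [:: a; c; a; c]) => // x1; rewrite x1 (Lam1 adj_orth) in E.
case/eqP: m1; apply/eqP; rewrite -subr_eq0; have : (m ^+ 2 - 1) *: X = 0 by rewrite scalerBl -E scale1r subrr.
by move/eqP; rewrite scaler_eq0 (negbTE X0) orbF.
Qed.
End QuasiFuchsian.

(** * The path of other endpoints *)

Section OtherEnds.
Variable R : realType.
Notation M := 'rV[R]_2.
Notation H := 'rV[R]_4.

Definition sqn (z : M) : R := z 0 0 ^+ 2 + z 0 1 ^+ 2.

(* The boundary point [z : 1] of hyperbolic space, on the affine slice of trace 1. *)
Definition bpt (z : M) : H := (sqn z + 1)^-1 *: v4 (sqn z) 1 (z 0 0) (z 0 1).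

Lemma sqn1_gt0 z : 0 < sqn z + 1.
Proof. by rewrite /sqn; have := sqr_ge0 (z 0 0); have := sqr_ge0 (z 0 1); lra. Qed.

Lemma bpt_bd z : bd (bpt z).
Proof.
have p := sqn1_gt0 z; have q0 : qd (bpt z) = 0.
  by rewrite /qd /bpt !v4E; move: p; rewrite /sqn => p; field; rewrite gt_eqF.
split=> //; apply: ball_closed_boundary; last by rewrite q0.
by rewrite /tr /bpt !v4E; field; rewrite gt_eqF.
Qed.

Lemma bpt_inj : injective bpt.
Proof.
move=> z w e; have p := sqn1_gt0 z; have q := sqn1_gt0 w.
have e1 := congr1 (fun X : H => X 0 1) e; rewrite /bpt !v4E !mulr1 in e1.
have e1' := invr_inj e1.
have e2 := congr1 (fun X : H => X 0 2) e; have e3 := congr1 (fun X : H => X 0 3) e.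
rewrite /bpt !v4E e1' in e2 e3; have n0 : (sqn w + 1)^-1 != 0 by rewrite invr_neq0 // gt_eqF.
by apply: rV2P; [apply: (mulfI n0) e2 | apply: (mulfI n0) e3].
Qed.

Lemma bpt1_neq0 z : bpt z 0 1 != 0.
Proof. by rewrite /bpt !v4E mulr1 invr_neq0 // gt_eqF // sqn1_gt0. Qed.

Lemma cat_bpt (T : topologicalType) (f : T -> M) t : cat f t -> cat (fun s => bpt (f s)) t.
Proof.
move=> cf; have cq : cat (fun s => sqn (f s)) t by rewrite /sqn; ct.
have cv : cat (fun s => v4 (sqn (f s)) 1 (f s 0 0) (f s 0 1)) t by apply: cat_v4; ct.
by rewrite /bpt; ct; rewrite gt_eqF // sqn1_gt0.
Qed.

Variables (G : groupType) (act : G -> M -> M) (L : G -> H -> H) (on : M -> H -> Prop).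
Hypothesis lf : leaf_system on.
Hypothesis la : leaf_action act L on.
Hypothesis ld : leaf_dir on.
Variable X0 : M -> H.
Hypothesis cX0 : continuous X0.
Hypothesis bX0 : forall x, ball_open (X0 x).
Hypothesis oX0 : forall x, on x (X0 x).

(** The base point of the leaf through [X], with the dummy value 0 when there is none. *)
Definition lv (X : H) : M := xget 0 [set x | on x X].

Lemma lv_on x X : on x X -> on (lv X) X.
Proof. by move=> o; rewrite /lv; case: xgetP => [y -> //|/(_ x)]; case. Qed.

Lemma cat_lv (T : topologicalType) (f : T -> H) t : cat f t -> (forall s, ball_closed (f s)) ->
  on (lv (f t)) (f t) -> (\forall s \near t, on (lv (f s)) (f s)) -> cat (fun s => lv (f s)) t.
Proof.
move=> cf bf o nn; apply/cvgrPdist_lt => e e0.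
have [d d0 hd] := on_continuous lf la (bf t) o e0.
have cg : cat (fun s => d - `|f s - f t|) t by ct.
have g0 : 0 < d - `|f t - f t| by rewrite subrr normr0 subr0.
apply: filterS2 (near_gt0 cg g0) nn => s; rewrite subr_gt0 => h os.
by rewrite distrC; exact: hd (bf s) h os.
Qed.

Definition shone (z : M) := exists x, on x (bpt z).
Definition kap (m : M) (t : R) : M := m + v2 0 (t - 2^-1).
(** Other end of the leaf through a point of the unit vertical segment centred at [m]. No leaf
    passes through the two extremities in the case of interest; the point itself is taken there,
    which is the continuous choice by [end_limit]. *)
Definition Fo (m : M) (t : R) : H :=
  let X := bpt (kap m t) in if (0 < t) && (t < 1) then oth X0 (lv X) X else X.
Record kgood (m : M) : Prop := {
  kg_int : forall t, 0 < t -> t < 1 -> shone (kap m t);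
  kg_0 : forall x, ~ on x (bpt (kap m 0));
  kg_1 : forall x, ~ on x (bpt (kap m 1)) }.

Lemma cat_kap (T : topologicalType) (m : T -> M) (f : T -> R) t : cat m t -> cat f t ->
  cat (fun s => kap (m s) (f s)) t.
Proof.
move=> cm cf; have c : cat (fun s => v2 0 (f s - 2^-1)) t by apply: cat_v2; ct.
by rewrite /kap; ct.
Qed.

Lemma Fo_bd m t : bd (Fo m t).
Proof. by rewrite /Fo; case: ifP => _; [apply: oth_bd => //; exact: bpt_bd | exact: bpt_bd]. Qed.

Lemma Fo_end m t : t = 0 \/ t = 1 -> Fo m t = bpt (kap m t).
Proof. by rewrite /Fo => -[->|->]; rewrite ltxx ?andbF. Qed.

Lemma Fo_int m t x : 0 < t -> t < 1 -> on x (bpt (kap m t)) -> Fo m t = oth X0 x (bpt (kap m t)).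
Proof.
move=> t0 t1 o; rewrite /Fo t0 t1 /=; congr (oth X0 _ _).
exact: (on_unique lf la (bpt_bd _).1 (lv_on o) o).
Qed.

Lemma Fo_cont_end m t : kgood m -> (forall x, ~ on x (bpt (kap m t))) -> Fo m t = bpt (kap m t) -> cat (Fo m) t.
Proof.
move=> km off e; apply/cvgrPdist_lt => eps e0.
have [d d0 hd] := end_limit lf la (bpt_bd _) off e0.
have cK : cat (fun s => bpt (kap m s)) t by apply: cat_bpt; apply: cat_kap; ct.
have c1 : cat (fun s => d - `|bpt (kap m s) - bpt (kap m t)|) t by ct.
have c2 : cat (fun s => eps - `|bpt (kap m s) - bpt (kap m t)|) t by ct.
have h1 : 0 < d - `|bpt (kap m t) - bpt (kap m t)| by rewrite subrr normr0 subr0.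
have h2 : 0 < eps - `|bpt (kap m t) - bpt (kap m t)| by rewrite subrr normr0 subr0.
apply: filterS2 (near_gt0 c1 h1) (near_gt0 c2 h2) => s; rewrite !subr_gt0 => k1 k2.
rewrite e distrC /Fo; case: ifP => [/andP[s0 s1]|//].
have [x o] := kg_int km s0 s1; have ol := lv_on o.
apply: (hd _ _ _ (bpt_bd _).1 _ ol _ k1); first exact: (oth_bd bX0 _ (bpt_bd _)).1.
exact: (oth_on lf oX0).
Qed.

Lemma Fo_cont m : kgood m -> continuous (Fo m).
Proof.
move=> km t; change (cat (Fo m) t).
have cK s : cat (fun s => bpt (kap m s)) s by apply: cat_bpt; apply: cat_kap; ct.
have [->|t0] := eqVneq t 0; first by apply: Fo_cont_end => //; [exact: kg_0 | apply: Fo_end; left].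
have [->|t1] := eqVneq t 1; first by apply: Fo_cont_end => //; [exact: kg_1 | apply: Fo_end; right].
have nr (a : R -> R) : continuous a -> 0 < a t -> \forall s \near t, 0 < a s.
  by move=> ca; apply: near_gt0; exact: ca.
have [tn|tp] := ltP t 0.
  apply: (cat_near (cK t)); have := nr (fun s => - s) ltac:(ct); rewrite oppr_gt0 => /(_ tn).
  by apply: filterS => s; rewrite oppr_gt0 /Fo => h; rewrite ltNge (ltW h).
have [tg|tl] := ltP 1 t.
  apply: (cat_near (cK t)); have := nr (fun s => s - 1) ltac:(ct); rewrite subr_gt0 => /(_ tg).
  by apply: filterS => s; rewrite subr_gt0 /Fo => h; rewrite (ltNge s) (ltW h) andbF.
have t0' : 0 < t by rewrite lt_neqAle eq_sym t0.
have t1' : t < 1 by rewrite lt_neqAle t1.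
have nn : \forall s \near t, 0 < s < 1.
  have := nr (fun s => s) ltac:(ct) t0'; have := nr (fun s => 1 - s) ltac:(ct).
  by rewrite subr_gt0 => /(_ t1'); apply: filterS2 => s; rewrite subr_gt0 => -> ->.
apply: (@cat_near _ _ (fun s => oth X0 (lv (bpt (kap m s))) (bpt (kap m s)))).
  apply: (cat_oth cX0 bX0 (cK t) _ (bpt_bd _)); apply: cat_lv => //.
  - by move=> s; case: (bpt_bd (kap m s)).
  - by have [x] := kg_int km t0' t1'; exact: lv_on.
  - by apply: filterS nn => s /andP[s0 s1]; have [x] := kg_int km s0 s1; exact: lv_on.
by apply: filterS nn => s; rewrite /Fo => ->.
Qed.

Variable S : R -> M.
Hypothesis cS : continuous S.
Hypothesis oS : forall s, shone (S s).

(** The vertical segment down to [S s1], the curve [S], and the vertical segment at [S s2] form a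
    path of points on leaves; by [oth_path] it cannot join the two ends of one leaf. *)
Lemma connected_ends (s1 t : R) x (s2 d : R) : kgood (S s1) -> 0 < t -> t < 1 ->
  (forall c, 0 <= c -> c <= 1 -> shone (S s2 + v2 0 (c * d))) ->
  on x (bpt (kap (S s1) t)) -> bpt (S s2 + v2 0 d) != oth X0 x (bpt (kap (S s1) t)).
Proof.
move=> km t0 t1 h2 o.
pose f r := v2 0 ((1 - cl (3 * r)) * (t - 2^-1)) + S (s1 + cl (3 * r - 1) * (s2 - s1)) + v2 0 (cl (3 * r - 2) * d).
have f0 : f 0 = kap (S s1) t.
  have [z1 z2 z3] : [/\ cl (3 * 0) = 0 :> R, cl (3 * 0 - 1) = 0 :> R & cl (3 * 0 - 2) = 0 :> R].
    by split; apply: cl_le0; lra.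
  rewrite /f z1 z2 z3 !mul0r addr0.
  by apply: rV2P; rewrite /kap !rvE; ring.
have f1 : f 1 = S s2 + v2 0 d.
  have [z1 z2 z3] : [/\ cl (3 * 1) = 1 :> R, cl (3 * 1 - 1) = 1 :> R & cl (3 * 1 - 2) = 1 :> R].
    by split; apply: cl_ge1; lra.
  rewrite /f z1 z2 z3 !mul1r subrr mul0r subrKC.
  by apply: rV2P; rewrite !rvE; ring.
have gf r : shone (f r).
  have [r1|r1] := leP (3 * r) 1.
    have -> : f r = kap (S s1) (2^-1 + (1 - cl (3 * r)) * (t - 2^-1)).
      have [z2 z3] : cl (3 * r - 1) = 0 /\ cl (3 * r - 2) = 0 by split; apply: cl_le0; lra.
      rewrite /f z2 z3 !mul0r addr0.
      by apply: rV2P; rewrite /kap !rvE; ring.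
    have /andP[c0 c1] := cl_itv (3 * r).
    by apply: (kg_int km); nra.
  have -> : f r = S (s1 + cl (3 * r - 1) * (s2 - s1)) + v2 0 (cl (3 * r - 2) * d).
    have z1 : cl (3 * r) = 1 by apply: cl_ge1; lra.
    rewrite /f z1 subrr mul0r.
    by apply: rV2P; rewrite !rvE; ring.
  have [r2|r2] := leP (3 * r) 2.
    have z3 : cl (3 * r - 2) = 0 by apply: cl_le0; lra.
    rewrite z3 mul0r.
    by rewrite (_ : v2 0 0 = 0) ?addr0 //; apply: rV2P; rewrite !rvE.
  have z2 : cl (3 * r - 1) = 1 by apply: cl_ge1; lra.
  by rewrite z2 mul1r subrKC; have /andP[c0 c1] := cl_itv (3 * r - 2); exact: h2.
have ccl (g : R -> R) s : cat g s -> cat (fun r => cl (g r)) s by move=> cg; exact: cat_cl.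
have cf : continuous f.
  move=> r; change (cat f r); rewrite /f.
  have k1 : cat (fun r : R => v2 0 ((1 - cl (3 * r)) * (t - 2^-1))) r.
    by apply: cat_v2; ct; apply: ccl; ct.
  have k2 : cat (fun r : R => v2 0 (cl (3 * r - 2) * d)) r by apply: cat_v2; ct; apply: ccl; ct.
  by ct; apply: ccl; ct.
rewrite -f1 -f0 in o *.
have -> : x = lv (bpt (f 0)) by exact: (on_unique lf la (bpt_bd _).1 o (lv_on o)).
have cb r : cat (fun s => bpt (f s)) r by apply: cat_bpt; exact: cf.
have ol r : on (lv (bpt (f r))) (bpt (f r)) by have [y] := gf r; exact: lv_on.
apply: (oth_path lf la ld cX0 bX0 oX0 (bpt_bd (kap (S s1) 0)) (bpt1_neq0 _) (kg_0 km)
  (f := fun r => bpt (f r)) (x := fun r => lv (bpt (f r)))).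
- by move=> r _.
- move=> r _; apply: (cat_lv (f := fun s => bpt (f s)) (cb r)) => [s||].
  + by case: (bpt_bd (f s)).
  + exact: ol.
  + by apply: filterS filterT => s _; exact: ol.
- by move=> r _; split => //; exact: bpt_bd.
Qed.

Lemma Fo_avoid (s1 t s : R) : kgood (S s1) -> 0 <= t -> t <= 1 -> Fo (S s1) t != bpt (S s).
Proof.
move=> km t0 t1; have [x oxs] := oS s.
have [e|n0] := eqVneq t 0.
  by apply/eqP; rewrite Fo_end ?e; [move=> h; apply: (kg_0 km (x := x)); rewrite h | left].
have [e|n1] := eqVneq t 1.
  by apply/eqP; rewrite Fo_end ?e; [move=> h; apply: (kg_1 km (x := x)); rewrite h | right].
have {}t0 : 0 < t by rewrite lt_neqAle eq_sym n0.
have {}t1 : t < 1 by rewrite lt_neqAle n1.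
have [y o] := kg_int km t0 t1; rewrite (Fo_int t0 t1 o) eq_sym.
have v0 : v2 0 0 = 0 :> M by apply: rV2P; rewrite !rvE.
have := @connected_ends s1 t y s 0 km t0 t1; rewrite v0 addr0; apply => // c _ _.
by rewrite mulr0 v0 addr0.
Qed.

(* Chords of distinct leaves are disjoint in the closed ball. *)
Lemma Fo_sep (s1 s2 t1 t al be c c' : R) : kgood (S s1) -> kgood (S s2) -> 0 < t1 -> t1 < 1 -> 0 <= t -> t <= 1 ->
  kap (S s2) t != kap (S s1) t1 -> 0 <= c -> 0 <= c' -> 0 < c + c' ->
  c *: bpt (kap (S s2) t) + c' *: Fo (S s2) t != al *: bpt (kap (S s1) t1) + be *: Fo (S s1) t1.
Proof.
move=> k1 k2 t10 t11 t0 t1l ne c0 c0' cc; apply/eqP => e.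
have [x1 o1] := kg_int k1 t10 t11; have F1 := Fo_int t10 t11 o1.
have on1 : on x1 (al *: bpt (kap (S s1) t1) + be *: Fo (S s1) t1).
  by apply: (lf_lin lf) => //; apply: (on_scale lf); rewrite F1; exact: (oth_on lf oX0).
have endc : Fo (S s2) t = bpt (kap (S s2) t) -> on x1 (bpt (kap (S s2) t)).
  move=> h; move: on1; rewrite -e h -scalerDl => /(on_scale lf (c + c')^-1).
  by rewrite scalerA mulVf ?scale1r // gt_eqF.
have [e0|n0] := eqVneq t 0.
  by apply: (kg_0 k2 (x := x1)); rewrite -{1}e0; apply: endc; apply: Fo_end; left.
have [e1|n1] := eqVneq t 1.
  by apply: (kg_1 k2 (x := x1)); rewrite -{1}e1; apply: endc; apply: Fo_end; right.
have {}t0 : 0 < t by rewrite lt_neqAle eq_sym n0.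
have {}t1l : t < 1 by rewrite lt_neqAle n1.
have [x2 o2] := kg_int k2 t0 t1l; have F2 := Fo_int t0 t1l o2.
have on2 : on x2 (c *: bpt (kap (S s2) t) + c' *: Fo (S s2) t).
  by apply: (lf_lin lf) => //; apply: (on_scale lf); rewrite F2; exact: (oth_on lf oX0).
have bZ : ball_closed ((c + c')^-1 *: (c *: bpt (kap (S s2) t) + c' *: Fo (S s2) t)).
  split; last first.
    have := (bpt_bd (kap (S s2) t)).1.2; have := (Fo_bd (S s2) t).1.2.
    move: (bpt _) (Fo _ _) => u v tu tv.
    by rewrite trZ trD !trZ tu tv !mulr1 mulVf // gt_eqF.
  apply: psdZ; first by rewrite invr_ge0 ltW.
  by apply: psdD; apply: psdZ => //; [exact: (bpt_bd _).1.1 | exact: (Fo_bd _ _).1.1].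
have x12 : x2 = x1.
  by apply: (on_unique lf la bZ); apply: (on_scale lf) => //; rewrite e.
rewrite x12 in o2.
have [h|h] := oth_unique lf ld bX0 oX0 (bpt_bd _) o1 (bpt_bd _) o2.
  by case/eqP: ne; exact: bpt_inj.
have hd c2 : 0 <= c2 -> c2 <= 1 -> shone (S s2 + v2 0 (c2 * (t - 2^-1))).
  move=> a0 a1; have := @kg_int _ k2 (2^-1 + c2 * (t - 2^-1)).
  by rewrite /kap [X in v2 0 X](_ : _ = c2 * (t - 2^-1)); [apply; nra | ring].
by have /eqP := connected_ends k1 t10 t11 hd o1; exact.
Qed.
End OtherEnds.

(** * Winding obstructions *)

Section Angles.
Variable R : realType.
Notation M := 'rV[R]_2.

Lemma dir_same (u v : M) a : dir u a -> dir v a -> exists2 c, 0 < c & u = c *: v.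
Proof.
move=> [r r0 ->] [s s0 ->]; exists (r / s); first by rewrite divr_gt0.
by rewrite scalerA divfK // gt_eqF.
Qed.

Lemma cos1_sin0 (D : R) : cos D = 1 -> sin D = 0.
Proof. by move=> c; have := cos2Dsin2 D; rewrite c expr1n => h; apply/eqP; rewrite -sqrf_eq0; apply/eqP; lra. Qed.

Lemma dir_shift (u : M) a D : dir u a -> cos D = 1 -> dir u (a + D).
Proof.
move=> [r r0 ->] c; exists r => //; rewrite /pol cosD sinD c (cos1_sin0 c).
by congr (_ *: v2 _ _); ring.
Qed.

Lemma dir_polar (u : M) a : dir u a -> exists2 r, 0 < r & u 0 0 = r * cos a /\ u 0 1 = r * sin a.
Proof. by move=> [r r0 ->]; exists r => //; rewrite /pol !rvE. Qed.

Lemma stay_lt (h : R -> R) a b c : continuous h -> a <= b -> (forall s, a <= s -> s <= b -> h s != c) ->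
  h a < c -> h b < c.
Proof.
move=> ch ab ne ha; rewrite ltNge; apply/negP => hb.
have [|s /andP[s0 s1] /eqP] := @ivt R h a b c ch ab; first by rewrite (ltW ha) hb.
by apply/negP; exact: ne.
Qed.

Lemma stay_gt (h : R -> R) a b c : continuous h -> a <= b -> (forall s, a <= s -> s <= b -> h s != c) ->
  c < h a -> c < h b.
Proof.
move=> ch ab ne ha; rewrite ltNge; apply/negP => hb.
have [|s /andP[s0 s1] /eqP] := @ivt R h a b c ch ab; first by rewrite (ltW ha) hb orbT.
by apply/negP; exact: ne.
Qed.

Lemma stay_in (h : R -> R) a b l r : continuous h ->
  (forall s, a <= s -> s <= b -> h s != l /\ h s != r) -> l < h a -> h a < r ->
  forall s, a <= s -> s <= b -> l < h s /\ h s < r.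
Proof.
move=> ch ne ha hr s s0 s1; split.
  by apply: (stay_gt ch s0) ha => x x0 x1; case: (ne x) => //; lra.
by apply: (stay_lt ch s0) hr => x x0 x1; case: (ne x) => //; lra.
Qed.

Lemma sin_sgn (x : R) : -pi < x -> x < pi -> [/\ (0 < sin x -> 0 < x), (sin x < 0 -> x < 0) & (0 < x -> 0 < sin x)].
Proof.
move=> x0 x1; split.
- move=> h; rewrite ltNge; apply/negP => hx.
  by have := @sin_ge0_pi R (- x); rewrite sinN => /(_ ltac:(apply/andP; split; lra)); lra.
- move=> h; rewrite ltNge; apply/negP => hx.
  by have := @sin_ge0_pi R x => /(_ ltac:(apply/andP; split; lra)); lra.
- by move=> h; apply: sin_gt0_pi; rewrite h.
Qed.

Lemma cos_half (x : R) : - pi <= x -> x <= pi -> 0 < cos x -> - (pi / 2) < x /\ x < pi / 2.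
Proof.
move=> x0 x1 cx; suff h (y : R) : 0 <= y -> y <= pi -> 0 < cos y -> y < pi / 2.
  have [y0|y0] := leP 0 x; first by split; [have := pi_gt0 R; lra | exact: h].
  split; last by have := pi_gt0 R; lra.
  by have := h (- x); rewrite cosN => /(_ ltac:(lra) ltac:(lra) cx); lra.
move=> y0 y1 cy; rewrite ltNge; apply/negP => hy.
have := @sin_ge0_pi R (y - pi / 2); rewrite sinB sin_pihalf cos_pihalf.
by move=> /(_ ltac:(apply/andP; split; lra)); lra.
Qed.

Lemma half_lift (f : R -> M) (th : R -> R) (u : M) : continuous th ->
  (forall s, 0 <= s <= 1 -> dir (f s) (th s)) -> (forall s, 0 <= s <= 1 -> 0 < dot (f s) u) ->
  `|th 1 - th 0| < pi.
Proof.
move=> ct d p; have i0 : 0 <= (0 : R) <= 1 by rewrite lexx ler01.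
apply: (@lift_noneg R f (fun=> f 0) th (fun=> th 0) 0 1) => //.
- by ct.
- by move=> s _; exact: d.
- move=> s c hs c0; apply/eqP => e; have := p s hs; have := p 0 i0; rewrite e /dot !rvE => h1.
  by rewrite !mulNr -!mulrA -opprD -mulrDr oppr_gt0 ltNge (ltW (mulr_gt0 c0 h1)).
- by rewrite subrr normr0 pi_gt0.
Qed.

(** If (a, b) never vanished on the square, its argument would lift. From a value in the left
    half-plane, the side t = 0 takes it through the positive vertical direction, and the side t = 1
    through the negative one, so at the corner (1, 1) the two routes disagree by 2 pi. *)
Lemma rect_cross (a b : R * R -> R) : continuous a -> continuous b ->
  (forall p, 0 <= p.1 <= 1 -> 0 <= p.2 <= 1 -> a p = 0 -> b p != 0) ->
  (forall t, 0 <= t <= 1 -> a (t, 0) < 0 /\ 0 < a (t, 1)) ->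
  (forall s, 0 <= s <= 1 -> (a (0, s) = 0 -> 0 < b (0, s)) /\ (a (1, s) = 0 -> b (1, s) < 0)) -> False.
Proof.
move=> ca cb nz hs ht; have p0 := pi_gt0 R.
have i0 : 0 <= (0 : R) <= 1 by rewrite lexx ler01.
have i1 : 0 <= (1 : R) <= 1 by rewrite lexx ler01.
have cf : continuous (fun p => v2 (a p) (b p)).
  by move=> p; apply: cat_v2; [exact: ca | exact: cb].
have fn0 p : 0 <= p.1 <= 1 -> 0 <= p.2 <= 1 -> v2 (a p) (b p) != 0.
  move=> h1 h2; apply/eqP => e; have e0 := congr1 (fun v : M => v 0 0) e.
  have e1 := congr1 (fun v : M => v 0 1) e; rewrite !rvE in e0 e1.
  by have := nz p h1 h2 e0; rewrite e1 eqxx.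
have [th0 [cth0 hth0]] := lift cf fn0.
have [a00 _] := hs 0 i0.
have dm : dir (v2 (- 1) 0 : M) pi.
  by exists 1; rewrite ?ltr01 // scale1r /pol cospi sinpi.
have [z0 [d0 l0 r0]] : exists z, [/\ dir (v2 (a (0, 0)) (b (0, 0))) z, pi / 2 < z & z < pi + pi / 2].
  have hd : 0 < dot (v2 (- 1) 0) (v2 (a (0, 0)) (b (0, 0))) by rewrite /dot !rvE; lra.
  have := dir_atan dm hd; set q := atan _ => h; exists (pi + q); split => //.
    by have := atan_gtNpi2 (crs (v2 (- 1) 0) (v2 (a (0, 0)) (b (0, 0))) / dot (v2 (- 1) 0) (v2 (a (0, 0)) (b (0, 0)))); rewrite -/q; lra.
  by have := atan_ltpi2 (crs (v2 (- 1) 0) (v2 (a (0, 0)) (b (0, 0))) / dot (v2 (- 1) 0) (v2 (a (0, 0)) (b (0, 0)))); rewrite -/q; lra.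
have cD := dir_cos (hth0 (0, 0) i0 i0) d0.
pose th p := th0 p + (z0 - th0 (0, 0)).
have cth : continuous th by rewrite /th; ct.
have hth p : 0 <= p.1 <= 1 -> 0 <= p.2 <= 1 -> exists2 r, 0 < r & a p = r * cos (th p) /\ b p = r * sin (th p).
  move=> h1 h2; have := dir_polar (dir_shift (hth0 p h1 h2) cD); rewrite !rvE; exact.
have th00 : th (0, 0) = z0 by rewrite /th; ring.
have c1 : continuous (fun s => th (0, s)) by ct.
have c2 : continuous (fun s => th (1, s)) by ct.
have c3 : continuous (fun t => th (t, 0)) by ct.
have c4 : continuous (fun t => th (t, 1)) by ct.
have cp2 : cos (pi / 2) = 0 :> R by exact: cos_pihalf.
have sp2 : sin (pi / 2) = 1 :> R by exact: sin_pihalf.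
have cq : cos (- (pi / 2)) = 0 :> R by rewrite cosN.
have cr : cos (pi + pi / 2) = 0 :> R by rewrite cosD cp2 sinpi; ring.
have sq : sin (- (pi / 2)) = -1 :> R by rewrite sinN sp2.
have sr : sin (pi + pi / 2) = -1 :> R by rewrite sinD cp2 sp2 sinpi cospi; ring.
have e2 : 2 * pi + pi / 2 = pi + (pi + pi / 2) :> R by ring.
have cz : cos (2 * pi + pi / 2) = 0 :> R by rewrite e2 cosD cr sinpi mul0r mulr0 subr0.
have sz : sin (2 * pi + pi / 2) = 1 :> R.
  by rewrite e2 sinD cr sr sinpi cospi mulr0 add0r mulrNN mulr1.
have A1 : - (pi / 2) < th (0, 1) /\ th (0, 1) < pi + pi / 2.
  apply: (@stay_in (fun s => th (0, s)) 0 1) => //; try (rewrite th00; lra).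
  move=> s s0 s1; have hs' : 0 <= s <= 1 by rewrite s0.
  have [r r0' [ea eb]] := hth (0, s) i0 hs'; have [k _] := ht s hs'.
  by split; apply/eqP => e; move: k; rewrite ea eb e ?cq ?cr mulr0 => /(_ erefl); rewrite ?sq ?sr; lra.
have A2 : - (pi / 2) < th (0, 1) /\ th (0, 1) < pi / 2.
  split; first by case: A1.
  have [r r0' [ea _]] := hth (0, 1) i0 i1; have [_] := hs 0 i0; rewrite ea pmulr_rgt0 // => cp.
  have [l r'] := A1; rewrite ltNge; apply/negP => g.
  have := @sin_ge0_pi R (th (0, 1) - pi / 2); rewrite sinB sp2 cp2 => /(_ ltac:(apply/andP; split; lra)); lra.
have A3 : pi / 2 < th (1, 0) /\ th (1, 0) < pi + pi / 2.
  apply: (@stay_in (fun t => th (t, 0)) 0 1) => //; try (rewrite th00; lra).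
  move=> s s0 s1; have hs' : 0 <= s <= 1 by rewrite s0.
  have [r r0' [ea _]] := hth (s, 0) hs' i0; have [k _] := hs s hs'.
  by split; apply/eqP => e; move: k; rewrite ea e ?cp2 ?cr mulr0 ltxx.
have A4 : pi / 2 < th (1, 1) /\ th (1, 1) < 2 * pi + pi / 2.
  apply: (@stay_in (fun s => th (1, s)) 0 1) => //; try lra; try by case: A3; lra.
  move=> s s0 s1; have hs' : 0 <= s <= 1 by rewrite s0.
  have [r r0' [ea eb]] := hth (1, s) i1 hs'; have [_ k] := ht s hs'.
  by split; apply/eqP => e; move: k; rewrite ea eb e ?cp2 ?cz mulr0 => /(_ erefl); rewrite ?sp2 ?sz; lra.
have A5 : - (pi / 2) < th (1, 1) /\ th (1, 1) < pi / 2.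
  apply: (@stay_in (fun t => th (t, 1)) 0 1) => //; try by case: A2; lra.
  move=> s s0 s1; have hs' : 0 <= s <= 1 by rewrite s0.
  have [r r0' [ea _]] := hth (s, 1) hs' i1; have [_ k] := hs s hs'.
  by split; apply/eqP => e; move: k; rewrite ea e ?cp2 ?cq mulr0 ltxx.
by case: A4; case: A5; lra.
Qed.
End Angles.

(** * A leaf with one end far away *)

Section FirstStep.
Variable R : realType.
Notation M := 'rV[R]_2.
Notation H := 'rV[R]_4.

Lemma bpt_affine (X : H) : bd X -> X 0 1 != 0 -> X = bpt (v2 (X 0 2 / X 0 1) (X 0 3 / X 0 1)).
Proof.
move=> [[_ t1] q0] n0; rewrite /tr /qd in t1 q0.
have e : (sqn (v2 (X 0 2 / X 0 1) (X 0 3 / X 0 1)) + 1)^-1 = X 0 1.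
  apply: invr_inj; rewrite invrK /sqn !rvE.
  have -> : (X 0 2 / X 0 1) ^+ 2 + (X 0 3 / X 0 1) ^+ 2 + 1 = (X 0 2 ^+ 2 + X 0 3 ^+ 2 + X 0 1 ^+ 2) / X 0 1 ^+ 2 by field.
  have -> : X 0 2 ^+ 2 + X 0 3 ^+ 2 + X 0 1 ^+ 2 = X 0 1.
    have -> : X 0 2 ^+ 2 + X 0 3 ^+ 2 = X 0 0 * X 0 1 by lra.
    by have -> : X 0 0 = 1 - X 0 1; [lra | ring].
  by field.
apply: rV4P; rewrite /bpt e !v4E ?rvE; try by field.
have -> : sqn (v2 (X 0 2 / X 0 1) (X 0 3 / X 0 1)) = (X 0 2 ^+ 2 + X 0 3 ^+ 2) / X 0 1 ^+ 2 by rewrite /sqn !rvE; field.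
have -> : X 0 2 ^+ 2 + X 0 3 ^+ 2 = X 0 0 * X 0 1 by lra.
by field.
Qed.

Variables (S : R -> M) (F : R -> H) (B sa sm sb : R).
Hypothesis cS : continuous S.
Hypothesis cF : continuous F.
Hypothesis bF : forall t, bd (F t).
Hypothesis F0 : F 0 = bpt (v2 0 (- 2^-1)).
Hypothesis F1 : F 1 = bpt (v2 0 2^-1).
Hypothesis av : forall t s, 0 <= t -> t <= 1 -> F t != bpt (S s).
Hypothesis B1 : 1 <= B.
Hypothesis SN : S 0 = - S 1.
Hypothesis SB : B ^+ 2 <= sqn (S 1).
Hypothesis sord : [/\ 0 <= sa, sa < sm, sm < sb & sb <= 1].
Hypothesis Sm : S sm = 0.
Hypothesis Spos : forall s, sa <= s -> s < sm -> 0 < S s 0 0.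
Hypothesis Sneg : forall s, sm < s -> s <= sb -> S s 0 0 < 0.
Hypothesis Saxis : forall s, 0 <= s -> s <= 1 -> s != sm -> S s 0 0 = 0 -> 4^-1 < sqn (S s).

(* Otherwise the other ends stay in a disc of radius B, and the angle psi(s) subtended at S s by the path F
   is a lift of (|S|^2 - 1/4, - S_x): it loses more than pi when S crosses the segment between the ends
   of F, although |psi| < pi at both extremities of S, which lie outside of the disc. *)
Lemma far_end : exists t, [/\ 0 < t, t < 1 & B ^+ 2 * F t 0 1 <= F t 0 0].
Proof.
apply: contrapT => hn; have p0 := pi_gt0 R; have [sa0 sam smb sb1] := sord.
have i0 : 0 <= (0 : R) <= 1 by rewrite lexx ler01.
have i1 : 0 <= (1 : R) <= 1 by rewrite lexx ler01.
have B2 : 1 <= B ^+ 2 by rewrite expr_ge1 // (le_trans ler01).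
have lt t : 0 <= t <= 1 -> F t 0 0 < B ^+ 2 * F t 0 1.
  move=> /andP[t0 t1]; have h := sqn1_gt0 (v2 0 2^-1 : M).
  have ends : t = 0 \/ t = 1 -> F t 0 0 < B ^+ 2 * F t 0 1.
    have k : 4^-1 < B ^+ 2 by lra.
    by move=> [->|->]; rewrite ?F0 ?F1 /bpt !v4E mulrCA ltr_pM2l ?invr_gt0 ?sqn1_gt0 // /sqn !rvE; lra.
  have [e|n0] := eqVneq t 0; first by apply: ends; left.
  have [e|n1] := eqVneq t 1; first by apply: ends; right.
  rewrite ltNge; apply/negP => le; apply: hn; exists t; split => //.
    by rewrite lt_neqAle eq_sym n0.
  by rewrite lt_neqAle n1.
have F1p t : 0 <= t <= 1 -> 0 < F t 0 1.
  move=> ht; have := lt t ht; have [[[a b _] _] _] := bF t => h.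
  by rewrite lt_neqAle b andbT; apply/eqP => e; move: h; rewrite -e mulr0; lra.
pose z t : M := v2 (F (cl t) 0 2 / F (cl t) 0 1) (F (cl t) 0 3 / F (cl t) 0 1).
have cz : continuous z.
  move=> t; have cFt : cat (fun t => F (cl t)) t.
    by apply: (cat_comp (h := F) (f := @cl R)); [exact: cF | exact: (cat_cl (f := id) (@cat_id _ t))].
  change (cat (fun t => v2 (F (cl t) 0 2 / F (cl t) 0 1) (F (cl t) 0 3 / F (cl t) 0 1)) t).
  by apply: cat_v2; ct; rewrite gt_eqF // F1p // cl_itv.
have hz t : 0 <= t <= 1 -> F t = bpt (z t).
  by move=> ht; rewrite /z cl_id //; apply: bpt_affine => //; rewrite gt_eqF // F1p.
have nz t : 0 <= t <= 1 -> sqn (z t) < B ^+ 2.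
  move=> ht; have := lt t ht; rewrite {1 2}(hz t ht) /bpt !v4E mulr1.
  by rewrite mulrC -subr_gt0 -mulrBl pmulr_lgt0 ?subr_gt0 // invr_gt0 sqn1_gt0.
have z0 : z 0 = v2 0 (- 2^-1) by apply: bpt_inj; rewrite -hz.
have z1 : z 1 = v2 0 2^-1 by apply: bpt_inj; rewrite -hz.
have cf : continuous (fun p : R * R => z p.1 - S p.2) by ct.
have fn0 p : 0 <= p.1 <= 1 -> 0 <= p.2 <= 1 -> z p.1 - S p.2 != 0.
  move=> h1 _; rewrite subr_eq0; apply/eqP => e.
  by have /andP[a b] := h1; have := av p.2 a b; rewrite (hz _ h1) e eqxx.
have [th [cth hth]] := lift cf fn0.
pose psi s := th (1, s) - th (0, s).
have cpsi : continuous psi by rewrite /psi; ct.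
have far s : B ^+ 2 <= sqn (S s) -> 0 <= s <= 1 -> `|psi s| < pi.
  move=> hB hs; apply: (@half_lift _ (fun t => z t - S s) (fun t => th (t, s)) (- S s)).
  - by ct.
  - by move=> t ht; exact: (hth (t, s)).
  - move=> t ht; move: (nz t ht) hB; rewrite /dot /sqn; move: (z t) (S s) => w q; rewrite !rvE.
    move: (w 0 0) (w 0 1) (q 0 0) (q 0 1) => x y u v h2 h1.
    by have := sqr_ge0 (x - u); have := sqr_ge0 (y - v); lra.
have /andP[e0l e0r] : - pi < psi 0 < pi.
  by rewrite -ltr_norml; apply: far => //; rewrite SN /sqn !rvE !sqrrN.
have /andP[e1l e1r] : - pi < psi 1 < pi by rewrite -ltr_norml; apply: far.
have V s : 0 <= s <= 1 -> exists2 r, 0 < r & - S s 0 0 = r * sin (psi s).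
  move=> hs; have [r r0 h] := dir_crs (hth (0, s) i0 hs) (hth (1, s) i1 hs).
  by exists r => //; rewrite -h /= z0 z1 /crs !rvE; field.
have V' s : 0 <= s <= 1 -> exists2 r, 0 < r & sqn (S s) - 4^-1 = r * cos (psi s).
  move=> hs; have [r r0 h] := dir_dot (hth (0, s) i0 hs) (hth (1, s) i1 hs).
  by exists r => //; rewrite -h /= z0 z1 /dot /sqn !rvE; field.
have npi s k : 0 <= s -> s <= 1 -> s != sm -> cos k = -1 -> psi s != k.
  move=> s0 s1 ne ck; have hs : 0 <= s <= 1 by rewrite s0.
  apply/eqP => e; have [r r0] := V s hs; have [q q0] := V' s hs; rewrite e ck.
  have -> : sin k = 0.
    by have := cos2Dsin2 k; rewrite ck => h; apply/eqP; rewrite -sqrf_eq0; apply/eqP; lra.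
  by move=> h1 h2; have := Saxis s0 s1 ne ltac:(lra); lra.
have cpi : cos (- pi) = -1 :> R by rewrite cosN cospi.
have [al ar] : - pi < psi sa /\ psi sa < pi.
  apply: (stay_in cpsi _ e0l e0r) => // s s0 s1.
  have ne : s != sm by rewrite lt_eqF; lra.
  by split; apply: npi; rewrite ?cospi //; lra.
have Sp s : sa <= s -> s < sm -> sin (psi s) < 0.
  move=> h1 h2; have [|r r0 h] := V s; first by apply/andP; lra.
  by have := Spos h1 h2; rewrite -oppr_lt0 h pmulr_rlt0.
have Sn s : sm < s -> s <= sb -> 0 < sin (psi s).
  move=> h1 h2; have [|r r0 h] := V s; first by apply/andP; lra.
  by have := Sneg h1 h2; rewrite -oppr_gt0 h pmulr_rgt0.
have hm : 0 <= sm <= 1 by apply/andP; lra.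
have cm : cos (psi sm) < 0.
  by have [r r0] := V' sm hm; rewrite Sm /sqn !rvE => h; rewrite -(pmulr_rlt0 _ r0) -h; lra.
have sm0 : sin (psi sm) = 0.
  by have [r r0] := V sm hm; rewrite Sm !rvE oppr0 => /esym/eqP; rewrite mulf_eq0 gt_eqF //= => /eqP.
have a0 : psi sa < 0 by have [_ h _] := sin_sgn al ar; apply/h/Sp; lra.
have m0 : psi sm < 0.
  apply: (stay_lt cpsi (ltW sam)) a0 => s s0 s1; apply/eqP => e.
  have [h|h] := ltP s sm; first by have := Sp s s0 h; rewrite e sin0 ltxx.
  have es : sm = s by lra.
  by move: cm; rewrite es e cos0; lra.
(* At [sm] the curve passes through 0, which sees the two ends of [F] in opposite directions; up to
   there the angle has been negative. *)
have mpi : psi sm = - pi.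
  apply/le_anti/andP; split; rewrite leNgt; apply/negP => h.
    have [_ _] := @sin_sgn _ (- psi sm) ltac:(lra) ltac:(lra); rewrite sinN sm0 oppr0 ltxx; lra.
  have [|c /andP[c0 c1] e] := @ivt R psi sa sm (- pi) cpsi (ltW sam).
    by apply/orP; right; apply/andP; lra.
  have [hc|hc] := ltP c sm; first by have := Sp c c0 hc; rewrite e sinN sinpi oppr0 ltxx.
  by move: h; rewrite -e (_ : c = sm) ?ltxx //; lra.
have b0 : psi sb < 0.
  apply: (stay_lt cpsi (ltW smb)) m0 => s s0 s1; apply/eqP => e.
  have [h|h] := ltP sm s; first by have := Sn s h s1; rewrite e sin0 ltxx.
  have es : sm = s by lra.
  by move: cm; rewrite es e cos0; lra.
have bpi : psi sb < - pi.
  rewrite ltNge; apply/negP => h; have := Sn sb smb (lexx _).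
  have := @sin_ge0_pi R (- psi sb); rewrite sinN => /(_ ltac:(apply/andP; split; lra)); lra.
have : psi 1 < - pi.
  apply: (stay_lt cpsi sb1) bpi => s s0 s1; apply: npi => //; first lra.
  by rewrite gt_eqF //; lra.
by move: e1l; lra.
Qed.
End FirstStep.

(** * Projection along a chord towards infinity *)

Section SecondStep.
Variable R : realType.
Notation M := 'rV[R]_2.
Notation H := 'rV[R]_4.

Definition hat (z : M) : H := v4 (sqn z) 1 (z 0 0) (z 0 1).
(** Homogeneous coordinates around infinity, which is the point a = b = 0. *)
Definition hatY (a b : R) : H := v4 1 (a ^+ 2 + b ^+ 2) a b.

Lemma bptE z : bpt z = (sqn z + 1)^-1 *: hat z. Proof. by []. Qed.

(* Projection along the chord from the point v2 0 p to the point 1 / (a - i b). *)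
Definition ml (a b p : R) (X : H) : M :=
  v2 (X 0 2 - a * X 0 0 + p * (a * X 0 3 - b * X 0 2))
     (X 0 3 - b * X 0 0 - p * X 0 1 + p * (a * X 0 2 + b * X 0 3)).

Lemma mlD a b p X X' : ml a b p (X + X') = ml a b p X + ml a b p X'.
Proof. by apply: rV2P; rewrite /ml !rvE; ring. Qed.
Lemma mlZ a b p c X : ml a b p (c *: X) = c *: ml a b p X.
Proof. by apply: rV2P; rewrite /ml !rvE; ring. Qed.

Lemma ml_ker a b p X : p ^+ 2 * (a ^+ 2 + b ^+ 2) != 1 -> ml a b p X = 0 ->
  exists al be, X = al *: hat (v2 0 p) + be *: hatY a b.
Proof.
move=> n1 e; have e0 := congr1 (fun v : M => v 0 0) e; have e1 := congr1 (fun v : M => v 0 1) e.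
rewrite /ml !rvE in e0 e1; pose d := 1 - p ^+ 2 * (a ^+ 2 + b ^+ 2).
have d0 : d != 0 by rewrite subr_eq0 eq_sym.
exists ((X 0 1 - (a ^+ 2 + b ^+ 2) * X 0 0) / d), ((X 0 0 - p ^+ 2 * X 0 1) / d).
have E2 : X 0 2 * d = a * (X 0 0 - p ^+ 2 * X 0 1).
  rewrite /d; have -> : X 0 2 * (1 - p ^+ 2 * (a ^+ 2 + b ^+ 2)) =
    (1 + p * b) * (X 0 2 - a * X 0 0 + p * (a * X 0 3 - b * X 0 2)) -
    p * a * (X 0 3 - b * X 0 0 - p * X 0 1 + p * (a * X 0 2 + b * X 0 3)) + a * (X 0 0 - p ^+ 2 * X 0 1) by ring.
  by rewrite e0 e1; ring.
have E3 : X 0 3 * d = p * (X 0 1 - (a ^+ 2 + b ^+ 2) * X 0 0) + b * (X 0 0 - p ^+ 2 * X 0 1).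
  rewrite /d; have -> : X 0 3 * (1 - p ^+ 2 * (a ^+ 2 + b ^+ 2)) =
    (1 - p * b) * (X 0 3 - b * X 0 0 - p * X 0 1 + p * (a * X 0 2 + b * X 0 3)) -
    p * a * (X 0 2 - a * X 0 0 + p * (a * X 0 3 - b * X 0 2)) +
    p * (X 0 1 - (a ^+ 2 + b ^+ 2) * X 0 0) + b * (X 0 0 - p ^+ 2 * X 0 1) by ring.
  by rewrite e0 e1; ring.
apply: rV4P; rewrite /hat /hatY !v4E ?rvE /sqn ?rvE; apply: (mulIf d0); rewrite ?E2 ?E3; move: d0; rewrite /d => d0; field => //.
Qed.

(** For small [a] and [b] this is a perturbation of the translation of [z] by [v2 0 (- p)]. *)
Definition cm (a b p : R) (z : M) : M :=
  v2 (z 0 0 - a * sqn z + p * (a * z 0 1 - b * z 0 0))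
     (z 0 1 - b * sqn z - p + p * (a * z 0 0 + b * z 0 1)).

Lemma ml_hat a b p z : ml a b p (hat z) = cm a b p z.
Proof. by apply: rV2P; rewrite /ml /hat /cm !rvE !v4E; ring. Qed.

Lemma cm_bound_arith (a b p x y q K : R) : - 100^-1 <= a <= 100^-1 -> - 100^-1 <= b <= 100^-1 ->
  - 2^-1 <= p <= 2^-1 -> 0 <= q -> (exists X Y, [/\ - X <= x <= X, - Y <= y <= Y & q + (X + Y) / 2 <= K]) ->
  `|p * (a * y - b * x) - a * q| <= K / 100 /\ `|p * (a * x + b * y) - b * q| <= K / 100.
Proof.
move=> /andP[a0 a1] /andP[b0 b1] /andP[p0 p1] q0 [X [Y [/andP[x0 x1] /andP[y0 y1] hK]]].
have bil (u v U V : R) : 0 <= U -> - U <= u -> u <= U -> - V <= v -> v <= V -> `|u * v| <= U * V.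
  by move=> *; rewrite normrM; apply: ler_pM => //; rewrite ler_norml; apply/andP.
have X0 : 0 <= X by lra.
have Y0 : 0 <= Y by lra.
have h100 : 0 <= 100^-1 :> R by lra.
have ax := bil a x _ _ h100 a0 a1 x0 x1; have ay := bil a y _ _ h100 a0 a1 y0 y1.
have bx := bil b x _ _ h100 b0 b1 x0 x1; have byy := bil b y _ _ h100 b0 b1 y0 y1.
have q1 : - q <= q by lra.
have aq := bil a q _ _ h100 a0 a1 q1 (lexx q); have bq := bil b q _ _ h100 b0 b1 q1 (lexx q).
have half (w : R) : `|p * w| <= 2^-1 * `|w|.
  by rewrite normrM ler_wpM2r // ler_norml; apply/andP.
split; apply: le_trans (ler_normB _ _) _.
  by have := half (a * y - b * x); have := ler_normB (a * y) (b * x); lra.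
by have := half (a * x + b * y); have := ler_normD (a * x) (b * y); lra.
Qed.

(* The bracket is negative because |b - n y2| is small, so al and y0 - y2 have opposite signs. *)
Lemma cross_sign (a b p y0 y2 x c al be : R) (n := a ^+ 2 + b ^+ 2) :
  - 100^-1 <= a <= 100^-1 -> - 100^-1 <= b <= 100^-1 -> - 2^-1 <= p <= 2^-1 -> n <= 5000^-1 ->
  64/10 <= y2 <= 75/10 -> 69/10 <= y0 <= 7 -> - (9/2) <= x <= 9/2 -> 0 < c -> c <= 2 -> y0 != y2 ->
  x ^+ 2 + y0 ^+ 2 = c * y2 ^+ 2 + al * p ^+ 2 + be -> 1 = c + al + be * n -> x = be * a ->
  y0 = c * y2 + al * p + be * b ->
  0 < (y0 - y2) * ((x ^+ 2 + (y0 - p) ^+ 2) * (1 + n * y2 ^+ 2 - 2 * b * y2) -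
                   (y2 - p) ^+ 2 * (1 + n * (x ^+ 2 + y0 ^+ 2) - 2 * (a * x + b * y0))).
Proof.
move=> /andP[a0 a1] /andP[b0 b1] /andP[p0 p1] n1 /andP[y20 y21] /andP[y00 y01] /andP[x0 x1] c0 c2 ne E0 E1 E2 E3.
have n0 : 0 <= n by rewrite /n; have := sqr_ge0 a; have := sqr_ge0 b; clear; lra.
pose u2 := (y2 - p) ^+ 2; pose v2 := 1 + n * y2 ^+ 2 - 2 * b * y2.
pose vI := 1 + n * (x ^+ 2 + y0 ^+ 2) - 2 * (a * x + b * y0); pose m := 1 + n * p ^+ 2 - 2 * b * p.
have u2p : 0 < u2 by rewrite exprn_gt0 //; clear -y20 p1; lra.
have q2 : 0 <= n * y2 ^+ 2 by rewrite mulr_ge0 // sqr_ge0.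
have qI : 0 <= n * (x ^+ 2 + y0 ^+ 2) by rewrite mulr_ge0 // addr_ge0 // sqr_ge0.
have qp : 0 <= n * p ^+ 2 by rewrite mulr_ge0 // sqr_ge0.
have hby : b * y2 <= 100^-1 * y2 by apply: ler_wpM2r => //; clear -y20; lra.
have v2p : 0 < v2 by rewrite /v2; clear -q2 hby y21; lra.
have mp : 0 < m by rewrite /m; clear -qp b0 b1 p0 p1; nra.
have vIp : 7/10 <= vI.
  rewrite /vI; have k : b * y0 <= 100^-1 * y0 by apply: ler_wpM2r => //; clear -y00; lra.
  have ax : a * x <= 5/100 by clear -a0 a1 x0 x1; nra.
  by clear -qI k y01 ax; lra.
have vIE : vI = c * v2 + al * m.
  rewrite /vI /v2 /m; have -> : x ^+ 2 + y0 ^+ 2 = c * y2 ^+ 2 + al * p ^+ 2 + be by [].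
  have -> : a * x = a * (be * a) by rewrite {1}E2.
  have -> : b * y0 = b * (c * y2 + al * p + be * b) by rewrite {1}E3.
  by rewrite {1}E1 /n; ring.
have nul : c * (al * u2 + be * v2) + al * be * m = 0.
  have -> : c * (al * u2 + be * v2) + al * be * m = (c * y2 ^+ 2 + al * p ^+ 2 + be) * (c + al + be * n) - (be * a) ^+ 2 - (c * y2 + al * p + be * b) ^+ 2.
    by rewrite /u2 /v2 /m /n; ring.
  by rewrite -E0 -E1 -E2 -E3; ring.
have bv : be * vI = - (c * al * u2) by rewrite vIE; clear -nul; lra.
have dy : y0 - y2 = al * (p - y2) + be * (b - n * y2).
  have k : y2 * 1 = y2 * (c + al + be * n) by rewrite -E1.
  by move: E3 k; clear; lra.
pose w := (y2 - p) * (vI + c * (y2 - p) * (b - n * y2)).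
have dyv : (y0 - y2) * vI = - al * w.
  rewrite dy mulrDl -mulrA mulrAC bv /w /u2; ring.
have wp : 0 < w.
  rewrite /w mulr_gt0 //; first by clear -y20 p1; lra.
  have d1 : - (2/100) <= b - n * y2.
    have k : n * y2 <= 5000^-1 * y2 by apply: ler_wpM2r => //; clear -y20; lra.
    by clear -k b0 y21; lra.
  have k1 : c * (y2 - p) <= 2 * 8 by apply: ler_pM; clear -c0 c2 y20 y21 p0 p1; lra.
  have k0 : 0 <= c * (y2 - p) by apply: mulr_ge0; clear -c0 y20 p1; lra.
  by have := ler_wpM2l k0 d1; clear -vIp k1; lra.
have al0 : al * (y0 - y2) < 0.
  have vp : 0 < vI by apply: lt_le_trans vIp; rewrite divr_gt0.
  have al_ne : al != 0.
    apply: contra_neq ne => z; have := dyv; rewrite z oppr0 mul0r => /eqP.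
    by rewrite mulf_eq0 (gt_eqF vp) orbF subr_eq0 => /eqP.
  rewrite -(pmulr_llt0 _ vp) -mulrA dyv mulNr mulrN oppr_lt0 mulrA -expr2 mulr_gt0 // lt_neqAle eq_sym sqrf_eq0 al_ne sqr_ge0 //.
have be0 : 0 < be * (y0 - y2).
  have vp : 0 < vI by apply: lt_le_trans vIp; rewrite divr_gt0.
  rewrite -(pmulr_lgt0 _ vp) mulrAC bv mulNr oppr_gt0.
  have -> : c * al * u2 * (y0 - y2) = (c * u2) * (al * (y0 - y2)) by ring.
  by rewrite pmulr_rlt0 // mulr_gt0.
have uIE : x ^+ 2 + (y0 - p) ^+ 2 = c * u2 + be * m.
  have -> : x ^+ 2 + (y0 - p) ^+ 2 = (x ^+ 2 + y0 ^+ 2) + p ^+ 2 * 1 - 2 * p * y0 by ring.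
  by rewrite E0 {1}E1 {1}E3 /u2 /m /n; ring.
rewrite uIE -/v2 -/u2 -/vI vIE.
have -> : (y0 - y2) * ((c * u2 + be * m) * v2 - u2 * (c * v2 + al * m)) =
  m * (v2 * (be * (y0 - y2)) - u2 * (al * (y0 - y2))) by ring.
rewrite mulr_gt0 //; have := mulr_gt0 v2p be0; have : u2 * (al * (y0 - y2)) < 0 by rewrite pmulr_rlt0.
by clear; lra.
Qed.

(** The half-planes bounded by the line through [P] and [Y] cut the sphere in arcs, along which the
    ratio of the products with [P] and [Y] is strictly monotone. Angle and ratio are thus
    coordinates on the sphere minus two points. *)
Lemma pencil_inj (P Y X X' : H) al be c : qd P = 0 -> qd Y = 0 -> qd X = 0 -> qd X' = 0 ->
  0 < mk P Y -> 0 < mk P X -> 0 < mk Y X -> 0 < mk P X' -> 0 < mk Y X' -> 0 < c ->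
  X = c *: X' + (al *: P + be *: Y) -> mk P X * mk Y X' = mk P X' * mk Y X -> al = 0 /\ be = 0.
Proof.
move=> qP qY qX qX' m0 u0 v0 u1 v1 c0 e; move: u0 v0.
have eu : mk P X = c * mk P X' + be * mk P Y.
  by rewrite e !mkDr !mkZr mk_self qP; ring.
have ev : mk Y X = c * mk Y X' + al * mk P Y.
  by rewrite e !mkDr !mkZr mk_self qY (mkC Y P); ring.
have eq0 : 0 = 2 * c * (al * mk P X' + be * mk Y X') + 2 * al * be * mk P Y.
  have : qd X = c ^+ 2 * qd X' + al ^+ 2 * qd P + be ^+ 2 * qd Y + c * al * mk P X' + c * be * mk Y X' + al * be * mk P Y.
    by rewrite e /qd /mk !v4E; ring.
  by rewrite qX qX' qP qY; lra.
rewrite eu ev; move: (mk P Y) (mk P X') (mk Y X') m0 u1 v1 eq0 => m u v m0 u1 v1 eq0 hu hv h.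
have h1 : be * v = al * u by apply: (mulfI (lt0r_neq0 m0)); lra.
have h2 : al * (2 * c * u + be * m) = 0 by rewrite h1 in eq0; lra.
have [a0|an] := eqVneq al 0.
  split => //; move: h1; rewrite a0 mul0r => /eqP; rewrite mulf_eq0 (gt_eqF v1) orbF => /eqP //.
have h3 : 2 * c * u + be * m = 0 by apply/eqP; move/eqP: h2; rewrite mulf_eq0 (negbTE an).
have := mulr_gt0 c0 u1; lra.
Qed.

End SecondStep.

(** * The barrier *)

Section Passage.
Variable R : realType.
Notation M := 'rV[R]_2.
Notation H := 'rV[R]_4.

Lemma sin_neg_pi (x : R) : 0 < x -> x < 2 * pi -> sin x < 0 -> pi < x.
Proof.
move=> x0 x1 s; rewrite ltNge; apply/negP => h.
by have := @sin_ge0_pi R x; rewrite h (ltW x0) => /(_ erefl); rewrite leNgt s.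
Qed.

Variables (p y0 v1 v2' v3 v4' : R) (Y : H) (I : R -> M) (F : R -> H).
Hypothesis hp : - 2^-1 <= p <= 2^-1.
Hypothesis hy : 69/10 <= y0 <= 7.
Hypothesis bY : bd Y.
Hypothesis farY : 100 ^+ 2 * Y 0 1 <= Y 0 0.
Let A t := bpt (kap (v2 0 y0) t).
Hypothesis cF : continuous F.
Hypothesis bF : forall t, bd (F t).
Hypothesis F0 : F 0 = A 0.
Hypothesis F1 : F 1 = A 1.
Hypothesis av : forall t s, 0 <= t -> t <= 1 -> F t != bpt (I s).
Hypothesis sep : forall t c c' al be, 0 <= t -> t <= 1 -> 0 <= c -> 0 <= c' -> 0 < c + c' ->
  c *: A t + c' *: F t != al *: bpt (v2 0 p) + be *: Y.
Hypothesis cI : continuous I.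
Hypothesis vord : [/\ 0 <= v1, v1 <= v2', v2' <= v3, v3 <= v4' & v4' <= 1].
(** The barrier passes below, to the right, above, to the left and again below the origin, in more
    than a full turn. Only on the third arc, at the height [y0] of the middle of the segment [A],
    can it be seen in the same direction as a point of [A]. *)
Hypothesis ph1 : forall s, 0 <= s -> s <= v1 -> [/\ -1 <= I s 0 0, I s 0 0 <= 5/2, - (7/2) <= I s 0 1 & I s 0 1 <= - (5/2)].
Hypothesis ph2 : forall s, v1 <= s -> s <= v2' -> [/\ 5/2 <= I s 0 0, I s 0 0 <= 11/2, - 7 <= I s 0 1, I s 0 1 <= 7 &
  - 6 * I s 0 0 + I s 0 1 <= - 8].
Hypothesis ph3 : forall s, v2' <= s -> s <= v3 -> [/\ - (9/2) <= I s 0 0, I s 0 0 <= 9/2 & I s 0 1 = y0].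
Hypothesis ph4 : forall s, v3 <= s -> s <= v4' -> [/\ - (19/2) <= I s 0 0, I s 0 0 <= - (9/2), - (21/2) <= I s 0 1, I s 0 1 <= 21/2 &
  6 * I s 0 0 + I s 0 1 <= - 20].
Hypothesis ph5 : forall s, v4' <= s -> s <= 1 -> [/\ - (13/2) <= I s 0 0, I s 0 0 <= 13/2, - (21/2) <= I s 0 1 & I s 0 1 <= - (103/10)].
Hypothesis start : I 0 0 0 = -1.
Hypothesis stop : I 1 0 0 = 13/2.

Let a := Y 0 2 / Y 0 0.
Let b := Y 0 3 / Y 0 0.
Let n := a ^+ 2 + b ^+ 2.

Lemma Y0_gt0 : 0 < Y 0 0.
Proof. by have [[[y y1 _] t1] _] := bY; move: t1 farY; rewrite /tr => t1 f; nra. Qed.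

Lemma Y_hat : Y = Y 0 0 *: hatY a b.
Proof.
have y := Y0_gt0; have := bY.2; rewrite /qd => q.
have e : Y 0 1 = Y 0 0 * (a ^+ 2 + b ^+ 2).
  apply: (mulfI (lt0r_neq0 y)); rewrite /a /b; have -> : Y 0 0 * Y 0 1 = Y 0 2 ^+ 2 + Y 0 3 ^+ 2 by lra.
  by field; rewrite gt_eqF.
by apply: rV4P; rewrite /hatY !v4E ?mulr1 -?e // /a /b mulrC divfK // gt_eqF.
Qed.

Lemma n_small : n <= 10000^-1.
Proof.
have y := Y0_gt0; have e := congr1 (fun X : H => X 0 1) Y_hat; rewrite /hatY !v4E -/n in e.
by rewrite -(ler_pM2l y) -e; move: farY; lra.
Qed.

Lemma ab_small : - 100^-1 <= a <= 100^-1 /\ - 100^-1 <= b <= 100^-1.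
Proof.
have := n_small; rewrite /n => h; have ha := sqr_ge0 a; have hb := sqr_ge0 b.
have k (x : R) : x ^+ 2 <= 10000^-1 -> - 100^-1 <= x <= 100^-1.
  move=> hx; rewrite -ler_norml -(@ler_pXn2r _ 2) ?nnegrE // real_normK ?num_real //.
  by apply: le_trans hx _; rewrite exprVn; lra.
by split; apply: k; lra.
Qed.

Lemma ker_n1 : p ^+ 2 * (a ^+ 2 + b ^+ 2) != 1.
Proof.
have := n_small; rewrite -/n; have /andP[p0 p1] := hp; have : 0 <= n by rewrite addr_ge0 // sqr_ge0.
move=> n0 n1; have p2 : p ^+ 2 <= 1 by nra.
by apply/eqP => e; have := ler_wpM2r n0 p2; lra.
Qed.

Notation mm := (ml a b p).

Lemma mm_ker X : mm X = 0 -> exists al be, X = al *: bpt (v2 0 p) + be *: Y.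
Proof.
move=> /(ml_ker ker_n1)[al [be ->]]; exists (al * (sqn (v2 0 p) + 1)), (be / Y 0 0).
have hy' : hatY a b = (Y 0 0)^-1 *: Y.
  by rewrite [X in _ = _ *: X]Y_hat scalerA mulVf ?scale1r // gt_eqF // Y0_gt0.
have hp' : hat (v2 0 p) = (sqn (v2 0 p) + 1) *: bpt (v2 0 p).
  by rewrite bptE scalerA mulfV ?scale1r // gt_eqF // sqn1_gt0.
by rewrite hy' {1}hp' !scalerA.
Qed.

Lemma mm_sep t c c' : 0 <= t -> t <= 1 -> 0 <= c -> 0 <= c' -> 0 < c + c' -> c *: mm (A t) + c' *: mm (F t) != 0.
Proof.
move=> t0 t1 c0 c0' cc; apply/eqP; rewrite -!mlZ -mlD => /mm_ker[al [be e]].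
by have := sep al be t0 t1 c0 c0' cc; rewrite e eqxx.
Qed.

Lemma cm_near (z : M) K : (exists X Z, [/\ - X <= z 0 0 <= X, - Z <= z 0 1 <= Z & sqn z + (X + Z) / 2 <= K]) ->
  [/\ z 0 0 - K / 100 <= cm a b p z 0 0, cm a b p z 0 0 <= z 0 0 + K / 100,
      z 0 1 - p - K / 100 <= cm a b p z 0 1 & cm a b p z 0 1 <= z 0 1 - p + K / 100].
Proof.
move=> h; have [ha hb] := ab_small; have q0 : 0 <= sqn z by rewrite addr_ge0 // sqr_ge0.
have [] := cm_bound_arith ha hb hp q0 h; rewrite !ler_norml /cm !rvE => /andP[h1 h2] /andP[h3 h4].
by split; lra.
Qed.

Lemma sqX (x X : R) : - X <= x <= X -> x ^+ 2 <= X ^+ 2.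
Proof. by move=> /andP[h1 h2]; nra. Qed.

Lemma cm_box (z : M) X Z K : - X <= z 0 0 <= X -> - Z <= z 0 1 <= Z -> X ^+ 2 + Z ^+ 2 + (X + Z) / 2 <= K ->
  [/\ z 0 0 - K / 100 <= cm a b p z 0 0, cm a b p z 0 0 <= z 0 0 + K / 100,
      z 0 1 - p - K / 100 <= cm a b p z 0 1 & cm a b p z 0 1 <= z 0 1 - p + K / 100].
Proof.
move=> hx hz hK; apply: cm_near; exists X, Z; split => //; have := sqX hx; have := sqX hz.
by rewrite /sqn; lra.
Qed.

Lemma cm_A t : 0 <= t -> t <= 1 -> let C := cm a b p (kap (v2 0 y0) t) in
  [/\ - (6/10) <= C 0 0, C 0 0 <= 6/10 & 53/10 <= C 0 1].
Proof.
move=> t0 t1 C; have /andP[p0 p1] := hp; have /andP[y0l y0r] := hy.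
have k0 : kap (v2 0 y0) t 0 0 = 0 by rewrite /kap !rvE; ring.
have k1 : kap (v2 0 y0) t 0 1 = y0 + (t - 2^-1) by rewrite /kap !rvE.
have hbx := @cm_box (kap (v2 0 y0) t) 0 (15/2) 60; rewrite -/C k0 k1 in hbx.
by case: (hbx ltac:(apply/andP; lra) ltac:(apply/andP; lra) ltac:(lra)) => ? ? ? ?; split; lra.
Qed.

Lemma cm_I1 s : 0 <= s -> s <= v1 -> let C := cm a b p (I s) in [/\ I s 0 0 - 22/100 <= C 0 0, C 0 0 <= I s 0 0 + 22/100, - 43/10 <= C 0 1 & C 0 1 < 0].
Proof.
move=> s0 s1 C; have /andP[p0 p1] := hp; have [x0 x1 z0 z1] := ph1 s0 s1.
have hbx := @cm_box (I s) (5/2) (7/2) 22 ltac:(apply/andP; lra) ltac:(apply/andP; lra) ltac:(lra).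
by rewrite -/C in hbx; case: hbx => ? ? ? ?; split; lra.
Qed.

Lemma cm_I2 s : v1 <= s -> s <= v2' -> let C := cm a b p (I s) in 0 < C 0 0 /\ - 6 * C 0 0 + C 0 1 < 0.
Proof.
move=> s0 s1 C; have /andP[p0 p1] := hp; have [x0 x1 z0 z1 l] := ph2 s0 s1.
have hbx := @cm_box (I s) (11/2) 7 86 ltac:(apply/andP; lra) ltac:(apply/andP; lra) ltac:(lra).
by rewrite -/C in hbx; case: hbx => ? ? ? ?; split; lra.
Qed.

Lemma cm_I3 s : v2' <= s -> s <= v3 -> let C := cm a b p (I s) in 0 < C 0 1 /\ C 0 1 <= 9.
Proof.
move=> s0 s1 C; have /andP[p0 p1] := hp; have /andP[y0l y0r] := hy; have [x0 x1 z0] := ph3 s0 s1.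
have hbx := @cm_box (I s) (9/2) 7 76 ltac:(apply/andP; lra) ltac:(apply/andP; lra) ltac:(lra).
by rewrite -/C in hbx; case: hbx => ? ? ? ?; split; lra.
Qed.

Lemma cm_I4 s : v3 <= s -> s <= v4' -> let C := cm a b p (I s) in C 0 0 < 0 /\ 6 * C 0 0 + C 0 1 < 0.
Proof.
move=> s0 s1 C; have /andP[p0 p1] := hp; have [x0 x1 z0 z1 l] := ph4 s0 s1.
have hbx := @cm_box (I s) (19/2) (21/2) 211 ltac:(apply/andP; lra) ltac:(apply/andP; lra) ltac:(lra).
by rewrite -/C in hbx; case: hbx => ? ? ? ?; split; lra.
Qed.

Lemma cm_I5 s : v4' <= s -> s <= 1 -> let C := cm a b p (I s) in [/\ I s 0 0 - 161/100 <= C 0 0, - 13 <= C 0 1 & C 0 1 < 0].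
Proof.
move=> s0 s1 C; have /andP[p0 p1] := hp; have [x0 x1 z0 z1] := ph5 s0 s1.
have hbx := @cm_box (I s) (13/2) (21/2) 161 ltac:(apply/andP; lra) ltac:(apply/andP; lra) ltac:(lra).
by rewrite -/C in hbx; case: hbx => ? ? ? ?; split; lra.
Qed.

Let Ph := hat (v2 0 p).
Let Yh := hatY a b.
(** The radial coordinate about the chord, from 0 at [v2 0 p] to infinity at [Y]. *)
Definition rho_ratio (X : H) := mk Ph X / mk Yh X.

Lemma mm_bpt z : mm (bpt z) = (sqn z + 1)^-1 *: cm a b p z.
Proof. by rewrite bptE mlZ ml_hat. Qed.

Lemma mm_P : mm (bpt (v2 0 p)) = 0.
Proof. by rewrite mm_bpt [cm _ _ _ _](_ : _ = 0) ?scaler0 //; apply: rV2P; rewrite /cm /sqn !rvE; ring. Qed.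

Lemma mm_Y : mm Y = 0.
Proof. by rewrite Y_hat mlZ [ml _ _ _ (hatY _ _)](_ : _ = 0) ?scaler0 //; apply: rV2P; rewrite /ml /hatY !rvE !v4E; ring. Qed.

Lemma mk_PY_gt0 X : bd X -> mm X != 0 -> 0 < mk Ph X /\ 0 < mk Yh X.
Proof.
move=> bX n0; split.
  have : 0 < mk (bpt (v2 0 p)) X.
    apply: bd_mk_gt0; [exact: bpt_bd | exact: bX.1 |].
    by apply: contraNneq n0 => <-; rewrite mm_P.
  by rewrite mkC bptE mkZr mkC pmulr_rgt0 // invr_gt0 sqn1_gt0.
have : 0 < mk Y X.
  by apply: bd_mk_gt0 => //; [exact: bX.1 | apply: contraNneq n0 => <-; rewrite mm_Y].
by rewrite mkC [X in mk _ X]Y_hat mkZr mkC pmulr_rgt0 // Y0_gt0.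
Qed.

Lemma rho_bpt z : rho_ratio (bpt z) = (z 0 0 ^+ 2 + (z 0 1 - p) ^+ 2) / (1 + n * (z 0 0 ^+ 2 + z 0 1 ^+ 2) - 2 * (a * z 0 0 + b * z 0 1)).
Proof.
rewrite /rho_ratio bptE !mkZr invfM mulrACA mulfV ?mul1r ?invr_neq0 ?gt_eqF ?sqn1_gt0 //.
by congr (_ / _); rewrite /mk /Ph /Yh /hat /hatY !v4E ?rvE /sqn ?rvE /n; ring.
Qed.

(** The third arc passes through the middle of [A]: in the direction of the lower end it is farther
    from [v2 0 p] than this end, in that of the upper end it is closer. *)
Lemma side_sign t s c : t = 0 \/ t = 1 -> v2' <= s -> s <= v3 -> 0 < c ->
  cm a b p (I s) = c *: cm a b p (kap (v2 0 y0) t) -> 0 < (2^-1 - t) * (rho_ratio (bpt (I s)) - rho_ratio (A t)).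
Proof.
move=> ht s0 s1 c0 e.
have t0 : 0 <= t by case: ht => ->.
have t1 : t <= 1 by case: ht => ->; lra.
have /andP[y0l y0r] := hy.
have yr2 : 64/10 <= y0 + (t - 2^-1) <= 75/10 by case: ht => ->; apply/andP; lra.
have yne : 2^-1 - t != 0 by case: ht => ->; apply/eqP; lra.
have [x0 x1 z0] := ph3 s0 s1; have [_ C9] := cm_I3 s0 s1; have [_ _ A1] := cm_A t0 t1.
have c2 : c <= 2.
  have e1 : cm a b p (I s) 0 1 = c * cm a b p (kap (v2 0 y0) t) 0 1 by rewrite e mxE.
  rewrite e1 in C9.
  by rewrite leNgt; apply/negP => h; nra.
have : mm (hat (I s) + (- c) *: hat (kap (v2 0 y0) t)) = 0 by rewrite mlD mlZ !ml_hat e scaleNr subrr.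
move=> /(ml_ker ker_n1)[al [be h]].
pose y2 := y0 + (t - 2^-1).
have k0 : kap (v2 0 y0) t 0 0 = 0 by rewrite /kap !rvE; ring.
have k1 : kap (v2 0 y0) t 0 1 = y2 by rewrite /kap !rvE.
have [E0 E1 E2 E3] : [/\ I s 0 0 ^+ 2 + y0 ^+ 2 = c * y2 ^+ 2 + al * p ^+ 2 + be, 1 = c + al + be * n,
    I s 0 0 = be * a & y0 = c * y2 + al * p + be * b].
  move: h k0 k1; move: (kap (v2 0 y0) t) => zk h k0 k1.
  have E0 := congr1 (fun X : H => X 0 0) h; have E1 := congr1 (fun X : H => X 0 1) h.
  have E2 := congr1 (fun X : H => X 0 2) h; have E3 := congr1 (fun X : H => X 0 3) h.
  rewrite /hat /hatY !v4E /sqn ?rvE ?k0 ?k1 ?z0 in E0 E1 E2 E3.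
  by split; rewrite /n; lra.
have [ha hb] := ab_small; have ns := n_small; rewrite /n in ns.
have bp : bd (bpt (I s)) by exact: bpt_bd.
have mI : mm (bpt (I s)) != 0.
  rewrite mm_bpt scaler_eq0 negb_or invr_neq0 ?gt_eqF ?sqn1_gt0 //=.
  by apply/eqP => z; have [+ _] := cm_I3 s0 s1; rewrite z rvE ltxx.
have mA : mm (A t) != 0.
  rewrite mm_bpt scaler_eq0 negb_or invr_neq0 ?gt_eqF ?sqn1_gt0 //=.
  by apply/eqP => z; move: A1; rewrite z rvE; lra.
have [uI vI] := mk_PY_gt0 bp mI; have [uA vA] := mk_PY_gt0 (bpt_bd _ : bd (A t)) mA.
have vI' : 0 < 1 + n * (I s 0 0 ^+ 2 + y0 ^+ 2) - 2 * (a * I s 0 0 + b * y0).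
  have -> : 1 + n * (I s 0 0 ^+ 2 + y0 ^+ 2) - 2 * (a * I s 0 0 + b * y0) = mk Yh (hat (I s)).
    by rewrite /mk /Yh /hat /hatY !v4E /sqn z0 /n; ring.
  by move: vI; rewrite bptE mkZr pmulr_rgt0 // invr_gt0 sqn1_gt0.
have vA' : 0 < 1 + n * y2 ^+ 2 - 2 * b * y2.
  have -> : 1 + n * y2 ^+ 2 - 2 * b * y2 = mk Yh (hat (kap (v2 0 y0) t)).
    move: k0 k1; move: (kap (v2 0 y0) t) => zk k0 k1.
    by rewrite /mk /Yh /hat /hatY !v4E /sqn k0 k1 /n; ring.
  by move: vA; rewrite /A bptE mkZr pmulr_rgt0 // invr_gt0 sqn1_gt0.
have cr := @cross_sign R a b p y0 y2 (I s 0 0) c al be ha hb hp.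
have dyE : y0 - y2 = 2^-1 - t by rewrite /y2; ring.
rewrite -dyE !rho_bpt k0 k1 z0 -/n.
move: (I s 0 0) E0 E1 E2 E3 x0 x1 vI' vA' cr => x E0 E1 E2 E3 x0 x1 vI' vA' cr.
have -> : 1 + n * (0 ^+ 2 + y2 ^+ 2) - 2 * (a * 0 + b * y2) = 1 + n * y2 ^+ 2 - 2 * b * y2 by ring.
have -> : 0 ^+ 2 + (y2 - p) ^+ 2 = (y2 - p) ^+ 2 by ring.
have {}cr : 0 < (y0 - y2) * ((x ^+ 2 + (y0 - p) ^+ 2) * (1 + n * y2 ^+ 2 - 2 * b * y2) -
                   (y2 - p) ^+ 2 * (1 + n * (x ^+ 2 + y0 ^+ 2) - 2 * (a * x + b * y0))).
  apply: cr yr2 hy _ c0 c2 _ E0 E1 E2 E3.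
  - by apply: le_trans ns _; rewrite lef_pV2 ?posrE ?ler_nat ?ltr0n.
  - by apply/andP.
  - by rewrite -subr_eq0 dyE.
move: (1 + n * y2 ^+ 2 - 2 * b * y2) (1 + n * (x ^+ 2 + y0 ^+ 2) - 2 * (a * x + b * y0)) (x ^+ 2 + (y0 - p) ^+ 2) ((y2 - p) ^+ 2) (y0 - y2) vA' vI' cr.
move=> va vi ui ua d va0 vi0 cr.
have -> : d * (ui / vi - ua / va) = d * (ui * va - ua * vi) / (va * vi) by field; rewrite !gt_eqF.
by rewrite divr_gt0 // mulr_gt0.
Qed.

Lemma cat_ml (T : topologicalType) (f : T -> H) t : cat f t -> cat (fun s => mm (f s)) t.
Proof. by move=> cf; rewrite /ml; apply: cat_v2; ct. Qed.

Lemma dir_near (u v : M) al : dir u al -> 0 < dot u v -> exists z, [/\ dir v z, al - pi / 2 < z & z < al + pi / 2].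
Proof.
move=> du hd; have := dir_atan du hd; set q := crs u v / dot u v => h; exists (al + atan q); split => //.
  by have := atan_gtNpi2 q; lra.
by have := atan_ltpi2 q; lra.
Qed.

Lemma dir_unscale k (u : M) al : 0 < k -> dir (k *: u) al -> dir u al.
Proof. by move=> k0 d; have := @dirZ R k^-1 _ _ ltac:(by rewrite invr_gt0) d; rewrite scalerA mulVf ?scale1r // gt_eqF. Qed.

Lemma cm_I_neq0 s : 0 <= s -> s <= 1 -> cm a b p (I s) != 0.
Proof.
have nz (C : M) (x y : R) : x * C 0 0 + y * C 0 1 != 0 -> C != 0.
  by apply: contraNneq => ->; rewrite !rvE !mulr0 addr0.
move=> s0 s1; have [h1|h1] := leP s v1.
  by have [_ _ _ h] := cm_I1 s0 h1; apply: (nz _ 0 1); rewrite lt_eqF //; lra.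
have [h2|h2] := leP s v2'.
  by have [h _] := cm_I2 (ltW h1) h2; apply: (nz _ 1 0); rewrite gt_eqF //; lra.
have [h3|h3] := leP s v3.
  by have [h _] := cm_I3 (ltW h2) h3; apply: (nz _ 0 1); rewrite gt_eqF //; lra.
have [h4|h4] := leP s v4'.
  by have [h _] := cm_I4 (ltW h3) h4; apply: (nz _ 1 0); rewrite lt_eqF //; lra.
by have [_ _ h] := cm_I5 (ltW h4) s1; apply: (nz _ 0 1); rewrite lt_eqF //; lra.
Qed.

Lemma cl_iv t : 0 <= t -> t <= 1 -> cl t = t :> R.
Proof. by move=> t0 t1; apply: cl_id; rewrite t0. Qed.

(** The chords from [A t] to [F t] are disjoint from the chord of projection, so the straight
    homotopy between their projections avoids 0 and the two arguments stay within pi of each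
    other. *)
Lemma lifts_AF : exists tA tB : R -> R, [/\ continuous tA, continuous tB,
  forall t, 0 <= t -> t <= 1 -> [/\ dir (cm a b p (kap (v2 0 y0) t)) (tA t), dir (mm (F t)) (tB t),
    0 < tA t /\ tA t < pi & `|tB t - tA t| < pi] & tB 0 = tA 0 /\ tB 1 = tA 1].
Proof.
have p0 := pi_gt0 R.
pose g (q : R * R) := (1 - cl q.2) *: mm (A (cl q.1)) + cl q.2 *: mm (F (cl q.1)).
have cg : continuous g.
  move=> q; change (cat (fun q : R * R => (1 - cl q.2) *: mm (A (cl q.1)) + cl q.2 *: mm (F (cl q.1))) q).
  have c1 : cat (fun q : R * R => cl q.1) q by apply: (cat_cl (f := fun q : R * R => q.1)); ct.
  have c2 : cat (fun q : R * R => cl q.2) q by apply: (cat_cl (f := fun q : R * R => q.2)); ct.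
  have c3 : cat (fun q : R * R => mm (A (cl q.1))) q by apply: cat_ml; apply: cat_bpt; apply: cat_kap; ct.
  have c4 : cat (fun q : R * R => mm (F (cl q.1))) q by apply: cat_ml; ct.
  by ct.
have gn0 q : g q != 0.
  have /andP[x0 x1] := cl_itv q.1; have /andP[z0 z1] := cl_itv q.2.
  by apply: mm_sep => //; lra.
have [th [cth hth]] := lift cg (fun q _ _ => gn0 q).
have g0 t : 0 <= t -> t <= 1 -> g (t, 0) = mm (A t).
  by move=> t0 t1; rewrite /g /= (cl_iv t0 t1) (cl_le0 (lexx 0)) subr0 scale1r scale0r addr0.
have g1 t : 0 <= t -> t <= 1 -> g (t, 1) = mm (F t).
  by move=> t0 t1; rewrite /g /= (cl_iv t0 t1) (cl_ge1 (lexx 1)) subrr scale1r scale0r add0r.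
have bounds (x : R) : 0 <= x -> x <= 1 -> 0 <= x <= 1 by move=> -> ->.
have e0 : (0 : R) <= 0 by [].
have e1 : (0 : R) <= 1 by exact: ler01.
have e2 : (1 : R) <= 1 by [].
have d2 : dir (v2 0 1 : M) (pi / 2).
  by exists 1; rewrite ?ltr01 // scale1r /pol cos_pihalf sin_pihalf.
have [z [dz zl zr]] : exists z, [/\ dir (mm (A 0)) z, pi / 2 - pi / 2 < z & z < pi / 2 + pi / 2].
  apply: dir_near d2 _; have [_ _ h] := cm_A e0 e1.
  rewrite /dot /A mm_bpt !rvE mul0r add0r mul1r -/(cm a b p (kap (v2 0 y0) 0) 0 1).
  by rewrite mulr_gt0 ?invr_gt0 ?sqn1_gt0 //; move: h; rewrite /cm !rvE; lra.
have cD : cos (z - th (0, 0)) = 1.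
  by apply: (dir_cos (u := mm (A 0))) => //; rewrite -g0 //; apply: hth; apply: bounds.
set D := z - th (0, 0) in cD.
have cA : continuous (fun t => th (t, 0) + D) by ct.
have cB : continuous (fun t => th (t, 1) + D) by ct.
have eq01 t : t = 0 \/ t = 1 -> th (t, 1) = th (t, 0).
  move=> ht; have t0 : 0 <= t by case: ht => ->.
  have t1 : t <= 1 by case: ht => ->.
  have cst r : g (t, r) = mm (A t).
    rewrite /g /= (cl_iv t0 t1).
    have -> : F t = A t by case: ht => ->.
    by rewrite -scalerDl subrK scale1r.
  apply: (@cos1_cst R (fun r => th (t, r)) 0 1) => //; first by ct.
  move=> s /andP[s0 s1]; apply: (dir_cos (u := mm (A t))).
    by rewrite -(cst 0); apply: hth; apply: bounds.
  by rewrite -(cst s); apply: hth; apply: bounds.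
have dA t : 0 <= t -> t <= 1 -> dir (cm a b p (kap (v2 0 y0) t)) (th (t, 0) + D).
  move=> t0 t1; apply: (@dir_unscale (sqn (kap (v2 0 y0) t) + 1)^-1); first by rewrite invr_gt0 sqn1_gt0.
  rewrite -mm_bpt -/(A t) -g0 //; apply: dir_shift cD; apply: hth; exact: bounds.
exists (fun t => th (t, 0) + D), (fun t => th (t, 1) + D); split => //; last first.
  by rewrite (eq01 0) ?(eq01 1) //; [right | left].
move=> t t0 t1; split.
- exact: dA.
- by rewrite -g1 //; apply: dir_shift cD; apply: hth; exact: bounds.
- apply: (stay_in (h := fun t => th (t, 0) + D) (a := 0) (b := 1)) => //.
  + move=> s s0 s1; have [r r0 [_ h]] := dir_polar (dA s s0 s1); have [_ _ k] := cm_A s0 s1.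
    have k' : 0 < sin (th (s, 0) + D) by rewrite -(pmulr_rgt0 _ r0) -h; lra.
    by split; apply/eqP => e; rewrite e ?sin0 ?sinpi ltxx in k'.
  + by rewrite /D; lra.
  + by rewrite /D; lra.
- have -> : th (t, 1) + D - (th (t, 0) + D) = th (t, 1) - th (t, 0) by ring.
  apply: (@lift_noneg R (fun r => g (t, r)) (fun=> mm (A t)) (fun r => th (t, r)) (fun=> th (t, 0)) 0 1) => //.
  + by ct.
  + by ct.
  + by move=> s hs; apply: hth => //; exact: bounds.
  + by move=> s hs; rewrite -g0 //; apply: hth; exact: bounds.
  + move=> s c /andP[s0 s1] c0; rewrite /g /= (cl_iv t0 t1) (cl_iv s0 s1) -subr_eq0 opprK addrAC -scalerDl.
    by apply: mm_sep => //; lra.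
  + by rewrite subrr normr0.
Qed.

(** The argument is followed through the five arcs, each of which keeps the barrier in a half-plane:
    from below, in (- pi, 0), once around to below again, in (pi, 2 pi). *)
Lemma lift_I : exists2 ph : R -> R, continuous ph & [/\ forall s, 0 <= s -> s <= 1 -> dir (cm a b p (I s)) (ph s),
  forall s, 0 <= s -> s <= v1 -> - pi < ph s /\ ph s < 0 &
  forall s, v4' <= s -> s <= 1 -> pi < ph s /\ ph s < 2 * pi].
Proof.
have p0 := pi_gt0 R; have [v10 v12 v23 v34 v41] := vord.
pose f (q : R * R) := mm (bpt (I (cl q.2))).
have cf : continuous f.
  move=> q; have c2 : cat (fun q : R * R => cl q.2) q by apply: (cat_cl (f := fun q : R * R => q.2)); ct.
  change (cat (fun q : R * R => mm (bpt (I (cl q.2)))) q).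
  by apply: cat_ml; apply: cat_bpt; ct.
have fn0 q : f q != 0.
  have /andP[z0 z1] := cl_itv q.2.
  by rewrite /f mm_bpt scaler_eq0 negb_or invr_neq0 ?gt_eqF ?sqn1_gt0 //= cm_I_neq0.
have [th [cth hth]] := lift cf (fun q _ _ => fn0 q).
have bounds (x : R) : 0 <= x -> x <= 1 -> 0 <= x <= 1 by move=> -> ->.
have d2 : dir (v2 0 (-1) : M) (- (pi / 2)).
  by exists 1; rewrite ?ltr01 // scale1r /pol cosN sinN cos_pihalf sin_pihalf.
have hI s : 0 <= s -> s <= 1 -> dir (cm a b p (I s)) (th (0, s)).
  move=> s0 s1; apply: (@dir_unscale (sqn (I s) + 1)^-1); first by rewrite invr_gt0 sqn1_gt0.
  rewrite -mm_bpt -[X in I X](cl_iv s0 s1) -/(f (0, s)); apply: hth; exact: bounds.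
have [_ _ _ neg0] := cm_I1 (lexx 0) v10.
have [z [dz zl zr]] : exists z, [/\ dir (cm a b p (I 0)) z, - (pi / 2) - pi / 2 < z & z < - (pi / 2) + pi / 2].
  by apply: dir_near d2 _; rewrite /dot [v2 _ _ _ _]v2E [v2 _ _ _ _]v2E; lra.
have cD : cos (z - th (0, 0)) = 1 by apply: (dir_cos (hI 0 _ _) dz) => //; lra.
set D := z - th (0, 0) in cD; pose ph s := th (0, s) + D.
have cph : continuous ph by rewrite /ph; ct.
have dI s : 0 <= s -> s <= 1 -> dir (cm a b p (I s)) (ph s).
  by move=> s0 s1; apply: dir_shift cD; exact: hI.
have ph0 : ph 0 = z by rewrite /ph /D; ring.
have pl s : 0 <= s -> s <= 1 -> exists2 r, 0 < r & cm a b p (I s) 0 0 = r * cos (ph s) /\ cm a b p (I s) 0 1 = r * sin (ph s).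
  by move=> s0 s1; exact: dir_polar (dI s s0 s1).
have S1 s : 0 <= s -> s <= v1 -> sin (ph s) < 0.
  move=> s0 s1; have [||r r0 [_ h]] := pl s; try lra.
  by have [_ _ _ k] := cm_I1 s0 s1; rewrite -(pmulr_rlt0 _ r0) -h.
have S2 s : v1 <= s -> s <= v2' -> 0 < cos (ph s).
  move=> s0 s1; have [||r r0 [h _]] := pl s; try lra.
  by have [k _] := cm_I2 s0 s1; rewrite -(pmulr_rgt0 _ r0) -h.
have S3 s : v2' <= s -> s <= v3 -> 0 < sin (ph s).
  move=> s0 s1; have [||r r0 [_ h]] := pl s; try lra.
  by have [k _] := cm_I3 s0 s1; rewrite -(pmulr_rgt0 _ r0) -h.
have S4 s : v3 <= s -> s <= v4' -> cos (ph s) < 0.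
  move=> s0 s1; have [||r r0 [h _]] := pl s; try lra.
  by have [k _] := cm_I4 s0 s1; rewrite -(pmulr_rlt0 _ r0) -h.
have S5 s : v4' <= s -> s <= 1 -> sin (ph s) < 0.
  move=> s0 s1; have [||r r0 [_ h]] := pl s; try lra.
  by have [_ _ k] := cm_I5 s0 s1; rewrite -(pmulr_rlt0 _ r0) -h.
have cN : cos (- (pi / 2)) = 0 :> R by rewrite cosN cos_pihalf.
have c3 : cos (pi + pi / 2) = 0 :> R by rewrite cosD cos_pihalf sinpi mul0r mulr0 subr0.
have s2 : sin (2 * pi) = 0 :> R.
  have -> : 2 * pi = pi + pi :> R by ring.
  by rewrite sinD sinpi mul0r mulr0 addr0.
have B1 s : 0 <= s -> s <= v1 -> - pi < ph s /\ ph s < 0.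
  apply: (stay_in (h := ph) (a := 0) (b := v1)) => //; rewrite ?ph0; try lra.
  by move=> x x0 x1; have hx := S1 x x0 x1; split; apply/eqP => e; move: hx; rewrite e ?sinN ?sinpi ?sin0 ?oppr0 ltxx.
have [b1l b1r] := B1 v1 v10 (lexx _).
have [c1l c1r] := @cos_half R (ph v1) ltac:(lra) ltac:(lra) (S2 v1 (lexx _) v12).
have B2 s : v1 <= s -> s <= v2' -> - (pi / 2) < ph s /\ ph s < pi / 2.
  apply: (stay_in (h := ph) (a := v1) (b := v2')) => //.
  by move=> x x0 x1; have hx := S2 x x0 x1; split; apply/eqP => e; move: hx; rewrite e ?cN ?cos_pihalf ltxx.
have [b2l b2r] := B2 v2' v12 (lexx _).
have [k2 _ _] := @sin_sgn R (ph v2') ltac:(lra) ltac:(lra); have {}k2 := k2 (S3 v2' (lexx _) v23).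
have B3 s : v2' <= s -> s <= v3 -> 0 < ph s /\ ph s < pi.
  apply: (stay_in (h := ph) (a := v2') (b := v3)) => //; last lra.
  by move=> x x0 x1; have hx := S3 x x0 x1; split; apply/eqP => e; move: hx; rewrite e ?sinpi ?sin0 ltxx.
have [b3l b3r] := B3 v3 v23 (lexx _).
have [c3l c3r] : - (pi / 2) < pi - ph v3 /\ pi - ph v3 < pi / 2.
  apply: cos_half; try lra.
  by rewrite cosB cospi sinpi mul0r addr0 mulN1r oppr_gt0; exact: S4.
have B4 s : v3 <= s -> s <= v4' -> pi / 2 < ph s /\ ph s < pi + pi / 2.
  apply: (stay_in (h := ph) (a := v3) (b := v4')) => //; try lra.
  by move=> x x0 x1; have hx := S4 x x0 x1; split; apply/eqP => e; move: hx; rewrite e ?c3 ?cos_pihalf ltxx.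
have [b4l b4r] := B4 v4' v34 (lexx _).
have k4 := @sin_neg_pi (ph v4') ltac:(lra) ltac:(lra) (S5 v4' (lexx _) v41).
exists ph => //; split => //.
apply: (stay_in (h := ph) (a := v4') (b := 1)) => //; last lra.
by move=> x x0 x1; have hx := S5 x x0 x1; split; apply/eqP => e; move: hx; rewrite e ?sinpi ?s2 ltxx.
Qed.

Lemma start_crs (x y u v : R) : x <= -1 + 22/100 -> - 43/10 <= y -> y < 0 -> - (6/10) <= u -> u <= 6/10 -> 53/10 <= v ->
  x * v - y * u < 0.
Proof. by move=> *; nra. Qed.

Lemma stop_crs (x y u v : R) : 13/2 - 161/100 <= x -> - 13 <= y -> y < 0 -> - (6/10) <= u -> u <= 6/10 -> 53/10 <= v ->
  u * y - v * x < 0.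
Proof. by move=> *; nra. Qed.

(* In polar coordinates about the chord from v2 0 p to Y, the path I is a barrier over an interval of angles
   that contains all angles of F, and F starts below it and ends above it. *)
Lemma no_passage : False.
Proof.
have p0 := pi_gt0 R; have [v10 v12 v23 v34 v41] := vord.
have [tA [tB [cA cB hAB [eq0 eq1]]]] := lifts_AF.
have [ph cph [dI ph0 ph1']] := lift_I.
have bounds (x : R) : 0 <= x -> x <= 1 -> 0 <= x <= 1 by move=> -> ->.
have e0 : (0 : R) <= 0 by [].
have e1 : (0 : R) <= 1 by exact: ler01.
have e2 : (1 : R) <= 1 by [].
have Fn t : 0 <= t -> t <= 1 -> mm (F t) != 0.
  by move=> t0 t1; have [_ d _ _] := hAB t t0 t1; exact: dir_neq0 d.
have In s : 0 <= s -> s <= 1 -> mm (bpt (I s)) != 0.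
  by move=> s0 s1; rewrite mm_bpt scaler_eq0 negb_or invr_neq0 ?gt_eqF ?sqn1_gt0 //= cm_I_neq0.
pose al (q : R * R) := ph q.2 - tB q.1.
pose be (q : R * R) := rho_ratio (bpt (I (cl q.2))) - rho_ratio (F (cl q.1)).
have ends t s : t = 0 \/ t = 1 -> 0 <= s -> s <= 1 -> ph s = tB t -> 0 < (2^-1 - t) * be (t, s).
  move=> ht s0 s1 e.
  have t0 : 0 <= t by case: ht => ->.
  have t1 : t <= 1 by case: ht => ->.
  have eA : tB t = tA t by case: ht => ->.
  have FA : F t = A t by case: ht => ->.
  have [dA _ _ _] := hAB t t0 t1; have := dI s s0 s1; rewrite e eA => dS.
  have [c c0 ec] := dir_same dS dA; have [A0 A1 A2] := cm_A t0 t1.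
  have ex := congr1 (fun v : M => v 0 0) ec; have ey := congr1 (fun v : M => v 0 1) ec.
  rewrite [in RHS]mxE in ex; rewrite [in RHS]mxE in ey.
  rewrite /be /= (cl_iv s0 s1) (cl_iv t0 t1) FA.
  have pos : 0 < c * cm a b p (kap (v2 0 y0) t) 0 1 by rewrite mulr_gt0 //; lra.
  have [h1|h1] := leP s v1.
    by have [_ _ _ h] := cm_I1 s0 h1; lra.
  have [h2|h2] := leP s v2'.
    have [_ h] := cm_I2 (ltW h1) h2; rewrite ex ey in h.
    have := mulr_gt0 c0 (_ : 0 < - 6 * cm a b p (kap (v2 0 y0) t) 0 0 + cm a b p (kap (v2 0 y0) t) 0 1).
    by move=> /(_ ltac:(lra)); lra.
  have [h3|h3] := leP s v3.
    exact: side_sign ht (ltW h2) h3 c0 ec.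
  have [h4|h4] := leP s v4'.
    have [_ h] := cm_I4 (ltW h3) h4; rewrite ex ey in h.
    have := mulr_gt0 c0 (_ : 0 < 6 * cm a b p (kap (v2 0 y0) t) 0 0 + cm a b p (kap (v2 0 y0) t) 0 1).
    by move=> /(_ ltac:(lra)); lra.
  by have [_ _ h] := cm_I5 (ltW h4) s1; lra.
apply: (@rect_cross R al be).
- by rewrite /al; ct.
- move=> q; change (cat (fun q : R * R => rho_ratio (bpt (I (cl q.2))) - rho_ratio (F (cl q.1))) q).
  have c1 : cat (fun q : R * R => cl q.1) q by apply: (cat_cl (f := fun q : R * R => q.1)); ct.
  have c2 : cat (fun q : R * R => cl q.2) q by apply: (cat_cl (f := fun q : R * R => q.2)); ct.
  have kI : cat (fun q : R * R => bpt (I (cl q.2))) q by apply: cat_bpt; ct.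
  have kF : cat (fun q : R * R => F (cl q.1)) q by ct.
  have k1 : cat (fun q : R * R => mk Ph (bpt (I (cl q.2)))) q by apply: (cat_mk (u := fun=> Ph)); [exact: cat_cst | exact: kI].
  have k2 : cat (fun q : R * R => mk Yh (bpt (I (cl q.2)))) q by apply: (cat_mk (u := fun=> Yh)); [exact: cat_cst | exact: kI].
  have k3 : cat (fun q : R * R => mk Ph (F (cl q.1))) q by apply: (cat_mk (u := fun=> Ph)); [exact: cat_cst | exact: kF].
  have k4 : cat (fun q : R * R => mk Yh (F (cl q.1))) q by apply: (cat_mk (u := fun=> Yh)); [exact: cat_cst | exact: kF].
  have /andP[x0 x1] := cl_itv q.1; have /andP[z0 z1] := cl_itv q.2.
  have [_ n1] := mk_PY_gt0 (bpt_bd _) (In _ z0 z1); have [_ n2] := mk_PY_gt0 (bF _) (Fn _ x0 x1).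
  by rewrite /rho_ratio; ct; rewrite gt_eqF.
- move=> [t s] /= /andP[t0 t1] /andP[s0 s1] e; rewrite /be /= (cl_iv s0 s1) (cl_iv t0 t1) subr_eq0.
  apply/eqP => eb; have [_ dF _ _] := hAB t t0 t1; have dS := dI s s0 s1.
  have {}e : ph s = tB t by apply/eqP; rewrite -subr_eq0; apply/eqP.
  rewrite e in dS; have dS' : dir (mm (bpt (I s))) (tB t).
    by rewrite mm_bpt; apply: dirZ => //; rewrite invr_gt0 sqn1_gt0.
  have [c c0 ec] := dir_same dS' dF.
  have : mm (bpt (I s) + (- c) *: F t) = 0 by rewrite mlD (mlZ _ _ _ (- c)) ec scaleNr subrr.
  move=> /(ml_ker ker_n1)[al' [be' h]].
  have hX : bpt (I s) = c *: F t + (al' *: Ph + be' *: Yh) by rewrite -/Ph -/Yh in h; rewrite -h scaleNr addrC subrK.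
  have [uI vI] := mk_PY_gt0 (bpt_bd _) (In _ s0 s1); have [uF vF] := mk_PY_gt0 (bF t) (Fn _ t0 t1).
  have mPY : 0 < mk Ph Yh.
    have [/andP[a0 a1] /andP[b0 b1]] := ab_small; have /andP[pl pr] := hp.
    have -> : mk Ph Yh = p ^+ 2 * (a ^+ 2 + b ^+ 2) + 1 - 2 * (p * b).
      by rewrite /mk /Ph /Yh /hat /hatY !v4E ?rvE /sqn ?rvE; ring.
    have : 0 <= p ^+ 2 * (a ^+ 2 + b ^+ 2) by rewrite mulr_ge0 ?addr_ge0 ?sqr_ge0.
    have : p * b <= 2^-1 * 100^-1 by apply: le_trans (ler_norm _) _; rewrite normrM; apply: ler_pM => //; rewrite ler_norml; apply/andP; split; lra.
    lra.
  have eq1' : mk Ph (bpt (I s)) * mk Yh (F t) = mk Ph (F t) * mk Yh (bpt (I s)).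
    by move: eb; rewrite /rho_ratio => /eqP; rewrite (eqr_div _ _ (lt0r_neq0 vI) (lt0r_neq0 vF)) => /eqP.
  have qP : qd Ph = 0 by rewrite /qd /Ph /hat !v4E /sqn; ring.
  have qY : qd Yh = 0 by rewrite /qd /Yh /hatY !v4E; ring.
  have [a0 b0] := pencil_inj qP qY (bpt_bd (I s)).2 (bF t).2 mPY uI vI uF vF c0 hX eq1'.
  have hX' : bpt (I s) = c *: F t by rewrite hX a0 b0 !scale0r !addr0.
  have c1 : c = 1.
    have := (bpt_bd (I s)).1.2; rewrite hX' trZ (bF t).1.2 mulr1; exact.
  by have := av s t0 t1; rewrite hX' c1 scale1r eqxx.
- move=> t /andP[t0 t1]; have [dA _ [Al Ar] hd] := hAB t t0 t1; rewrite /al /=.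
  move: hd; rewrite ltr_norml => /andP[hd1 hd2]; have [A0 A1 A2] := cm_A t0 t1.
  have [q1 q2] := ph0 0 e0 v10; have [q3 q4] := ph1' 1 v41 e2.
  have [_ x1 y1 y2] := cm_I1 e0 v10; have [w1 w2 w3] := cm_I5 v41 e2.
  rewrite start in x1; rewrite stop in w1.
  have [c c0 hc] := dir_crs (dI 0 e0 e1) dA; have [d d0 hd] := dir_crs dA (dI 1 e1 e2).
  (* The negative sines will place [tA t] more than pi above the initial and more than pi below the
     final angle of the barrier; as [tB t] is within pi of [tA t], it lies between them. *)
  have s1 : sin (tA t - ph 0) < 0.
    by rewrite -(pmulr_rlt0 _ c0) -hc /crs; exact: start_crs.
  have s2 : sin (ph 1 - tA t) < 0.
    by rewrite -(pmulr_rlt0 _ d0) -hd /crs; exact: stop_crs.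
  have := @sin_neg_pi (tA t - ph 0) ltac:(lra) ltac:(lra) s1.
  have := @sin_neg_pi (ph 1 - tA t) ltac:(lra) ltac:(lra) s2.
  by split; lra.
- move=> s /andP[s0 s1]; split => e.
    have {}e : ph s = tB 0 by apply/eqP; rewrite -subr_eq0; apply/eqP.
    by have := ends 0 s (or_introl erefl) s0 s1 e; rewrite subr0 pmulr_rgt0 // invr_gt0.
  have {}e : ph s = tB 1 by apply/eqP; rewrite -subr_eq0; apply/eqP.
  have h := ends 1 s (or_intror erefl) s0 s1 e.
  by rewrite ltNge; apply/negP => h'; have k : (2^-1 - 1) * be (1, s) <= 0; [by apply: mulr_le0_ge0 => //; lra | lra].
Qed.
End Passage.

(** * Segments with good orbits *)

Section TameSegments.
Variable R : realType.
Notation M := 'rV[R]_2.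
Notation H := 'rV[R]_4.
Variables (n : nat) (cx cy : nat -> R) (adj : rel nat).
Notation polar := (polar cx cy).
Notation lam := (lam cx cy).
Notation refl := (refl cx cy).
Notation tame := (tame n cx cy).
Hypothesis adjC : symmetric adj.
Hypothesis adj_orth : forall i j, (i < n)%N -> (j < n)%N -> adj i j -> mk (polar i) (polar j) = 0.
Hypothesis nadj_orth : forall i j, (i < n)%N -> (j < n)%N -> i != j -> ~~ adj i j -> 2 <= mk (polar i) (polar j).

Lemma lam_hat i (z : M) : lam i (hat z) = (z 0 0 - cx i) ^+ 2 + (z 0 1 - cy i) ^+ 2 - 2^-1.
Proof. by rewrite lamE polarE /mk /hat !v4E /sqn; ring. Qed.

Lemma tr_hat_gt0 (z : M) : 0 < tr (hat z).
Proof. by rewrite /tr /hat !v4E sqn1_gt0. Qed.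

(** A point of a unit segment whose ends are at distance at least 1 from a centre has squared
    distance at least 3/4 from it, hence lies outside the circle by a fixed amount. *)
Lemma tame_edge (p q : M) t : (0 < n)%N -> 0 <= t -> t <= 1 -> (q 0 0 - p 0 0) ^+ 2 + (q 0 1 - p 0 1) ^+ 2 = 1 ->
  (forall i, (i < n)%N -> 1 <= (p 0 0 - cx i) ^+ 2 + (p 0 1 - cy i) ^+ 2 /\ 1 <= (q 0 0 - cx i) ^+ 2 + (q 0 1 - cy i) ^+ 2) ->
  tame (hat (p + t *: (q - p))).
Proof.
move=> n0 t0 t1 e far; have far' i : (i < n)%N -> 4^-1 <= lam i (hat (p + t *: (q - p))).
  move=> /far[h1 h2]; rewrite lam_hat !rvE.
  have -> : (p 0 0 + t * (q 0 0 - p 0 0) - cx i) ^+ 2 + (p 0 1 + t * (q 0 1 - p 0 1) - cy i) ^+ 2 =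
    (1 - t) * ((p 0 0 - cx i) ^+ 2 + (p 0 1 - cy i) ^+ 2) + t * ((q 0 0 - cx i) ^+ 2 + (q 0 1 - cy i) ^+ 2)
    - t * (1 - t) * ((q 0 0 - p 0 0) ^+ 2 + (q 0 1 - p 0 1) ^+ 2) by ring.
  have u0 : 0 <= 1 - t by lra.
  have := ler_wpM2l u0 h1; have := ler_wpM2l t0 h2; have := sqr_ge0 (t - 2^-1); rewrite e; lra.
have p4 : (0 : R) < 4^-1 by rewrite invr_gt0.
apply: (tame_fund adjC adj_orth nadj_orth p4 (tr_hat_gt0 _) n0); first by have := far' 0%N n0; lra.
by move=> i ? _; exact: far'.
Qed.

Definition hgt : R := Num.sqrt 3 / 2.
Lemma hgt_sq : hgt ^+ 2 = 3 / 4.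
Proof. by rewrite /hgt exprMn sqr_sqrtr ?ler0n // exprVn; lra. Qed.
Lemma hgt_bound : 866/1000 <= hgt <= 867/1000.
Proof.
have h0 : 0 <= hgt by rewrite divr_ge0 // sqrtr_ge0.
by have := hgt_sq => h; apply/andP; split; rewrite leNgt; apply/negP => k; nra.
Qed.

(** On the vertical line through its centre, the inversion sends the distance [d] to [1 / (2 d)];
    [e] tells whether the centre is above or below, and the scalar restores the normalization of
    [hat]. *)
Lemma refl_step i (x y0 y e : R) : e = 1 \/ e = -1 -> cx i = x -> cy i = y0 + e * hgt -> - 2^-1 <= y -> y <= 2^-1 ->
  refl i (hat (v2 x (y0 + y))) = (2 * (hgt - e * y) ^+ 2) *: hat (v2 x (y0 + e * (hgt - (2 * (hgt - e * y))^-1))).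
Proof.
have /andP[h0 h1] := hgt_bound; move=> he ex ey yl yr.
have d0 : hgt - e * y != 0 by rewrite gt_eqF //; case: he => ->; lra.
have e2 : e ^+ 2 = 1 by case: he => ->; rewrite ?expr1n ?sqrrN ?expr1n.
have yE : y = e * (hgt - (hgt - e * y)) by rewrite subKr mulrA -expr2 e2 mul1r.
rewrite yE; move: (hgt - e * y) d0 => d d0.
have -> : hgt - e * (e * (hgt - d)) = d by rewrite mulrA -expr2 e2 mul1r subKr.
have L : lam i (hat (v2 x (y0 + e * (hgt - d)))) = d ^+ 2 - 2^-1.
  rewrite lam_hat !v2E ex ey subrr.
  have -> : y0 + e * (hgt - d) - (y0 + e * hgt) = - (e * d) by ring.
  by rewrite sqrrN exprMn e2 mul1r expr0n add0r.
rewrite reflE L polarE ex ey; apply: rV4P; rewrite /hat !v4E ?v2E /sqn ?v2E.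
- have E (k : R) : (x ^+ 2 + (y0 + e * k) ^+ 2) = x ^+ 2 + y0 ^+ 2 + 2 * y0 * e * k + k ^+ 2.
    by rewrite sqrrD exprMn e2 mul1r; ring.
  by rewrite !E; field.
- by field.
- by field.
- by field.
Qed.

Section Crossing.
Variables (x y0 : R) (a c : nat).
Hypothesis an : (a < n)%N.
Hypothesis cn : (c < n)%N.
Hypothesis ca : cx a = x /\ cy a = y0 + 1 * hgt.
Hypothesis cc : cx c = x /\ cy c = y0 + -1 * hgt.
Hypothesis far : forall i y, (i < n)%N -> i != a -> i != c -> - 2^-1 <= y -> y <= 2^-1 ->
  3 / 4 <= (x - cx i) ^+ 2 + (y0 + y - cy i) ^+ 2.

Let A := 2 * hgt + 1.
Let B := 2 * hgt - 1.

(** On each half of the segment only the circle with the nearer centre can be touched, and it takes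
    the exceptional role in [tame_fund]. *)
Lemma tame_cross_base y : - 2^-1 < y -> y < 2^-1 -> 0 <= lam a (hat (v2 x (y0 + y))) -> 0 <= lam c (hat (v2 x (y0 + y))) ->
  tame (hat (v2 x (y0 + y))).
Proof.
move=> yl yr la lc; have /andP[h0 h1] := hgt_bound; have h2 := hgt_sq.
have fi i : (i < n)%N -> i != a -> i != c -> 4^-1 <= lam i (hat (v2 x (y0 + y))).
  by move=> i0 ia ic; have := far i0 ia ic (ltW yl) (ltW yr); rewrite lam_hat !v2E; lra.
have p4 : (0 : R) < 4^-1 by rewrite invr_gt0.
have [y0'|y0'] := leP 0 y.
  apply: (tame_fund adjC adj_orth nadj_orth p4 (tr_hat_gt0 _) an) => // i i0 ia.
  have [->|ic] := eqVneq i c; last exact: fi.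
  by rewrite lam_hat !v2E cc.1 cc.2; nra.
apply: (tame_fund adjC adj_orth nadj_orth p4 (tr_hat_gt0 _) cn) => // i i0 ic.
have [->|ia] := eqVneq i a; last exact: fi.
by rewrite lam_hat !v2E ca.1 ca.2; nra.
Qed.

Lemma lam_cross (e y : R) i : e = 1 \/ e = -1 -> cx i = x /\ cy i = y0 + e * hgt ->
  2 * lam i (hat (v2 x (y0 + y))) = A * (2^-1 - e * y) ^+ 2 - B * (2^-1 + e * y) ^+ 2.
Proof.
move=> he [e1 e2]; rewrite lam_hat !v2E e1 e2 /A /B; have h2 := hgt_sq.
have -> : y0 + y - (y0 + e * hgt) = y - e * hgt by ring.
by case: he => ->; move: h2; rewrite ?mul1r ?mulN1r; lra.
Qed.

(* The ratio (1/2 + y) / (1/2 - y) is mapped by the two reflections to K / m and 1 / (K m), K = A / B. *)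
Lemma tame_cross_ind N y : - 2^-1 < y -> y < 2^-1 ->
  B ^+ (N.*2.+1) * (2^-1 + y) ^+ 2 <= A ^+ (N.*2.+1) * (2^-1 - y) ^+ 2 ->
  B ^+ (N.*2.+1) * (2^-1 - y) ^+ 2 <= A ^+ (N.*2.+1) * (2^-1 + y) ^+ 2 -> tame (hat (v2 x (y0 + y))).
Proof.
have /andP[h0 h1] := hgt_bound; have h2 := hgt_sq.
have e1 : (1 : R) = 1 \/ (1 : R) = -1 by left.
have e2 : (-1 : R) = 1 \/ (-1 : R) = -1 by right.
have A0 : 0 < A by rewrite /A; lra.
have B0 : 0 < B by rewrite /B; lra.
have BA : B <= A by rewrite /A /B; lra.
have AB : A * B = 2 by rewrite /A /B; lra.
elim: N y => [|N IH] y yl yr c1 c2.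
  have la := lam_cross y e1 ca; have lc := lam_cross y e2 cc.
  by apply: tame_cross_base => //; move: c1 c2 la lc; rewrite !expr1 ?mul1r ?mulN1r ?opprK; lra.
have step e i : e = 1 \/ e = -1 -> (i < n)%N -> cx i = x /\ cy i = y0 + e * hgt -> lam i (hat (v2 x (y0 + y))) < 0 ->
    tame (hat (v2 x (y0 + y))).
  move=> he i0 ci li; have lE := lam_cross y he ci; have [ex ey] := ci.
  have rs := refl_step he ex ey (ltW yl) (ltW yr).
  have d0 : 0 < hgt - e * y by case: he => ->; lra.
  pose u := 2^-1 - e * y; pose v := 2^-1 + e * y.
  have u0 : 0 < u by rewrite /u; case: he => ->; lra.
  have v0 : 0 < v by rewrite /v; case: he => ->; lra.
  have cuv : B ^+ (N.*2.+3) * v ^+ 2 <= A ^+ (N.*2.+3) * u ^+ 2.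
    by move: c1 c2; rewrite /u /v doubleS; case: he => ->; rewrite ?mul1r ?mulN1r ?opprK.
  have luv : A * u ^+ 2 <= B * v ^+ 2 by rewrite /u /v; lra.
  rewrite -(reflK cx cy i (hat _)) rs; apply: tame_refl => //.
  apply: tameZ; first by rewrite mulr_gt0 // exprn_gt0.
  set d := hgt - e * y in d0 rs *; pose y' := e * (hgt - (2 * d)^-1).
  have uE : 2^-1 - (hgt - (2 * d)^-1) = B * v / (2 * d).
    have -> : B * v = 2 * d * (2^-1 - hgt) + 1.
      by rewrite /B /v /d; case: he => ->; move: h2; lra.
    by field; rewrite gt_eqF.
  have vE : 2^-1 + (hgt - (2 * d)^-1) = A * u / (2 * d).
    have -> : A * u = 2 * d * (2^-1 + hgt) - 1.
      by rewrite /A /u /d; case: he => ->; move: h2; lra.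
    by field; rewrite gt_eqF.
  have U0 : 0 < B * v / (2 * d) by rewrite divr_gt0 // mulr_gt0.
  have V0 : 0 < A * u / (2 * d) by rewrite divr_gt0 // mulr_gt0.
  have scl (K1 K2 s1 s2 w : R) : 0 < w -> K1 * s1 ^+ 2 <= K2 * s2 ^+ 2 -> K1 * (s1 / w) ^+ 2 <= K2 * (s2 / w) ^+ 2.
    by move=> w0 h; rewrite !expr_div_n (mulrA K1) (mulrA K2) ler_pM2r // invr_gt0 exprn_gt0.
  have dd : 0 < 2 * d by rewrite mulr_gt0.
  have k1 : B ^+ (N.*2.+1) * (A * u / (2 * d)) ^+ 2 <= A ^+ (N.*2.+1) * (B * v / (2 * d)) ^+ 2.
    apply: scl => //; have h3 : B ^+ N.*2 <= A ^+ N.*2 by rewrite lerXn2r ?nnegrE // ltW.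
    have -> : B ^+ (N.*2.+1) * (A * u) ^+ 2 = B ^+ N.*2 * (B * A * (A * u ^+ 2)) by rewrite exprS; ring.
    have -> : A ^+ (N.*2.+1) * (B * v) ^+ 2 = A ^+ N.*2 * (B * A * (B * v ^+ 2)) by rewrite exprS; ring.
    apply: ler_pM => //; first by rewrite exprn_ge0 // ltW.
      by rewrite !mulr_ge0 ?sqr_ge0 // ltW.
    by apply: ler_wpM2l => //; rewrite mulr_ge0 // ltW.
  have k2 : B ^+ (N.*2.+1) * (B * v / (2 * d)) ^+ 2 <= A ^+ (N.*2.+1) * (A * u / (2 * d)) ^+ 2.
    apply: scl => //.
    have -> : B ^+ (N.*2.+1) * (B * v) ^+ 2 = B ^+ (N.*2.+3) * v ^+ 2 by rewrite exprMn mulrA -exprD addn2.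
    by have -> : A ^+ (N.*2.+1) * (A * u) ^+ 2 = A ^+ (N.*2.+3) * u ^+ 2 by rewrite exprMn mulrA -exprD addn2.
  case: (he) => ee; rewrite ee ?mul1r ?mulN1r.
    by apply: IH; rewrite ?uE ?vE //; move: uE vE U0 V0; lra.
  by apply: IH; rewrite ?opprK ?uE ?vE //; move: uE vE U0 V0; lra.
have [la|la] := ltP (lam a (hat (v2 x (y0 + y)))) 0; first exact: step e1 an ca la.
have [lc|lc] := ltP (lam c (hat (v2 x (y0 + y)))) 0; first exact: step e2 cn cc lc.
exact: tame_cross_base.
Qed.

Lemma tame_cross y : - 2^-1 < y -> y < 2^-1 -> tame (hat (v2 x (y0 + y))).
Proof.
move=> yl yr; have /andP[h0 h1] := hgt_bound.
have u0 : 0 < 2^-1 - y by lra.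
have v0 : 0 < 2^-1 + y by lra.
have B0 : 0 < B by rewrite /B; lra.
have BA : 2 * B <= A by rewrite /A /B; lra.
(* As [A] is at least [2 * B], the power [2 N + 1] of [A / B] exceeds [N], which bounds both squared
   ratios. *)
pose N := Num.bound (((2^-1 + y) / (2^-1 - y)) ^+ 2 + ((2^-1 - y) / (2^-1 + y)) ^+ 2).
have hN : ((2^-1 + y) / (2^-1 - y)) ^+ 2 + ((2^-1 - y) / (2^-1 + y)) ^+ 2 < N%:R.
  by apply: archi_boundP; rewrite addr_ge0 ?sqr_ge0.
have AN : N%:R * B ^+ (N.*2.+1) <= A ^+ (N.*2.+1).
  apply: (@le_trans _ _ ((2 * B) ^+ (N.*2.+1))); last by rewrite lerXn2r ?nnegrE //; lra.
  rewrite exprMn; apply: ler_wpM2r; first by rewrite exprn_ge0 // ltW.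
  rewrite -natrX ler_nat; apply: leq_trans (ltnW (ltn_expl N (ltnSn 1))) _.
  by rewrite leq_exp2l // -addnn -addnS leq_addr.
have aux (s t : R) : 0 < s -> 0 < t -> (s / t) ^+ 2 <= N%:R -> B ^+ (N.*2.+1) * s ^+ 2 <= A ^+ (N.*2.+1) * t ^+ 2.
  move=> s0 t0 h; have t2 : 0 < t ^+ 2 by rewrite exprn_gt0.
  rewrite -ler_pdivrMr // -mulrA -expr_div_n mulrC.
  by apply: le_trans AN; apply: ler_wpM2r => //; rewrite exprn_ge0 // ltW.
have q1 := sqr_ge0 ((2^-1 + y) / (2^-1 - y)); have q2 := sqr_ge0 ((2^-1 - y) / (2^-1 + y)).
by apply: (tame_cross_ind (N := N)) => //; apply: aux => //; lra.
Qed.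

(** The fixed points are the limit points of the pencil of the two circles, at height plus or minus
    the square root of [hgt ^+ 2] - 1/2, that is 1/2. This is why the crossing segments have unit
    length. *)
Lemma lox_cross s : s = 2^-1 \/ s = - 2^-1 -> refl a (refl c (hat (v2 x (y0 + s)))) =
  (2 * (hgt + s) ^+ 2) ^+ 2 *: hat (v2 x (y0 + s)).
Proof.
move=> hs; have /andP[h0 h1] := hgt_bound; have h2 := hgt_sq.
have e1 : (1 : R) = 1 \/ (1 : R) = -1 by left.
have e2 : (-1 : R) = 1 \/ (-1 : R) = -1 by right.
have sl : - 2^-1 <= s by case: hs => ->; lra.
have sr : s <= 2^-1 by case: hs => ->; lra.
have s2 : s ^+ 2 = 4^-1 by case: hs => ->; rewrite ?sqrrN exprVn; lra.
have d0 : hgt + s != 0 by rewrite gt_eqF //; case: hs => ->; lra.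
have kE : (2 * (hgt + s))^-1 = hgt - s.
  apply: (mulfI (x := 2 * (hgt + s))); first by rewrite mulf_neq0.
  by rewrite mulfV ?mulf_neq0 //; move: h2 s2; lra.
rewrite (refl_step e2 cc.1 cc.2 sl sr) !mulN1r opprK kE reflZ.
have -> : - (hgt - (hgt - s)) = - s by ring.
have r := refl_step e1 ca.1 ca.2 (y := - s) ltac:(lra) ltac:(lra).
rewrite r !mul1r opprK kE subKr scalerA; congr (_ *: _); ring.
Qed.

Lemma lox_mult s : s = 2^-1 \/ s = - 2^-1 -> ((2 * (hgt + s) ^+ 2) ^+ 2) ^+ 2 != 1.
Proof.
have /andP[h0 h1] := hgt_bound; have h2 := hgt_sq; case=> ->.
  have k : 2 <= 2 * (hgt + 2^-1) ^+ 2 by nra.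
  have k2 : 4 <= (2 * (hgt + 2^-1) ^+ 2) ^+ 2 by nra.
  by rewrite gt_eqF //; nra.
have k0 : 0 <= 2 * (hgt - 2^-1) ^+ 2 by rewrite mulr_ge0 // sqr_ge0.
have k : 2 * (hgt - 2^-1) ^+ 2 <= 2^-1 by nra.
have k2 : (2 * (hgt - 2^-1) ^+ 2) ^+ 2 <= 4^-1 by nra.
by rewrite lt_eqF //; have := sqr_ge0 (2 * (hgt - 2^-1) ^+ 2); nra.
Qed.
End Crossing.
End TameSegments.

(** * The double spiral *)

Section Lattice.
Local Open Scope Z_scope.

Definition pt : Type := (Z * Z)%type.
(** The pair (k, l) stands for k + l w with w = exp(i pi / 3); the six units are listed
    counterclockwise. *)
Definition hexdir (d : nat) : pt := nth (0, 0) [:: (1, 0); (0, 1); (-1, 1); (-1, 0); (0, -1); (1, -1)] d.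
Fixpoint walk (p : pt) (runs : seq (nat * nat)) : seq pt :=
  if runs is (d, k) :: r then
    let l := [seq (p.1 + Z.of_nat j * (hexdir d).1, p.2 + Z.of_nat j * (hexdir d).2) | j <- iota 1 k] in
    l ++ walk (last p l) r
  else [::].
(* Eisenstein norm: the squared distance of the lattice points v and w. *)
Definition nm (v w : pt) : Z := (v.1 - w.1) * (v.1 - w.1) + (v.1 - w.1) * (v.2 - w.2) + (v.2 - w.2) * (v.2 - w.2).

(* The double spiral and the induced cycle formed by its neighbours, as runs (direction, length). *)
Definition spiral : seq pt := (-106, 12) :: walk (-106, 12)
  [:: (0, 105); (5, 10); (4, 10); (3, 7); (2, 6); (1, 6); (0, 3); (5, 2); (4, 2); (3, 1);
      (4, 2); (5, 2); (0, 3); (1, 6); (2, 6); (3, 7); (4, 10); (5, 10); (0, 105)]%N.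
Definition bank : seq pt := walk (-107, 12)
  [:: (1, 1); (0, 106); (5, 11); (4, 11); (3, 8); (2, 7); (1, 7); (0, 4); (5, 3); (4, 3); (3, 1);
      (4, 1); (5, 1); (0, 2); (1, 5); (2, 5); (3, 6); (4, 9); (5, 9); (0, 105); (5, 1); (4, 1);
      (3, 106); (2, 11); (1, 11); (0, 8); (5, 7); (4, 7); (3, 4); (2, 3); (1, 3); (0, 1); (1, 1);
      (2, 1); (3, 2); (4, 5); (5, 5); (0, 6); (1, 9); (2, 9); (3, 105); (2, 1)]%N.

Definition sp (i : nat) : pt := nth (0, 0) spiral i.
Definition bk (i : nat) : pt := nth (0, 0) bank i.

Fixpoint induced (s : seq pt) : bool :=
  if s is x :: s' then
    (if s' is y :: t then (nm x y =? 1) && all (fun z => 3 <=? nm x z) t else true) && induced s'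
  else true.

Lemma inducedP s : induced s -> forall i j, (i < j)%N -> (j < size s)%N ->
  if j == i.+1 then nm (nth (0, 0) s i) (nth (0, 0) s j) = 1 else 3 <= nm (nth (0, 0) s i) (nth (0, 0) s j).
Proof.
elim: s => [//|x s IH] /= /andP[hx hs] [|i] [|j] //= ij js; last exact: IH.
case: s hx js {IH hs} => [//|y t] /andP[/Z.eqb_eq h1 h2]; case: j ij => [//|j] _ /= jt.
by apply/Z.leb_le; apply: (all_nthP (0, 0) h2).
Qed.

(** In half units, [2 * v.1 + v.2 - 1] is the abscissa, and [v.2] is the row. The edge lies in a
    half-plane bounded by the rows 1 or -1, or by the abscissas 1/2 or -1/2, which misses the
    central crossing segment. *)
Definition sep_edge (v w : pt) : bool :=
  [|| (1 <=? v.2) && (1 <=? w.2), (v.2 <=? -1) && (w.2 <=? -1),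
      (1 <=? 2 * v.1 + v.2 - 1) && (1 <=? 2 * w.1 + w.2 - 1) |
      (2 * v.1 + v.2 - 1 <=? -1) && (2 * w.1 + w.2 - 1 <=? -1)].

(** Integer forms of the conditions on the five arcs of the barrier, with abscissas in half units.
    The coefficients 24 and 7 are the slope 6 and the upper bound 7/8 of [hgt], cleared of
    denominators; the companion condition without [v.2] covers the rows for which this bound goes
    the wrong way. *)
Definition phase1 (v : pt) := let X := 2 * v.1 + v.2 - 1 in [&& -2 <=? X, X <=? 5, -4 <=? v.2 & v.2 <=? -3].
Definition phase2 (v : pt) := let X := 2 * v.1 + v.2 - 1 in
  [&& 5 <=? X, X <=? 11, -8 <=? v.2, v.2 <=? 8, 64 <=? 24 * X - 7 * v.2 & 64 <=? 24 * X].
Definition phase3 (v : pt) := let X := 2 * v.1 + v.2 - 1 in [&& -9 <=? X, X <=? 9 & v.2 =? 8].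
Definition phase4 (v : pt) := let X := 2 * v.1 + v.2 - 1 in
  [&& -19 <=? X, X <=? -9, -12 <=? v.2, v.2 <=? 12, 24 * X + 7 * v.2 <=? -160 & 24 * X <=? -160].
Definition phase5 (v : pt) := let X := 2 * v.1 + v.2 - 1 in [&& -13 <=? X, X <=? 13 & v.2 =? -12].
Definition span (f : pt -> bool) (i j : nat) := all (fun k => f (sp k)) (iota i (j - i).+1).

Lemma size_bank : size bank = 612%N. Proof. by vm_compute. Qed.
Lemma size_spiral : size spiral = 304%N. Proof. by vm_compute. Qed.
Lemma bank_induced : [&& induced (take 610.+1 bank), induced (behead bank) &
  nm (nth (0, 0) bank 0) (nth (0, 0) bank 610.+1) =? 1].
Proof. by vm_compute. Qed.
Lemma spiral_steps : all (fun i => nm (sp i.+1) (sp i) =? 1) (iota 0 303). Proof. by vm_compute. Qed.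
Lemma spiral_bank : all (fun p => all (fun c => 1 <=? nm p c) bank) spiral. Proof. by vm_compute. Qed.
Lemma spiral_sep : all (fun i => (i == 151%N) || sep_edge (sp i) (sp i.+1)) (iota 0 303). Proof. by vm_compute. Qed.
Lemma span1 : span phase1 155 159. Proof. by vm_compute. Qed.
Lemma span2 : span phase2 159 171. Proof. by vm_compute. Qed.
Lemma span3 : span phase3 171 178. Proof. by vm_compute. Qed.
Lemma span4 : span phase4 178 198. Proof. by vm_compute. Qed.
Lemma span5 : span phase5 198 209. Proof. by vm_compute. Qed.
Lemma sp_values : [/\ sp 0 = (-106, 12), sp 303 = (107, -12), sp 151 = (1, 0) & sp 152 = (0, 0)] /\
  [/\ sp 173 = (-3, 8), sp 174 = (-4, 8), sp 155 = (1, -3) & sp 209 = (13, -12)].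
Proof. by vm_compute. Qed.
Lemma bk_values : [/\ bk 467 = (0, 1), bk 161 = (1, -1), bk 439 = (-4, 9) & bk 177 = (-3, 7)].
Proof. by vm_compute. Qed.

Opaque bank spiral.

Lemma nm_sym v w : nm v w = nm w v. Proof. rewrite /nm; nia. Qed.

(** The list without its last point and the list without its first are induced paths; only the pair
    of the two extreme points escapes both checks. *)
Lemma induced_cycle (s : seq pt) n : size s = n.+2 -> induced (take n.+1 s) -> induced (behead s) ->
  nm (nth (0, 0) s 0) (nth (0, 0) s n.+1) = 1 -> forall i j, (i < j)%N -> (j < n.+2)%N ->
  if (j == i.+1) || ((i == 0%N) && (j == n.+1)) then nm (nth (0, 0) s i) (nth (0, 0) s j) = 1
  else 3 <= nm (nth (0, 0) s i) (nth (0, 0) s j).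
Proof.
move=> sz h1 h2 h3 i j ij jn; case: i ij => [|i] ij.
  have [->|jl] := eqVneq j n.+1; first by rewrite orbT.
  have jl' : (j < n.+1)%N by lia.
  have := @inducedP _ h1 0%N j ij; rewrite size_take sz ltnSn => /(_ jl').
  by rewrite !nth_take // andbF orbF.
rewrite /= orbF; case: j ij jn => [//|j] ij jn.
by have := @inducedP _ h2 i j ij; rewrite size_behead sz !nth_behead eqSS; apply.
Qed.

Lemma cadj_lt i j : (i < j)%N -> cadj 304 i j = (j == i.+1) || ((i == 0%N) && (j == 611%N)).
Proof.
move=> ij; rewrite /cadj; have -> : od 305 = 611%N by [].
have -> : (i == j.+1) = false by apply/eqP; lia.
have -> : (j == 0%N) = false by apply/eqP; lia.
by rewrite /= orbF.
Qed.

Lemma bank_nm i j : (i < 612)%N -> (j < 612)%N -> i != j ->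
  if cadj 304 i j then nm (bk i) (bk j) = 1 else 3 <= nm (bk i) (bk j).
Proof.
wlog ij : i j / (i < j)%N.
  move=> h hi hj ne; have [l|l] := ltnP i j; first exact: h.
  by rewrite cadjC nm_sym; apply: h => //; [rewrite ltn_neqAle eq_sym ne | rewrite eq_sym].
move=> hi hj _; have /and3P[h1 h2 /Z.eqb_eq h3] := bank_induced.
have := @induced_cycle bank 610 size_bank h1 h2 h3 i j ij hj; rewrite -/(bk i) -/(bk j).
by rewrite cadj_lt.
Qed.

Lemma pair_neq (x y z t : Z) : (x, y) <> (z, t) -> x <> z \/ y <> t.
Proof. by move=> h; case: (Z.eq_dec x z) => [e|]; [right=> e'; case: h; rewrite e e' | left]. Qed.

Lemma lattice_cases (q v : pt) : v <> q -> v <> (q.1 + 1, q.2) -> v <> (q.1, q.2 + 1) -> v <> (q.1 + 1, q.2 - 1) ->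
  let k := v.1 - q.1 in let l := v.2 - q.2 in
  [\/ l = 0 /\ (k <= -1 \/ 2 <= k), l = 1 /\ (k <= -1 \/ 1 <= k), l = -1 /\ (k <= 0 \/ 2 <= k) | 2 <= l \/ l <= -2].
Proof.
case: q v => [q1 q2] [v1 v2] /= n1 n2 n3 n4.
have {}n1 := pair_neq n1.
have {}n2 := pair_neq n2.
have {}n3 := pair_neq n3.
have {}n4 := pair_neq n4.
have : v2 - q2 = 0 \/ v2 - q2 = 1 \/ v2 - q2 = -1 \/ (2 <= v2 - q2 \/ v2 - q2 <= -2) by lia.
case=> [e|[e|[e|e]]]; [apply: Or41 | apply: Or42 | apply: Or43 | exact: Or44]; split=> //; lia.
Qed.

Definition pt0 : pt := (0, 0).
Definition crossers (q : pt) (a c : nat) := bk a = (q.1, q.2 + 1) /\ bk c = (q.1 + 1, q.2 - 1).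
Definition succ_pt (q : pt) : pt := (q.1 + 1, q.2).
End Lattice.

Section LatticePlane.
Variable R : realType.
Notation M := 'rV[R]_2.
Notation H := 'rV[R]_4.

Definition zr (z : Z) : R := (int_of_Z z)%:~R.
Lemma zrD a b : zr (Z.add a b) = zr a + zr b.
Proof. by rewrite /zr -intrD -rmorphD. Qed.
Lemma zrB a b : zr (Z.sub a b) = zr a - zr b.
Proof. by rewrite /zr -intrB -rmorphB. Qed.
Lemma zrM a b : zr (Z.mul a b) = zr a * zr b.
Proof. by rewrite /zr -intrM -rmorphM. Qed.
Lemma zr_le a b : Z.le a b -> zr a <= zr b.
Proof. by move=> h; rewrite /zr ler_int; lia. Qed.
(** The shift by 1/2 puts the middle of the central edge, from (0, 0) to (1, 0), at the origin. *)
Definition px (v : pt) : R := (2 * zr v.1 + zr v.2 - 1) / 2.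
Definition py (v : pt) : R := zr v.2 * hgt R.
Definition lpos (v : pt) : M := v2 (px v) (py v).

Lemma pos_dist v w : (px v - px w) ^+ 2 + (py v - py w) ^+ 2 = zr (nm v w).
Proof.
rewrite /nm !zrD !zrM !zrB /px /py.
have -> : (zr v.2 * hgt R - zr w.2 * hgt R) ^+ 2 = (zr v.2 - zr w.2) ^+ 2 * hgt R ^+ 2 by ring.
by rewrite hgt_sq; field.
Qed.

Lemma zr_num (p : BinNums.positive) : zr (Zpos p) = (Pos.to_nat p)%:R. Proof. by []. Qed.
Lemma zr_neg (p : BinNums.positive) : zr (Zneg p) = - (Pos.to_nat p)%:R.
Proof. by rewrite -[Zneg p]/(Z.opp (Zpos p)) -[Z.opp _]/(Z.sub 0 (Zpos p)) zrB zr_num /zr /= sub0r. Qed.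

Definition cxb (i : nat) : R := px (bk i).
Definition cyb (i : nat) : R := py (bk i).

(** The product is the squared distance minus 1, so the norms 1 and at least 3 give the values 0 and
    at least 2 that the reflections require. *)
Lemma mk_polar i j : mk (polar cxb cyb i) (polar cxb cyb j) = zr (nm (bk i) (bk j)) - 1.
Proof. by rewrite -pos_dist /mk /polar !v4E /cxb /cyb; field. Qed.

Lemma bank_orth i j : (i < 612)%N -> (j < 612)%N -> cadj 304 i j -> mk (polar cxb cyb i) (polar cxb cyb j) = 0.
Proof.
move=> hi hj h; rewrite mk_polar; have ne : i != j.
  by apply/eqP => e; move: h; rewrite e /cadj; have -> : od 305 = 611%N by []; lia.
have := bank_nm hi hj ne; rewrite h => ->; exact: subrr.
Qed.

Lemma bank_nonorth i j : (i < 612)%N -> (j < 612)%N -> i != j -> ~~ cadj 304 i j ->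
  2 <= mk (polar cxb cyb i) (polar cxb cyb j).
Proof.
move=> hi hj ne h; rewrite mk_polar; have := bank_nm hi hj ne; rewrite (negbTE h) => /zr_le.
by have -> : zr 3 = 3 by []; lra.
Qed.

Lemma spiral_far i k : (i < 612)%N -> (k <= 303)%N -> 1 <= (px (sp k) - cxb i) ^+ 2 + (py (sp k) - cyb i) ^+ 2.
Proof.
move=> hi hk; rewrite pos_dist; have -> : 1 = zr 1 by [].
apply: zr_le; have sz : size spiral = 304%N by exact: size_spiral.
have := all_nthP pt0 spiral_bank k; rewrite sz => /(_ hk) h.
by have := all_nthP pt0 h i; rewrite size_bank => /(_ hi) /Z.leb_le.
Qed.

(* The lattice points other than the two ends q, q + (1, 0) of a horizontal edge and their common neighbours
   are far from the unit segment that crosses the edge orthogonally. *)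
Lemma lattice_far (q : pt) (a c i : nat) y : crossers q a c -> bk i <> q -> bk i <> succ_pt q -> bk i <> bk a -> bk i <> bk c ->
  - 2^-1 <= y -> y <= 2^-1 -> 3 / 4 <= (px q + 2^-1 - cxb i) ^+ 2 + (py q + y - cyb i) ^+ 2.
Proof.
move=> [-> ->] n1 n2 n3 n4 yl yr; have /andP[h0 h1] := hgt_bound R.
have := lattice_cases n1 n2 n3 n4; rewrite /cxb /cyb; move: (bk i) => v {n1 n2 n3 n4}.
pose k := Z.sub v.1 q.1; pose l := Z.sub v.2 q.2.
rewrite -/k -/l => hk.
have -> : px q + 2^-1 - px v = 2^-1 - zr k - zr l / 2 by rewrite /k /l !zrB /px /=; field.
have -> : py q + y - py v = y - zr l * hgt R by rewrite /k /l !zrB /py /=; ring.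
have sq1 (x : R) : 1 <= x \/ x <= - 1 -> 1 <= x ^+ 2 by case=> h; nra.
have s2 := sqr_ge0 (2^-1 - zr k - zr l / 2); have s3 := sqr_ge0 (y - zr l * hgt R).
have z1 : zr 1 = 1 by [].
have z2 : zr 2 = 2 by [].
have zm1 : zr (-1) = -1 by rewrite zr_neg.
have zm2 : zr (-2) = -2 by rewrite zr_neg.
have z0 : zr 0 = 0 by [].
case: hk => [[e hk]|[e hk]|[e hk]|[e|e]].
- rewrite e z0 in s2 s3 *.
  have : 1 <= (2^-1 - zr k - 0 / 2) ^+ 2 by apply: sq1; case: hk => /zr_le; rewrite ?zm1 ?z2; lra.
  lra.
- rewrite e z1 in s2 s3 *.
  have : 1 <= (2^-1 - zr k - 1 / 2) ^+ 2 by apply: sq1; case: hk => /zr_le; rewrite ?zm1 ?z1; lra.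
  lra.
- rewrite e zm1 in s2 s3 *.
  have : 1 <= (2^-1 - zr k - -1 / 2) ^+ 2 by apply: sq1; case: hk => /zr_le; rewrite ?z0 ?z2; lra.
  lra.
- have := zr_le e; rewrite z2 => L2.
  have : 1 <= (y - zr l * hgt R) ^+ 2 by apply: sq1; right; nra.
  lra.
- have := zr_le e; rewrite zm2 => L2.
  have : 1 <= (y - zr l * hgt R) ^+ 2 by apply: sq1; left; nra.
  lra.
Qed.

Section Path.
Variables (T : nat) (P : nat -> M).

(** Each edge contributes a clamped increment, so the polygon is continuous without case analysis;
    the parameter counts edges, and the path is constant outside of [0, T]. *)
Definition poly_path (u : R) : M := P 0%N + \sum_(i < T) cl (u - i%:R) *: (P i.+1 - P i).

Lemma poly_path_cont : continuous poly_path.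
Proof.
move=> u; change (cat poly_path u); rewrite /poly_path.
apply: catD; first exact: cat_cst.
have h i : cat (fun u : R => cl (u - i%:R) *: (P i.+1 - P i)) u.
  have c : cat (fun u : R => cl (u - i%:R)) u by apply: (cat_cl (f := fun u : R => u - i%:R)); ct.
  by ct.
by apply: (cat_sum (f := fun (i : 'I_T) (u : R) => cl (u - i%:R) *: (P i.+1 - P i))) => i _; exact: h.
Qed.

Lemma poly_path_seg i u : (i < T)%N -> i%:R <= u -> u <= i.+1%:R -> poly_path u = P i + (u - i%:R) *: (P i.+1 - P i).
Proof.
move=> iT u0 u1; rewrite /poly_path.
have early k : (k <= i)%N -> \sum_(j < k) cl (u - j%:R) *: (P j.+1 - P j) = P k - P 0%N.
  elim: k => [|k IH] ki; first by rewrite big_ord0 subrr.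
  rewrite big_ord_recr /= IH ?(ltnW ki) // cl_ge1 ?scale1r; first by rewrite addrC addrA subrK.
  have : k.+1%:R <= i%:R :> R by rewrite ler_nat.
  by rewrite -natr1; lra.
have late k : \sum_(j < i.+1 + k) cl (u - j%:R) *: (P j.+1 - P j) = P i - P 0%N + (u - i%:R) *: (P i.+1 - P i).
  elim: k => [|k IH].
    rewrite addn0 big_ord_recr /= early // cl_id //; rewrite -natr1 in u1; apply/andP; lra.
  rewrite addnS big_ord_recr /= IH cl_le0 ?scale0r ?addr0 //.
  have : i.+1%:R <= (i.+1 + k)%:R :> R by rewrite ler_nat leq_addr.
  by lra.
by rewrite -[T](subnKC iT) late addrA [P 0%N + _]addrC subrK.
Qed.

Lemma poly_path_le0 u : u <= 0 -> poly_path u = P 0%N.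
Proof.
move=> u0; rewrite /poly_path big1 ?addr0 // => i _; rewrite cl_le0 ?scale0r //.
have : 0 <= i%:R :> R by [].
by lra.
Qed.

Lemma poly_path_geT u : T%:R <= u -> poly_path u = P T.
Proof.
move=> uT; rewrite /poly_path; have h k : (k <= T)%N -> \sum_(j < k) cl (u - j%:R) *: (P j.+1 - P j) = P k - P 0%N.
  elim: k => [|k IH] ki; first by rewrite big_ord0 subrr.
  rewrite big_ord_recr /= IH ?(ltnW ki) // cl_ge1 ?scale1r; first by rewrite addrC addrA subrK.
  have : k.+1%:R <= T%:R :> R by rewrite ler_nat.
  by rewrite -natr1; lra.
by rewrite h // subrKC.
Qed.

Lemma poly_path_edge (u : R) i j : (i < j)%N -> (j <= T)%N -> i%:R <= u -> u <= j%:R ->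
  exists k, [/\ (i <= k)%N, (k < j)%N, k%:R <= u & u <= k.+1%:R].
Proof.
move=> ij jT u0 u1; have p0 : 0 <= u by apply: le_trans u0.
have [e|ne] := eqVneq u j%:R.
  exists j.-1; rewrite e ler_nat ler_nat; split; lia.
have /andP[t0 t1] := truncn_itv p0.
exists (Num.truncn u); split => //; last exact: ltW.
  by rewrite -ltnS -(ltr_nat R); apply: le_lt_trans t1.
by rewrite -(ltr_nat R); apply: le_lt_trans t0 _; rewrite lt_neqAle ne.
Qed.

Lemma poly_path_any u : (0 < T)%N -> exists i t, [/\ (i < T)%N, 0 <= t, t <= 1 & poly_path u = P i + t *: (P i.+1 - P i)].
Proof.
move=> T0; have [u0|u0] := leP u 0.
  by exists 0%N, 0; rewrite poly_path_le0 // scale0r addr0.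
have [uT|uT] := leP T%:R u.
  by exists T.-1, 1; rewrite poly_path_geT // prednK // scale1r subrKC; split => //; rewrite prednK.
have [k [_ kT k0 k1]] := poly_path_edge T0 (leqnn T) (ltW u0) (ltW uT).
exists k, (u - k%:R); split; [exact: kT | lra | by move: k1; rewrite -natr1; lra | exact: poly_path_seg].
Qed.

Lemma poly_path_lin (al be c : R) i j u : (i < j)%N -> (j <= T)%N -> i%:R <= u -> u <= j%:R ->
  (forall k, (i <= k)%N -> (k <= j)%N -> c <= al * P k 0 0 + be * P k 0 1) ->
  c <= al * poly_path u 0 0 + be * poly_path u 0 1.
Proof.
move=> ij jT u0 u1 h; have [k [ik kj k0 k1]] := poly_path_edge ij jT u0 u1.
have kT : (k < T)%N by apply: leq_trans jT.
rewrite (poly_path_seg kT k0 k1) !rvE; have := h k ik (ltnW kj); have := h k.+1 (leqW ik) kj.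
rewrite -natr1 in k1; move: (P k 0 0) (P k 0 1) (P k.+1 0 0) (P k.+1 0 1) => a b a' b' h1 h2.
have t0 : 0 <= u - k%:R by lra.
have t1 : 0 <= 1 - (u - k%:R) by lra.
by have := ler_wpM2l t0 h1; have := ler_wpM2l t1 h2; lra.
Qed.
End Path.
End LatticePlane.

(** * The path along the spiral *)

Section Configuration.
Variable R : realType.
Notation M := 'rV[R]_2.
Notation H := 'rV[R]_4.
Notation cx := (@cxb R).
Notation cy := (@cyb R).
Notation n := 612%N.

Definition sp_path (u : R) : M := poly_path 303 (fun k => lpos R (sp k)) u.
Definition spiral_path (s : R) : M := sp_path (303 * s).

Lemma sp_path_cont : continuous sp_path.
Proof. exact: poly_path_cont. Qed.

Lemma spiral_path_cont : continuous spiral_path.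
Proof.
move=> s; change (cat (fun s : R => sp_path (303 * s)) s).
by apply: (cat_comp (h := sp_path) (f := fun s : R => 303 * s)); [exact: sp_path_cont | ct].
Qed.

Lemma sp_path_seg i (u : R) : (i < 303)%N -> i%:R <= u -> u <= i.+1%:R ->
  sp_path u 0 0 = px R (sp i) + (u - i%:R) * (px R (sp i.+1) - px R (sp i)) /\
  sp_path u 0 1 = py R (sp i) + (u - i%:R) * (py R (sp i.+1) - py R (sp i)).
Proof. by move=> h u0 u1; rewrite /sp_path (poly_path_seg _ h u0 u1) !rvE. Qed.

Lemma sp_step i : (i < 303)%N -> (px R (sp i.+1) - px R (sp i)) ^+ 2 + (py R (sp i.+1) - py R (sp i)) ^+ 2 = 1.
Proof.
move=> hi; rewrite pos_dist; have := allP spiral_steps i; rewrite mem_iota add0n => /(_ hi) /Z.eqb_eq ->.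
by [].
Qed.

Lemma spiral_path_tame (s : R) : tame n cx cy (hat (spiral_path s)).
Proof.
have [i [t [hi t0 t1 e]]] := @poly_path_any R 303 (fun k => lpos R (sp k)) (303 * s) isT.
rewrite /spiral_path /sp_path e.
apply: (tame_edge (@cadjC 304) (@bank_orth R) (@bank_nonorth R)) => //; rewrite ?v2E.
  exact: sp_step.
by move=> k hk; split; apply: spiral_far => //; exact: ltnW.
Qed.

Lemma bank_neq_spiral i k : (i < n)%N -> (k <= 303)%N -> bk i <> sp k.
Proof.
move=> hi hk e; have := @spiral_far R i k hi hk; rewrite /cxb /cyb e !subrr expr0n /= addr0.
by rewrite ler10.
Qed.

Lemma bank_inj i j : (i < n)%N -> (j < n)%N -> i != j -> bk i <> bk j.
Proof.
move=> hi hj ne e; have := bank_nm hi hj ne; rewrite e; case: ifP => _ h.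
  by have := pos_dist R (bk j) (bk j); rewrite h !subrr expr0n /= addr0 => /eqP; rewrite eq_sym oner_eq0.
have := zr_le R h; rewrite -pos_dist !subrr expr0n /= addr0.
by have -> : zr R 3 = 3 by []; lra.
Qed.

Lemma zrE : [/\ zr R 0 = 0, zr R 1 = 1, zr R 2 = 2, zr R 3 = 3 & zr R (-1) = -1] /\
  [/\ zr R 5 = 5, zr R (-3) = -3, zr R (-4) = -4, zr R 8 = 8 & zr R 12 = 12] /\
  [/\ zr R (-12) = -12, zr R 13 = 13, zr R 107 = 107, zr R (-106) = -106 & zr R (-2) = -2].
Proof. by split; [|split]; split => //; rewrite zr_neg. Qed.

Lemma mid_path i (u : R) : (i < 303)%N -> u = i%:R + 2^-1 ->
  sp_path u = v2 ((px R (sp i) + px R (sp i.+1)) / 2) ((py R (sp i) + py R (sp i.+1)) / 2).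
Proof.
move=> hi ->; have a1 : i%:R <= i%:R + 2^-1 :> R by lra.
have e1 : i.+1%:R = i%:R + 1 :> R by rewrite -addn1 natrD.
have a2 : i%:R + 2^-1 <= i.+1%:R :> R by rewrite e1; lra.
by have [h1 h2] := sp_path_seg hi a1 a2; apply: rV2P; rewrite ?h1 ?h2 !v2E; field.
Qed.

Lemma core_center : spiral_path 2^-1 = v2 (px R pt0 + 2^-1) (py R pt0).
Proof.
have [[_ _ v151 v152] _] := sp_values; have [[z0 z1 _ _ _] _] := zrE.
have e : 303 * 2^-1 = 151%:R + 2^-1 :> R by lra.
rewrite /spiral_path (@mid_path 151 _ isT e) v151 v152.
by apply: rV2P; rewrite !v2E /px /py /= ?z0 ?z1; field.
Qed.

Lemma core_center0 : spiral_path 2^-1 = 0.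
Proof.
have [[z0 _ _ _ _] _] := zrE; rewrite core_center.
by apply: rV2P; rewrite !rvE /px /py /= z0; field.
Qed.

(** The parameter (173 + 1/2) / 303 of the middle of the edge from vertex 173 to vertex 174, where
    the arm crosses the axis at height [8 * hgt]. *)
Definition s_two : R := 347 / 606.
Definition q_two : pt := sp 174.
Definition y_two : R := 8 * hgt R.

Lemma side_center : spiral_path s_two = v2 (px R q_two + 2^-1) (py R q_two) /\ spiral_path s_two = v2 0 y_two.
Proof.
have [_ [v173 v174 _ _]] := sp_values; have [_ [[_ z3 z4 z8 _] _]] := zrE.
have e : 303 * s_two = 173%:R + 2^-1 :> R by rewrite /s_two; lra.
rewrite /spiral_path (@mid_path 173 _ isT e) /q_two v173 v174.
by split; apply: rV2P; rewrite !v2E /px /py /y_two /= ?z3 ?z4 ?z8; field.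
Qed.

Lemma zle x y : Z.leb x y -> zr R x <= zr R y.
Proof. by move=> /Z.leb_le; exact: zr_le. Qed.

Lemma span_lin (f : pt -> bool) i j (al be c u : R) : span f i j -> (i < j)%N -> (j <= 303)%N ->
  (forall v, f v -> c <= al * px R v + be * py R v) -> i%:R <= u -> u <= j%:R ->
  c <= al * sp_path u 0 0 + be * sp_path u 0 1.
Proof.
move=> sf ij jT hf u0 u1; apply: (@poly_path_lin R 303 _ al be c i j u ij jT u0 u1) => k ik kj.
rewrite !v2E; apply: hf; have := allP sf k; rewrite mem_iota; apply.
by rewrite ik addnS ltnS subnKC // ltnW.
Qed.

Lemma core_seg (s : R) : 151 / 303 <= s -> s <= 152 / 303 -> spiral_path s 0 0 = 2^-1 - (303 * s - 151).
Proof.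
move=> s0 s1; have [[_ _ v151 v152] _] := sp_values; have [[z0 z1 _ _ _] _] := zrE.
have [||h _] := @sp_path_seg 151 (303 * s) isT; [lra | by rewrite -natr1; lra |].
by rewrite /spiral_path h v151 v152 /px /= z0 z1; lra.
Qed.

(** An edge on one side of the abscissas 1/2 or -1/2 misses the axis, one beyond the rows 1 or -1
    meets it at squared height at least 3/4, and the central edge meets it only at its middle. *)
Lemma off_axis (s : R) : 0 <= s -> s <= 1 -> s != 2^-1 -> spiral_path s 0 0 = 0 -> 4^-1 < sqn (spiral_path s).
Proof.
move=> s0 s1 ne x0; have /andP[h0 h1] := hgt_bound R.
have [[z0 z1 z2 _ zm1] _] := zrE.
have u0 : 0%:R <= 303 * s by lra.
have u1 : 303 * s <= 303%:R by lra.
have [k [_ hk k0 k1]] := @poly_path_edge R 303 (303 * s) 0 303 isT (leqnn _) u0 u1.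
have [ex ey] := sp_path_seg hk k0 k1; rewrite -/(spiral_path s) in ex ey.
have := allP spiral_sep k; rewrite mem_iota add0n => /(_ hk) /orP[/eqP e|].
  rewrite e in k0 k1; have := @core_seg s ltac:(lra) ltac:(rewrite -natr1 in k1; lra).
  by rewrite x0 => h; case/eqP: ne; lra.
have t0 : 0 <= 303 * s - k%:R by lra.
have t1 : 0 <= 1 - (303 * s - k%:R) by rewrite -natr1 in k1; lra.
move: ex ey; rewrite x0; move: (sp k) (sp k.+1) (303 * s - k%:R) t0 t1 => v w t t0 t1 ex ey.
have far : 3 / 4 <= (spiral_path s 0 1) ^+ 2 -> 4^-1 < sqn (spiral_path s).
  by rewrite /sqn x0 expr0n /= add0r; lra.
case/or4P => /andP[/zle hv /zle hw]; rewrite ?zrB ?zrD ?zrM ?z1 ?z2 ?zm1 in hv hw.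
- apply: far; have a1 : hgt R <= py R v by rewrite /py; nra.
  have a2 : hgt R <= py R w by rewrite /py; nra.
  have b1 := ler_wpM2l t1 a1; have b2 := ler_wpM2l t0 a2.
  have : hgt R <= spiral_path s 0 1 by rewrite ey; lra.
  by move: (spiral_path s 0 1) => y hy; have := hgt_sq R; nra.
- apply: far; have a1 : py R v <= - hgt R by rewrite /py; nra.
  have a2 : py R w <= - hgt R by rewrite /py; nra.
  have b1 := ler_wpM2l t1 a1; have b2 := ler_wpM2l t0 a2.
  have : spiral_path s 0 1 <= - hgt R by rewrite ey; lra.
  by move: (spiral_path s 0 1) => y hy; have := hgt_sq R; nra.
- have a1 : 2^-1 <= px R v by rewrite /px; lra.
  have a2 : 2^-1 <= px R w by rewrite /px; lra.
  by have := ler_wpM2l t1 a1; have := ler_wpM2l t0 a2; lra.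
- have a1 : px R v <= - 2^-1 by rewrite /px; lra.
  have a2 : px R w <= - 2^-1 by rewrite /px; lra.
  by have := ler_wpM2l t1 a1; have := ler_wpM2l t0 a2; lra.
Qed.

Lemma spiral_ends : spiral_path 0 = - spiral_path 1 /\ 100 ^+ 2 <= sqn (spiral_path 1).
Proof.
have [[v0 v303 _ _] _] := sp_values; have [_ [[_ _ _ _ z12] [zm12 _ z107 zm106 _]]] := zrE.
have e0 : spiral_path 0 = lpos R (sp 0) by rewrite /spiral_path mulr0 /sp_path poly_path_le0.
have e1 : spiral_path 1 = lpos R (sp 303) by rewrite /spiral_path mulr1 /sp_path poly_path_geT.
rewrite e0 e1 v0 v303 /lpos /px /py /= z12 zm12 z107 zm106; split.
  by apply: rV2P; rewrite !rvE; field.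
rewrite /sqn !v2E; have := sqr_ge0 (- 12 * hgt R); lra.
Qed.

Lemma phase1_real v : phase1 v -> [/\ -1 <= px R v, px R v <= 5 / 2, - (7 / 2) <= py R v & py R v <= - (5 / 2)].
Proof.
have /andP[h0 h1] := hgt_bound R; have [[_ z1 z2 _ _] [[z5 zm3 zm4 _ _] [_ _ _ _ zm2]]] := zrE.
move=> /and4P[/zle a /zle b /zle c /zle d]; rewrite ?zrB ?zrD ?zrM ?z1 ?z2 ?z5 ?zm3 ?zm4 ?zm2 in a b c d.
by split; rewrite /px /py; [lra | lra | nra | nra].
Qed.

Lemma phase2_real v : phase2 v -> [/\ 5 / 2 <= px R v, px R v <= 11 / 2, - 7 <= py R v, py R v <= 7 & - 6 * px R v + py R v <= - 8].
Proof.
have /andP[h0 h1] := hgt_bound R; have [[_ z1 z2 _ _] [[z5 _ _ z8 _] _]] := zrE.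
have z11 : zr R 11 = 11 by [].
have z24 : zr R 24 = 24 by [].
have z7 : zr R 7 = 7 by [].
have z64 : zr R 64 = 64 by [].
have zm8 : zr R (-8) = -8 by rewrite zr_neg.
move=> /and5P[/zle a /zle b /zle c /zle d /andP[/zle e /zle f]].
rewrite ?zrB ?zrD ?zrM ?zrB ?zrD ?zrM ?z1 ?z2 ?z5 ?z8 ?z11 ?z24 ?z7 ?z64 ?zm8 in a b c d e f.
split; rewrite /px /py; [lra | lra | nra | nra |].
have [g|g] := leP 0 (zr R v.2).
  have k : zr R v.2 * hgt R <= zr R v.2 * (7 / 8) by apply: ler_wpM2l => //; lra.
  by lra.
have k : zr R v.2 * hgt R <= 0 by apply: mulr_le0_ge0; lra.
by lra.
Qed.

Lemma phase3_real v : phase3 v -> [/\ - (9 / 2) <= px R v, px R v <= 9 / 2 & py R v = y_two].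
Proof.
have [[_ z1 z2 _ _] [[_ _ _ z8 _] _]] := zrE.
have z9 : zr R 9 = 9 by [].
have zm9 : zr R (-9) = -9 by rewrite zr_neg.
move=> /and3P[/zle a /zle b /Z.eqb_eq c]; rewrite ?zrB ?zrD ?zrM ?z1 ?z2 ?z9 ?zm9 in a b.
by split; rewrite /px /py /y_two ?c ?z8 //; rewrite c z8 in a b; lra.
Qed.

Lemma phase4_real v : phase4 v -> [/\ - (19 / 2) <= px R v, px R v <= - (9 / 2), - (21 / 2) <= py R v, py R v <= 21 / 2 & 6 * px R v + py R v <= - 20].
Proof.
have /andP[h0 h1] := hgt_bound R; have [[_ z1 z2 _ _] [[_ _ _ _ z12] [zm12 _ _ _ _]]] := zrE.
have zm19 : zr R (-19) = -19 by rewrite zr_neg.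
have z24 : zr R 24 = 24 by [].
have z7 : zr R 7 = 7 by [].
have zm160 : zr R (-160) = -160 by rewrite zr_neg.
have zm9 : zr R (-9) = -9 by rewrite zr_neg.
move=> /and5P[/zle a /zle b /zle c /zle d /andP[/zle e /zle f]].
rewrite ?zrD ?zrM ?zrB ?zrD ?zrM ?z1 ?z2 ?z12 ?zm12 ?zm19 ?z24 ?z7 ?zm160 ?zm9 in a b c d e f.
split; rewrite /px /py; [lra | lra | nra | nra |].
have [g|g] := leP 0 (zr R v.2).
  have k : zr R v.2 * hgt R <= zr R v.2 * (7 / 8) by apply: ler_wpM2l => //; lra.
  by lra.
have k : zr R v.2 * hgt R <= 0 by apply: mulr_le0_ge0; lra.
by lra.
Qed.

Lemma phase5_real v : phase5 v -> [/\ - (13 / 2) <= px R v, px R v <= 13 / 2, - (21 / 2) <= py R v & py R v <= - (103 / 10)].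
Proof.
have /andP[h0 h1] := hgt_bound R; have [[_ z1 z2 _ _] [_ [zm12 z13 _ _ _]]] := zrE.
have zm13 : zr R (-13) = -13 by rewrite zr_neg.
move=> /and3P[/zle a /zle b /Z.eqb_eq c]; rewrite ?zrB ?zrD ?zrM ?z1 ?z2 ?z13 ?zm13 in a b.
by split; rewrite /px /py ?c ?zm12; rewrite ?c ?zm12 in a b; lra.
Qed.

(** The barrier is the arc from vertex 155 to vertex 209, of 54 edges; the vertices 159, 171, 178
    and 198 that separate its phases become the parameters 4/54, 16/54, 23/54 and 43/54. *)
Lemma span_phase1 (s : R) : 0 <= s -> s <= 4 / 54 -> let z := sp_path (155 + 54 * s) in [/\ -1 <= z 0 0, z 0 0 <= 5 / 2, - (7 / 2) <= z 0 1 & z 0 1 <= - (5 / 2)].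
Proof.
move=> s0 s1 z; have u0 : 155%:R <= 155 + 54 * s by lra.
have u1 : 155 + 54 * s <= 159%:R by lra.
have P al be c h := @span_lin phase1 155 159 al be c _ span1 isT isT h u0 u1.
rewrite -/z in P; move: (z 0 0) (z 0 1) P => x y P {s0 s1 u0 u1}.
split.
- have := P 1 0 (-1); rewrite !(mul0r, mul1r, mulN1r, add0r, addr0) => h.
  by move: (h ltac:(by move=> v /phase1_real[*]; lra)) => {h}; lra.
- have := P (-1) 0 (- (5 / 2)); rewrite !(mul0r, mul1r, mulN1r, add0r, addr0) => h.
  by move: (h ltac:(by move=> v /phase1_real[*]; lra)) => {h}; lra.
- have := P 0 1 (- (7 / 2)); rewrite !(mul0r, mul1r, mulN1r, add0r, addr0) => h.
  by move: (h ltac:(by move=> v /phase1_real[*]; lra)) => {h}; lra.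
- have := P 0 (-1) (5 / 2); rewrite !(mul0r, mul1r, mulN1r, add0r, addr0) => h.
  by move: (h ltac:(by move=> v /phase1_real[*]; lra)) => {h}; lra.
Qed.

Lemma span_phase2 (s : R) : 4 / 54 <= s -> s <= 16 / 54 -> let z := sp_path (155 + 54 * s) in [/\ 5 / 2 <= z 0 0, z 0 0 <= 11 / 2, - 7 <= z 0 1, z 0 1 <= 7 & - 6 * z 0 0 + z 0 1 <= - 8].
Proof.
move=> s0 s1 z; have u0 : 159%:R <= 155 + 54 * s by lra.
have u1 : 155 + 54 * s <= 171%:R by lra.
have P al be c h := @span_lin phase2 159 171 al be c _ span2 isT isT h u0 u1.
rewrite -/z in P; move: (z 0 0) (z 0 1) P => x y P {s0 s1 u0 u1}.
split.
- have := P 1 0 (5 / 2); rewrite !(mul0r, mul1r, mulN1r, add0r, addr0) => h.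
  by move: (h ltac:(by move=> v /phase2_real[*]; lra)) => {h}; lra.
- have := P (-1) 0 (- (11 / 2)); rewrite !(mul0r, mul1r, mulN1r, add0r, addr0) => h.
  by move: (h ltac:(by move=> v /phase2_real[*]; lra)) => {h}; lra.
- have := P 0 1 (- 7); rewrite !(mul0r, mul1r, mulN1r, add0r, addr0) => h.
  by move: (h ltac:(by move=> v /phase2_real[*]; lra)) => {h}; lra.
- have := P 0 (-1) (- 7); rewrite !(mul0r, mul1r, mulN1r, add0r, addr0) => h.
  by move: (h ltac:(by move=> v /phase2_real[*]; lra)) => {h}; lra.
- have := P 6 (-1) 8; rewrite !(mul0r, mul1r, mulN1r, add0r, addr0) => h.
  by move: (h ltac:(by move=> v /phase2_real[*]; lra)) => {h}; lra.
Qed.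

Lemma span_phase4 (s : R) : 23 / 54 <= s -> s <= 43 / 54 -> let z := sp_path (155 + 54 * s) in [/\ - (19 / 2) <= z 0 0, z 0 0 <= - (9 / 2), - (21 / 2) <= z 0 1, z 0 1 <= 21 / 2 & 6 * z 0 0 + z 0 1 <= - 20].
Proof.
move=> s0 s1 z; have u0 : 178%:R <= 155 + 54 * s by lra.
have u1 : 155 + 54 * s <= 198%:R by lra.
have P al be c h := @span_lin phase4 178 198 al be c _ span4 isT isT h u0 u1.
rewrite -/z in P; move: (z 0 0) (z 0 1) P => x y P {s0 s1 u0 u1}.
split.
- have := P 1 0 (- (19 / 2)); rewrite !(mul0r, mul1r, mulN1r, add0r, addr0) => h.
  by move: (h ltac:(by move=> v /phase4_real[*]; lra)) => {h}; lra.
- have := P (-1) 0 (9 / 2); rewrite !(mul0r, mul1r, mulN1r, add0r, addr0) => h.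
  by move: (h ltac:(by move=> v /phase4_real[*]; lra)) => {h}; lra.
- have := P 0 1 (- (21 / 2)); rewrite !(mul0r, mul1r, mulN1r, add0r, addr0) => h.
  by move: (h ltac:(by move=> v /phase4_real[*]; lra)) => {h}; lra.
- have := P 0 (-1) (- (21 / 2)); rewrite !(mul0r, mul1r, mulN1r, add0r, addr0) => h.
  by move: (h ltac:(by move=> v /phase4_real[*]; lra)) => {h}; lra.
- have := P (-6) (-1) 20; rewrite !(mul0r, mul1r, mulN1r, add0r, addr0) => h.
  by move: (h ltac:(by move=> v /phase4_real[*]; lra)) => {h}; lra.
Qed.

Lemma span_phase5 (s : R) : 43 / 54 <= s -> s <= 1 -> let z := sp_path (155 + 54 * s) in [/\ - (13 / 2) <= z 0 0, z 0 0 <= 13 / 2, - (21 / 2) <= z 0 1 & z 0 1 <= - (103 / 10)].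
Proof.
move=> s0 s1 z; have u0 : 198%:R <= 155 + 54 * s by lra.
have u1 : 155 + 54 * s <= 209%:R by lra.
have P al be c h := @span_lin phase5 198 209 al be c _ span5 isT isT h u0 u1.
rewrite -/z in P; move: (z 0 0) (z 0 1) P => x y P {s0 s1 u0 u1}.
split.
- have := P 1 0 (- (13 / 2)); rewrite !(mul0r, mul1r, mulN1r, add0r, addr0) => h.
  by move: (h ltac:(by move=> v /phase5_real[*]; lra)) => {h}; lra.
- have := P (-1) 0 (- (13 / 2)); rewrite !(mul0r, mul1r, mulN1r, add0r, addr0) => h.
  by move: (h ltac:(by move=> v /phase5_real[*]; lra)) => {h}; lra.
- have := P 0 1 (- (21 / 2)); rewrite !(mul0r, mul1r, mulN1r, add0r, addr0) => h.
  by move: (h ltac:(by move=> v /phase5_real[*]; lra)) => {h}; lra.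
- have := P 0 (-1) (103 / 10); rewrite !(mul0r, mul1r, mulN1r, add0r, addr0) => h.
  by move: (h ltac:(by move=> v /phase5_real[*]; lra)) => {h}; lra.
Qed.

Lemma span_phase3 (s : R) : 16 / 54 <= s -> s <= 23 / 54 -> let z := sp_path (155 + 54 * s) in
  [/\ - (9 / 2) <= z 0 0, z 0 0 <= 9 / 2 & z 0 1 = y_two].
Proof.
move=> s0 s1 z; have u0 : 171%:R <= 155 + 54 * s by lra.
have u1 : 155 + 54 * s <= 178%:R by lra.
have P al be c h := @span_lin phase3 171 178 al be c _ span3 isT isT h u0 u1.
rewrite -/z in P; move: (z 0 0) (z 0 1) P => x y P {s0 s1 u0 u1}.
have p1 v : phase3 v -> - (9 / 2) <= 1 * px R v + 0 * py R v by move=> /phase3_real[*]; lra.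
have p2 v : phase3 v -> - (9 / 2) <= -1 * px R v + 0 * py R v by move=> /phase3_real[*]; lra.
have p3 v : phase3 v -> y_two <= 0 * px R v + 1 * py R v by move=> /phase3_real[_ _ ->]; lra.
have p4 v : phase3 v -> - y_two <= 0 * px R v + -1 * py R v by move=> /phase3_real[_ _ ->]; lra.
by have := P _ _ _ p1; have := P _ _ _ p2; have := P _ _ _ p3; have := P _ _ _ p4; split; lra.
Qed.

Lemma sp_path_vertex i : (i < 303)%N -> sp_path i%:R 0 0 = px R (sp i).
Proof.
move=> hi; have h1 : i%:R <= i.+1%:R :> R by rewrite ler_nat.
have [h _] := sp_path_seg hi (lexx _) h1; rewrite h; move: (px R (sp i)) (px R (sp i.+1)) => x y; ring.
Qed.

Lemma path_start : sp_path (155 + 54 * 0) 0 0 = -1.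
Proof.
have [_ [_ _ v155 _]] := sp_values; have [[_ z1 _ _ _] [[_ zm3 _ _ _] _]] := zrE.
have -> : 155 + 54 * 0 = 155%:R :> R by rewrite mulr0 addr0.
rewrite (@sp_path_vertex 155 isT); move: (sp 155) v155 => w ->.
by rewrite /px /= z1 zm3; lra.
Qed.

Lemma path_stop : sp_path (155 + 54 * 1) 0 0 = 13 / 2.
Proof.
have [_ [_ _ _ v209]] := sp_values; have [_ [_ [zm12 z13 _ _ _]]] := zrE.
have -> : 155 + 54 * 1 = 209%:R :> R by rewrite mulr1 -natrD.
rewrite (@sp_path_vertex 209 isT); move: (sp 209) v209 => w ->.
by rewrite /px /= z13 zm12; lra.
Qed.

Variables (act : surface_group 305 -> M -> M) (on : M -> H -> Prop).
Notation L := (@Lam R 304 cx cy).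
Hypothesis lf : leaf_system on.
Hypothesis la : leaf_action act L on.
Hypothesis ld : leaf_dir on.
Hypothesis free : forall a x, act a x = x -> a = 1%g.

Lemma bptZ (z : M) : bpt z = (sqn z + 1)^-1 *: hat z. Proof. by []. Qed.

Lemma tame_shone (z : M) : tame n cx cy (hat z) -> shone on z.
Proof.
move=> h; apply: (good_leaf lf la (bpt_bd z).1); apply: (@tame_good R 304 cx cy (@bank_orth R)).
by rewrite bptZ; apply: tameZ h; rewrite invr_gt0 sqn1_gt0.
Qed.

(** The neighbours of the edge on the bank, above and below, give the two inversions. Interior
    points of the segment are tame; its ends are fixed by a nontrivial element, which acts freely on
    the leaf space, so they lie on no leaf. *)
Lemma kgood_edge (q : pt) a c k1 k2 : (a < n)%N -> (c < n)%N -> crossers q a c -> (k1 <= 303)%N -> (k2 <= 303)%N ->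
  sp k1 = q -> sp k2 = succ_pt q -> kgood on (v2 (px R q + 2^-1) (py R q)).
Proof.
move=> an cn hac h1 h2 e1 e2; have [ea ec] := hac; have [[z0 z1 z2 _ zm1] _] := zrE.
have ca : cx a = px R q + 2^-1 /\ cy a = py R q + 1 * hgt R.
  by rewrite /cxb /cyb ea /px /py /= zrD z1; split; [field | ring].
have cc : cx c = px R q + 2^-1 /\ cy c = py R q + -1 * hgt R.
  by rewrite /cxb /cyb ec /px /py /= zrD zrB z1; split; [field | ring].
have far i (y : R) : (i < n)%N -> i != a -> i != c -> - 2^-1 <= y -> y <= 2^-1 ->
    3 / 4 <= (px R q + 2^-1 - cx i) ^+ 2 + (py R q + y - cy i) ^+ 2.
  move=> hi ia ic; apply: (lattice_far hac).
  - by rewrite -e1; exact: bank_neq_spiral.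
  - by rewrite -e2; exact: bank_neq_spiral.
  - exact: bank_inj.
  - exact: bank_inj.
have kE (t : R) : kap (v2 (px R q + 2^-1) (py R q)) t = v2 (px R q + 2^-1) (py R q + (t - 2^-1)).
  by apply: rV2P; rewrite /kap !rvE ?addr0.
have off (s : R) : s = 2^-1 \/ s = - 2^-1 -> forall x, ~ on x (bpt (v2 (px R q + 2^-1) (py R q + s))).
  move=> hs; set z := v2 _ _; have := lox_cross ca cc hs; rewrite -/z => lx.
  have lx' : refl cx cy a (refl cx cy c (bpt z)) = (2 * (hgt R + s) ^+ 2) ^+ 2 *: bpt z.
    by rewrite bptZ !reflZ lx !scalerA mulrC.
  have nz : bpt z != 0.
    by apply/eqP => e; have := bpt1_neq0 z; rewrite e mxE eqxx.
  have [x x1 ex] := @loxodromic R 304 cx cy (@bank_orth R) a c (bpt z) _ an cn lx' (lox_mult hs) nz.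
  apply: (fixed_off lf la (bpt_bd z).1 _ ex).
    apply/eqP => m0; have := la_K la x (bpt z); rewrite ex m0 scale0r => e.
    by case/eqP: nz; rewrite -e; have := LZ la x^-1%g 0 0; rewrite !scale0r.
  by move=> p; apply/eqP => /free.
split.
- move=> t t0 t1; rewrite kE; apply: tame_shone.
  by apply: (tame_cross (@cadjC 304) (@bank_orth R) (@bank_nonorth R) an cn ca cc far); lra.
- by rewrite kE sub0r; apply: off; right.
- by rewrite kE (_ : 1 - 2^-1 = 2^-1); [apply: off; left | field].
Qed.

Lemma kgood_core : kgood on (spiral_path 2^-1).
Proof.
have [[_ _ v151 v152] _] := sp_values; have [b1 b2 _ _] := bk_values.
have hc : crossers pt0 467 161 by split; [rewrite b1 | rewrite b2].
have e1 : sp 152 = pt0 by rewrite v152.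
have e2 : sp 151 = succ_pt pt0 by rewrite v151.
rewrite core_center; exact: (@kgood_edge pt0 467 161 152 151 isT isT hc isT isT e1 e2).
Qed.

Lemma kgood_side : kgood on (spiral_path s_two).
Proof.
have [_ [v173 v174 _ _]] := sp_values; have [_ _ b1 b2] := bk_values.
have hc : crossers q_two 439 177 by split; rewrite ?b1 ?b2 /q_two v174.
have e2 : sp 173 = succ_pt q_two by rewrite v173 /q_two v174.
rewrite side_center.1; exact: (@kgood_edge q_two 439 177 174 173 isT isT hc isT isT erefl e2).
Qed.

End Configuration.

(** * Conclusion *)

Section Contradiction.
Variable R : realType.
Notation M := 'rV[R]_2.
Notation H := 'rV[R]_4.
Notation cx := (@cxb R).
Notation cy := (@cyb R).
Variables (act : surface_group 305 -> M -> M) (on : M -> H -> Prop).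
Hypothesis lf : leaf_system on.
Hypothesis la : leaf_action act (@Lam R 304 cx cy) on.
Hypothesis ld : leaf_dir on.
Hypothesis free : forall a x, act a x = x -> a = 1%g.

Lemma spiral_contradiction : False.
Proof.
have [X0 [cX0 hX0]] := lf_base lf.
have bX0 x : ball_open (X0 x) by case: (hX0 x).
have oX0 x : on x (X0 x) by case: (hX0 x).
have oS s : shone on (spiral_path s) by apply: (tame_shone lf la); exact: spiral_path_tame.
have cS := @spiral_path_cont R; have k1 := kgood_core lf la free; have k2 := kgood_side lf la free.
pose F1 := Fo on X0 (spiral_path 2^-1); pose F2 := Fo on X0 (spiral_path (s_two R)).
have c1 : continuous F1 := Fo_cont lf la cX0 bX0 oX0 k1.
have c2 : continuous F2 := Fo_cont lf la cX0 bX0 oX0 k2.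
have kE (t : R) : kap (spiral_path (2^-1 : R)) t = v2 0 (t - 2^-1) by rewrite core_center0 /kap add0r.
have [t1 [t10 t11 far]] : exists t, [/\ 0 < t, t < 1 & 100 ^+ 2 * F1 t 0 1 <= F1 t 0 0].
  have [eN eB] := spiral_ends R.
  (* The three parameters are the ends and the middle of the central edge, from vertex 151 to vertex
     152, along which the spiral crosses the axis from right to left. *)
  refine (@far_end R (@spiral_path R) F1 100 (151 / 303) 2^-1 (152 / 303) cS c1 _ _ _ _ _ _ _ _ _ _ _ _).
  - by move=> t; exact: Fo_bd.
  - by rewrite /F1 Fo_end; [rewrite kE sub0r | left].
  - by rewrite /F1 Fo_end; [rewrite kE; congr (bpt (v2 0 _)); field | right].
  - by move=> t s t0 t1; exact: (Fo_avoid lf la ld cX0 bX0 oX0 cS oS).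
  - by rewrite ler1n.
  - exact: eN.
  - exact: eB.
  - by split; lra.
  - exact: core_center0.
  - by move=> s s0 s1; rewrite core_seg; lra.
  - by move=> s s0 s1; rewrite core_seg; lra.
  - exact: off_axis.
have /andP[h0 h1] := hgt_bound R.
have yb : 69 / 10 <= (y_two R) <= 7 by rewrite /(y_two R); apply/andP; split; lra.
have IE s : sp_path (155 + 54 * s) = spiral_path ((155 + 54 * s) / 303) by rewrite /spiral_path; congr (sp_path _); field.
(* The chord of projection is the leaf found above: its near end has height [t1 - 2^-1], its far end
   is [F1 t1]. *)
apply: (@no_passage R (t1 - 2^-1) (y_two R) (4 / 54) (16 / 54) (23 / 54) (43 / 54) (F1 t1)
  (fun s => sp_path (155 + 54 * s)) F2).
- by apply/andP; split; lra.
- exact: yb.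
- exact: Fo_bd.
- exact: far.
- exact: c2.
- by move=> t; exact: Fo_bd.
- by rewrite /F2 Fo_end; [rewrite (side_center R).2 | left].
- by rewrite /F2 Fo_end; [rewrite (side_center R).2 | right].
- by move=> t s t0 t1'; rewrite IE; exact: (Fo_avoid lf la ld cX0 bX0 oX0 cS oS).
- move=> t c c' al be t0 t1' a0 a1 a2.
  have ne : kap (spiral_path (s_two R)) t != kap (spiral_path 2^-1) t1.
    rewrite kE (side_center R).2; apply/eqP => e; have := congr1 (fun v : M => v 0 1) e.
    by rewrite /kap !rvE; move/andP: yb => [y0 y1]; lra.
  have := Fo_sep lf la ld cX0 bX0 oX0 cS oS al be k1 k2 t10 t11 t0 t1' ne a0 a1 a2.
  by rewrite kE /F1 /F2 (side_center R).2.
- move=> s; change (cat (fun s : R => sp_path (155 + 54 * s)) s).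
  by apply: (cat_comp (h := @sp_path R) (f := fun s : R => 155 + 54 * s)); [exact: sp_path_cont | ct].
- by split; lra.
- exact: span_phase1.
- exact: span_phase2.
- exact: span_phase3.
- exact: span_phase4.
- exact: span_phase5.
- exact: path_start.
- exact: path_stop.
Qed.
End Contradiction.

Theorem theoremA4 (R : realType) :
  exists g : nat, (2 <= g)%N /\
  exists rho : surface_group g -> 'M[R[i]]_2,
    [/\ sl2_representation rho, quasi_fuchsian rho &
      forall act : surface_group g -> 'rV[R]_2 -> 'rV[R]_2, deck_action act ->
        (~ exists u : 'rV[R]_2 -> {vspace 'rV[R]_4},
             [/\ forall x, mixed (u x), equivariant rho act u &
                 fitting_immersion u]) /\
        (~ exists u : 'rV[R]_2 -> {vspace 'rV[R]_4},
             [/\ forall x, mixed (u x), equivariant rho act u,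
                 continuous_pencil u &
                 exists Phi : R -> circle_bundle u -> circle_bundle u,
                   fitting_flow Phi /\ flow_equivariant rho act Phi])].
Proof.
(* The construction is indexed by g - 1 = 304; the 612 points of the bank are the 2 g + 2 sides of
   the polygon. *)
exists 305; split=> //; exists (@rho R 304 (@cxb R) (@cyb R)).
have sl := @rho_sl2 R 304 _ _ (@bank_orth R).
split; [exact: sl | exact: (@rho_quasi_fuchsian R 304 _ _ (@bank_orth R) (@bank_nonorth R)) |].
move=> act hact; have free := deck_free hact.
split.
  move=> [u [mx eq [su _ ft]]].
  have la := leaf_action_pencil sl hact eq.
  have ld := onp_leaf_dir mx (smooth_continuous_pencil su).
  exact: (spiral_contradiction (immersion_leaf_system mx su ft) la ld free).
move=> [u [mx eq cu [Phi [fl _]]]].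
have la := leaf_action_pencil sl hact eq; have ld := onp_leaf_dir mx cu.
exact: (spiral_contradiction (flow_leaf_system mx cu (flow_lift_ex fl)) la ld free).
Qed.
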